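(* Assume that $B$ is causal and that $(\varepsilon_n)$ has finite conditional moment of order $>2$. Let $(\widehat\theta_n)$ be the least squares (LS) estimator (gain $a_n=1$ for all $n$), used in the persistently excited adaptive tracking control $U_n=x_{n+1}-\widehat\theta_n^{\,t}\Phi_n+\xi_{n+1}$, and let $S_n=\sum_{k=0}^{n}\Phi_k\Phi_k^{t}+I_\delta$. Then $$\lim_{n\to\infty}\frac{S_n}{n}=\Lambda\qquad\text{a.s.}$$ In addition, the tracking is residually optimal (i.e. $C_n\to\Gamma+\Delta$ a.s.), with $$\|C_n-\Delta_n\|=\mathcal{O}\left(\frac{\log n}{n}\right)\qquad\text{a.s.}$$ Finally, $\widehat\theta_n$ converges almost surely to $\theta$, with $$\|\widehat\theta_n-\theta\|^2=\mathcal{O}\left(\frac{\log n}{n}\right)\qquad\text{a.s.}$$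
   Context: **Model.** Let $d,p,q\ge1$ be integers and $\delta=d(p+q)$. The $d$-dimensional process $\mathrm{ARX}_d(p,q)$ is given for all $n\ge0$ by $$X_{n+1}=\theta^{t}\Phi_n+U_n+\varepsilon_{n+1},\qquad \theta^{t}=(A_1,\dots,A_p,B_1,\dots,B_q),$$ where $A_i,B_j$ are unknown square matrices of order $d$. Here $X_n,U_n,\varepsilon_n$ are the output, input and driven noise, and $$\Phi_n=(X_n^{t},\dots,X_{n-p+1}^{t},U_{n-1}^{t},\dots,U_{n-q}^{t})^{t}\in\mathbb{R}^{\delta}$$ (with a given initial state of the system). Put $A(z)=I_d-A_1z-\cdots-A_pz^p$ and $B(z)=I_d+B_1z+\cdots+B_qz^q$. $B$ is called causal if $\det(B(z))\ne0$ for all $z\in\mathbb{C}$ with $|z|\le1$. **Noise.** $(\varepsilon_n)$ is a martingale difference sequence adapted to the filtration $\mathbb{F}=(\mathcal{F}_n)$, where $\mathcal{F}_n$ is the $\sigma$-algebra of the events occurring up to time $n$. For all $n\ge0$, $\mathbb{E}[\varepsilon_{n+1}\varepsilon_{n+1}^{t}|\mathcal{F}_n]=\Gamma$ a.s., where $\Gamma$ is a positive definite deterministic matrix. It satisfies the strong law of large numbers: $\frac1n\sum_{k=1}^n\varepsilon_k\varepsilon_k^{t}\to\Gamma$ a.s. ''Finite conditional moment of order $>2$'' means $\sup_{n\ge0}\mathbb{E}[\|\varepsilon_{n+1}\|^{\alpha}|\mathcal{F}_n]<\infty$ a.s. for some $\alpha>2$. **Estimator.** For a positive gain sequence $(a_n)$,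 the estimator of $\theta$ is defined, with $\widehat\theta_0$ arbitrary, by $$\widehat\theta_{n+1}=\widehat\theta_n+a_nS_n^{-1}(a)\Phi_n\left(X_{n+1}-U_n-\widehat\theta_n^{\,t}\Phi_n\right)^{t},\qquad S_n(a)=\sum_{k=0}^na_k\Phi_k\Phi_k^{t}+I_\delta.$$ The LS estimator corresponds to $a_n=1$, in which case $S_n(a)=S_n$. **Control.** $U_n=x_{n+1}-\widehat\theta_n^{\,t}\Phi_n+\xi_{n+1}$ for all $n\ge0$. The reference trajectory $(x_n)$ is predictable ($x_{n+1}$ is $\mathcal{F}_n$-measurable) and satisfies $\sum_{k=1}^n\|x_k\|^2=o(n)$ a.s. $(\xi_n)$ is an exogenous noise of dimension $d$, adapted to $\mathbb{F}$, with mean $0$ and positive definite covariance matrix $\Delta$. It is independent of $(\varepsilon_n)$, of $(x_n)$ and of the initial state of the system, and it satisfies the strong law of large numbers. Consequently $$\Delta_n=\frac1n\sum_{k=1}^n(\varepsilon_k+\xi_k)(\varepsilon_k+\xi_k)^{t}$$ converges to $\Gamma+\Delta$ a.s. The average cost matrix is $$C_n=\frac1n\sum_{k=1}^n(X_k-x_k)(X_k-x_k)^{t}.$$ The tracking is called residually optimal if $C_n\to\Gamma+\Delta$ a.s. **Limiting matrix.** For causal $B$ write, in a disc of center $0$ and radius $>1$, $B^{-1}(z)=\sum_{k\ge0}D_kz^k$ and $B^{-1}(z)(A(z)-I_d)=\sum_{k\ge1}P_kz^k$. Put $P_0=0$ and $Q_k=D_k+P_k$ (so $Q_0=I_d$).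 For $1\le i\le q$, $$H_i=\sum_{k=i}^\infty P_k\Gamma P_{k-i+1}^{t}+\sum_{k=i-1}^\infty Q_k\Delta Q_{k-i+1}^{t}.$$ $H$ is the symmetric $dq\times dq$ matrix whose $(i,j)$ block of order $d$ is $H_{j-i+1}$ if $j\ge i$ and $H_{i-j+1}^{t}$ if $j<i$. For $0\le i\le p-1$, $K_i=P_i\Gamma+Q_i\Delta$ (so $K_0=\Delta$), and $K$ is the $dq\times dp$ matrix whose $(i,j)$ block ($1\le i\le q$, $1\le j\le p$) is $K_{j-i}$ if $j\ge i$ and $0$ if $j<i$. $L$ is the block diagonal matrix of order $dp$ with all diagonal blocks equal to $\Gamma+\Delta$. Finally $$\Lambda=\begin{pmatrix} L & K^{t} \\ K & H \end{pmatrix}.$$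
   Formalization: The exogenous noise is assumed white: given its own past, its next value has conditional mean 0 and conditional covariance Delta; with only mean 0 and covariance Delta at each time (e.g. a stationary autoregressive noise) the stated limit Lambda fails. *)

(* Defs.v *)
From HB Require Import structures.
From mathcomp Require Import all_boot all_order all_algebra.
From mathcomp Require Import complex.
From mathcomp Require Import all_classical all_reals all_analysis.
From mathcomp Require Import measurable_realfun.

Set Implicit Arguments.
Unset Strict Implicit.
Unset Printing Implicit Defensive.

Import Order.TTheory GRing.Theory Num.Theory.
Import numFieldNormedType.Exports.

Local Open Scope classical_set_scope.
Local Open Scope ring_scope.

Section Matrices.
Context {R : realType}.

(* Euclidean norm of a vector, Frobenius norm of a matrix.  (The library's
   norm on matrices is the maximum norm.) *)
Definition enorm m n (M : 'M[R]_(m, n)) : R :=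
  Num.sqrt (\sum_i \sum_j M i j ^+ 2).

Definition posdef n (M : 'M[R]_n) : Prop :=
  M^T = M /\ forall v : 'cV[R]_n, v != 0 -> 0 < (v^T *m M *m v) 0 0.

(* (1/n) (v_1 v_1^t + ... + v_n v_n^t); the value at n = 0 is irrelevant. *)
Definition avg_outer d (v : nat -> 'cV[R]_d) (n : nat) : 'M[R]_d :=
  n%:R^-1 *: \sum_(1 <= k < n.+1) v k *m (v k)^T.

End Matrices.

Section Probability.
Context {R : realType} {disp : measure_display} {T : measurableType disp}.
Variable P : probability T R.
Implicit Types (G H : set_system T) (F : nat -> set_system T).

Definition filtration F : Prop :=
  (forall n, sigma_algebra [set: T] (F n)) /\
  (forall n, F n `<=` measurable) /\
  (forall n, F n `<=` F n.+1).

Definition meas_wrt G {d'} {E : sigmaRingType d'} (f : T -> E) : Prop :=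
  forall B : set E, measurable B -> G (f @^-1` B).

Definition mx_meas_wrt G m n (Y : T -> 'M[R]_(m, n)) : Prop :=
  forall i j, meas_wrt G (fun w => Y w i j : R).

(* Z is a version of E[Y | G], for an integrable Y. *)
Definition is_cond_exp G (Y Z : T -> R) : Prop :=
  [/\ P.-integrable setT (EFin \o Y), P.-integrable setT (EFin \o Z),
      meas_wrt G Z &
      forall A, G A ->
        (\int[P]_(w in A) (Y w)%:E = \int[P]_(w in A) (Z w)%:E)%E].

Definition mx_is_cond_exp G m n (Y Z : T -> 'M[R]_(m, n)) : Prop :=
  forall i j, is_cond_exp G (fun w => Y w i j) (fun w => Z w i j).

(* Z is a version of E[Y | G], for a nonnegative Y which need not be
   integrable. *)
Definition is_cond_exp_ge0 G (Y : T -> R) (Z : T -> \bar R) : Prop :=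
  [/\ meas_wrt G Z, forall w, (0 <= Z w)%E &
      forall A, G A ->
        (\int[P]_(w in A) (Y w)%:E = \int[P]_(w in A) Z w)%E].

Definition coords m n (Y : T -> 'M[R]_(m, n)) : set (T -> R) :=
  [set f | exists i j, f = fun w => Y w i j].

Definition sigma_gen (C : set (T -> R)) : set_system T :=
  <<s [set E | exists2 f, C f & exists2 B, measurable B & E = f @^-1` B] >>.

Definition indep_sigma G H : Prop :=
  forall A B, G A -> H B -> P (A `&` B) = (P A * P B)%E.

(* The process e is indexed by n >= 1 : the value e 0 is never used. *)
Definition mart_diff F d (e : nat -> T -> 'cV[R]_d) : Prop :=
  (forall n, mx_meas_wrt (F n.+1) (e n.+1)) /\
  (forall n, mx_is_cond_exp (F n) (e n.+1) (fun=> 0)).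

Definition cond_covariance F d (e : nat -> T -> 'cV[R]_d) (V : 'M[R]_d)
    : Prop :=
  forall n, mx_is_cond_exp (F n) (fun w => e n.+1 w *m (e n.+1 w)^T) (fun=> V).

Definition slln d (e : nat -> T -> 'cV[R]_d) (V : 'M[R]_d) : Prop :=
  {ae P, forall w, avg_outer (e^~ w) n @[n --> \oo] --> V}.

Definition finite_cond_moment F d (e : nat -> T -> 'cV[R]_d) (alpha : R)
    : Prop :=
  exists Z : nat -> T -> \bar R,
    (forall n, is_cond_exp_ge0 (F n) (fun w => enorm (e n.+1 w) `^ alpha) (Z n))
    /\ {ae P, forall w, (ereal_sup (range (Z^~ w)) < +oo)%E}.

Definition past d (xi : nat -> T -> 'cV[R]_d) (n : nat) : set_system T :=
  sigma_gen (\bigcup_(k in `I_n) coords (xi k.+1)).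

(* Exogenous noise with mean 0 and covariance matrix V: the conditional mean
   and covariance of xi_(n+1) given xi_1, ..., xi_n are 0 and V.  This holds
   both for independent variables with mean 0 and covariance V and for
   martingale differences with conditional covariance V. *)
Definition centered_noise d (xi : nat -> T -> 'cV[R]_d) (V : 'M[R]_d) : Prop :=
  mart_diff (past xi) xi /\ cond_covariance (past xi) xi V.

End Probability.

Section Model.
Context {R : realType} {disp : measure_display} {T : measurableType disp}.
Variables d p q : nat.

(* \sum_(i < p) d + \sum_(j < q) d = d (p + q), in the form required by the
   block constructions. *)
Definition delta_dim : nat := (\sum_(i < p) d + \sum_(j < q) d)%N.

(* A i and B j stand for A_(i+1) and B_(j+1). *)
Definition theta_of (A : 'I_p -> 'M[R]_d) (B : 'I_q -> 'M[R]_d)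
    : 'M[R]_(delta_dim, d) :=
  (row_mx (\mxrow_(i < p) A i) (\mxrow_(j < q) B j))^T.

(* Processes with an initial segment are indexed by the integers:
   X_n is used for n > - p and U_n for n >= - q. *)
Definition Phi (X U : int -> T -> 'cV[R]_d) (n : nat) (w : T)
    : 'cV[R]_delta_dim :=
  col_mx (\mxcol_(i < p) X (n%:Z - i%:Z) w)
         (\mxcol_(j < q) U (n%:Z - j.+1%:Z) w).

Definition arx (theta : 'M[R]_(delta_dim, d)) (X U : int -> T -> 'cV[R]_d)
    (eps : nat -> T -> 'cV[R]_d) : Prop :=
  forall (n : nat) w,
    X n.+1%:Z w = theta^T *m Phi X U n w + U n%:Z w + eps n.+1 w.

Definition S_ (a : nat -> R) (X U : int -> T -> 'cV[R]_d) (n : nat) (w : T)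
    : 'M[R]_delta_dim :=
  \sum_(0 <= k < n.+1) a k *: (Phi X U k w *m (Phi X U k w)^T) + 1%:M.

Definition is_estimator (a : nat -> R) (X U : int -> T -> 'cV[R]_d)
    (thetah : nat -> T -> 'M[R]_(delta_dim, d)) : Prop :=
  forall (n : nat) w,
    thetah n.+1 w = thetah n w
      + a n *: (invmx (S_ a X U n w) *m Phi X U n w *m
          (X n.+1%:Z w - U n%:Z w - (thetah n w)^T *m Phi X U n w)^T).

Definition ls_gain : nat -> R := fun=> 1.

Definition tracking_control (X U : int -> T -> 'cV[R]_d)
    (thetah : nat -> T -> 'M[R]_(delta_dim, d))
    (x xi : nat -> T -> 'cV[R]_d) : Prop :=
  forall (n : nat) w,
    U n%:Z w = x n.+1 w - (thetah n w)^T *m Phi X U n w + xi n.+1 w.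

Definition init_state_meas (F0 : set_system T) (X U : int -> T -> 'cV[R]_d)
    (thetah0 : T -> 'M[R]_(delta_dim, d)) : Prop :=
  [/\ forall i : 'I_p, mx_meas_wrt F0 (X (- i%:Z)),
      forall j : 'I_q, mx_meas_wrt F0 (U (- j.+1%:Z)) &
      mx_meas_wrt F0 thetah0].

Definition init_state_coords (X U : int -> T -> 'cV[R]_d)
    (thetah0 : T -> 'M[R]_(delta_dim, d)) : set (T -> R) :=
  (\bigcup_(i in [set: 'I_p]) coords (X (- i%:Z))) `|`
  (\bigcup_(j in [set: 'I_q]) coords (U (- j.+1%:Z))) `|`
  coords thetah0.

(* C_n *)
Definition avg_cost (X : int -> T -> 'cV[R]_d) (x : nat -> T -> 'cV[R]_d)
    (n : nat) (w : T) : 'M[R]_d :=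
  avg_outer (fun k => X k%:Z w - x k w) n.

(* Delta_n *)
Definition avg_noise (eps xi : nat -> T -> 'cV[R]_d) (n : nat) (w : T)
    : 'M[R]_d :=
  avg_outer (fun k => eps k w + xi k w) n.

End Model.

Arguments Phi {R disp T d} p q X U n w.
Arguments S_ {R disp T d} p q a X U n w.


Section Limit.
Context {R : realType} {d p q : nat}.
Variables (A : 'I_p -> 'M[R]_d) (B : 'I_q -> 'M[R]_d).

Definition cmx (M : 'M[R]_d) : 'M[R[i]]_d := map_mx (fun r : R => r%:C%C) M.

Definition Apol (z : R[i]) : 'M[R[i]]_d :=
  1%:M - \sum_(i < p) z ^+ i.+1 *: cmx (A i).

Definition Bpol (z : R[i]) : 'M[R[i]]_d :=
  1%:M + \sum_(j < q) z ^+ j.+1 *: cmx (B j).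

Definition causal : Prop := forall z : R[i], `|z| <= 1 -> \det (Bpol z) != 0.

(* f z = \sum_k M_k z^k for |z| < r; the convergence is entrywise in
   the field of complex numbers. *)
Definition power_series_on (r : R) (f : R[i] -> 'M[R[i]]_d)
    (M : nat -> 'M[R]_d) : Prop :=
  forall z : R[i], `|z| < r%:C%C -> forall i j,
    ((\sum_(0 <= k < n) z ^+ k *: cmx (M k)) i j : (R[i])^o) @[n --> \oo]
      --> (f z i j : (R[i])^o).

Definition expansions (D Pc : nat -> 'M[R]_d) : Prop :=
  Pc 0%N = 0 /\
  exists r : R, [/\ 1 < r,
    forall z : R[i], `|z| < r%:C%C -> \det (Bpol z) != 0,
    power_series_on r (fun z => invmx (Bpol z)) D &
    power_series_on r (fun z => invmx (Bpol z) *m (Apol z - 1%:M)) Pc].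

Variables (Gam Del : 'M[R]_d) (D Pc : nat -> 'M[R]_d).

Definition Qc (k : nat) : 'M[R]_d := D k + Pc k.

(* H_i, for i >= 1 *)
Definition Hcoef (i : nat) : 'M[R]_d :=
  limn (fun n => \sum_(i <= k < n) Pc k *m Gam *m (Pc (k.+1 - i)%N)^T) +
  limn (fun n => \sum_(i.-1 <= k < n) Qc k *m Del *m (Qc (k.+1 - i)%N)^T).

Definition Kcoef (i : nat) : 'M[R]_d := Pc i *m Gam + Qc i *m Del.

Definition Hmx : 'M[R]_(\sum_(i < q) d, \sum_(j < q) d) :=
  \mxblock_(i < q, j < q)
    (if (i <= j)%N then Hcoef (j - i).+1%N else (Hcoef (i - j).+1%N)^T).

Definition Kmx : 'M[R]_(\sum_(i < q) d, \sum_(j < p) d) :=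
  \mxblock_(i < q, j < p) (if (i <= j)%N then Kcoef (j - i)%N else 0).

Definition Lmx : 'M[R]_(\sum_(i < p) d) := \mxdiag_(i < p) (Gam + Del).

Definition Lambda : 'M[R]_(delta_dim d p q) := block_mx Lmx Kmx^T Kmx Hmx.

End Limit.

(* Main.v *)
(* Write pi_k = (theta - thetah_k)^t Phi_k for the prediction error, so that
   X_{k+1} - x_{k+1} = pi_k + eps_{k+1} + xi_{k+1}, let N_n = I + sum_{k<n} Phi_k Phi_k^t,
   s_n = tr N_n, and f_k = Phi_k^t N_k^-1 Phi_k.  The least squares Lyapunov function
   gives |N_n^(1/2) (thetah_n - theta)|^2 + sum_{k<n} |pi_k|^2 / (1 + f_k) = O(log s_n);
   the martingale terms are handled by a truncated martingale convergence argument, using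
   the conditional moment of order > 2.  Since B is causal, |Phi_k|^2 is bounded by a
   geometrically weighted sum of squared outputs and noises, and a Gronwall argument gives
   s_n = O(n^(1+kappa)) for every kappa > 0.

   The noise xi is white for a filtration that contains all of eps, x and the initial
   state.  In a direction v of the regressor space, Phi_k . v is a combination
   g.eps_k + h.xi_k of the latest noises plus a term known before time k; the cross terms
   are o(n), again by the Lyapunov bound for the regressor (X - eps - xi, Phi).  Shifting v
   in time p + q times yields N_n >= c n (n / s_n)^(p+q).  With the polynomial bound this
   forces f_k to be small with respect to |Phi_k|^2, hence s_n = O(n), and then N_n >= c n.
   So f_k is bounded, sum_{k<n} |pi_k|^2 = O(log n) and |thetah_n - theta|^2 = O(log n / n).
   Finally Phi_k is, up to a square negligible error, a linear filter with geometric
   coefficients of (eps, xi), and averaging gives Lambda. *)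

Require Import Defs.
From mathcomp Require Import all_boot all_order all_algebra.
From mathcomp Require Import complex.
From mathcomp Require Import all_classical all_reals all_analysis.
From mathcomp Require Import measurable_realfun.
From mathcomp Require Import perm ring lra zify.

Set Implicit Arguments.
Unset Strict Implicit.
Unset Printing Implicit Defensive.

Import Order.TTheory GRing.Theory Num.Theory.
Import numFieldNormedType.Exports.

Local Open Scope classical_set_scope.
Local Open Scope ring_scope.

(** * Least squares recursion *)

(** The estimates form a circle: bounding the regressors requires excitation, and the excitation
    bound degrades with [s_n / n]. The circle is broken by the summable decrease of [\tr (Jm n)],
    which gives the polynomial bound before any excitation. Since the excess kappa is arbitrary,
    kappa = 1/(4(p+q)) turns the loss [(s_n / n)^(p+q)] into a fourth root of n, which the
    logarithmic estimates can afford.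

    Two filtrations are forced. The exogenous noise is centered given its own past, so it is shown
    to be white for an enlarged filtration and not for [F]; in the enlarged one the driven noise is
    known in advance, so its martingale bounds are taken in [F]. The higher moment concerns [eps]
    only: for [xi] the Lyapunov bound is O(log^2), enough for the cross terms, where o(n) is all
    that is required.

    Limit theorems for martingales are reduced to boundedness: a normalized martingale stays
    bounded, and summation by parts removes the normalization. Once the almost sure events are
    collected, the argument is deterministic along one path. *)

Section Vectors.
Context {R : realType}.

Definition nsq m n (M : 'M[R]_(m, n)) : R := \sum_i \sum_j M i j ^+ 2.

Definition dot n (u v : 'cV[R]_n) : R := \sum_i u i 0 * v i 0.

Lemma enorm_sqr m n (M : 'M[R]_(m, n)) : enorm M ^+ 2 = nsq M.
Proof.
rewrite sqr_sqrtr //; apply: sumr_ge0 => i _; apply: sumr_ge0 => j _.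
exact: sqr_ge0.
Qed.

Lemma nsq_ge0 m n (M : 'M[R]_(m, n)) : 0 <= nsq M.
Proof. by apply: sumr_ge0 => i _; apply: sumr_ge0 => j _; exact: sqr_ge0. Qed.

Lemma enorm_ge0 m n (M : 'M[R]_(m, n)) : 0 <= enorm M.
Proof. exact: sqrtr_ge0. Qed.

Lemma nsq_entry m n (M : 'M[R]_(m, n)) i j : M i j ^+ 2 <= nsq M.
Proof.
rewrite /nsq (bigD1 i) //= (bigD1 j) //= -addrA lerDl addr_ge0 //.
  by apply: sumr_ge0 => k _; exact: sqr_ge0.
by apply: sumr_ge0 => k _; apply: sumr_ge0 => l _; exact: sqr_ge0.
Qed.

Lemma nsq_cV n (v : 'cV[R]_n) : nsq v = \sum_i v i 0 ^+ 2.
Proof. by apply: eq_bigr => i _; rewrite big_ord1. Qed.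

Lemma dotvv n (v : 'cV[R]_n) : dot v v = nsq v.
Proof. by rewrite nsq_cV; apply: eq_bigr => i _; rewrite expr2. Qed.

Lemma dotC n (u v : 'cV[R]_n) : dot u v = dot v u.
Proof. by apply: eq_bigr => i _; rewrite mulrC. Qed.

Lemma dotDl n (u v w : 'cV[R]_n) : dot (u + v) w = dot u w + dot v w.
Proof. by rewrite -big_split; apply: eq_bigr => i _; rewrite mxE mulrDl. Qed.

Lemma dotDr n (u v w : 'cV[R]_n) : dot u (v + w) = dot u v + dot u w.
Proof. by rewrite dotC dotDl !(dotC _ u). Qed.

Lemma dotZl n a (u v : 'cV[R]_n) : dot (a *: u) v = a * dot u v.
Proof. by rewrite mulr_sumr; apply: eq_bigr => i _; rewrite mxE mulrA. Qed.

Lemma dotZr n a (u v : 'cV[R]_n) : dot u (a *: v) = a * dot u v.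
Proof. by rewrite dotC dotZl dotC. Qed.

Lemma dotNl n (u v : 'cV[R]_n) : dot (- u) v = - dot u v.
Proof. by rewrite -scaleN1r dotZl mulN1r. Qed.

Lemma dotNr n (u v : 'cV[R]_n) : dot u (- v) = - dot u v.
Proof. by rewrite dotC dotNl dotC. Qed.

Lemma dotBl n (u v w : 'cV[R]_n) : dot (u - v) w = dot u w - dot v w.
Proof. by rewrite dotDl dotNl. Qed.

Lemma dotBr n (u v w : 'cV[R]_n) : dot u (v - w) = dot u v - dot u w.
Proof. by rewrite dotDr dotNr. Qed.

Lemma dot_suml n I r (Q : pred I) (f : I -> 'cV[R]_n) v :
  dot (\sum_(i <- r | Q i) f i) v = \sum_(i <- r | Q i) dot (f i) v.
Proof.
elim/big_rec2: _ => [|i y x _ <-]; last by rewrite dotDl.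
by apply: big1 => i _; rewrite mxE mul0r.
Qed.

Lemma dot0l n (v : 'cV[R]_n) : dot 0 v = 0.
Proof. by apply: big1 => i _; rewrite mxE mul0r. Qed.

Lemma dotE n (u v : 'cV[R]_n) : u^T *m v = (dot u v)%:M.
Proof.
apply/matrixP => i j; rewrite !mxE !ord1 eqxx mulr1n.
by apply: eq_bigr => k _; rewrite !mxE.
Qed.

Lemma dot_mulmxl m n (M : 'M[R]_(m, n)) u v : dot (M *m u) v = dot u (M^T *m v).
Proof.
have : (M *m u)^T *m v = u^T *m (M^T *m v) by rewrite trmx_mul mulmxA.
by rewrite !dotE => /matrixP/(_ 0 0); rewrite !mxE eqxx.
Qed.

Lemma outer_mul n m (u : 'cV[R]_n) (v w : 'cV[R]_m) :
  u *m v^T *m w = dot v w *: u.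
Proof. by rewrite -mulmxA dotE mul_mx_scalar. Qed.

Lemma dot_outer n (v u w : 'cV[R]_n) :
  dot v (u *m u^T *m w) = dot u v * dot u w.
Proof. by rewrite outer_mul dotZr mulrC (dotC v). Qed.

Lemma trace_outer n (u v : 'cV[R]_n) : \tr (u *m v^T) = dot u v.
Proof.
rewrite /mxtrace; apply: eq_bigr => i _.
by rewrite mxE big_ord1 mxE.
Qed.

Lemma nsq_eq0 m n (M : 'M[R]_(m, n)) : nsq M = 0 -> M = 0.
Proof.
move=> M0; apply/matrixP => i j; rewrite mxE.
apply/eqP; rewrite -sqrf_eq0 eq_le sqr_ge0 andbT.
by rewrite -M0 nsq_entry.
Qed.

Lemma sqr_dot_le n (u v : 'cV[R]_n) : dot u v ^+ 2 <= nsq u * nsq v.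
Proof.
have [v0'|v0] := eqVneq (nsq v) 0.
  by rewrite v0' mulr0 (nsq_eq0 v0') dotC dot0l expr0n.
have vp : 0 < nsq v by rewrite lt_def v0 nsq_ge0.
have := nsq_ge0 (nsq v *: u - dot u v *: v).
rewrite -dotvv dotBl !dotBr !dotZl !dotZr !dotvv (dotC v u) => H.
have : 0 <= nsq v * (nsq u * nsq v - dot u v ^+ 2) by nra.
by rewrite pmulr_rge0 // subr_ge0.
Qed.

Lemma nsq0 m n : nsq (0 : 'M[R]_(m, n)) = 0.
Proof. by apply: big1 => i _; apply: big1 => j _; rewrite mxE expr0n. Qed.

Lemma nsqZ m n a (M : 'M[R]_(m, n)) : nsq (a *: M) = a ^+ 2 * nsq M.
Proof.
rewrite mulr_sumr; apply: eq_bigr => i _; rewrite mulr_sumr.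
by apply: eq_bigr => j _; rewrite mxE exprMn.
Qed.

Lemma nsqN m n (M : 'M[R]_(m, n)) : nsq (- M) = nsq M.
Proof. by rewrite -scaleN1r nsqZ sqrrN expr1n mul1r. Qed.

Lemma nsqD m n (M N : 'M[R]_(m, n)) : nsq (M + N) <= 2 * nsq M + 2 * nsq N.
Proof.
rewrite !mulr_sumr -big_split; apply: ler_sum => i _ /=.
rewrite !mulr_sumr -big_split; apply: ler_sum => j _ /=.
rewrite mxE; have := sqr_ge0 (M i j - N i j); nra.
Qed.

Lemma nsqB m n (M N : 'M[R]_(m, n)) : nsq (M - N) <= 2 * nsq M + 2 * nsq N.
Proof. by rewrite -(nsqN N) nsqD. Qed.

Lemma nsq_tr m n (M : 'M[R]_(m, n)) : nsq M^T = nsq M.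
Proof.
rewrite /nsq exchange_big; apply: eq_bigr => i _; apply: eq_bigr => j _.
by rewrite mxE.
Qed.

Lemma nsq_col m n (M : 'M[R]_(m, n)) : nsq M = \sum_j nsq (col j M).
Proof.
rewrite /nsq exchange_big; apply: eq_bigr => i _; apply: eq_bigr => j _.
by rewrite big_ord1 mxE.
Qed.

Lemma nsqM m n k (M : 'M[R]_(m, n)) (N : 'M[R]_(n, k)) :
  nsq (M *m N) <= nsq M * nsq N.
Proof.
have -> : nsq (M *m N) = \sum_i \sum_j dot (row i M)^T (col j N) ^+ 2.
  apply: eq_bigr => i _; apply: eq_bigr => j _; congr (_ ^+ 2).
  by rewrite mxE; apply: eq_bigr => l _; rewrite !mxE.
rewrite (_ : nsq M = \sum_i nsq (row i M)^T); last first.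
  apply: eq_bigr => i _; rewrite nsq_tr /nsq big_ord1.
  by apply: eq_bigr => j _; rewrite mxE.
rewrite mulr_suml; apply: ler_sum => i _.
rewrite [nsq N]nsq_col mulr_sumr; apply: ler_sum => j _; exact: sqr_dot_le.
Qed.

Lemma nsq_col_mx m n k (M : 'M[R]_(m, k)) (N : 'M[R]_(n, k)) :
  nsq (col_mx M N) = nsq M + nsq N.
Proof.
rewrite /nsq big_split_ord; congr (_ + _); apply: eq_bigr => i _;
  apply: eq_bigr => j _; by rewrite ?col_mxEu ?col_mxEd.
Qed.

Lemma dot_col_mx m n (a u : 'cV[R]_m) (b v : 'cV[R]_n) :
  dot (col_mx a b) (col_mx u v) = dot a u + dot b v.
Proof.
rewrite /dot big_split_ord; congr (_ + _); apply: eq_bigr => i _;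
  by rewrite ?col_mxEu ?col_mxEd.
Qed.

End Vectors.

Section LeastSquares.
Context {R : realType} {m : nat}.
Variable Z : nat -> 'cV[R]_m.

Definition Nm n : 'M[R]_m := 1%:M + \sum_(k < n) Z k *m (Z k)^T.

(* The inverse of [Nm n], by the Sherman-Morrison formula. *)
Fixpoint Jm n : 'M[R]_m :=
  if n is k.+1 then
    let u := Jm k *m Z k in
    Jm k - (1 + dot (Z k) u)^-1 *: (u *m u^T)
  else 1%:M.

Definition gain n : R := dot (Z n) (Jm n *m Z n).

(** This is [Z_n^t N_{n+1}^{-1} Z_n], the leverage of the newest regressor once it has been
    included; unlike [gain], it never exceeds 1. *)
Definition leverage n : R := gain n / (1 + gain n).

Lemma NmS n : Nm n.+1 = Nm n + Z n *m (Z n)^T.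
Proof. by rewrite /Nm big_ord_recr addrA. Qed.

Lemma JmS n : Jm n.+1
  = Jm n - (1 + gain n)^-1 *: ((Jm n *m Z n) *m (Jm n *m Z n)^T).
Proof. by []. Qed.

Lemma Nm_sym n : (Nm n)^T = Nm n.
Proof.
elim: n => [|n IH]; first by rewrite /Nm big_ord0 addr0 trmx1.
by rewrite NmS linearD /= IH trmx_mul trmxK.
Qed.

Lemma Jm_sym n : (Jm n)^T = Jm n.
Proof.
elim: n => [|n IH]; first by rewrite trmx1.
by rewrite JmS linearB /= linearZ /= IH !trmx_mul !trmxK IH.
Qed.

Lemma dot_Nm n v : dot v (Nm n *m v) = nsq v + \sum_(k < n) dot (Z k) v ^+ 2.
Proof.
elim: n => [|n IH]; first by rewrite /Nm !big_ord0 !addr0 mul1mx dotvv.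
rewrite NmS mulmxDl dotDr IH big_ord_recr /= addrA; congr (_ + _).
by rewrite dot_outer expr2.
Qed.

Lemma dot_Nm_ge n v : nsq v <= dot v (Nm n *m v).
Proof. by rewrite dot_Nm lerDl; apply: sumr_ge0 => k _; exact: sqr_ge0. Qed.

(** Conditional on the inverse because the induction in [Jm_Nm] divides by [1 + gain n], whose
    positivity must come from the inverse property at [n] alone. *)
Lemma Jm_psd_of_inv n : Jm n *m Nm n = 1%:M ->
  forall v, 0 <= dot v (Jm n *m v).
Proof.
move=> JN v; have NJ : Nm n *m Jm n = 1%:M by apply: mulmx1C.
have := dot_Nm_ge n (Jm n *m v); rewrite mulmxA NJ mul1mx dotC.
by apply: le_trans; exact: nsq_ge0.
Qed.

Lemma Jm_Nm n : Jm n *m Nm n = 1%:M.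
Proof.
elim: n => [|n IH]; first by rewrite /Nm big_ord0 addr0 mulmx1.
have g0 : 0 <= gain n by exact: Jm_psd_of_inv.
have uN : (Jm n *m Z n)^T *m Nm n = (Z n)^T.
  by rewrite trmx_mul Jm_sym -mulmxA IH mulmx1.
rewrite JmS NmS mulmxDr !mulmxBl IH -!scalemxAl -(mulmxA _ _ (Nm n)) uN.
rewrite (mulmxA (_ *m _^T) (Z n)) (outer_mul (Jm n *m Z n)) -!scalemxAl mulmxA.
rewrite -[LHS]addrA -[RHS]addr0; congr (_ + _).
rewrite dotC -/(gain n) scalerA.
set W := _ *m (Z n)^T.
rewrite -[X in _ + (X - _)]scale1r -!scaleNr -!scalerDl.
rewrite (_ : _ + (1 + _) = 0 :> R) ?scale0r //.
by rewrite /GRing.scale /=; field; rewrite lt0r_neq0 // ltr_pwDl.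
Qed.

Lemma Nm_Jm n : Nm n *m Jm n = 1%:M.
Proof. exact/mulmx1C/Jm_Nm. Qed.

Lemma Jm_psd n v : 0 <= dot v (Jm n *m v).
Proof. exact/Jm_psd_of_inv/Jm_Nm. Qed.

Lemma invmx_Nm n : invmx (Nm n) = Jm n.
Proof.
have /mulmx1_unit[uN _] := Nm_Jm n.
by rewrite -[LHS]mulmx1 -(Nm_Jm n) mulKmx.
Qed.

Lemma gain_ge0 n : 0 <= gain n. Proof. exact: Jm_psd. Qed.

Lemma leverage_ge0 n : 0 <= leverage n.
Proof. by rewrite divr_ge0 ?addr_ge0 ?gain_ge0. Qed.

Lemma leverage_le1 n : leverage n <= 1.
Proof.
have g0 := gain_ge0 n.
by rewrite ler_pdivrMr ?ltr_pwDl // mul1r lerDr.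
Qed.

(** Matrix determinant lemma: the bordered matrix [E] is made block triangular in two ways, by row
    operations [L1] and [L2] of determinant 1. *)
Lemma det_NmS n : \det (Nm n.+1) = \det (Nm n) * (1 + gain n).
Proof.
pose E := block_mx (Nm n) (- Z n) (Z n)^T (1%:M : 'M[R]_1).
pose L1 := block_mx 1%:M (Z n) 0 (1%:M : 'M[R]_1).
pose L2 := block_mx (1%:M : 'M[R]_m) 0 (- ((Z n)^T *m Jm n)) (1%:M : 'M[R]_1).
have E1 : L1 *m E = block_mx (Nm n.+1) 0 (Z n)^T 1%:M.
  rewrite mulmx_block !mul1mx !mul0mx mulmx1 add0r NmS addNr add0r.
  by [].
have E2 : L2 *m E = block_mx (Nm n) (- Z n) 0 (1 + gain n)%:M.
  rewrite mulmx_block !mul1mx !mul0mx addr0 mulNmx -mulmxA Jm_Nm mulmx1 addNr.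
  congr (block_mx _ _ _ _); first by rewrite addr0.
  by rewrite mulNmx mulmxN opprK -mulmxA dotE -/(gain n) addrC raddfD.
have : \det (L1 *m E) = \det (L2 *m E).
  by rewrite !det_mulmx det_ublock det_lblock !det1 !mul1r.
by rewrite E1 E2 det_lblock det_ublock det1 mulr1 det_scalar1.
Qed.

Lemma det_Nm_ge1 n : 1 <= \det (Nm n).
Proof.
elim: n => [|n IH]; first by rewrite /Nm big_ord0 addr0 det1.
rewrite det_NmS; have g0 := gain_ge0 n; nra.
Qed.

Lemma leverage_le_ln n : leverage n <= ln (1 + gain n).
Proof.
have g0 := gain_ge0 n; have p : 0 < 1 + gain n by rewrite ltr_pwDl.
have q : 0 < (1 + gain n)^-1 by rewrite invr_gt0.
have := @le_ln1Dx R ((1 + gain n)^-1 - 1).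
rewrite (_ : 1 + ((1 + gain n)^-1 - 1) = (1 + gain n)^-1); last by ring.
rewrite lnV ?posrE // => H.
have {}H : - ln (1 + gain n) <= (1 + gain n)^-1 - 1 by apply: H; lra.
rewrite /leverage; suff -> : gain n / (1 + gain n) = 1 - (1 + gain n)^-1 by lra.
by field; rewrite lt0r_neq0.
Qed.

(** [1 + gain] is the ratio of consecutive determinants, so the logarithms telescope. The factor
    [log s_n] in the Lyapunov bounds originates here. *)
Lemma sum_leverage n : \sum_(k < n) leverage k <= ln (\det (Nm n)).
Proof.
elim: n => [|n IH]; first by rewrite big_ord0 ln_ge0 // det_Nm_ge1.
have g0 := gain_ge0 n; have d1 := det_Nm_ge1 n.
rewrite big_ord_recr /= det_NmS lnM ?posrE ?ltr_pwDl //; last by lra.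
by rewrite lerD // leverage_le_ln.
Qed.

Lemma trace_Nm n : \tr (Nm n) = m%:R + \sum_(k < n) nsq (Z k).
Proof.
rewrite /Nm raddfD /= mxtrace1 raddf_sum /=; congr (_ + _).
by apply: eq_bigr => k _; rewrite trace_outer dotvv.
Qed.

(* The decrease [\tr (Jm n) - \tr (Jm n.+1)]. *)
Definition decr n : R := nsq (Jm n *m Z n) / (1 + gain n).

Lemma decr_ge0 n : 0 <= decr n.
Proof. by rewrite divr_ge0 ?nsq_ge0 // addr_ge0 // gain_ge0. Qed.

Lemma trace_Jm n : \tr (Jm n) = m%:R - \sum_(k < n) decr k.
Proof.
elim: n => [|n IH]; first by rewrite big_ord0 subr0 mxtrace1.
rewrite JmS linearB linearZ /= IH trace_outer dotvv big_ord_recr /= opprD addrA.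
by congr (_ - _); rewrite /decr mulrC.
Qed.

Lemma trace_psd_ge0 (M : 'M[R]_m) :
  (forall v, 0 <= dot v (M *m v)) -> 0 <= \tr M.
Proof.
move=> H; apply: sumr_ge0 => i _.
have := H (delta_mx i 0); rewrite -colE /dot (bigD1 i) //= big1 => [|j ji].
  by rewrite addr0 !mxE !eqxx mul1r.
by rewrite mxE (negbTE ji) mul0r.
Qed.

(** The traces of the positive matrices [Jm n] decrease from [m] and stay nonnegative. The bound
    involves neither [n] nor the size of the regressors, which is what allows growth control before
    excitation. *)
Lemma sum_decr_le n : \sum_(k < n) decr k <= m%:R.
Proof.
have := trace_psd_ge0 (@Jm_psd n).
by rewrite trace_Jm subr_ge0.
Qed.

(** Cauchy-Schwarz bounds [gain^2 / (1 + gain)] by [decr * nsq (Z n)], and [gain - 1] lies below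
    that quotient. *)
Lemma gain_le_decr n : gain n <= 1 + decr n * nsq (Z n).
Proof.
have g0 := gain_ge0 n; have p : 0 < 1 + gain n by rewrite ltr_pwDl.
have : gain n ^+ 2 <= nsq (Z n) * nsq (Jm n *m Z n) by exact: sqr_dot_le.
rewrite /decr mulrAC -lerBlDl ler_pdivlMr //; nra.
Qed.

(** Testing the hypothesis at [v = Jm n *m w] and applying Cauchy-Schwarz to [dot w v] replaces
    spectral theory. *)
Lemma Jm_le_of_Nm_ge n (lam : R) (w : 'cV[R]_m) : 0 < lam ->
  (forall v, lam * nsq v <= dot v (Nm n *m v)) ->
  dot w (Jm n *m w) <= nsq w / lam.
Proof.
move=> l0 H; set v := Jm n *m w.
have := H v; rewrite /v mulmxA Nm_Jm mul1mx dotC -/v => H1.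
have := sqr_dot_le w v => H2.
have q0 : 0 <= dot w v by exact: Jm_psd.
rewrite ler_pdivlMr //.
have [->|q1] := eqVneq (dot w v) 0; first by rewrite mul0r nsq_ge0.
have qp : 0 < dot w v by rewrite lt_def q1.
have := nsq_ge0 w; have := nsq_ge0 v; nra.
Qed.

Lemma Nm_entry_le n i j : `|Nm n i j| <= \tr (Nm n).
Proof.
elim: n => [|n IH].
  rewrite /Nm big_ord0 addr0 mxtrace1 mxE.
  case: eqP => _; rewrite ?normr1 ?normr0 // ler1n.
  by case: (m) i => // -[].
rewrite NmS mxE raddfD /= trace_outer; apply: le_trans (ler_normD _ _) _.
apply: lerD => //; rewrite mxE big_ord1 mxE dotvv ler_norml.
have := nsq_entry (Z n) i 0; have := nsq_entry (Z n) j 0.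
have [->|ij] := eqVneq i j.
  move=> h _; have := sqr_ge0 (Z n j 0); lra.
move=> _ _.
have : Z n i 0 ^+ 2 + Z n j 0 ^+ 2 <= nsq (Z n).
  rewrite nsq_cV (bigD1 i) //= (bigD1 j) 1?eq_sym //= addrA lerDl.
  by apply: sumr_ge0 => k _; exact: sqr_ge0.
have := sqr_ge0 (Z n i 0 + Z n j 0); have := sqr_ge0 (Z n i 0 - Z n j 0); nra.
Qed.

(** Leibniz expansion with every entry bounded by the trace. The crude constant is harmless, since
    only the logarithm of the determinant is used. *)
Lemma det_Nm_le n : \det (Nm n) <= (m`!)%:R * \tr (Nm n) ^+ m.
Proof.
apply: le_trans (ler_norm _) _.
rewrite /determinant; apply: le_trans (ler_norm_sum _ _ _) _.
have -> : (m`!)%:R * \tr (Nm n) ^+ m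
    = \sum_(s : {perm 'I_m}) \prod_(i < m) \tr (Nm n) :> R.
  by rewrite sumr_const prodr_const card_Sn card_ord mulr_natl.
apply: ler_sum => s _; rewrite normrM normrX normrN1 expr1n mul1r normr_prod.
by apply: ler_prod => i _; rewrite normr_ge0 Nm_entry_le.
Qed.

Lemma trace_Nm_ge n : m%:R <= \tr (Nm n).
Proof. by rewrite trace_Nm lerDl; apply: sumr_ge0 => k _; exact: nsq_ge0. Qed.

Lemma trace_Nm_mono : {homo (fun n => \tr (Nm n)) : i j / (i <= j)%N >-> i <= j}.
Proof.
apply: homo_leq => [//|x y z|n]; first exact: le_trans.
by rewrite /= NmS mxtraceD trace_outer dotvv lerDl nsq_ge0.
Qed.

Lemma ln_det_Nm_le n :
  ln (\det (Nm n)) <= ln ((m`!)%:R) + m%:R * ln (\tr (Nm n)).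
Proof.
have d1 := det_Nm_ge1 n.
have tp : 0 < \tr (Nm n) ^+ m.
  have := trace_Nm_ge n; case: (m) (\tr _) => [|k] t; first by rewrite expr0.
  by move=> kt; rewrite exprn_gt0 // (lt_le_trans _ kt).
have fp : 0 < (m`!)%:R :> R by rewrite ltr0n fact_gt0.
apply: le_trans (_ : ln ((m`!)%:R * \tr (Nm n) ^+ m) <= _).
  rewrite ler_ln ?posrE ?det_Nm_le ?mulr_gt0 //; lra.
rewrite lnM ?posrE // lerD2l.
have := trace_Nm_ge n; case: (m) (\tr _) => [|k] t.
  by rewrite expr0 ln1 mul0r.
move=> kt; rewrite lnXn ?mulr_natl //.
by rewrite (lt_le_trans _ kt).
Qed.

Section Recursion.
Variables (M0 : 'cV[R]_m) (e : nat -> R).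

(* For a least squares estimator driven by the noise [e], [Jm n *m Mv n] is the
   estimation error, [tau n] the prediction error and [Qf n] the Lyapunov function. *)
Definition Mv n : 'cV[R]_m := M0 + \sum_(k < n) e k *: Z k.
Definition tau n : R := dot (Z n) (Jm n *m Mv n).
Definition Qf n : R := dot (Mv n) (Jm n *m Mv n).

Lemma MvS n : Mv n.+1 = Mv n + e n *: Z n.
Proof. by rewrite /Mv big_ord_recr addrA. Qed.

Lemma Qf_ge0 n : 0 <= Qf n. Proof. exact: Jm_psd. Qed.

Lemma QfS n : Qf n.+1 = Qf n - tau n ^+ 2 / (1 + gain n)
  + 2 * (tau n / (1 + gain n) * e n) + leverage n * e n ^+ 2.
Proof.
have g0 := gain_ge0 n; have p : 1 + gain n != 0 by rewrite lt0r_neq0 // ltr_pwDl.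
have uM v : dot (Jm n *m Z n) v = dot (Z n) (Jm n *m v).
  by rewrite dot_mulmxl Jm_sym.
rewrite /Qf /tau MvS JmS; move: (Mv n) => M.
rewrite mulmxBl dotBr -scalemxAl dotZr dot_outer.
rewrite mulmxDr -scalemxAr !dotDl !dotDr !dotZl !dotZr !uM.
rewrite (dotC M (Jm n *m Z n)) uM -/(gain n).
by rewrite /leverage; field.
Qed.

Lemma Qf_sum n : Qf n + \sum_(k < n) tau k ^+ 2 / (1 + gain k) =
  Qf 0 + 2 * (\sum_(k < n) tau k / (1 + gain k) * e k)
  + \sum_(k < n) leverage k * e k ^+ 2.
Proof.
elim: n => [|n IH]; first by rewrite !big_ord0 mulr0 !addr0.
by rewrite !big_ord_recr /= QfS; move: IH; lra.
Qed.

End Recursion.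

End LeastSquares.

(** * Measurability and conditional expectations *)

Section MeasWrt.
Context {R : realType} {disp : measure_display} {T : measurableType disp}.
Variable G : set_system T.
Hypothesis sG : sigma_algebra [set: T] G.
Implicit Types f g : T -> R.

Let T' : measurableType _ := g_sigma_algebraType G.

Lemma meas_wrtP d' (E : measurableType d') (f : T -> E) :
  meas_wrt G f <-> measurable_fun [set: T'] (f : T' -> E).
Proof.
have GE : @measurable _ T' = G by exact: measurable_g_measurableTypeE.
split=> [H _ Y mY|H Y mY]; first by rewrite setTI GE; exact: H.
by have := H measurableT Y mY; rewrite setTI GE.
Qed.

Lemma sigma_setT : G [set: T].
Proof.
by rewrite -(measurable_g_measurableTypeE sG); exact: (@measurableT _ T').
Qed.

Lemma sigma_setI A B : G A -> G B -> G (A `&` B).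
Proof. by rewrite -(measurable_g_measurableTypeE sG); exact: measurableI. Qed.

Lemma meas_wrt_cst (c : R) : meas_wrt G (fun=> c).
Proof. exact/meas_wrtP/measurable_cst. Qed.

Lemma meas_wrtD f g : meas_wrt G f -> meas_wrt G g ->
  meas_wrt G (fun w => f w + g w).
Proof. by move=> /meas_wrtP mf /meas_wrtP mg; exact/meas_wrtP/measurable_funD. Qed.

Lemma meas_wrtB f g : meas_wrt G f -> meas_wrt G g ->
  meas_wrt G (fun w => f w - g w).
Proof. by move=> /meas_wrtP mf /meas_wrtP mg; exact/meas_wrtP/measurable_funB. Qed.

Lemma meas_wrtM f g : meas_wrt G f -> meas_wrt G g ->
  meas_wrt G (fun w => f w * g w).
Proof. by move=> /meas_wrtP mf /meas_wrtP mg; exact/meas_wrtP/measurable_funM. Qed.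

Lemma meas_wrt_comp (h : R -> R) f : measurable_fun [set: R] h ->
  meas_wrt G f -> meas_wrt G (fun w => h (f w)).
Proof.
by move=> mh /meas_wrtP mf; apply/meas_wrtP; exact: (measurableT_comp mh).
Qed.

Lemma meas_wrt_sum I (r : seq I) (Q : pred I) (f : I -> T -> R) :
  (forall i, meas_wrt G (f i)) ->
  meas_wrt G (fun w => \sum_(i <- r | Q i) f i w).
Proof.
move=> mf; elim: r => [|i r IH].
  by under eq_fun do rewrite big_nil; exact: meas_wrt_cst.
under eq_fun do rewrite big_cons; case: (Q i) => //.
exact: meas_wrtD.
Qed.

Lemma meas_wrtX f n : meas_wrt G f -> meas_wrt G (fun w => f w ^+ n).
Proof. by move=> /meas_wrtP mf; exact/meas_wrtP/measurable_funX. Qed.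

Lemma meas_wrtV f : meas_wrt G f -> (forall w, 0 <= f w) ->
  meas_wrt G (fun w => (f w)^-1).
Proof.
move=> mf f0.
have -> : (fun w => (f w)^-1) = (fun w => f w `^ (- 1)).
  by apply/funext => w; rewrite powRN powRr1.
exact: (meas_wrt_comp (@measurable_powR R (- 1)%R)).
Qed.

Lemma meas_wrt_indic (A : set T) : G A -> meas_wrt G (\1_A : T -> R).
Proof.
move=> GA; apply/meas_wrtP; apply: measurable_indic.
by rewrite measurable_g_measurableTypeE.
Qed.

Lemma meas_wrt_le f g : meas_wrt G f -> meas_wrt G g -> G [set w | f w <= g w].
Proof.
move=> /meas_wrtP mf /meas_wrtP mg.
have := @measurable_fun_ler _ T' R [set: T'] f g mf mg.
move=> /(_ measurableT [set true] I); rewrite setTI.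
by rewrite measurable_g_measurableTypeE.
Qed.

Lemma meas_wrt_lt f g : meas_wrt G f -> meas_wrt G g -> G [set w | f w < g w].
Proof.
move=> /meas_wrtP mf /meas_wrtP mg.
have := @measurable_fun_ltr _ T' R [set: T'] f g mf mg.
move=> /(_ measurableT [set true] I); rewrite setTI.
by rewrite measurable_g_measurableTypeE.
Qed.

End MeasWrt.

Lemma meas_wrt_sub {R : realType} {disp : measure_display}
    {T : measurableType disp} (G H : set_system T) (f : T -> R) :
  G `<=` H -> meas_wrt G f -> meas_wrt H f.
Proof. by move=> GH mf B mB; exact/GH/mf. Qed.

Lemma meas_wrt_fun {R : realType} {disp : measure_display}
    {T : measurableType disp} (G : set_system T) (f : T -> R) :
  G `<=` measurable -> meas_wrt G f -> measurable_fun [set: T] f.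
Proof. by move=> GH mf _ B mB; rewrite setTI; exact/GH/mf. Qed.

(** * Expectations and conditional inequalities with bounded factors *)

Section Expectation.
Context {R : realType} {disp : measure_display} {T : measurableType disp}.
Variable P : probability T R.
Implicit Types f g h : T -> R.

Definition intg f : Prop := P.-integrable [set: T] (EFin \o f).
Definition Ex f : R := \int[P]_w f w.

Lemma intg_meas f : intg f -> measurable_fun [set: T] f.
Proof. by move=> /integrableP[/measurable_EFinP]. Qed.

Lemma intgD f g : intg f -> intg g -> intg (fun w => f w + g w).
Proof. by move=> fi gi; exact: (integrableD measurableT fi gi). Qed.

Lemma intgB f g : intg f -> intg g -> intg (fun w => f w - g w).
Proof. by move=> fi gi; exact: (integrableB measurableT fi gi). Qed.

Lemma intgZ c f : intg f -> intg (fun w => c * f w).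
Proof. by move=> fi; exact: (integrableZl measurableT c fi). Qed.

Lemma intg_cst c : intg (fun=> c).
Proof. exact: finite_measure_integrable_cst. Qed.

Lemma intg_norm f : intg f -> intg (fun w => `|f w|).
Proof. exact: integrable_norm. Qed.

Lemma intgMb h f (C : R) : measurable_fun [set: T] h -> (forall w, `|h w| <= C) ->
  intg f -> intg (fun w => h w * f w).
Proof.
move=> mh hC fi; apply: (integrableMr measurableT mh _ fi).
exists C; split; first exact: num_real.
by move=> M CM w _ /=; rewrite (le_trans (hC w)) // ltW.
Qed.

Lemma intg_sum I (r : seq I) (f : I -> T -> R) :
  (forall i, intg (f i)) -> intg (fun w => \sum_(i <- r) f i w).
Proof.
move=> fi; elim: r => [|i r IH].
  by under eq_fun do rewrite big_nil; exact: intg_cst.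
by under eq_fun do rewrite big_cons; exact: intgD.
Qed.

Lemma intg_le f g : measurable_fun [set: T] f -> (forall w, `|f w| <= g w) ->
  intg g -> intg f.
Proof.
move=> mf fg; apply: le_integrable => //; first exact/measurable_EFinP.
move=> w _ /=; rewrite lee_fin (le_trans (fg w)) //; exact: ler_norm.
Qed.

Lemma Ex_fin f : intg f -> (\int[P]_w (f w)%:E = (Ex f)%:E)%E.
Proof. by move=> fi; rewrite /Ex /Rintegral fineK // integrable_fin_num. Qed.

Lemma ExD f g : intg f -> intg g -> Ex (fun w => f w + g w) = Ex f + Ex g.
Proof. exact: RintegralD. Qed.

Lemma ExB f g : intg f -> intg g -> Ex (fun w => f w - g w) = Ex f - Ex g.
Proof. exact: RintegralB. Qed.

Lemma ExZ c f : intg f -> Ex (fun w => c * f w) = c * Ex f.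
Proof. exact: RintegralZl. Qed.

Lemma Ex_cst c : Ex (fun=> c) = c.
Proof.
rewrite /Ex Rintegral_cst //; have /= -> := probability_setT P; exact: mulr1.
Qed.

Lemma Ex_le f g : intg f -> intg g -> (forall w, f w <= g w) -> Ex f <= Ex g.
Proof. by move=> fi gi fg; apply: le_Rintegral => // w _; exact: fg. Qed.

Lemma Ex_ge0 f : (forall w, 0 <= f w) -> 0 <= Ex f.
Proof. by move=> f0; apply: Rintegral_ge0 => w _. Qed.

Lemma Ex_sum I (r : seq I) (f : I -> T -> R) : (forall i, intg (f i)) ->
  Ex (fun w => \sum_(i <- r) f i w) = \sum_(i <- r) Ex (f i).
Proof.
move=> fi; elim: r => [|i r IH].
  by under eq_fun do rewrite big_nil; rewrite Ex_cst big_nil.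
under eq_fun do rewrite big_cons; rewrite ExD ?IH ?big_cons //.
exact: intg_sum.
Qed.

Lemma Ex_indicM A f : \int[P]_(w in A) f w = Ex (fun w => \1_A w * f w).
Proof.
rewrite Rintegral_mkcond; congr Rintegral; apply/funext => w.
by rewrite patchE indicE; case: ifP => _; rewrite ?mul1r ?mul0r.
Qed.

Lemma intg_indicM A f : measurable A -> intg f -> intg (fun w => \1_A w * f w).
Proof.
move=> mA; apply: (@intgMb _ _ 1); first exact: measurable_indic.
by move=> w; rewrite indicE; case: (_ \in _); rewrite ?normr1 ?normr0.
Qed.

(** The sum is the integer part of [y] capped at [K]: a staircase that stays within 1 of [y] as long
    as the cap is not reached. *)
Lemma steps_le (y : R) K : 0 <= y ->
  \sum_(j < K) (j.+1%:R <= y)%R%:R <= y /\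
  (y < K.+1%:R -> y <= \sum_(j < K) (j.+1%:R <= y)%R%:R + 1).
Proof.
move=> y0; elim: K => [|K [IH1 IH2]].
  by rewrite big_ord0 add0r; split=> // /ltW.
rewrite big_ord_recr /=; have [Ky|yK] := leP (K.+1%:R) y.
  have -> : \sum_(j < K) (j.+1%:R <= y)%R%:R = K%:R :> R.
    rewrite -[K in RHS]card_ord -sumr_const; apply: eq_bigr => j _.
    rewrite (le_trans _ Ky) // ler_nat ltnS ltnW //; exact: ltn_ord.
  by rewrite [true%:R]/(1 : R) natr1; split=> // /ltW; rewrite -[K.+2%:R]natr1.
by rewrite addr0; split=> // _; exact: IH2.
Qed.

(* A bounded nonnegative [G]-measurable [h] is within [1/N] of
   [1/N \sum_j 1_{j <= N h}]. *)
Lemma cond_le0 (G : set_system T) (W h : T -> R) C :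
  sigma_algebra [set: T] G -> G `<=` measurable -> intg W ->
  (forall A, G A -> Ex (fun w => \1_A w * W w) <= 0) ->
  meas_wrt G h -> (forall w, 0 <= h w <= C) ->
  Ex (fun w => h w * W w) <= 0.
Proof.
move=> sG GM Wi WA mh hC.
have mh' := meas_wrt_fun GM mh.
pose B := Ex (fun w => `|W w|).
have B0 : 0 <= B by exact: Ex_ge0.
suff H (N : nat) : Ex (fun w => h w * W w) <= N.+1%:R^-1 * B.
  rewrite leNgt; apply/negP => E0.
  have := archimedean.Num.Theory.archi_boundP (divr_ge0 B0 (ltW E0)).
  set n := archimedean.Num.bound _; apply/negP; rewrite -leNgt.
  have := H n; rewrite ler_pdivlMl // ler_pdivlMr //; apply: le_trans.
  by rewrite ler_pM2r // ler_nat.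
pose K := archimedean.Num.bound (N.+1%:R * C).
pose A (j : nat) := [set w | j.+1%:R <= N.+1%:R * h w].
have GA j : G (A j).
  by apply: meas_wrt_le => //; [exact: meas_wrt_cst|apply: meas_wrtM => //; exact: meas_wrt_cst].
pose hN w := N.+1%:R^-1 * \sum_(j < K) (\1_(A j) w : R).
have hNE w : hN w = N.+1%:R^-1 * \sum_(j < K) (j.+1%:R <= N.+1%:R * h w)%R%:R.
  congr (_ * _); apply: eq_bigr => j _; rewrite indicE.
  by congr ((nat_of_bool _)%:R); apply/idP/idP => [/set_mem|/mem_set].
have hN1 w : 0 <= h w - hN w <= N.+1%:R^-1.
  have /andP[h0 hc] := hC w.
  have y0 : 0 <= N.+1%:R * h w by rewrite mulr_ge0.
  have [s1 s2] := steps_le K y0; rewrite hNE.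
  have {}s2 : N.+1%:R * h w <= \sum_(j < K) (j.+1%:R <= N.+1%:R * h w)%R%:R + 1.
    apply: s2; apply: le_lt_trans (_ : N.+1%:R * C < _); first by rewrite ler_pM2l.
    have C0 : 0 <= N.+1%:R * C by rewrite (le_trans y0) // ler_pM2l.
    apply: lt_trans (archimedean.Num.Theory.archi_boundP C0) _.
    by rewrite ltr_nat.
  move: s1 s2; set S := \sum_(j < K) _ => s1 s2.
  rewrite -[h w](@mulKf _ N.+1%:R) ?pnatr_eq0 //.
  rewrite -mulrBr mulrC; apply/andP; split.
    by rewrite mulr_ge0 // ?subr_ge0 // ?invr_ge0.
  by rewrite -[leRHS]mul1r ler_pM2r ?invr_gt0 // lerBlDl.
have mhN : measurable_fun [set: T] hN.
  apply: (meas_wrt_fun GM); apply: meas_wrtM => //; first exact: meas_wrt_cst.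
  by apply: meas_wrt_sum => // j; exact: meas_wrt_indic.
have i1 : intg (fun w => (h w - hN w) * W w).
  apply: (@intgMb _ _ (N.+1%:R^-1)) => //; first exact: measurable_funB.
  by move=> w; have /andP[p0 p1] := hN1 w; rewrite ger0_norm.
have iA j : intg (fun w => \1_(A j) w * W w).
  by apply: intg_indicM => //; exact: GM.
have hNW : (fun w => hN w * W w)
    = (fun w => N.+1%:R^-1 * \sum_(j < K) (\1_(A j) w * W w)).
  by apply/funext => w; rewrite /hN -mulrA mulr_suml.
have i2 : intg (fun w => hN w * W w).
  by rewrite hNW; apply: intgZ; exact: intg_sum.
have -> : (fun w => h w * W w)
    = (fun w => (h w - hN w) * W w + hN w * W w).
  by apply/funext => w; rewrite mulrBl subrK.
rewrite ExD // -[leRHS]addr0; apply: lerD.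
  rewrite -ExZ; last exact: intg_norm.
  apply: Ex_le => //; first by apply: intgZ; exact: intg_norm.
  move=> w; have /andP[p0 p1] := hN1 w.
  apply: le_trans (ler_norm _) _; rewrite normrM ger0_norm //.
  by rewrite ler_wpM2r.
rewrite hNW ExZ; last exact: intg_sum.
rewrite Ex_sum //; apply: mulr_ge0_le0; first by rewrite invr_ge0.
by apply: sumr_le0 => j _; exact: WA.
Qed.

(** [Y] may fail to be integrable, so it is first cut to the event [A] where [Z <= K]. The cut
    variable [W] is integrable, [W - K] integrates to at most 0 over every set of [G], and
    [cond_le0] applies; [h] vanishes off [A], so nothing is lost. *)
Lemma Ex_cond_ge0_le (G : set_system T) (Y h : T -> R) (Z : T -> \bar R)
    (K C : R) :
  sigma_algebra [set: T] G -> G `<=` measurable ->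
  measurable_fun [set: T] Y -> (forall w, 0 <= Y w) ->
  is_cond_exp_ge0 P G Y Z -> meas_wrt G h -> (forall w, 0 <= h w <= C) ->
  0 <= K ->
  (forall w, h w != 0 -> (Z w <= K%:E)%E) ->
  intg (fun w => h w * Y w) /\
  Ex (fun w => h w * Y w) <= K * Ex h.
Proof.
move=> sG GM mY Y0 [mZ Z0 YZ] mh hC K0 hZ.
have mh' := meas_wrt_fun GM mh.
pose A := [set w | (Z w <= K%:E)%E].
have GA : G A.
  rewrite (_ : A = Z @^-1` [set` `]-oo, K%:E]%E]); first exact/mZ/emeasurable_itv.
  by apply/seteqP; split => w /=; rewrite in_itv.
have mA : measurable A by exact: GM.
pose W w := \1_A w * Y w.
have hW : (fun w => h w * Y w) = (fun w => h w * W w).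
  apply/funext => w; rewrite /W indicE.
  have [wA|wA] := boolP (w \in A); first by rewrite mul1r.
  have [->|h0] := eqVneq (h w) 0; first by rewrite !mul0r.
  by case/negP: wA; apply/mem_set/hZ.
have mW : measurable_fun [set: T] W by apply: measurable_funM.
have WB B : G B -> (\int[P]_(w in B) (W w)%:E <= K%:E * P B)%E.
  move=> GB; have mB : measurable B by exact: GM.
  have GAB : G (B `&` A) by exact: sigma_setI.
  have -> : (\int[P]_(w in B) (W w)%:E = \int[P]_(w in B `&` A) (Y w)%:E)%E.
    rewrite integral_mkcondr; apply: eq_integral => w _.
    rewrite patchE /W indicE; case: (w \in A); by rewrite ?mul1r ?mul0r.
  rewrite YZ //; apply: le_trans (_ : \int[P]_(w in B `&` A) (K%:E) <= _)%E.
    apply: ge0_le_integral => //.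
    - exact: measurableI.
    - have mZ' : measurable_fun [set: T] Z.
        by move=> _ E mE; rewrite setTI; exact/GM/mZ.
      exact: measurable_funS mZ'.
    - by move=> w [].
  rewrite integral_cst; last exact: measurableI.
  apply: lee_wpmul2l; first by rewrite lee_fin.
  apply: le_measure; rewrite ?inE //; exact: measurableI.
have iW : intg W.
  apply/integrableP; split; first exact/measurable_EFinP.
  have GT : G [set: T] by exact: sigma_setT.
  apply: le_lt_trans (_ : K%:E * P [set: T] < +oo)%E.
    apply: le_trans (WB _ GT); rewrite le_eqVlt; apply/orP; left; apply/eqP.
    apply: eq_integral => w _ /=; rewrite ger0_norm // /W indicE.
    by case: (_ \in _); rewrite ?mul1r ?mul0r.
  by rewrite probability_setT mule1 ltry.
have iWK : intg (fun w => W w - K) by apply: intgB => //; exact: intg_cst.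
have ih : intg h.
  apply: (@intg_le _ (fun=> C)) => // [w|]; last exact: intg_cst.
  by have /andP[h0 hc] := hC w; rewrite ger0_norm.
have ihW : intg (fun w => h w * W w).
  apply: (@intgMb _ _ C) => // w; have /andP[h0 hc] := hC w.
  by rewrite ger0_norm.
rewrite hW; split=> //.
have := @cond_le0 G (fun w => W w - K) h C sG GM iWK.
have -> : (fun w => h w * (W w - K)) = (fun w => h w * W w - K * h w).
  by apply/funext => w; rewrite mulrBr (mulrC K).
rewrite ExB //; last exact: intgZ.
rewrite ExZ // subr_le0; apply=> // B GB.
have mB : measurable B by exact: GM.
have -> : (fun w => \1_B w * (W w - K)) = (fun w => \1_B w * W w - K * \1_B w).
  by apply/funext => w; rewrite mulrBr (mulrC K).
have iB : intg (\1_B) by exact: integrable_indic.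
rewrite ExB ?ExZ //; [|exact: intg_indicM|exact: intgZ].
rewrite subr_le0 -lee_fin EFinM -!Ex_fin //; last exact: intg_indicM.
rewrite integral_indic // setIT.
apply: le_trans (WB _ GB); rewrite [leRHS]integral_mkcond le_eqVlt.
apply/orP; left; apply/eqP; apply: eq_integral => w _.
by rewrite patchE indicE; case: (w \in B); rewrite ?mul1r ?mul0r.
Qed.

End Expectation.

(** * Martingales *)

Section MartingaleBound.
Context {R : realType}.

(* The increments of [phi] are controlled by [psi], which is at most linear: this
   allows increments with finite moments of order slightly above 1. *)
Definition psi (t : R) : R := Num.min (t ^+ 2) `|t|.
Definition phi (t : R) : R := Num.sqrt (1 + t ^+ 2).

Lemma psi_ge0 t : 0 <= psi t.
Proof. by rewrite le_min sqr_ge0 normr_ge0. Qed.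

Lemma phi_sqr t : phi t ^+ 2 = 1 + t ^+ 2.
Proof. by rewrite sqr_sqrtr // addr_ge0 ?sqr_ge0. Qed.

Lemma phi_ge1 t : 1 <= phi t.
Proof.
by rewrite -[leLHS]sqrtr1 ler_wsqrtr // lerDl sqr_ge0.
Qed.

Lemma phi_ge t : `|t| <= phi t.
Proof. by rewrite -sqrtr_sqr ler_wsqrtr // lerDr. Qed.

Lemma phi_le t : phi t <= 1 + `|t|.
Proof.
rewrite -ler_sqr ?nnegrE ?addr_ge0 ?sqrtr_ge0 //.
by rewrite phi_sqr; have := normr_ge0 t; rewrite -(real_normK (num_real t)); nra.
Qed.

(* Both [phi'' <= 1] and [|phi'| <= 1]. *)
Lemma phiD x y : phi (x + y) <= phi x + x / phi x * y + 2 * psi y.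
Proof.
have a1 := phi_ge1 x; have a0 : 0 < phi x by lra.
have ax := phi_ge x.
have b1 := phi_ge1 (x + y).
have a2 := phi_sqr x; have b2 := phi_sqr (x + y).
have xa : x = x / phi x * phi x by rewrite divfK // lt0r_neq0.
have c1 : `|x / phi x| <= 1.
  by rewrite normrM normfV (gtr0_norm a0) ler_pdivrMr // mul1r.
set c := x / phi x in c1 xa *.
have zy := real_normK (num_real y); have z0 := normr_ge0 y.
set z := `|y| in zy z0 *.
have b2' : phi (x + y) ^+ 2 = phi x ^+ 2 + 2 * (c * phi x * y) + y ^+ 2.
  by rewrite b2 -xa sqrrD -mulr_natl a2; ring.
have cy : - z <= c * y.
  rewrite -lerN2 opprK; apply: le_trans (ler_norm _) _.
  by rewrite normrN normrM ler_piMl.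
have cy' : c * y <= z.
  by apply: le_trans (ler_norm _) _; rewrite normrM ler_piMl.
rewrite /psi -/z; have [h|h] := leP (y ^+ 2) z.
  have p : 0 <= phi x + c * y + 2 * y ^+ 2 by rewrite -zy; nra.
  rewrite -ler_sqr ?nnegrE ?sqrtr_ge0 // b2'.
  have := sqr_ge0 (c * y + 2 * y ^+ 2); have := sqr_ge0 y; nra.
have : phi (x + y) <= phi x + z.
  rewrite -ler_sqr ?nnegrE ?addr_ge0 ?sqrtr_ge0 // b2' -zy.
  have : phi x * (c * y) <= phi x * z by rewrite ler_pM2l.
  nra.
lra.
Qed.

Context {disp : measure_display} {T : measurableType disp}.
Variable P : probability T R.

(** A factor of arbitrary sign is made nonnegative by adding [C]; the shift costs nothing because
    [Y] and [Z] have the same mean. Each of the two inequalities is then an instance of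
    [cond_le0]. *)
Lemma cond_eq (G : set_system T) (Y Z h : T -> R) (C : R) :
  sigma_algebra [set: T] G -> G `<=` measurable ->
  is_cond_exp P G Y Z -> meas_wrt G h -> (forall w, `|h w| <= C) ->
  Ex P (fun w => h w * Y w) = Ex P (fun w => h w * Z w).
Proof.
move=> sG GM [iY iZ mZ YZ] mh hC.
have mh' := meas_wrt_fun GM mh.
have ihY : intg P (fun w => h w * Y w) by apply: (@intgMb _ _ _ _ _ _ C).
have ihZ : intg P (fun w => h w * Z w) by apply: (@intgMb _ _ _ _ _ _ C).
have EA A : G A -> Ex P (fun w => \1_A w * Y w) = Ex P (fun w => \1_A w * Z w).
  by move=> GA; rewrite -!Ex_indicM /Rintegral YZ.
have H (Y1 Z1 : T -> R) : intg P Y1 -> intg P Z1 ->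
    (forall A, G A -> Ex P (fun w => \1_A w * Y1 w) = Ex P (fun w => \1_A w * Z1 w)) ->
    Ex P (fun w => h w * Y1 w) <= Ex P (fun w => h w * Z1 w).
  move=> i1 i2 E1.
  have ih1 : intg P (fun w => h w * Y1 w) by apply: (@intgMb _ _ _ _ _ _ C).
  have ih2 : intg P (fun w => h w * Z1 w) by apply: (@intgMb _ _ _ _ _ _ C).
  have iW : intg P (fun w => Y1 w - Z1 w) by exact: intgB.
  have ET : Ex P Y1 = Ex P Z1.
    have cE (f : T -> R) : (fun w => cst 1 w * f w) = f.
      by apply/funext => w; rewrite /= mul1r.
    by have := E1 _ (sigma_setT sG); rewrite indicT !cE.
  have := @cond_le0 _ _ _ P G (fun w => Y1 w - Z1 w) (fun w => h w + C) (C + C) sG GM iW.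
  have -> : (fun w => (h w + C) * (Y1 w - Z1 w))
      = (fun w => (h w * Y1 w - h w * Z1 w) + C * (Y1 w - Z1 w)).
    by apply/funext => w; ring.
  rewrite ExD; [|exact: intgB|exact: intgZ].
  rewrite ExB // ExZ // ExB // ET subrr mulr0 addr0 subr_le0; apply.
  - move=> A GA; have mA : measurable A by exact: GM.
    under eq_fun do rewrite mulrBr.
    by rewrite ExB; [rewrite E1 // subrr|exact: intg_indicM|exact: intg_indicM].
  - by apply: meas_wrtD => //; exact: meas_wrt_cst.
  - move=> w; have := hC w; rewrite ler_norml => /andP[l1 l2].
    by apply/andP; split; lra.
apply/eqP; rewrite eq_le; apply/andP; split; apply: H => // A GA; by rewrite EA.
Qed.

Variable F : nat -> set_system T.
Hypothesis filtF : filtration F.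

Lemma filt_sigma n : sigma_algebra [set: T] (F n).
Proof. by case: filtF. Qed.

Lemma filt_meas n : F n `<=` measurable.
Proof. by case: filtF => _ []. Qed.

Lemma filt_le m n : (m <= n)%N -> F m `<=` F n.
Proof.
case: filtF => _ [_ FS] /subnK <-; elim: (n - m)%N => // k IH.
by apply: subset_trans IH _; exact: FS.
Qed.

Variables (y zeta : nat -> T -> R) (K : R).
Hypothesis my : forall k, meas_wrt (F k) (y k).
Hypothesis y1 : forall k w, `|y k w| <= 1.
Hypothesis mz : forall k, meas_wrt (F k.+1) (zeta k).
Hypothesis z0 : forall k, is_cond_exp P (F k) (zeta k) (fun=> 0).
Hypothesis sumK : forall n, \sum_(k < n) Ex P (fun w => psi (y k w * zeta k w)) <= K.

Fixpoint stopped (lam : R) n (w : T) : R :=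
  if n is k.+1 then
    stopped lam k w
      + \1_[set v | `|stopped lam k v| < lam] w * (y k w * zeta k w)
  else 0.

Lemma stopped_meas lam n : meas_wrt (F n) (stopped lam n).
Proof.
elim: n => [|n IH] /=; first exact: meas_wrt_cst (filt_sigma 0) _.
have sF := filt_sigma n.+1.
have IH' : meas_wrt (F n.+1) (stopped lam n).
  exact: meas_wrt_sub (filt_le (leqnSn n)) IH.
apply: meas_wrtD => //; apply: meas_wrtM => //; last first.
  by apply: meas_wrtM => //; exact: meas_wrt_sub (filt_le (leqnSn n)) (my n).
apply: meas_wrt_indic => //; apply: meas_wrt_lt => //; last exact: meas_wrt_cst.
by apply: meas_wrt_comp => //; exact: normr_measurable.
Qed.

Lemma intg_yz k : intg P (fun w => y k w * zeta k w).
Proof.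
apply: (@intgMb _ _ _ _ _ _ 1) => //; first exact: meas_wrt_fun (filt_meas (n := k)) _.
by case: (z0 k).
Qed.

Lemma intg_stopped lam n : intg P (stopped lam n).
Proof.
elim: n => [|n IH] /=; first exact: intg_cst.
apply: intgD => //; apply: intg_indicM; last exact: intg_yz.
have sF := filt_sigma n.
apply: (filt_meas (n := n)); apply: meas_wrt_lt => //; last exact: meas_wrt_cst.
by apply: meas_wrt_comp (stopped_meas lam n) => //; exact: normr_measurable.
Qed.

Lemma continuous_phi : continuous phi.
Proof.
move=> t; apply: continuous_comp; last exact: sqrt_continuous.
by apply: cvgD; [exact: cvg_cst|exact: exprn_continuous].
Qed.

Lemma measurable_phi : measurable_fun [set: R] phi.
Proof. by apply: continuous_measurable_fun; exact: continuous_phi. Qed.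

Lemma measurable_psi : measurable_fun [set: R] psi.
Proof. by apply: measurable_minr => //; exact: normr_measurable. Qed.

Lemma intg_phi_stopped lam n : intg P (fun w => phi (stopped lam n w)).
Proof.
apply: (@intg_le _ _ _ _ _ (fun w => 1 + `|stopped lam n w|)).
- apply: measurableT_comp measurable_phi _.
  exact: meas_wrt_fun (filt_meas (n := n)) (stopped_meas lam n).
- by move=> w; rewrite ger0_norm ?phi_le // sqrtr_ge0.
- by apply: intgD; [exact: intg_cst|exact/intg_norm/intg_stopped].
Qed.

Lemma intg_psi k : intg P (fun w => psi (y k w * zeta k w)).
Proof.
apply: (@intg_le _ _ _ _ _ (fun w => `|y k w * zeta k w|)).
- apply: measurableT_comp measurable_psi _; exact: intg_meas (intg_yz k).
- by move=> w; rewrite ger0_norm ?psi_ge0 // ge_min lexx orbT.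
- exact/intg_norm/intg_yz.
Qed.

(** The linear term of [phiD] has conditional mean 0, so only the [psi] terms accumulate. The bound
    depends neither on [n] nor on [lam]. *)
Lemma Ex_phi_stopped lam n : Ex P (fun w => phi (stopped lam n w)) <= 1 + 2 * K.
Proof.
apply: le_trans (_ : 1 + 2 * \sum_(k < n) Ex P (fun w => psi (y k w * zeta k w)) <= _).
  elim: n => [|n IH].
    rewrite big_ord0 mulr0 addr0 /= (_ : (fun=> _) = fun=> 1) ?Ex_cst //.
    by apply/funext => w; rewrite /phi expr0n addr0 sqrtr1.
  rewrite big_ord_recr /=.
  pose A := [set v | `|stopped lam n v| < lam].
  have sF := filt_sigma n.
  have FA : F n A.
    apply: meas_wrt_lt => //; last exact: meas_wrt_cst.
    by apply: meas_wrt_comp (stopped_meas lam n) => //; exact: normr_measurable.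
  have mA : measurable A by exact: (filt_meas (n := n)).
  pose h w := \1_A w * y n w * (stopped lam n w / phi (stopped lam n w)).
  have mh : meas_wrt (F n) h.
    apply: meas_wrtM => //; first by apply: meas_wrtM => //; exact: meas_wrt_indic.
    apply: meas_wrtM => //; first exact: stopped_meas.
    apply: meas_wrtV => // [|w]; last exact: sqrtr_ge0.
    by apply: meas_wrt_comp (stopped_meas lam n) => //; exact: measurable_phi.
  have h1 w : `|h w| <= 1.
    rewrite /h normrM -[leRHS]mulr1 ler_pM //.
      rewrite normrM -[leRHS]mulr1 ler_pM // indicE.
      by case: (_ \in _); rewrite ?normr1 ?normr0.
    have p0 : 0 < phi (stopped lam n w) by have := phi_ge1 (stopped lam n w); lra.
    by rewrite normrM normfV (gtr0_norm p0) ler_pdivrMr // mul1r phi_ge.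
  have Eh : Ex P (fun w => h w * zeta n w) = 0.
    rewrite (cond_eq sF (filt_meas (n := n)) (z0 n) mh h1).
    by under eq_fun do rewrite mulr0; exact: Ex_cst.
  have ih : intg P (fun w => h w * zeta n w).
    apply: (@intgMb _ _ _ _ _ _ 1) => //; first exact: meas_wrt_fun (filt_meas (n := n)) _.
    by case: (z0 n).
  have i1 : intg P (fun w => phi (stopped lam n w) + h w * zeta n w).
    by apply: intgD => //; exact: intg_phi_stopped.
  have i2 : intg P (fun w => 2 * psi (y n w * zeta n w)) by apply/intgZ/intg_psi.
  apply: le_trans (_ : Ex P (fun w => phi (stopped lam n w) + h w * zeta n w
      + 2 * psi (y n w * zeta n w)) <= _).
    apply: Ex_le; [exact: (intg_phi_stopped lam n.+1)|exact: intgD|move=> w].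
    rewrite -/A; have := phiD (stopped lam n w) (\1_A w * (y n w * zeta n w)).
    move/le_trans; apply; apply: lerD.
      rewrite lerD2l le_eqVlt; apply/orP; left; apply/eqP; rewrite /h; ring.
    rewrite ler_pM2l // indicE; case: (_ \in _); rewrite ?mul1r // mul0r.
    by rewrite {1}/psi expr0n normr0 minxx psi_ge0.
  rewrite ExD // ExD //; last exact: intg_phi_stopped.
  by rewrite Eh addr0 ExZ ?mulrDr ?addrA ?lerD2r //; exact: intg_psi.
by rewrite lerD2l ler_pM2l.
Qed.

Lemma stopped_prob (lam : R) n : 0 < lam ->
  (P [set w | (lam <= `|stopped lam n w|)%R] <= ((1 + 2 * K) / lam)%:E)%E.
Proof.
move=> l0; set B := [set w | _].
have mB : measurable B.
  apply: (filt_meas (n := n)); have sF := filt_sigma n.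
  apply: meas_wrt_le => //; first exact: meas_wrt_cst.
  by apply: meas_wrt_comp (stopped_meas lam n) => //; exact: normr_measurable.
have iB : intg P (\1_B) by exact: integrable_indic.
have -> : P B = (Ex P (\1_B))%:E.
  by rewrite -Ex_fin // integral_indic // setIT.
rewrite lee_fin ler_pdivlMr // mulrC -ExZ //.
apply: le_trans (Ex_phi_stopped lam n).
apply: Ex_le; [exact: intgZ|exact: intg_phi_stopped|move=> w].
rewrite indicE; have [/set_mem wB|_] := boolP (w \in B).
  by rewrite mulr1 (le_trans wB) // phi_ge.
by rewrite mulr0 sqrtr_ge0.
Qed.

Lemma stopped_mono lam n w : lam <= `|stopped lam n w| ->
  stopped lam n.+1 w = stopped lam n w.
Proof.
move=> h /=; rewrite indicE memNset ?mul0r ?addr0 // => /= h'.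
by move: (lt_le_trans h' h); rewrite ltxx.
Qed.

Lemma stopped_eq lam n w : (forall m, `|stopped lam m w| < lam) ->
  stopped lam n w = \sum_(k < n) y k w * zeta k w.
Proof.
move=> H; elim: n => [|n IH]; first by rewrite big_ord0.
by rewrite big_ord_recr /= -IH indicE mem_set /= ?mul1r.
Qed.

(** Freezing makes the events [B l n] increase with [n], so Markov's inequality at a fixed time
    passes to the supremum by continuity of the measure and replaces a maximal inequality; then [l]
    tends to infinity. *)
Lemma martingale_bounded :
  {ae P, forall w, exists C : R, forall n, `|\sum_(k < n) y k w * zeta k w| <= C}.
Proof.
pose B (l n : nat) := [set w | l.+1%:R <= `|stopped l.+1%:R n w|].
have mB l n : measurable (B l n).
  apply: (filt_meas (n := n)); have sF := filt_sigma n.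
  apply: meas_wrt_le => //; first exact: meas_wrt_cst.
  by apply: meas_wrt_comp (stopped_meas _ n) => //; exact: normr_measurable.
have ndB l : nondecreasing_seq (B l).
  apply/nondecreasing_seqP => n; apply/subsetPset => w /= h.
  by have E := stopped_mono h; rewrite /B /mkset E.
have PB l : (P (\bigcup_n B l n) <= ((1 + 2 * K) / l.+1%:R)%:E)%E.
  have mU : measurable (\bigcup_n B l n) by exact: bigcup_measurable.
  have := nondecreasing_cvg_mu (mu := P) (mB l) mU (ndB l).
  move=> /cvg_lim <- //; apply: lime_le; first by apply/cvg_ex; eexists; exact: (nondecreasing_cvg_mu (mu := P) (mB l) mU (ndB l)).
  by apply: nearW => n; exact: stopped_prob.
exists (\bigcap_l \bigcup_n B l n); split.
- by apply: bigcap_measurable => // l _; exact: bigcup_measurable.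
- apply/eqP; rewrite eq_le measure_ge0 andbT.
  apply/lee_addgt0Pr => e e0; rewrite add0e.
  have := archimedean.Num.Theory.archi_boundP (divr_ge0 (normr_ge0 (1 + 2 * K)) (ltW e0)).
  set l := archimedean.Num.bound _; rewrite ltr_pdivrMr // => H.
  apply: le_trans (_ : P (\bigcup_n B l n) <= _)%E.
    apply: le_measure; rewrite ?inE.
    - by apply: bigcap_measurable => // i _; exact: bigcup_measurable.
    - exact: bigcup_measurable.
    - by move=> w /= /(_ l I).
  apply: le_trans (PB l) _; rewrite lee_fin ler_pdivrMr // [leRHS]mulrC.
  apply: le_trans (ler_norm _) _; apply: le_trans (ltW H) _.
  by rewrite ler_pM2r // ler_nat.
- move=> w /= H l _; apply: contrapT => H2; apply: H; exists l.+1%:R => n.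
  have H3 m : `|stopped l.+1%:R m w| < l.+1%:R.
    by rewrite ltNge; apply/negP => h; apply: H2; exists m.
  by rewrite -(stopped_eq n H3) ltW.
Qed.

End MartingaleBound.

(** * Summation by parts and normalizing powers *)

Section Summation.
Context {R : realType}.

(** Summation by parts with monotone weights: Kronecker's lemma with boundedness in place of
    convergence. *)
Lemma abel_bound (W S : nat -> R) C n :
  {homo W : i j / (i <= j)%N >-> i <= j} -> 0 <= W 0%N -> S 0%N = 0 ->
  (forall k, `|S k| <= C) ->
  `|\sum_(k < n) W k.+1 * (S k.+1 - S k)| <= 2 * C * W n.
Proof.
move=> nW W0 S0 SC.
have C0 : 0 <= C by apply: le_trans (SC 0%N).
have Wn0 : 0 <= W n by apply: le_trans W0 _; exact: nW.
have -> : \sum_(k < n) W k.+1 * (S k.+1 - S k)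
    = W n * S n - \sum_(k < n) (W k.+1 - W k) * S k.
  elim: n {Wn0} => [|n IH]; first by rewrite !big_ord0 S0 mulr0 subr0.
  by rewrite !big_ord_recr /= IH; ring.
have H : `|\sum_(k < n) (W k.+1 - W k) * S k| <= C * (W n - W 0%N).
  elim: n {Wn0} => [|n IH]; first by rewrite big_ord0 normr0 subrr mulr0.
  rewrite big_ord_recr /=; apply: le_trans (ler_normD _ _) _.
  apply: le_trans (lerD IH _) (_ : _ + C * (W n.+1 - W n) <= _); last by lra.
  have d0 : 0 <= W n.+1 - W n by rewrite subr_ge0 nW.
  by rewrite normrM (ger0_norm d0) mulrC ler_wpM2r.
apply: le_trans (ler_normB _ _) _.
have : `|W n * S n| <= C * W n by rewrite normrM (ger0_norm Wn0) mulrC ler_wpM2r.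
nra.
Qed.

(* [s^(3/4)] *)
Definition s34 (s : R) : R := Num.sqrt s * Num.sqrt (Num.sqrt s).

Lemma s34_mono a b : a <= b -> s34 a <= s34 b.
Proof. by move=> ab; apply: ler_pM; rewrite ?sqrtr_ge0 ?ler_wsqrtr. Qed.

Lemma s34_ge0 a : 0 <= s34 a.
Proof. by rewrite mulr_ge0 ?sqrtr_ge0. Qed.

Lemma s34_ge1 a : 1 <= a -> 1 <= s34 a.
Proof.
by move=> a1; have := s34_mono a1; rewrite {1}/s34 !sqrtr1 mulr1.
Qed.

Lemma s34_sqr a : 0 <= a -> s34 a ^+ 2 = a * Num.sqrt a.
Proof. by move=> a0; rewrite exprMn !sqr_sqrtr ?sqrtr_ge0. Qed.

Lemma s34_le (del : R) : 0 < del -> exists C, forall a, 0 <= a -> s34 a <= del * a + C.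
Proof.
move=> d0; exists (del^-1 ^+ 3) => a a0.
rewrite /s34; set b := Num.sqrt a; set c := Num.sqrt b.
have b0 : 0 <= b by exact: sqrtr_ge0.
have c0 : 0 <= c by exact: sqrtr_ge0.
have ba : b ^+ 2 = a by rewrite sqr_sqrtr.
have cb : c ^+ 2 = b by rewrite sqr_sqrtr.
have i0 : 0 < del^-1 by rewrite invr_gt0.
(* With [c] the fourth root of [a], the left side is [c^3]. Below the threshold it is bounded by the
   constant; above it [c^3 <= del * c^4]. *)
have [h|h] := leP c del^-1.
  have : c ^+ 3 <= del^-1 ^+ 3 by rewrite lerXn2r // nnegrE ltW.
  have : 0 <= del * a by rewrite mulr_ge0 // ltW.
  by rewrite -cb -exprSr; lra.
have : 1 <= del * c by rewrite -ler_pdivrMl // mulr1 ltW.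
rewrite -ba -cb => h1; have : 0 <= del^-1 ^+ 3 by rewrite exprn_ge0 // ltW.
suff : c ^+ 3 <= del * c * c ^+ 3 by rewrite -!exprSr -exprM => H; move: H; rewrite -!mulrA -exprS; lra.
by rewrite ler_peMl // exprn_ge0.
Qed.

(** Discrete comparison with the integral of [t^(-3/2)] from 1 to infinity, whose value is 2. The
    exponent 3/4 is above 1/2 for this convergence, and below 1 so that [s34] is absorbed by a small
    multiple of its argument. *)
Lemma sum_s34 (Y : nat -> R) n :
  \sum_(k < n) Y k ^+ 2 / s34 (1 + \sum_(j < k.+1) Y j ^+ 2) ^+ 2 <= 2.
Proof.
pose s n := 1 + \sum_(j < n) Y j ^+ 2.
have s1 m : 1 <= s m by rewrite lerDl sumr_ge0 // => i _; exact: sqr_ge0.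
suff : \sum_(k < n) Y k ^+ 2 / s34 (s k.+1) ^+ 2 <= 2 - 2 / Num.sqrt (s n).
  move=> /le_trans; apply; rewrite lerBlDr lerDl divr_ge0 // sqrtr_ge0.
elim: n => [|n IH].
  by rewrite /s !big_ord0 addr0 sqrtr1 divr1 subrr.
rewrite big_ord_recr /=; apply: le_trans (lerD IH (lexx _)) _.
rewrite s34_sqr; last by have := s1 n.+1; lra.
have -> : Y n ^+ 2 = s n.+1 - s n by rewrite /s big_ord_recr /=; ring.
set a := Num.sqrt (s n); set b := Num.sqrt (s n.+1).
have a1 : 1 <= a by rewrite -sqrtr1 ler_wsqrtr.
have ab : a <= b.
  by rewrite ler_wsqrtr // /s [in leRHS]big_ord_recr /= addrA lerDl sqr_ge0.
have ea : s n = a ^+ 2 by rewrite sqr_sqrtr //; have := s1 n; lra.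
have eb : s n.+1 = b ^+ 2 by rewrite sqr_sqrtr //; have := s1 n.+1; lra.
have a0 : 0 < a by lra.
have b0 : 0 < b by lra.
rewrite ea eb.
suff : (b ^+ 2 - a ^+ 2) / (b ^+ 2 * b) <= 2 / a - 2 / b by lra.
have -> : 2 / a - 2 / b = (2 * (b - a) * b ^+ 2) / (a * (b ^+ 2 * b)).
  by field; rewrite !lt0r_neq0.
have p : 0 < b ^+ 2 * b by rewrite mulr_gt0 ?exprn_gt0.
rewrite ler_pdivrMr // mulrAC ler_pdivlMr ?mulr_gt0 //.
have -> : (b ^+ 2 - a ^+ 2) * (a * (b ^+ 2 * b)) = (b ^+ 2 - a ^+ 2) * a * (b ^+ 2 * b).
  by ring.
apply: ler_wpM2r; first exact: ltW.
have h1 : a * a <= b * b by nra.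
have h2 : a * b <= b * b by nra.
have : (b - a) * ((b + a) * a) <= (b - a) * (2 * (b * b)).
  by apply: ler_wpM2l; [lra|nra].
lra.
Qed.

Lemma sum_inv_sqr (f : nat -> R) n : (forall k, 0 <= f k) ->
  \sum_(k < n) f k / (1 + \sum_(j < k.+1) f j) ^+ 2 <= 1.
Proof.
move=> f0; pose s n := 1 + \sum_(j < n) f j.
have s1 m : 1 <= s m by rewrite lerDl sumr_ge0.
suff : \sum_(k < n) f k / s k.+1 ^+ 2 <= 1 - (s n)^-1.
  move=> /le_trans; apply; rewrite lerBlDr lerDl invr_ge0; have := s1 n; lra.
elim: n => [|n IH].
  by rewrite /s !big_ord0 addr0 invr1 subrr.
rewrite big_ord_recr /=; apply: le_trans (lerD IH (lexx _)) _.
have e : s n.+1 = s n + f n by rewrite /s big_ord_recr /= addrA.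
have fn := f0 n; have h1 := s1 n; rewrite e.
suff : f n / (s n + f n) ^+ 2 <= (s n)^-1 - (s n + f n)^-1 by lra.
have -> : (s n)^-1 - (s n + f n)^-1 = f n / (s n * (s n + f n)).
  by field; rewrite !lt0r_neq0 //; lra.
rewrite ler_wpM2l // lef_pV2 ?posrE ?exprn_gt0 ?mulr_gt0 //; nra.
Qed.

(** Discrete comparison with the integral of [t^(-p)] from 1 to infinity. The primitive is handled
    in the variable [ln t], where [expR_ge1Dx] bounds its increments. *)
Lemma sum_powR_inv (f : nat -> R) n p : (forall k, 0 <= f k) -> 1 < p ->
  \sum_(k < n) f k / (1 + \sum_(j < k.+1) f j) `^ p <= (p - 1)^-1.
Proof.
move=> f0 p1; pose s n := 1 + \sum_(j < n) f j.
have s1 m : 1 <= s m by rewrite lerDl sumr_ge0.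
have c0 : 0 < p - 1 by rewrite subr_gt0.
suff : \sum_(k < n) f k / s k.+1 `^ p
    <= (p - 1)^-1 * (1 - expR (- (p - 1) * ln (s n))).
  move=> /le_trans; apply; apply: ler_piMr; first by rewrite invr_ge0 ltW.
  by rewrite lerBlDr lerDl expR_ge0.
elim: n => [|n IH].
  by rewrite /s !big_ord0 addr0 ln1 mulr0 expR0 subrr mulr0.
rewrite big_ord_recr /=; apply: le_trans (lerD IH (lexx _)) _.
have e : s n.+1 = s n + f n by rewrite /s big_ord_recr /= addrA.
have fn := f0 n; have h1 := s1 n; have h2 := s1 n.+1.
have sp : 0 < s n by lra.
have sp' : 0 < s n.+1 by lra.
rewrite /powR gt_eqF //.
set u := ln (s n); set v := ln (s n.+1).
have uv : f n / s n.+1 <= v - u.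
  rewrite /u /v -ln_div ?posrE //.
  have := @le_ln1Dx R (s n / s n.+1 - 1).
  rewrite (_ : 1 + (s n / s n.+1 - 1) = s n / s n.+1); last by ring.
  have q : 0 < s n / s n.+1 by rewrite divr_gt0.
  have -> : f n / s n.+1 = 1 - s n / s n.+1 by rewrite e; field; rewrite -e lt0r_neq0.
  move=> H; have {}H := H _.
  have : ln (s n / s n.+1) <= s n / s n.+1 - 1 by apply: H; lra.
  rewrite !ln_div ?posrE //; lra.
have -> : f n / expR (p * v) = f n / s n.+1 * expR (- (p - 1) * v).
  rewrite -(lnK (x := s n.+1)) ?posrE // -/v -!expRN -mulrA -expRD.
  by congr (_ * expR _); ring.
have H1 : (v - u) * expR (- (p - 1) * v)
    <= (p - 1)^-1 * (expR (- (p - 1) * u) - expR (- (p - 1) * v)).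
  rewrite ler_pdivlMl //.
  have -> : expR (- (p - 1) * u)
      = expR ((p - 1) * (v - u)) * expR (- (p - 1) * v).
    by rewrite -expRD; congr expR; ring.
  have := expR_ge1Dx ((p - 1) * (v - u)).
  have := expR_gt0 (- (p - 1) * v); nra.
have H2 : f n / s n.+1 * expR (- (p - 1) * v) <= (v - u) * expR (- (p - 1) * v).
  by rewrite ler_wpM2r // expR_ge0.
nra.
Qed.

(** [psi] is the lower envelope of the first and second powers, hence below every intermediate one:
    moments of order slightly above 1 suffice for the increments. *)
Lemma psi_le_powR (t p : R) : 1 <= p <= 2 -> psi t <= `|t| `^ p.
Proof.
move=> /andP[p1 p2]; rewrite /psi; have [h|h] := leP `|t| 1.
  rewrite ge_min; apply/orP; left.
  rewrite -(real_normK (num_real t)).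
  have [->|t0] := eqVneq `|t| 0; first by rewrite expr0n powR_ge0.
  have tp : 0 < `|t| by rewrite lt_def t0 /=.
  rewrite -powR_mulrn //; apply: ger_powR => //; by rewrite tp.
rewrite ge_min; apply/orP; right.
by rewrite -{1}(powRr1 (normr_ge0 t)); apply: ler_powR => //; exact: ltW.
Qed.

Lemma powR_sq_le (e s p alpha : R) : 0 <= s -> 0 < p -> 2 * p <= alpha ->
  `|e ^+ 2 - s| `^ p <= (2 `^ p) * (1 + s `^ p) * (1 + `|e| `^ alpha).
Proof.
move=> s0 p0 pa.
have h : `|e ^+ 2 - s| <= 2 * Num.max (e ^+ 2) s.
  apply: le_trans (ler_normB _ _) _; rewrite !ger0_norm ?sqr_ge0 //.
  by rewrite mulr2n mulrDl mul1r lerD // le_max lexx ?orbT.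
apply: le_trans (ge0_ler_powR (ltW p0) _ _ h) _; rewrite ?nnegrE //.
  by rewrite mulr_ge0 // le_max s0 orbT.
rewrite powRM //; last by rewrite le_max s0 orbT.
rewrite -mulrA ler_pM2l ?powR_gt0 //.
have s1 := powR_ge0 s p; have e1 := powR_ge0 `|e| alpha.
have [_|_] := leP (e ^+ 2) s; first by nra.
suff : (e ^+ 2) `^ p <= 1 + `|e| `^ alpha by nra.
rewrite -(real_normK (num_real e)) -powR_mulrn // -powRrM.
have [h1|h1] := leP `|e| 1.
  have : `|e| `^ (2 * p) <= 1; last lra.
  apply: le_trans (_ : 1 `^ (2 * p) <= 1); last by rewrite powR1.
  by apply: ge0_ler_powR; rewrite ?nnegrE ?mulr_ge0 // ltW.
by have : `|e| `^ (2 * p) <= `|e| `^ alpha; [apply: ler_powR => //; exact: ltW|lra].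
Qed.

End Summation.

(** * Martingale bounds for a noise with constant conditional variance *)

Section Noise.
Context {R : realType} {disp : measure_display} {T : measurableType disp}.
Variable P : probability T R.
Variable F : nat -> set_system T.
Hypothesis filtF : filtration F.
Variables (e : nat -> T -> R) (s2 : R).
Hypothesis me : forall k, meas_wrt (F k.+1) (e k).
Hypothesis e0 : forall k, is_cond_exp P (F k) (e k) (fun=> 0).
Hypothesis e2 : forall k, is_cond_exp P (F k) (fun w => e k w ^+ 2) (fun=> s2).

Let sF n := filt_sigma filtF n.
Let FM n := @filt_meas _ _ _ filtF n.

Lemma cond_var_ge0 : 0 <= s2.
Proof.
have := @cond_eq _ _ _ P (F 0) _ _ (fun=> 1) 1 (sF 0) (@FM 0) (e2 0).
move=> /(_ (meas_wrt_cst (sF 0) _)) H.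
have {}H := H (fun=> _); rewrite normr1 in H.
have {}H := H (lexx 1); rewrite Ex_cst mul1r in H; rewrite -H.
by apply: Ex_ge0 => w; rewrite mul1r sqr_ge0.
Qed.

Lemma meas_wrt_partial (f : nat -> T -> R) n m : (n <= m.+1)%N ->
  (forall k, meas_wrt (F k) (f k)) ->
  meas_wrt (F m) (fun w => \sum_(k < n) f k w).
Proof.
move=> nm mf; elim: n nm => [|n IH] nm.
  by under eq_fun do rewrite big_ord0; exact: meas_wrt_cst.
under eq_fun do rewrite big_ord_recr /=.
apply: meas_wrtD => //; first by apply: IH; exact: ltnW.
exact: meas_wrt_sub (filt_le filtF _) (mf n).
Qed.

Lemma Ex_mul_e2 (h : T -> R) k C : meas_wrt (F k) h -> (forall w, `|h w| <= C) ->
  Ex P (fun w => h w * e k w ^+ 2) = s2 * Ex P h.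
Proof.
move=> mh hC; rewrite (cond_eq (sF k) (@FM k) (e2 k) mh hC).
rewrite -ExZ; first by congr Ex; apply/funext => w; rewrite mulrC.
apply: (@intg_le _ _ _ _ _ (fun=> C)) => //; last exact: intg_cst.
exact: meas_wrt_fun (@FM k) mh.
Qed.

Lemma intg_mul_e2 (h : T -> R) k C : meas_wrt (F k) h -> (forall w, `|h w| <= C) ->
  intg P (fun w => h w * e k w ^+ 2).
Proof.
move=> mh hC; apply: (@intgMb _ _ _ _ _ _ C) => //.
  exact: meas_wrt_fun (@FM k) mh.
by case: (e2 k).
Qed.

Lemma intg_bounded (h : T -> R) k C : meas_wrt (F k) h -> (forall w, `|h w| <= C) ->
  intg P h.
Proof.
move=> mh hC; apply: (@intg_le _ _ _ _ _ (fun=> C)) => //; last exact: intg_cst.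
exact: meas_wrt_fun (@FM k) mh.
Qed.

(** Each factor is divided by [s34] of the running sum of squares. By [sum_s34] the normalized
    martingale has a summable mean quadratic variation, so it is bounded, and [abel_bound] restores
    the weights. *)
Lemma martingale_s34 (Y : nat -> T -> R) : (forall k, meas_wrt (F k) (Y k)) ->
  {ae P, forall w, exists C : R, forall n, `|\sum_(k < n) Y k w * e k w|
     <= C * s34 (1 + \sum_(k < n) Y k w ^+ 2)}.
Proof.
move=> mY.
pose s n w := 1 + \sum_(k < n) Y k w ^+ 2.
have s1 n w : 1 <= s n w by rewrite lerDl sumr_ge0 // => i _; exact: sqr_ge0.
pose W n w := s34 (s n w).
have W1 n w : 1 <= W n w by exact: s34_ge1.
(* The weight [W k.+1] already contains the current term [Y k], which makes the normalized factor at
   most 1; it is still known at time [k]. *)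
have mW k : meas_wrt (F k) (W k.+1).
  have ms : meas_wrt (F k) (s k.+1).
    apply: meas_wrtD => //; first exact: meas_wrt_cst.
    by apply: (@meas_wrt_partial (fun j w => Y j w ^+ 2)) => // j; exact: meas_wrtX.
  have mq : measurable_fun [set: R] (@Num.sqrt R).
    by apply: continuous_measurable_fun; exact: sqrt_continuous.
  apply: meas_wrtM => //; do ?[apply: meas_wrt_comp => //].
pose y k w := Y k w / W k.+1 w.
have my k : meas_wrt (F k) (y k).
  by apply: meas_wrtM => //; apply: meas_wrtV => // w; exact: s34_ge0.
have ysq k w : y k w ^+ 2 = Y k w ^+ 2 / W k.+1 w ^+ 2.
  by rewrite /y exprMn exprVn.
have y1 k w : `|y k w| <= 1.
  rewrite -ler_sqr ?nnegrE // real_normK ?num_real // expr1n ysq.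
  have w1 := W1 k.+1 w; have w2 : 0 < W k.+1 w ^+ 2 by rewrite exprn_gt0 //; lra.
  rewrite ler_pdivrMr // mul1r.
  have s1' := s1 k.+1 w.
  rewrite /W s34_sqr; last by lra.
  have : 1 <= Num.sqrt (s k.+1 w) by rewrite -[leLHS]sqrtr1 ler_wsqrtr.
  have : Y k w ^+ 2 <= s k.+1 w.
    rewrite /s big_ord_recr /= addrA lerDr addr_ge0 // sumr_ge0 // => i _.
    exact: sqr_ge0.
  nra.
have y21 k w : `|y k w ^+ 2| <= 1 by rewrite normrX exprn_ile1.
have m2 k : meas_wrt (F k) (fun w => y k w ^+ 2) by exact: meas_wrtX.
have K n : \sum_(k < n) Ex P (fun w => psi (y k w * e k w)) <= s2 * 2.
  apply: le_trans (_ : \sum_(k < n) s2 * Ex P (fun w => y k w ^+ 2) <= _).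
    apply: ler_sum => k _; rewrite -(Ex_mul_e2 (m2 k) (y21 k)).
    apply: Ex_le; first by apply: intg_psi y1 e0 _.
      exact: intg_mul_e2 (m2 k) (y21 k).
    by move=> w; rewrite /psi ge_min exprMn lexx.
  rewrite -mulr_sumr ler_wpM2l ?cond_var_ge0 //.
  rewrite -Ex_sum; last by move=> k; exact: intg_bounded (m2 k) (y21 k).
  rewrite -[leRHS](Ex_cst P 2); apply: Ex_le; last 1 first.
  - by move=> w; under eq_bigr do rewrite ysq; exact: (sum_s34 (Y^~ w)).
  - by apply: intg_sum => k; exact: intg_bounded (m2 k) (y21 k).
  - exact: intg_cst.
have := martingale_bounded filtF my y1 me e0 K.
apply: filterS => w [C HC]; exists (2 * C) => n.
pose S n := \sum_(k < n) y k w * e k w.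
have -> : \sum_(k < n) Y k w * e k w = \sum_(k < n) W k.+1 w * (S k.+1 - S k).
  apply: eq_bigr => k _; rewrite /S big_ord_recr /= addrAC subrr add0r /y.
  by rewrite mulrA mulrCA divff ?mulr1 // lt0r_neq0 //; have := W1 k.+1 w; lra.
apply: (@abel_bound _ (W^~ w)) => //; last by rewrite /S big_ord0.
  apply: homo_leq => [//|x1 x2 x3|k]; first exact: le_trans.
  by apply: s34_mono; rewrite /s [in leRHS]big_ord_recr /= addrA lerDl sqr_ge0.
exact: s34_ge0.
Qed.

Lemma centered_sqr k : is_cond_exp P (F k) (fun w => e k w ^+ 2 - s2) (fun=> 0).
Proof.
have [i1 i2 _ H] := e2 k; split.
- exact: (@intgB _ _ _ P _ _ i1 i2).
- exact: (@intg_cst _ _ _ P 0).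
- exact: meas_wrt_cst.
move=> A FA; have mA : measurable A by exact: FM FA.
have j1 : P.-integrable A (EFin \o (fun w => e k w ^+ 2)).
  exact: integrableS i1.
have j2 : P.-integrable A (EFin \o (fun=> s2)) by exact: integrableS i2.
have := integralB_EFin mA j1 j2; rewrite /= => ->.
by rewrite H // subee ?integral0 //; exact: integrable_fin_num j2.
Qed.

Lemma ler_sum_ord_widen (f : nat -> R) m n : (forall k, 0 <= f k) -> (m <= n)%N ->
  \sum_(k < m) f k <= \sum_(k < n) f k.
Proof.
move=> f0 /subnK <-; elim: (n - m)%N => // j IH.
by apply: le_trans IH _; rewrite addSn big_ord_recr /= lerDl.
Qed.

(** With second moments only, [psi] is bounded by the absolute value, so the normalized weights
    themselves must be summable: they are divided by the square of the running sum, and the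
    conclusion loses a square. *)
Lemma sum_weighted_sqr (f : nat -> T -> R) : (forall k, meas_wrt (F k) (f k)) ->
  (forall k w, 0 <= f k w <= 1) ->
  {ae P, forall w, exists C : R, forall n, \sum_(k < n) f k w * e k w ^+ 2
     <= C * (1 + \sum_(k < n) f k w) ^+ 2}.
Proof.
move=> mf f01.
have f0 k w : 0 <= f k w by case/andP: (f01 k w).
pose s n w := 1 + \sum_(k < n) f k w.
have s1 n w : 1 <= s n w by rewrite lerDl sumr_ge0.
have ms k : meas_wrt (F k) (s k.+1).
  apply: meas_wrtD => //; first exact: meas_wrt_cst.
  exact: meas_wrt_partial.
pose y k w := f k w / s k.+1 w ^+ 2.
have my k : meas_wrt (F k) (y k).
  apply: meas_wrtM => //; apply: meas_wrtV => // [|w]; last exact: sqr_ge0.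
  exact: meas_wrtX.
have y0 k w : 0 <= y k w by rewrite divr_ge0 ?sqr_ge0.
have y1 k w : `|y k w| <= 1.
  rewrite ger0_norm // ler_pdivrMr; last by rewrite exprn_gt0 //; have := s1 k.+1 w; lra.
  by have := s1 k.+1 w; have /andP[_] := f01 k w; nra.
pose z k w := e k w ^+ 2 - s2.
have mz k : meas_wrt (F k.+1) (z k).
  by apply: meas_wrtB => //; [exact: meas_wrtX|exact: meas_wrt_cst].
have z0 := centered_sqr.
have K n : \sum_(k < n) Ex P (fun w => psi (y k w * z k w)) <= s2 * 2.
  apply: le_trans (_ : \sum_(k < n) s2 * 2 * Ex P (y k) <= _).
    apply: ler_sum => k _.
    have iy : intg P (y k) by exact: intg_bounded (my k) (y1 k).
    have i1 := intg_mul_e2 (my k) (y1 k).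
    have i2 : intg P (fun w => s2 * y k w) by exact: intgZ.
    have -> : s2 * 2 * Ex P (y k) = Ex P (fun w => y k w * e k w ^+ 2 + s2 * y k w).
      by rewrite ExD // (Ex_mul_e2 (my k) (y1 k)) ExZ //; ring.
    apply: Ex_le; [by apply: intg_psi y1 z0 _|exact: intgD|move=> w].
    rewrite /psi ge_min; apply/orP; right.
    rewrite normrM (ger0_norm (y0 _ _)) (mulrC s2) -mulrDr ler_wpM2l //.
    by apply: le_trans (ler_normB _ _) _; rewrite !ger0_norm ?sqr_ge0 ?cond_var_ge0.
  rewrite -mulr_sumr; apply: ler_piMr; first by rewrite mulr_ge0 ?cond_var_ge0.
  rewrite -Ex_sum; last by move=> k; exact: intg_bounded (my k) (y1 k).
  rewrite -[leRHS](Ex_cst P 1); apply: Ex_le; last 1 first.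
  - by move=> w; apply: (@sum_inv_sqr _ (f^~ w)).
  - by apply: intg_sum => k; exact: intg_bounded (my k) (y1 k).
  - exact: intg_cst.
have := martingale_bounded filtF my y1 mz z0 K.
apply: filterS => w [C HC]; exists (C + s2) => n.
have H : \sum_(k < n) y k w * e k w ^+ 2 <= C + s2.
  have -> : \sum_(k < n) y k w * e k w ^+ 2
      = \sum_(k < n) y k w * z k w + s2 * \sum_(k < n) y k w.
    rewrite mulr_sumr -big_split; apply: eq_bigr => k _ /=; rewrite /z; ring.
  apply: lerD; first exact: le_trans (ler_norm _) (HC n).
  apply: ler_piMr; [exact: cond_var_ge0|exact: (@sum_inv_sqr _ (f^~ w))].
rewrite mulrC -/(s n w); apply: le_trans (_ : s n w ^+ 2 * \sum_(k < n) y k w * e k w ^+ 2 <= _); last first.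
  by rewrite ler_wpM2l // sqr_ge0.
rewrite mulr_sumr; apply: ler_sum => k _; rewrite mulrA ler_wpM2r ?sqr_ge0 //.
rewrite /y mulrA ler_pdivlMr; last by rewrite exprn_gt0 //; have := s1 k.+1 w; lra.
rewrite mulrC ler_wpM2r // lerXn2r ?nnegrE ?(le_trans ler01 (s1 _ _)) //.
by rewrite lerD2l; apply: (@ler_sum_ord_widen (f^~ w)).
Qed.

(** With a moment above 2, [e^2 - s2] has a moment of order [p > 1], so it is enough that the [p]-th
    powers of the normalized weights be summable, and division by the running sum itself suffices.
    [N] stands for the norm of the noise vector, which carries the moment assumption, while [e] is
    one coordinate. *)
Lemma sum_weighted_sqr_moment (f : nat -> T -> R) (N : nat -> T -> R)
    (Z : nat -> T -> \bar R) (alpha : R) :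
  (forall k, meas_wrt (F k) (f k)) -> (forall k w, 0 <= f k w <= 1) ->
  2 < alpha ->
  (forall k, measurable_fun [set: T] (N k)) ->
  (forall k w, `|e k w| <= N k w) ->
  (forall k, is_cond_exp_ge0 P (F k) (fun w => N k w `^ alpha) (Z k)) ->
  {ae P, forall w, (ereal_sup (range (Z^~ w)) < +oo)%E} ->
  {ae P, forall w, exists C : R, forall n, \sum_(k < n) f k w * e k w ^+ 2
     <= C * (1 + \sum_(k < n) f k w)}.
Proof.
move=> mf f01 a2 mN eN NZ Zfin.
have f0 k w : 0 <= f k w by case/andP: (f01 k w).
have s20 := cond_var_ge0.
(* The first bound makes [2 * p <= alpha], the second keeps [psi_le_powR] applicable. *)
pose p := Num.min (alpha / 2) 2.
have p1 : 1 < p by rewrite lt_min ltr_pdivlMr // mul1r a2 /=; lra.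
have p2 : p <= 2 by rewrite ge_min lexx orbT.
have pa : 2 * p <= alpha by rewrite mulrC -ler_pdivlMr // ge_min lexx.
have p0 : 0 < p by lra.
pose s n w := 1 + \sum_(k < n) f k w.
have s1 n w : 1 <= s n w by rewrite lerDl sumr_ge0.
have sp n w : 0 < s n w by have := s1 n w; lra.
have ms k : meas_wrt (F k) (s k.+1).
  apply: meas_wrtD => //; first exact: meas_wrt_cst.
  exact: meas_wrt_partial.
(* The conditional moments are bounded by a finite but random constant. The weights are cut where
   the moment exceeds [L], the bound is proved for every integer [L], and for a given [w] some [L]
   cuts nothing. *)
pose A (L k : nat) := [set w | (Z k w <= L%:R%:E)%E].
have FA L k : F k (A L k).
  rewrite (_ : A L k = Z k @^-1` [set` `]-oo, L%:R%:E]%E]).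
    by have [mZ _ _] := NZ k; exact/mZ/emeasurable_itv.
  by apply/seteqP; split => w /=; rewrite in_itv.
pose y L k w := \1_(A L k) w * (f k w / s k.+1 w).
have my L k : meas_wrt (F k) (y L k).
  apply: meas_wrtM => //; first exact: meas_wrt_indic.
  by apply: meas_wrtM => //; apply: meas_wrtV => // w; exact: ltW.
have y0 L k w : 0 <= y L k w.
  by rewrite mulr_ge0 ?indicE // divr_ge0 // ltW.
have yf L k w : y L k w <= f k w / s k.+1 w.
  rewrite /y indicE; case: (_ \in _); rewrite ?mul1r // mul0r.
  by rewrite divr_ge0 // ltW.
have fs k w : f k w / s k.+1 w <= 1.
  rewrite ler_pdivrMr // mul1r /s big_ord_recr /= addrA lerDr.
  by rewrite addr_ge0 // sumr_ge0.
have y1 L k w : `|y L k w| <= 1.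
  by rewrite ger0_norm //; apply: le_trans (yf L k w) (fs k w).
pose z k w := e k w ^+ 2 - s2.
have mz k : meas_wrt (F k.+1) (z k).
  by apply: meas_wrtB => //; [exact: meas_wrtX|exact: meas_wrt_cst].
have z0 := centered_sqr.
pose C0 := 2 `^ p * (1 + s2 `^ p).
have C00 : 0 <= C0 by rewrite mulr_ge0 ?addr_ge0 ?powR_ge0.
have K L n : \sum_(k < n) Ex P (fun w => psi (y L k w * z k w))
    <= C0 * (1 + L%:R) * (p - 1)^-1.
  have mp k : meas_wrt (F k) (fun w => y L k w `^ p).
    exact: (meas_wrt_comp (sF k) (@measurable_powR R p) (my L k)).
  have yp1 k w : 0 <= y L k w `^ p <= 1.
    rewrite powR_ge0 /=; apply: le_trans (_ : 1 `^ p <= 1); last by rewrite powR1.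
    apply: ge0_ler_powR; rewrite ?nnegrE //; first exact: ltW.
    by rewrite -(ger0_norm (y0 _ _ _)) y1.
  have yp1' k w : `|y L k w `^ p| <= 1.
    by case/andP: (yp1 k w) => l1 l2; rewrite ger0_norm.
  have iy k : intg P (fun w => y L k w `^ p) by exact: intg_bounded (mp k) (yp1' k).
  apply: le_trans (_ : \sum_(k < n) C0 * (1 + L%:R) * Ex P (fun w => y L k w `^ p) <= _).
    apply: ler_sum => k _.
    have mNa : measurable_fun [set: T] (fun w => N k w `^ alpha).
      exact: measurableT_comp (@measurable_powR R alpha) (mN k).
    have hZ w : y L k w `^ p != 0 -> (Z k w <= L%:R%:E)%E.
      rewrite powR_eq0 negb_and => /orP[|]; last by rewrite negbK gt_eqF.
      by rewrite /y indicE; have [/set_mem //|_] := boolP (w \in A L k); rewrite mul0r eqxx.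
    have [iN EN] := @Ex_cond_ge0_le _ _ _ P (F k) (fun w => N k w `^ alpha)
      (fun w => y L k w `^ p) (Z k) L%:R 1 (sF k) (@FM k) mNa
      (fun w => powR_ge0 _ _) (NZ k) (mp k) (yp1 k) (ler0n _ _) hZ.
    have i2 : intg P (fun w => C0 * (y L k w `^ p + y L k w `^ p * N k w `^ alpha)).
      by apply: intgZ; exact: intgD.
    apply: le_trans (_ : Ex P (fun w => C0 * (y L k w `^ p + y L k w `^ p * N k w `^ alpha)) <= _).
      apply: Ex_le => //; first by apply: intg_psi (y1 L) z0 _.
      move=> w; apply: le_trans (psi_le_powR _ (_ : 1 <= p <= 2)) _.
        by rewrite p2 ltW.
      rewrite normrM (ger0_norm (y0 _ _ _)) powRM //.
      apply: le_trans (_ : y L k w `^ p * (C0 * (1 + `|e k w| `^ alpha)) <= _).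
        by rewrite ler_wpM2l ?powR_ge0 // powR_sq_le.
      have -> : C0 * (y L k w `^ p + y L k w `^ p * N k w `^ alpha)
        = y L k w `^ p * (C0 * (1 + N k w `^ alpha)) by ring.
      rewrite ler_wpM2l ?powR_ge0 // ler_wpM2l // lerD2l.
      apply: ge0_ler_powR; rewrite ?nnegrE //; first by lra.
      exact: le_trans (normr_ge0 _) (eN k w).
    rewrite ExZ; last exact: intgD.
    rewrite ExD // -mulrA ler_wpM2l // mulrDl mul1r lerD2l.
    exact: EN.
  rewrite -mulr_sumr ler_wpM2l //; first by rewrite mulr_ge0 // addr_ge0.
  rewrite -Ex_sum // -[leRHS](Ex_cst P); apply: Ex_le; last 1 first.
  - move=> w; apply: le_trans (@sum_powR_inv _ (f^~ w) n p (fun k => f0 k w) p1).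
    apply: ler_sum => k _.
    apply: le_trans (_ : (f k w / s k.+1 w) `^ p <= _).
      apply: ge0_ler_powR; rewrite ?nnegrE //; first exact: ltW.
      by rewrite divr_ge0 // ltW.
    rewrite powRM ?invr_ge0 ?(ltW (sp _ _)) //.
    rewrite -(powR_inv1 (ltW (sp _ _))) -powRrM mulN1r powRN.
    rewrite ler_wpM2r ?invr_ge0 ?powR_ge0 //.
    have /andP[h0 h1] := f01 k w.
    rewrite -[leRHS](powRr1 h0).
    have [->|fn0] := eqVneq (f k w) 0; first by rewrite powR0 ?gt_eqF // powR0.
    by apply: ger_powR; [rewrite lt_def fn0 h0|exact: ltW].
  - by apply: intg_sum.
  - exact: intg_cst.
have H L := martingale_bounded filtF (my L) (y1 L) mz z0 (K L).
have {}H := ae_foralln H.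
apply: filterS2 Zfin H => w Zw Hw.
have [L HL] : exists L : nat, forall k, (Z k w <= L%:R%:E)%E.
  have Zle k : (Z k w <= ereal_sup (range (Z^~ w)))%E.
    by apply: ereal_sup_ubound; exists k.
  have Z0 : (0 <= Z 0%N w)%E by case: (NZ 0%N).
  have r0 := le_trans Z0 (Zle 0%N).
  exists (archimedean.Num.bound (fine (ereal_sup (range (Z^~ w))))) => k.
  apply: le_trans (Zle k) _; rewrite -[leLHS]fineK ?lee_fin; last by rewrite ge0_fin_numE.
  by apply: ltW; apply: archimedean.Num.Theory.archi_boundP; exact: fine_ge0.
have yE k : y L k w = f k w / s k.+1 w.
  by rewrite /y indicE mem_set ?mul1r //; exact: HL.
have [C HC] := Hw L; exists (2 * C + s2) => n.
have -> : \sum_(k < n) f k w * e k w ^+ 2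
    = \sum_(k < n) f k w * z k w + s2 * \sum_(k < n) f k w.
  rewrite mulr_sumr -big_split; apply: eq_bigr => k _ /=; rewrite /z; ring.
rewrite mulrDl; apply: lerD; last first.
  by rewrite ler_wpM2l // lerDr.
apply: le_trans (ler_norm _) _.
pose S n := \sum_(k < n) y L k w * z k w.
have -> : \sum_(k < n) f k w * z k w = \sum_(k < n) s k.+1 w * (S k.+1 - S k).
  apply: eq_bigr => k _; rewrite /S big_ord_recr /= addrAC subrr add0r yE.
  by rewrite mulrA mulrCA divff ?mulr1 // lt0r_neq0.
apply: (@abel_bound _ (s^~ w)) => //; last by rewrite /S big_ord0.
  apply: homo_leq => [//|x1 x2 x3|k]; first exact: le_trans.
  by rewrite /s [in leRHS]big_ord_recr /= addrA lerDl.
by rewrite ltW.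
Qed.

End Noise.

(** * Independent enlargement of a filtration *)

Section Independence.
Context {R : realType} {disp : measure_display} {T : measurableType disp}.
Variable P : probability T R.

Lemma sigma_gen_sigma (C : set (T -> R)) : sigma_algebra [set: T] (sigma_gen C).
Proof. exact: smallest_sigma_algebra. Qed.

Lemma sigma_gen_meas (C : set (T -> R)) f : C f -> meas_wrt (sigma_gen C) f.
Proof.
by move=> Cf B mB; apply: sub_sigma_algebra; exists f => //; exists B.
Qed.

Lemma sigma_gen_sub (C : set (T -> R)) (S : set_system T) :
  sigma_algebra [set: T] S -> (forall f, C f -> meas_wrt S f) ->
  sigma_gen C `<=` S.
Proof.
move=> sS H; apply: smallest_sub => // E [f Cf [B mB ->]]; exact: H.
Qed.

Lemma sigma_gen_mono (C C' : set (T -> R)) : C `<=` C' ->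
  sigma_gen C `<=` sigma_gen C'.
Proof.
move=> CC; apply: sigma_gen_sub; first exact: sigma_gen_sigma.
by move=> f /CC; exact: sigma_gen_meas.
Qed.

Lemma sigma_measurable : sigma_algebra [set: T] (@measurable _ T).
Proof.
split; [exact: measurable0|by move=> A mA; exact: measurableD|].
by move=> F mF; exact: bigcup_measurable.
Qed.

(** Dominated convergence removes a truncation; this carries [cond_eq], stated for bounded factors,
    over to integrable ones. *)
Lemma Ex_trunc_cvg (V K : T -> R) : intg P V -> measurable_fun [set: T] K ->
  (forall w, `|K w| <= 1) ->
  Ex P (fun w => \1_[set v | `|V v| <= n%:R] w * V w * K w) @[n --> \oo]
    --> Ex P (fun w => V w * K w).
Proof.
move=> iV mK K1; have mV := intg_meas iV.
pose A n := [set v | `|V v| <= n%:R :> R].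
have mA n : measurable (A n).
  apply: (meas_wrt_le sigma_measurable).
    apply: (meas_wrt_comp sigma_measurable); first exact: normr_measurable.
    by move=> B mB; rewrite -[X in measurable X]setTI; exact: mV.
  exact: meas_wrt_cst sigma_measurable _.
have iVn n : intg P (fun w => \1_(A n) w * V w) by exact: intg_indicM.
have iVK f : intg P f -> intg P (fun w => f w * K w).
  move=> fi; under eq_fun do rewrite mulrC.
  exact: (@intgMb _ _ _ _ _ _ 1).
have [] := @dominated_convergence _ T R P setT measurableT
  (fun n w => (\1_(A n) w * V w * K w)%:E) (fun w => (V w * K w)%:E)
  (fun w => (`|V w|)%:E).
- by move=> n; case/integrableP: (iVK _ (iVn n)).
- by case/integrableP: (iVK _ iV).
- apply: aeW => w _; apply: cvg_near_cst.
  near=> n; rewrite /= indicE mem_set ?mul1r // /A /=.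
  near: n; exists (archimedean.Num.bound `|V w|) => // n /= Hn.
  apply: le_trans (ltW (archimedean.Num.Theory.archi_boundP _)) _ => //.
  by rewrite ler_nat.
- by apply/intg_norm.
- apply: aeW => w n _; rewrite lee_fin -mulrA normrM -[leRHS]mul1r.
  apply: ler_pM => //; first by rewrite indicE; case: (_ \in _); rewrite ?normr1 ?normr0.
  by rewrite normrM ler_piMr.
move=> _ _ H.
rewrite (Ex_fin (iVK _ iV)) in H.
exact: (fine_cvg H).
Unshelve. all: by end_near. Qed.

(** The roles are exchanged: by independence a constant is a version of the conditional expectation
    of [\1_B] given [G], and the truncated [V] is the known factor. *)
Lemma indep_Ex (G H : set_system T) (V : T -> R) (B : set T) :
  sigma_algebra [set: T] G -> G `<=` measurable -> H `<=` measurable ->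
  indep_sigma P G H -> intg P V -> meas_wrt G V -> H B ->
  Ex P (fun w => \1_B w * V w) = Ex P (\1_B) * Ex P V.
Proof.
move=> sG GM HM ind iV mV HB; have mB : measurable B by exact: HM.
have iB : intg P (\1_B) by exact: integrable_indic.
have PE A : measurable A -> P A = (Ex P (\1_A))%:E.
  move=> mA; rewrite -Ex_fin ?integral_indic ?setIT //; exact: integrable_indic.
have cB : is_cond_exp P G (\1_B) (fun=> Ex P (\1_B)).
  split=> //; [exact: intg_cst|exact: meas_wrt_cst|].
  move=> A GA; have mA : measurable A by exact: GM.
  rewrite integral_indic // setIC integral_cst // muleC -(PE _ mB).
  exact: ind.
have VB n : Ex P (fun w => \1_[set v | `|V v| <= n%:R] w * V w * \1_B w)
   = Ex P (fun w => \1_[set v | `|V v| <= n%:R] w * V w * Ex P (\1_B)).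
  apply: (cond_eq sG GM cB (C := n%:R)).
    apply: meas_wrtM => //; apply: meas_wrt_indic => //; apply: meas_wrt_le => //.
      by apply: meas_wrt_comp => //; exact: normr_measurable.
    exact: meas_wrt_cst.
  move=> w; rewrite indicE; have [/set_mem|_] := boolP (w \in _).
    by rewrite mul1r.
  by rewrite mul0r normr0.
have B1 w : `|\1_B w| <= 1 :> R.
  by rewrite indicE; case: (_ \in _); rewrite ?normr1 ?normr0.
have E1 : 0 <= Ex P (\1_B) <= 1.
  apply/andP; split; first by apply: Ex_ge0 => w.
  rewrite -[leRHS](Ex_cst P); apply: Ex_le => //; first exact: intg_cst.
have C1 := Ex_trunc_cvg iV (intg_meas iB) B1.
have C2 := @Ex_trunc_cvg V (fun=> Ex P (\1_B)) iV (measurable_cst _) _.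
have {}C2 := C2 (fun=> _); rewrite ger0_norm in C2; last by case/andP: E1.
have {}C2 := C2 (proj2 (andP E1)).
rewrite (funext VB) in C1.
have := cvg_unique (@norm_hausdorff _ R) C1 C2.
have -> : (fun w => V w * \1_B w) = (fun w => \1_B w * V w).
  by apply/funext => w; rewrite mulrC.
move=> ->; rewrite -ExZ //.
by congr Ex; apply/funext => w; rewrite mulrC.
Qed.

(** A pi-lambda argument. Intersections of a set of [sigma_gen C1] with one of [sigma_gen C2]
    generate the join; over such an intersection [Y - c] integrates to 0, because its restriction to
    the first set is measurable for [Cx] and so independent of the second. *)
Lemma cond_exp_join (Cx C1 C2 : set (T -> R)) (Y : T -> R) (c : R) :
  C1 `<=` Cx ->
  (forall f, Cx f -> measurable_fun [set: T] f) ->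
  (forall f, C2 f -> measurable_fun [set: T] f) ->
  indep_sigma P (sigma_gen Cx) (sigma_gen C2) ->
  meas_wrt (sigma_gen Cx) Y ->
  is_cond_exp P (sigma_gen C1) Y (fun=> c) ->
  is_cond_exp P (sigma_gen (C1 `|` C2)) Y (fun=> c).
Proof.
move=> C1x Cxm C2m ind mY [iY ic _ YE].
have genM (C : set (T -> R)) : (forall f, C f -> measurable_fun [set: T] f) ->
    sigma_gen C `<=` @measurable _ T.
  move=> Cm; apply: sigma_gen_sub; first exact: sigma_measurable.
  by move=> f /Cm mf B mB; rewrite -[X in measurable X]setTI; exact: mf.
have XM := genM _ Cxm; have M2 := genM _ C2m.
have M12 : sigma_gen (C1 `|` C2) `<=` @measurable _ T.
  by apply: genM => f [/C1x|]; [exact: Cxm|exact: C2m].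
pose W w := Y w - c.
have iW : intg P W by apply: intgB => //; exact: intg_cst.
pose L := [set E | measurable E /\ Ex P (fun w => \1_E w * W w) = 0].
have W0 A : sigma_gen C1 A -> Ex P (fun w => \1_A w * W w) = 0.
  move=> GA; have mA : measurable A by apply: XM; exact: sigma_gen_mono GA.
  have -> : (fun w => \1_A w * W w) = (fun w => \1_A w * Y w - \1_A w * c).
    by apply/funext => w; rewrite mulrBr.
  rewrite ExB; [|exact: intg_indicM|by apply: intg_indicM => //; exact: intg_cst].
  by rewrite -!Ex_indicM /Rintegral YE // subrr.
pose Pi := [set E | exists A B, [/\ sigma_gen C1 A, sigma_gen C2 B & E = A `&` B]].
have PiL : Pi `<=` L.
  move=> E [A [B [GA GB ->]]].
  have mA : measurable A by apply: XM; exact: sigma_gen_mono GA.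
  have mB : measurable B by exact: M2.
  split; first exact: measurableI.
  have -> : (fun w => \1_(A `&` B) w * W w) = (fun w => \1_B w * (\1_A w * W w)).
    by apply/funext => w; rewrite indicI /=; ring.
  rewrite (indep_Ex (sigma_gen_sigma Cx) XM M2 ind) ?W0 ?mulr0 //.
    exact: intg_indicM.
  apply: meas_wrtM; first exact: sigma_gen_sigma.
    apply: meas_wrt_indic; first exact: sigma_gen_sigma.
    exact: sigma_gen_mono GA.
  apply: meas_wrtB => //; first exact: sigma_gen_sigma.
  exact: (meas_wrt_cst (sigma_gen_sigma _)).
have PiI : setI_closed Pi.
  move=> _ _ [A [B [GA GB ->]]] [A' [B' [GA' GB' ->]]].
  exists (A `&` A'), (B `&` B'); split; last by rewrite setIACA.
    exact: (sigma_setI (sigma_gen_sigma _)).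
  exact: (sigma_setI (sigma_gen_sigma _)).
have PiT : Pi [set: T].
  exists setT, setT; split; last by rewrite setIT.
    exact: (sigma_setT (sigma_gen_sigma _)).
  exact: (sigma_setT (sigma_gen_sigma _)).
have dL : dynkin L.
  split; first exact: PiL.
  - move=> A [mA EA]; split; first exact: measurableC.
    have -> : (fun w => \1_(~` A) w * W w) = (fun w => \1_setT w * W w - \1_A w * W w).
      by apply/funext => w; rewrite !indicE in_setC in_setT mul1r; case: (w \in A); rewrite /= ?mul0r ?mul1r ?subrr ?subr0.
    have [mT ET] := PiL _ PiT.
    by rewrite ExB ?ET ?EA ?subrr //; exact: intg_indicM.
  - move=> F tF FL; have mF n : measurable (F n) by case: (FL n).
    have mU : measurable (\bigcup_k F k) by exact: bigcup_measurable.
    split=> //; rewrite -Ex_indicM /Rintegral.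
    rewrite (@integral_bigcup _ _ _ P F (EFin \o W)) //; last first.
      by apply: integrableS iW.
    rewrite eseries0 // => n _ _.
    have [_] := FL n; rewrite -Ex_indicM /Rintegral => EF.
    rewrite -[LHS]fineK; first by rewrite EF.
    by apply: integrable_fin_num => //; apply: integrableS iW.
have sL : sigma_gen (C1 `|` C2) `<=` L.
  apply: subset_trans (_ : <<s Pi >> `<=` L); last first.
    by rewrite -(setI_closed_g_dynkin_g_sigma_algebra PiI); exact: smallest_sub.
  apply: sigma_gen_sub; first exact: smallest_sigma_algebra.
  move=> f [C1f|C2f] B mB; apply: sub_sigma_algebra.
    exists (f @^-1` B), setT; split; last by rewrite setIT.
      exact: sigma_gen_meas.
    exact: (sigma_setT (sigma_gen_sigma _)).
  exists setT, (f @^-1` B); split; last by rewrite setTI.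
    exact: (sigma_setT (sigma_gen_sigma _)).
  exact: sigma_gen_meas.
split=> //; first exact: (meas_wrt_cst (sigma_gen_sigma _)).
move=> A GA; have [mA EA] := sL _ GA.
have i1 : intg P (fun w => \1_A w * Y w) by exact: intg_indicM.
have i2 : intg P (fun w => \1_A w * c).
  by apply: (intg_indicM mA (f := fun=> c)); exact: intg_cst.
have : Ex P (fun w => \1_A w * Y w) = Ex P (fun w => \1_A w * c).
  apply/eqP; rewrite -subr_eq0 -ExB //; apply/eqP; rewrite -[RHS]EA.
  by congr Ex; apply/funext => w; rewrite /W mulrBr.
rewrite -!Ex_indicM /Rintegral => E.
rewrite -[LHS]fineK; last by apply: integrable_fin_num => //; exact: integrableS iY.
rewrite E fineK //; apply: integrable_fin_num => //.
by apply: (@integrableS _ _ _ _ setT) => //; exact: intg_cst.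
Qed.

End Independence.

(** * Stochastic bounds for least squares *)

Section MatrixMeas.
Context {R : realType} {disp : measure_display} {T : measurableType disp}.
Variable G : set_system T.
Hypothesis sG : sigma_algebra [set: T] G.

Lemma mx_meas_cst m n (M : 'M[R]_(m, n)) : mx_meas_wrt G (fun=> M).
Proof. by move=> i j; exact: meas_wrt_cst. Qed.

Lemma mx_measD m n (f g : T -> 'M[R]_(m, n)) :
  mx_meas_wrt G f -> mx_meas_wrt G g -> mx_meas_wrt G (fun w => f w + g w).
Proof.
move=> mf mg i j; under eq_fun do rewrite mxE; exact: meas_wrtD.
Qed.

Lemma mx_measZ m n (a : T -> R) (g : T -> 'M[R]_(m, n)) :
  meas_wrt G a -> mx_meas_wrt G g -> mx_meas_wrt G (fun w => a w *: g w).
Proof.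
move=> mf mg i j; under eq_fun do rewrite mxE; exact: meas_wrtM.
Qed.

Lemma mx_measN m n (g : T -> 'M[R]_(m, n)) :
  mx_meas_wrt G g -> mx_meas_wrt G (fun w => - g w).
Proof.
move=> mg; under eq_fun do rewrite -scaleN1r.
by apply: mx_measZ => //; exact: meas_wrt_cst.
Qed.

Lemma mx_measB m n (f g : T -> 'M[R]_(m, n)) :
  mx_meas_wrt G f -> mx_meas_wrt G g -> mx_meas_wrt G (fun w => f w - g w).
Proof. by move=> mf mg; apply: mx_measD => //; exact: mx_measN. Qed.

Lemma mx_measM m n k (f : T -> 'M[R]_(m, n)) (g : T -> 'M[R]_(n, k)) :
  mx_meas_wrt G f -> mx_meas_wrt G g -> mx_meas_wrt G (fun w => f w *m g w).
Proof.
move=> mf mg i j; under eq_fun do rewrite mxE.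
by apply: meas_wrt_sum => // l; exact: meas_wrtM.
Qed.

Lemma mx_meas_tr m n (f : T -> 'M[R]_(m, n)) :
  mx_meas_wrt G f -> mx_meas_wrt G (fun w => (f w)^T).
Proof. by move=> mf i j; under eq_fun do rewrite mxE; exact: mf. Qed.

Lemma mx_meas_col m n k (f : T -> 'M[R]_(m, k)) (g : T -> 'M[R]_(n, k)) :
  mx_meas_wrt G f -> mx_meas_wrt G g -> mx_meas_wrt G (fun w => col_mx (f w) (g w)).
Proof.
move=> mf mg i j; case: (split_ordP i) => l ->.
  by under eq_fun do rewrite col_mxEu; exact: mf.
by under eq_fun do rewrite col_mxEd; exact: mg.
Qed.

Lemma meas_dot n (f g : T -> 'cV[R]_n) :
  mx_meas_wrt G f -> mx_meas_wrt G g -> meas_wrt G (fun w => dot (f w) (g w)).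
Proof.
by move=> mf mg; apply: meas_wrt_sum => // l; exact: meas_wrtM.
Qed.

(** The Sherman-Morrison recursion reduces measurability of the inverse matrix to sums, products and
    one scalar inverse per step. *)
Lemma mx_meas_comp_Jm m (Z : nat -> T -> 'cV[R]_m) n :
  (forall k, (k < n)%N -> mx_meas_wrt G (Z k)) ->
  mx_meas_wrt G (fun w => Jm (Z^~ w) n).
Proof.
elim: n => [|n IH] mZ; first exact: mx_meas_cst.
have mJ : mx_meas_wrt G (fun w => Jm (Z^~ w) n).
  by apply: IH => k kn; apply: mZ; exact: ltnW.
have mu : mx_meas_wrt G (fun w => Jm (Z^~ w) n *m Z n w).
  by apply: mx_measM => //; exact: mZ.
have mg : meas_wrt G (fun w => gain (Z^~ w) n).
  by apply: meas_dot => //; exact: mZ.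
apply: mx_measB => //; apply: mx_measZ; last first.
  by apply: mx_measM => //; exact: mx_meas_tr.
apply: meas_wrtV => // [|w]; last by rewrite addr_ge0 // gain_ge0.
by apply: meas_wrtD => //; exact: meas_wrt_cst.
Qed.

End MatrixMeas.

Lemma mx_meas_sub {R : realType} {disp : measure_display}
    {T : measurableType disp} (G H : set_system T) m n (f : T -> 'M[R]_(m, n)) :
  G `<=` H -> mx_meas_wrt G f -> mx_meas_wrt H f.
Proof. by move=> GH mf i j; exact: meas_wrt_sub GH (mf i j). Qed.

Section StochasticLS.
Context {R : realType} {disp : measure_display} {T : measurableType disp}.
Variable P : probability T R.
Variable F : nat -> set_system T.
Hypothesis filtF : filtration F.
Variables (e : nat -> T -> R) (s2 : R).
Hypothesis me : forall k, meas_wrt (F k.+1) (e k).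
Hypothesis e0 : forall k, is_cond_exp P (F k) (e k) (fun=> 0).
Hypothesis e2 : forall k, is_cond_exp P (F k) (fun w => e k w ^+ 2) (fun=> s2).
Variables (m : nat) (Z : nat -> T -> 'cV[R]_m) (M0 : T -> 'cV[R]_m).
Hypothesis mZ : forall k, mx_meas_wrt (F k) (Z k).
Hypothesis mM0 : mx_meas_wrt (F 0) M0.

Let sF n := filt_sigma filtF n.

Lemma meas_Jm n : mx_meas_wrt (F n) (fun w => Jm (Z^~ w) n).
Proof.
apply: mx_meas_comp_Jm => // k kn; apply: mx_meas_sub (mZ k).
exact: (filt_le filtF (ltnW kn)).
Qed.

Lemma meas_gain n : meas_wrt (F n) (fun w => gain (Z^~ w) n).
Proof. by apply: meas_dot => //; apply: mx_measM => //; exact: meas_Jm. Qed.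

Lemma meas_gain1 n : meas_wrt (F n) (fun w => (1 + gain (Z^~ w) n)^-1).
Proof.
apply: meas_wrtV => // [|w]; last by rewrite addr_ge0 // gain_ge0.
by apply: meas_wrtD => //; [exact: meas_wrt_cst|exact: meas_gain].
Qed.

Lemma meas_leverage n : meas_wrt (F n) (fun w => leverage (Z^~ w) n).
Proof. by apply: meas_wrtM => //; [exact: meas_gain|exact: meas_gain1]. Qed.

Lemma meas_Mv n : mx_meas_wrt (F n) (fun w => Mv (Z^~ w) (M0 w) (e^~ w) n).
Proof.
elim: n => [|n IH].
  by under eq_fun do rewrite /Mv big_ord0 addr0.
under eq_fun do rewrite MvS.
have le := filt_le filtF (leqnSn n).
apply: mx_measD => //; first exact: mx_meas_sub le IH.
by apply: mx_measZ => //; exact: mx_meas_sub le (mZ n).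
Qed.

Lemma meas_tau n : meas_wrt (F n) (fun w => tau (Z^~ w) (M0 w) (e^~ w) n).
Proof.
apply: meas_dot => //; apply: mx_measM => //; [exact: meas_Jm|exact: meas_Mv].
Qed.

(** The martingale term is of order [s34] of its quadratic variation, which the sum of
    [tau^2 / (1 + gain)] dominates. Half of that sum absorbs the martingale and the other half stays
    on the left. *)
Lemma Qf_bound : {ae P, forall w, exists C : R, forall n,
  Qf (Z^~ w) (M0 w) (e^~ w) n
    + 2^-1 * \sum_(k < n) tau (Z^~ w) (M0 w) (e^~ w) k ^+ 2 / (1 + gain (Z^~ w) k)
  <= C + \sum_(k < n) leverage (Z^~ w) k * e k w ^+ 2}.
Proof.
pose Y k w := tau (Z^~ w) (M0 w) (e^~ w) k / (1 + gain (Z^~ w) k).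
have mY k : meas_wrt (F k) (Y k).
  by apply: meas_wrtM => //; [exact: meas_tau|exact: meas_gain1].
have := martingale_s34 filtF me e0 e2 mY.
apply: filterS => w [C HC].
have C0 : 0 <= `|C| + 1 by rewrite addr_ge0.
(* The martingale enters [Qf_sum] with a factor 2, so bounding it by a quarter of the quadratic sum
   costs half of that sum. *)
have d0 : 0 < (4 * (`|C| + 1))^-1 by rewrite invr_gt0 mulr_gt0 ?ltr_wpDl.
have [D HD] := s34_le d0.
exists (Qf (Z^~ w) (M0 w) (e^~ w) 0 + 2^-1 + 2 * (`|C| + 1) * D) => n.
have := Qf_sum (Z^~ w) (M0 w) (e^~ w) n.
set A := \sum_(k < n) tau _ _ _ k ^+ 2 / _.
set B := \sum_(k < n) tau _ _ _ k / _ * _.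
set L := \sum_(k < n) leverage _ k * _.
have H1 := HC n; rewrite -/B in H1.
set y := \sum_(k < n) Y k w ^+ 2 in H1.
have y0 : 0 <= y by apply: sumr_ge0 => k _; exact: sqr_ge0.
have yA : y <= A.
  apply: ler_sum => k _; have g0 := gain_ge0 (Z^~ w) k.
  rewrite /Y expr_div_n ler_wpM2l ?sqr_ge0 //.
  rewrite lef_pV2 ?posrE ?exprn_gt0 ?ltr_pwDl //; nra.
have H2 := HD (1 + y) (addr_ge0 ler01 y0).
have H3 : B <= (`|C| + 1) * s34 (1 + y).
  apply: le_trans (ler_norm _) (le_trans H1 _).
  by rewrite ler_wpM2r ?s34_ge0 // (le_trans (ler_norm _)) // lerDl.
have H4 : (`|C| + 1) * s34 (1 + y) <= 4^-1 * (1 + y) + (`|C| + 1) * D.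
  apply: le_trans (ler_wpM2l C0 H2) _; rewrite mulrDr lerD2r invfM.
  rewrite mulrA mulrCA divff ?mulr1 // gt_eqF // ltr_wpDl //.
lra.
Qed.

(** The outer [1 +] lets additive constants be absorbed; the inner one covers [m = 0], where the
    trace vanishes. *)
Definition lntr n (w : T) : R := 1 + ln (1 + \tr (Nm (Z^~ w) n)).

Lemma trNm_ge0 n w : 0 <= \tr (Nm (Z^~ w) n).
Proof. exact: le_trans (ler0n _ _) (trace_Nm_ge _ _). Qed.

Lemma lntr_ge1 n w : 1 <= lntr n w.
Proof. by rewrite lerDl ln_ge0 // lerDl trNm_ge0. Qed.

Lemma leverage_lntr : exists C : R, 0 <= C /\ forall n w,
  1 + \sum_(k < n) leverage (Z^~ w) k <= C * lntr n w.
Proof.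
exists (1 + ln (m`!)%:R + m%:R).
have f1 : 1 <= (m`!)%:R :> R by rewrite ler1n fact_gt0.
have l0 : 0 <= ln (m`!)%:R :> R by exact: ln_ge0.
split=> [|n w]; first by rewrite !addr_ge0.
have := sum_leverage (Z^~ w) n; have := ln_det_Nm_le (Z^~ w) n.
have : ln (\tr (Nm (Z^~ w) n)) <= ln (1 + \tr (Nm (Z^~ w) n)).
  have [->|t0] := eqVneq (\tr (Nm (Z^~ w) n)) 0.
    by rewrite ln0 // addr0 ln1.
  have tp : 0 < \tr (Nm (Z^~ w) n) by rewrite lt_def t0 trNm_ge0.
  by rewrite ler_ln ?posrE ?lerDr // ltr_wpDl.
have := lntr_ge1 n w; rewrite /lntr.
set b := ln (1 + \tr _); set a := ln (\tr _); set c := ln (\det _).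
set s := \sum_(k < n) _.
have m0 : 0 <= m%:R :> R by [].
move=> h1 h2 h3 h4.
have h5 : m%:R * a <= m%:R * b by rewrite ler_wpM2l.
have h6 : 0 <= ln (m`!)%:R * b by rewrite mulr_ge0 //; lra.
lra.
Qed.

Lemma leverage01 k w : 0 <= leverage (Z^~ w) k <= 1.
Proof. by rewrite leverage_ge0 leverage_le1. Qed.

Lemma Qf_sum_ge0 (w : T) n :
  0 <= \sum_(k < n) tau (Z^~ w) (M0 w) (e^~ w) k ^+ 2 / (1 + gain (Z^~ w) k).
Proof.
by apply: sumr_ge0 => k _; rewrite divr_ge0 ?sqr_ge0 // addr_ge0 // gain_ge0.
Qed.

(** The leverages sum to O([lntr]), and [sum_weighted_sqr] squares this. The loss is acceptable for
    the cross terms of the excitation argument, and this version is available for [xi]. *)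
Lemma Qf_weak : {ae P, forall w, exists C : R, forall n,
  Qf (Z^~ w) (M0 w) (e^~ w) n <= C * lntr n w ^+ 2}.
Proof.
have [K [K0 HK]] := leverage_lntr.
have H := sum_weighted_sqr filtF me e2 meas_leverage leverage01.
apply: filterS2 Qf_bound H => w [C HC] [D HD].
exists (`|C| + `|D| * K ^+ 2) => n.
have h1 := HC n; have h2 := HD n; have h3 := Qf_sum_ge0 w n.
have h4 := HK n w; have h5 := lntr_ge1 n w.
have s0 : 0 <= \sum_(k < n) leverage (Z^~ w) k.
  by apply: sumr_ge0 => k _; exact: leverage_ge0.
have h6 : (1 + \sum_(k < n) leverage (Z^~ w) k) ^+ 2 <= (K * lntr n w) ^+ 2.
  by rewrite lerXn2r ?nnegrE ?addr_ge0 // mulr_ge0 //; lra.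
have h7 : D * (1 + \sum_(k < n) leverage (Z^~ w) k) ^+ 2
   <= `|D| * (K * lntr n w) ^+ 2.
  apply: le_trans (ler_wpM2r (sqr_ge0 _) (ler_norm D)) _.
  by rewrite ler_wpM2l.
have h8 : C <= `|C| * lntr n w ^+ 2.
  apply: le_trans (ler_norm _) _; rewrite ler_peMr // expr_ge1 //; lra.
rewrite mulrDl -mulrA -exprMn; lra.
Qed.

Lemma Qf_strong (N : nat -> T -> R) (V : nat -> T -> \bar R) (alpha : R) :
  2 < alpha ->
  (forall k, measurable_fun [set: T] (N k)) ->
  (forall k w, `|e k w| <= N k w) ->
  (forall k, is_cond_exp_ge0 P (F k) (fun w => N k w `^ alpha) (V k)) ->
  {ae P, forall w, (ereal_sup (range (V^~ w)) < +oo)%E} ->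
  {ae P, forall w, exists C : R, forall n,
    Qf (Z^~ w) (M0 w) (e^~ w) n
    + \sum_(k < n) tau (Z^~ w) (M0 w) (e^~ w) k ^+ 2 / (1 + gain (Z^~ w) k)
    <= C * lntr n w}.
Proof.
move=> a2 mN eN NV Vfin; have [K [K0 HK]] := leverage_lntr.
have H := sum_weighted_sqr_moment filtF me e2 meas_leverage leverage01
  a2 mN eN NV Vfin.
apply: filterS2 Qf_bound H => w [C HC] [D HD].
exists (2 * (`|C| + `|D| * K)) => n.
have h1 := HC n; have h2 := HD n; have h3 := Qf_sum_ge0 w n.
have h4 := HK n w; have h5 := lntr_ge1 n w.
have h9 := Qf_ge0 (Z^~ w) (M0 w) (e^~ w) n.
have s0 : 0 <= \sum_(k < n) leverage (Z^~ w) k.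
  by apply: sumr_ge0 => k _; exact: leverage_ge0.
have h7 : D * (1 + \sum_(k < n) leverage (Z^~ w) k) <= `|D| * (K * lntr n w).
  apply: le_trans (ler_wpM2r (addr_ge0 ler01 s0) (ler_norm D)) _.
  by rewrite ler_wpM2l.
have h8 : C <= `|C| * lntr n w.
  by apply: le_trans (ler_norm _) _; rewrite ler_peMr.
lra.
Qed.

End StochasticLS.

(** * Convolutions and power series *)

Section Convolution.
Context {R : realType}.

Definition conv a b c (M : nat -> 'M[R]_(a, b)) (v : nat -> 'M[R]_(b, c)) n :=
  \sum_(k < n.+1) M k *m v (n - k)%N.

Lemma sum_shift (V : nmodType) (f : nat -> V) n j :
  \sum_(k < n | (j <= k)%N) f (k - j)%N = \sum_(k < n - j) f k.
Proof.
rewrite -(big_mkord (fun k => (j <= k)%N) (fun k => f (k - j)%N)).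
rewrite -(big_mkord xpredT f).
have [nj|jn] := leqP n j.
  rewrite (eqP nj) [RHS]big_geq // big_nat_cond big1 // => i /andP[/andP[_ ni] ji].
  by move: (leq_trans ni (leq_trans nj ji)); rewrite ltnn.
rewrite (big_cat_nat _ _ (n := j)) //=; last exact: ltnW.
rewrite big_nat_cond big1 ?add0r => [|i /andP[/andP[_ ij] ji]]; last first.
  by move: (leq_trans ij ji); rewrite ltnn.
rewrite -[in LHS](add0n j) big_addn.
rewrite big_nat_cond [RHS]big_nat_cond; apply: eq_big => [i|i _].
  by rewrite leq_addl andbT.
by rewrite addnK.
Qed.

Lemma convA a b c e (M : nat -> 'M[R]_(a, b)) (N : nat -> 'M[R]_(b, c))
    (v : nat -> 'M[R]_(c, e)) n :
  conv M (conv N v) n = conv (conv M N) v n.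
Proof.
rewrite /conv.
under [LHS]eq_bigr => i _.
  rewrite mulmx_sumr.
  have -> : \sum_(k < (n - i).+1) M i *m (N k *m v (n - i - k)%N)
      = \sum_(k < n.+1 | (i <= k)%N) M i *m (N (k - i)%N *m v (n - k)%N).
    have -> : (n - i).+1 = (n.+1 - i)%N by rewrite subSn // -ltnS.
    rewrite -(sum_shift (fun k => M i *m (N k *m v (n - i - k)%N))).
    by apply: eq_bigr => k ik; rewrite -subnDA subnKC.
  over.
rewrite (exchange_big_dep xpredT) //=; apply: eq_bigr => k _.
rewrite mulmx_suml.
rewrite (big_ord_widen n.+1 (fun i => M i *m N (k - i)%N *m v (n - k)%N)) //.
by apply: eq_bigr => i _; rewrite mulmxA.
Qed.

Lemma convDl a b c (M N : nat -> 'M[R]_(a, b)) (v : nat -> 'M[R]_(b, c)) n :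
  conv (fun k => M k + N k) v n = conv M v n + conv N v n.
Proof. by rewrite /conv -big_split; apply: eq_bigr => k _; rewrite mulmxDl. Qed.

Lemma convDr a b c (M : nat -> 'M[R]_(a, b)) (u v : nat -> 'M[R]_(b, c)) n :
  conv M (fun k => u k + v k) n = conv M u n + conv M v n.
Proof. by rewrite /conv -big_split; apply: eq_bigr => k _; rewrite mulmxDr. Qed.

Lemma convNr a b c (M : nat -> 'M[R]_(a, b)) (v : nat -> 'M[R]_(b, c)) n :
  conv M (fun k => - v k) n = - conv M v n.
Proof. by rewrite /conv -sumrN; apply: eq_bigr => k _; rewrite mulmxN. Qed.

Lemma eq_conv a b c (M N : nat -> 'M[R]_(a, b)) (u v : nat -> 'M[R]_(b, c)) :
  M =1 N -> u =1 v -> conv M u =1 conv N v.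
Proof. by move=> MN uv n; apply: eq_bigr => k _; rewrite MN uv. Qed.

Lemma conv_delta a c (v : nat -> 'M[R]_(a, c)) n :
  conv (fun k => if k == 0%N then 1%:M else 0) v n = v n.
Proof.
rewrite /conv big_ord_recl /= mul1mx subn0 big1 ?addr0 // => i _.
by rewrite mul0mx.
Qed.

End Convolution.

(** * Power series, their coefficients and geometric decay *)

Section PowerSeries.
Context {R : realType}.

Lemma cvg_real_bounded (u : nat -> R) (l : R) : u @ \oo --> l ->
  exists C, forall n, `|u n| <= C.
Proof.
move=> /cvgP /cvg_seq_bounded [C [_ HC]]; exists (C + 1) => n.
by apply: (HC (C + 1)) => //; rewrite ltrDl.
Qed.

Lemma power_series_bounded (c : nat -> R) (t l : R) : 0 < t ->
  (\sum_(k < n) t ^+ k * c k) @[n --> \oo] --> l ->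
  exists C, forall k, `|c k| <= C * t^-1 ^+ k.
Proof.
move=> t0 /cvg_real_bounded[C HC]; exists (C + C) => k.
have tk : 0 < t ^+ k by rewrite exprn_gt0.
rewrite exprVn ler_pdivlMr // -[X in _ * X]gtr0_norm // -normrM mulrC.
have -> : t ^+ k * c k = \sum_(i < k.+1) t ^+ i * c i - \sum_(i < k) t ^+ i * c i.
  by rewrite big_ord_recr /= addrAC subrr add0r.
by apply: le_trans (ler_normB _ _) _; apply: lerD.
Qed.

Lemma sum_geom_le (x : R) m n : 0 <= x -> x <= 2^-1 ->
  \sum_(k < n) (if (m <= k)%N then x ^+ k else 0) <= 2 * x ^+ m.
Proof.
move=> x0 x2; rewrite -big_mkcond /=.
have -> : \sum_(k < n | (m <= k)%N) x ^+ k = \sum_(k < n | (m <= k)%N) x ^+ (k - m + m).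
  by apply: eq_bigr => k mk; rewrite subnK.
rewrite (sum_shift (fun k => x ^+ (k + m))).
have -> : \sum_(k < n - m) x ^+ (k + m) = x ^+ m * \sum_(k < n - m) x ^+ k.
  by rewrite mulr_sumr; apply: eq_bigr => k _; rewrite exprD mulrC.
rewrite mulrC ler_wpM2r ?exprn_ge0 //.
elim: (n - m)%N => [|k IH]; first by rewrite big_ord0.
rewrite big_ord_recl expr0.
have -> : \sum_(i < k) x ^+ lift ord0 i = x * \sum_(i < k) x ^+ i.
  by rewrite mulr_sumr; apply: eq_bigr => i _; rewrite -exprS.
have : 0 <= \sum_(i < k) x ^+ i by apply: sumr_ge0 => i _; rewrite exprn_ge0.
nra.
Qed.

(** Strong induction on the index: with the lower coefficients zero, [t^m * c m] would have to be
    compensated by a tail of order [t^(m+1)], which is impossible for small [t] unless [c m]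
    vanishes. *)
Lemma power_series_uniq (c : nat -> R) (r : R) : 0 < r ->
  (forall t, 0 < t -> t < r ->
     (\sum_(k < n) t ^+ k * c k) @[n --> \oo] --> (0 : R)) ->
  forall k, c k = 0.
Proof.
move=> r0 H m; elim/ltn_ind: m => m IH.
pose t0 := r / 2; have t00 : 0 < t0 by rewrite divr_gt0.
have t0r : t0 < r by rewrite ltr_pdivrMr // mulr2n mulrDr mulr1 ltrDl.
have [K HK] := power_series_bounded t00 (H _ t00 t0r).
have K0 : 0 <= K by have := HK 0%N; rewrite expr0 mulr1; apply: le_trans.
have t0V : 0 < t0^-1 by rewrite invr_gt0.
(* For [t <= t0 / 2] the tail is dominated by a geometric series of ratio at most 1/2; dividing by
   [t^m] leaves a bound linear in [t]. *)
have B t : 0 < t -> t <= t0 / 2 -> `|c m| <= 2 * K * t0^-1 ^+ m.+1 * t.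
  move=> tp tt; have tr : t < r by lra.
  have tm : 0 < t ^+ m by rewrite exprn_gt0.
  pose x := t / t0; have x0 : 0 <= x by rewrite divr_ge0 // ltW.
  have x2 : x <= 2^-1 by rewrite ler_pdivrMr // mulrC.
  have L n : (m < n)%N -> t ^+ m * `|c m| - 2 * K * x ^+ m.+1
      <= `|\sum_(k < n) t ^+ k * c k|.
    move=> mn; rewrite (bigD1 (Ordinal mn)) //=.
    set S := \sum_(k < n | _) _.
    have HS : `|S| <= 2 * K * x ^+ m.+1.
      apply: le_trans (ler_norm_sum _ _ _) _.
      apply: le_trans (_ : K * \sum_(k < n) (if (m.+1 <= k)%N then x ^+ k else 0) <= _); last first.
        by rewrite (mulrC 2) -mulrA ler_wpM2l // sum_geom_le.
      rewrite mulr_sumr big_mkcond; apply: ler_sum => k _.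
      case: ifPn => [km|_]; last first.
        by case: ifP => _; rewrite ?mulr0 // mulr_ge0 // exprn_ge0.
      case: ltngtP => [mk|km'|e].
      + rewrite normrM normrX (gtr0_norm tp) /x expr_div_n mulrCA -exprVn.
        rewrite ler_wpM2l ?exprn_ge0 ?HK //; exact: ltW.
      + by rewrite IH // mulr0 normr0 mulr0.
      + by move: km; rewrite -val_eqE /= -e eqxx.
    have h1 := lerB_normD (t ^+ m * c m) S.
    have h2 : t ^+ m * `|c m| = `|t ^+ m * c m| by rewrite normrM (gtr0_norm tm).
    rewrite h2; lra.
  have Lim : t ^+ m * `|c m| - 2 * K * x ^+ m.+1 <= 0.
    rewrite leNgt; apply/negP => Xp.
    have /cvgr0_norm_lt /(_ _ Xp) C0 := H t tp tr.
    near \oo => n.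
    have : `|\sum_(k < n) t ^+ k * c k| < t ^+ m * `|c m| - 2 * K * x ^+ m.+1.
      by near: n.
    apply/negP; rewrite -leNgt; apply: L; near: n; exact: nbhs_infty_gt.
  rewrite -(ler_pM2l tm); apply: le_trans (_ : 2 * K * x ^+ m.+1 <= _); first lra.
  rewrite /x expr_div_n -exprVn [t ^+ m.+1]exprSr le_eqVlt.
  by apply/orP; left; apply/eqP; ring.
apply/eqP; rewrite -normr_le0 leNgt; apply/negP => cp.
pose M := 2 * K * t0^-1 ^+ m.+1.
have M0 : 0 <= M by rewrite !mulr_ge0 // exprn_ge0 // ltW.
pose t := Num.min (t0 / 2) (`|c m| / (2 * (M + 1))).
have tp : 0 < t by rewrite lt_min !divr_gt0 // mulr_gt0 // ltr_wpDl.
have h1 := B t tp; rewrite ge_min lexx in h1; have {}h1 := h1 isT.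
have h2 : t <= `|c m| / (2 * (M + 1)) by rewrite ge_min lexx orbT.
rewrite -/M in h1; rewrite ler_pdivlMr in h2; last by rewrite mulr_gt0 // ltr_wpDl.
nra.
Unshelve. all: by end_near. Qed.

Lemma cvg_Re (u : nat -> R) (l : R[i]) :
  ((u n)%:C%C : (R[i])^o) @[n --> \oo] --> (l : (R[i])^o) ->
  u @ \oo --> complex.Re l.
Proof.
move=> /cvgrPdist_lt H; apply/cvgrPdist_lt => eps e0.
have := H eps%:C%C; rewrite ltcR => /(_ e0); apply: filterS => n.
move=> h; rewrite -ltcR; apply: le_lt_trans h.
have := normc_ge_Re (l - (u n)%:C%C).
by case: (l) => a b /=.
Qed.

Lemma cvg_bigsum (I : Type) (s : seq I) (f : I -> nat -> R) (l : I -> R) :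
  (forall i, f i n @[n --> \oo] --> l i) ->
  (\sum_(i <- s) f i n) @[n --> \oo] --> \sum_(i <- s) l i.
Proof.
move=> H; elim: s => [|i s IH].
  by rewrite big_nil; under eq_fun do rewrite big_nil; exact: cvg_cst.
by rewrite big_cons; under eq_fun do rewrite big_cons; exact: cvgD.
Qed.

Section Expansions.
Context {d p q : nat}.
Variables (A : 'I_p -> 'M[R]_d) (B : 'I_q -> 'M[R]_d) (D Pc : nat -> 'M[R]_d).
Hypothesis exps : expansions A B D Pc.

(** [Ac] and [Bc] are the coefficient sequences of A(z) and B(z) padded with zeros, so that the
    recursion of the model becomes an identity between convolutions. *)
Definition Ac (k : nat) : 'M[R]_d :=
  if k is j.+1 then (if insub j is Some i then - A i else 0) else 1%:M.

Definition Bc (k : nat) : 'M[R]_d :=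
  if k is j.+1 then (if insub j is Some i then B i else 0) else 1%:M.

Definition psum (t : R) (M : nat -> 'M[R]_d) n := \sum_(k < n) t ^+ k *: M k.

(** Since [N] is finitely supported, a partial sum of the product is a finite combination of delayed
    partial sums of [M]; convergence of the product then follows term by term, without absolute
    convergence. *)
Lemma psum_conv t (M N : nat -> 'M[R]_d) n K : (forall k, (K <= k)%N -> N k = 0) ->
  psum t (conv M N) n = \sum_(j < K) psum t M (n - j) *m (t ^+ j *: N j).
Proof.
move=> N0; rewrite /psum.
have -> : \sum_(j < K) (\sum_(k < n - j) t ^+ k *: M k) *m (t ^+ j *: N j)
    = \sum_(j < K) \sum_(k < n | (j <= k)%N) t ^+ k *: (M (k - j)%N *m N j).
  apply: eq_bigr => j _; rewrite mulmx_suml.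
  rewrite -(sum_shift (fun k => t ^+ k *: M k *m (t ^+ j *: N j))).
  apply: eq_bigr => k jk; rewrite -scalemxAl -scalemxAr scalerA -exprD subnK //.
rewrite (exchange_big_dep xpredT) //=; apply: eq_bigr => k _.
rewrite -scaler_sumr; congr (_ *: _); rewrite /conv.
rewrite (reindex_inj rev_ord_inj) /=.
rewrite (eq_bigr (fun i : 'I_k.+1 => M (k - i)%N *m N i)); last first.
  by move=> i _; rewrite subSS subKn // -ltnS.
rewrite (big_ord_widen (maxn K k.+1) (fun i => M (k - i)%N *m N i)) ?leq_maxr //.
rewrite [RHS](big_ord_widen_cond (maxn K k.+1) (fun j => (j <= k)%N)
  (fun i => M (k - i)%N *m N i)) ?leq_maxl //.
rewrite big_mkcond [RHS]big_mkcond; apply: eq_bigr => i _ /=.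
rewrite !ltnS; have [ik|ik] := leqP i k; have [iK|iK] := ltnP i K => //=.
by rewrite (N0 _ iK) mulmx0.
Qed.

Lemma cvg_psum_conv t (M N : nat -> 'M[R]_d) K (G : 'M[R]_d) :
  (forall k, (K <= k)%N -> N k = 0) ->
  (forall i j, (psum t M n i j @[n --> \oo] --> G i j)) ->
  forall i j, psum t (conv M N) n i j @[n --> \oo]
    --> (G *m psum t N K) i j.
Proof.
move=> N0 HG i j.
under eq_fun do rewrite (psum_conv t _ _ N0) summxE.
have -> : (G *m psum t N K) i j = \sum_(k < K) (G *m (t ^+ k *: N k)) i j.
  by rewrite /psum mulmx_sumr summxE.
apply: cvg_bigsum => k.
under eq_fun do rewrite mxE; rewrite mxE.
apply: cvg_bigsum => l; apply: cvgMr_tmp.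
by have := HG i l; rewrite -(cvg_centern k).
Qed.

Lemma psumD t (M N : nat -> 'M[R]_d) n :
  psum t (fun k => M k + N k) n = psum t M n + psum t N n.
Proof. by rewrite /psum -big_split; apply: eq_bigr => k _; rewrite scalerDr. Qed.

Lemma Ac0 k : (p < k)%N -> Ac k = 0.
Proof. by case: k => // k pk /=; rewrite insubF // ltnNge -ltnS pk. Qed.

Lemma Bc0 k : (q < k)%N -> Bc k = 0.
Proof. by case: k => // k pk /=; rewrite insubF // ltnNge -ltnS pk. Qed.

Lemma psum_finite m (N : 'I_m -> 'M[R]_d) t K : (m <= K)%N ->
  \sum_(k < K) t ^+ k.+1 *: (if insub (k : nat) is Some i then N i else 0)
  = \sum_(j < m) t ^+ j.+1 *: N j.
Proof.
move=> mK.
rewrite [RHS](eq_bigr (fun j : 'I_m => t ^+ j.+1 *: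
  (if insub (j : nat) is Some i then N i else 0))); last first.
  by move=> j _; rewrite valK.
rewrite [RHS](big_ord_widen K (fun j => t ^+ j.+1 *:
  (if insub j is Some i then N i else 0))) // [RHS]big_mkcond.
apply: eq_bigr => k _; case: ifPn => // km.
by rewrite insubF ?scaler0 //; exact: negbTE.
Qed.

Lemma real_complexXM (x y : R) n : (x ^+ n * y)%:C%C = x%:C%C ^+ n * y%:C%C.
Proof. by rewrite -rmorphXn -rmorphM. Qed.

Lemma cmx_pol m (N : 'I_m -> 'M[R]_d) t :
  \sum_(j < m) t%:C%C ^+ j.+1 *: cmx (N j) = cmx (\sum_(j < m) t ^+ j.+1 *: N j).
Proof.
apply/matrixP => i j; rewrite !mxE !summxE raddf_sum; apply: eq_bigr => k _.
by rewrite !mxE; exact/esym/real_complexXM.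
Qed.

Lemma cmxD (M N : 'M[R]_d) : cmx (M + N) = cmx M + cmx N.
Proof. by apply/matrixP => i j; rewrite !mxE raddfD. Qed.

Lemma cmxN (M : 'M[R]_d) : cmx (- M) = - cmx M.
Proof. by apply/matrixP => i j; rewrite !mxE raddfN. Qed.

Lemma cmx1 : cmx (1%:M : 'M[R]_d) = 1%:M.
Proof. by apply/matrixP => i j; rewrite !mxE; case: (i == j). Qed.

Lemma psum_Bc t : Bpol B t%:C%C = cmx (psum t Bc q.+1).
Proof.
rewrite /Bpol cmx_pol -cmx1 -cmxD; congr cmx.
rewrite /psum big_ord_recl expr0 scale1r; congr (_ + _).
by rewrite -(psum_finite B t (leqnn q)).
Qed.

Lemma psum_Ac t : Apol A t%:C%C = cmx (psum t Ac p.+1).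
Proof.
rewrite /Apol cmx_pol -cmx1 -cmxN -cmxD; congr cmx.
rewrite /psum big_ord_recl expr0 scale1r; congr (_ + _).
rewrite -sumrN (eq_bigr (fun j : 'I_p => t ^+ j.+1 *: (- A j))); last first.
  by move=> j _; rewrite scalerN.
by rewrite -(psum_finite (fun j => - A j) t (leqnn p)).
Qed.

(** At a real point the complex expansions have real coefficients; taking real parts transports them
    to [R], where uniqueness of coefficients is applied. *)
Definition remx (M : 'M[R[i]]_d) : 'M[R]_d := map_mx (fun z => complex.Re z) M.

Lemma remxM (M : 'M[R[i]]_d) (N : 'M[R]_d) : remx (M *m cmx N) = remx M *m N.
Proof.
apply/matrixP => i j; rewrite !mxE raddf_sum; apply: eq_bigr => k _.
rewrite !mxE; case: (M i k) => a b /=; by rewrite mulr0 subr0.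
Qed.

Lemma remx_cmx (M : 'M[R]_d) : remx (cmx M) = M.
Proof. by apply/matrixP => i j; rewrite !mxE. Qed.

Lemma power_series_psum r f (M : nat -> 'M[R]_d) t : 0 < t -> t < r ->
  power_series_on r f M ->
  forall i j, psum t M n i j @[n --> \oo] --> remx (f t%:C%C) i j.
Proof.
move=> t0 tr /(_ t%:C%C) H i j; rewrite mxE; apply: cvg_Re.
have {}H := H _ i j; rewrite normc_def /= expr0n /= addr0 sqrtr_sqr gtr0_norm // ltcR in H.
have {}H := H tr; move: H.
have E n : (psum t M n i j)%:C%C = (\sum_(0 <= k < n) t%:C%C ^+ k *: cmx (M k)) i j.
  rewrite /psum !summxE raddf_sum big_mkord; apply: eq_bigr => k _.
  by rewrite !mxE; exact: real_complexXM.
by under eq_fun do rewrite -E.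
Qed.

Lemma matrix_uniq (M N : nat -> 'M[R]_d) (r : R) (G : R -> 'M[R]_d) : 0 < r ->
  (forall t, 0 < t -> t < r -> forall i j, psum t M n i j @[n --> \oo] --> G t i j) ->
  (forall t, 0 < t -> t < r -> forall i j, psum t N n i j @[n --> \oo] --> G t i j) ->
  forall k, M k = N k.
Proof.
move=> r0 HM HN k; apply/matrixP => i j; apply/eqP; rewrite -subr_eq0; apply/eqP.
apply: (power_series_uniq (c := fun k => M k i j - N k i j) r0) => t t0 tr.
have H : psum t M n i j - psum t N n i j @[n --> \oo] --> (0 : R).
  by rewrite -(subrr (G t i j)); apply: cvgB; [exact: HM|exact: HN].
rewrite (_ : (fun n => _) = (fun n => psum t M n i j - psum t N n i j)) //.
apply/funext => n; rewrite /psum !summxE -sumrB; apply: eq_bigr => l _.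
by rewrite !mxE mulrBr.
Qed.

(** Coefficient form of [B^-1 B = I] and [B^-1 A = B^-1 + B^-1 (A - I)]: both sides have the same
    sums at the real points of the disc. In this form the inverse of [B] acts on sequences. *)
Lemma expansions_conv :
  (forall n, conv D Bc n = if n == 0%N then 1%:M else 0) /\
  (forall n, conv D Ac n = D n + Pc n).
Proof.
have [_ [r [r1 det0 HD HP]]] := exps.
have r0 : 0 < r by lra.
pose G t := remx (invmx (Bpol B t%:C%C)).
have cD t : 0 < t -> t < r -> forall i j, psum t D n i j @[n --> \oo] --> G t i j.
  by move=> t0 tr i j; exact: (@power_series_psum _ _ _ _ t0 tr HD).
have GB t : 0 < t -> t < r -> G t *m psum t Bc q.+1 = 1%:M.
  move=> t0 tr; rewrite -remxM -psum_Bc mulVmx; last first.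
    rewrite unitmxE unitfE; apply: det0.
    by rewrite normc_def /= expr0n /= addr0 sqrtr_sqr gtr0_norm // ltcR.
  by rewrite -cmx1 remx_cmx.
have cP t : 0 < t -> t < r -> forall i j, psum t Pc n i j @[n --> \oo]
    --> (G t *m (psum t Ac p.+1 - 1%:M)) i j.
  move=> t0 tr i j; have := @power_series_psum _ _ _ _ t0 tr HP i j.
  by rewrite psum_Ac -cmx1 -cmxN -cmxD remxM.
split.
- apply: (matrix_uniq (G := fun=> 1%:M) r0) => t t0 tr i j.
    rewrite -(GB _ t0 tr); apply: cvg_psum_conv; last exact: cD.
    by move=> k; exact: Bc0.
  apply: cvg_near_cst; near=> n.
  have : (0 < n)%N by near: n; exact: nbhs_infty_gt.
  move=> n0; rewrite -(prednK n0) /psum big_ord_recl expr0 scale1r big1 ?addr0 //.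
  by move=> k _; rewrite scaler0.
- apply: (matrix_uniq (G := fun t => G t *m psum t Ac p.+1) r0) => t t0 tr i j.
    apply: cvg_psum_conv; last exact: cD.
    by move=> k; exact: Ac0.
  have -> : G t *m psum t Ac p.+1 = G t + G t *m (psum t Ac p.+1 - 1%:M).
    by rewrite mulmxBr mulmx1 addrC subrK.
  under eq_fun do rewrite psumD mxE; rewrite mxE.
  by apply: cvgD; [exact: cD|exact: cP].
Unshelve. all: by end_near. Qed.

Lemma expansions_geometric : exists C rho : R, [/\ 0 <= C, 0 < rho, rho < 1,
  forall k i j, `|D k i j| <= C * rho ^+ k &
  forall k i j, `|Pc k i j| <= C * rho ^+ k].
Proof.
have [_ [r [r1 det0 HD HP]]] := exps.
(* At a point strictly between 1 and the radius the terms of the series are bounded, so the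
   coefficients decay like [t^-k] with [t^-1 < 1]. *)
pose t := (1 + r) / 2.
have t1 : 1 < t by rewrite ltr_pdivlMr //; lra.
have tr : t < r by rewrite ltr_pdivrMr //; lra.
have t0 : 0 < t by lra.
have H f (M : nat -> 'M[R]_d) : power_series_on r f M ->
    exists C, 0 <= C /\ forall k i j, `|M k i j| <= C * t^-1 ^+ k.
  move=> HM.
  have Hij (x : 'I_d * 'I_d) : exists C, forall k, `|M k x.1 x.2| <= C * t^-1 ^+ k.
    apply: (power_series_bounded (t := t) (l := remx (f t%:C%C) x.1 x.2)) => //.
    have := @power_series_psum _ _ _ _ t0 tr HM x.1 x.2.
    rewrite (_ : (fun n => psum t M n x.1 x.2) = fun n => \sum_(k < n) t ^+ k * M k x.1 x.2) //.
    by apply/funext => n; rewrite /psum summxE; apply: eq_bigr => k _; rewrite mxE.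
  have [C HC] := choice Hij.
  exists (\sum_x `|C x|); split=> [|k i j]; first by apply: sumr_ge0.
  apply: le_trans (HC (i, j) k) _; rewrite ler_wpM2r ?exprn_ge0 ?invr_ge0 ?(ltW t0) //.
  apply: le_trans (ler_norm _) _; rewrite (bigD1 (i, j)) //= lerDl.
  exact: sumr_ge0.
have [C1 [C10 HC1]] := H _ _ HD; have [C2 [C20 HC2]] := H _ _ HP.
have i0 : 0 < t^-1 by rewrite invr_gt0.
exists (C1 + C2), t^-1; split=> //; first exact: addr_ge0.
- by rewrite invf_lt1.
- move=> k i j; apply: le_trans (HC1 k i j) _.
  by rewrite ler_wpM2r ?exprn_ge0 ?(ltW i0) // lerDl.
- move=> k i j; apply: le_trans (HC2 k i j) _.
  by rewrite ler_wpM2r ?exprn_ge0 ?(ltW i0) // lerDr.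
Qed.

End Expansions.

End PowerSeries.

(** * Growth lemmas *)

Section Growth.
Context {R : realType}.

Lemma sqr_sum_weighted n (x w : 'I_n -> R) : (forall k, 0 < w k) ->
  (\sum_k x k) ^+ 2 <= (\sum_k w k) * (\sum_k x k ^+ 2 / w k).
Proof.
case: n x w => [|n] x w w0; first by rewrite !big_ord0 expr0n mul0r.
set S := \sum_k w k; set X := \sum_k x k; set Q := \sum_k _ / _.
have S0 : 0 < S.
  by rewrite /S big_ord_recl ltr_pwDl // sumr_ge0 // => k _; exact: ltW.
have : 0 <= \sum_k w k * (x k / w k - X / S) ^+ 2.
  by apply: sumr_ge0 => k _; rewrite mulr_ge0 ?sqr_ge0 // ltW.
have -> : \sum_k w k * (x k / w k - X / S) ^+ 2 = Q - X ^+ 2 / S.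
  rewrite (eq_bigr (fun k => x k ^+ 2 / w k - 2 * (X / S) * x k
      + (X / S) ^+ 2 * w k)); last first.
    by move=> k _; field; rewrite !lt0r_neq0.
  rewrite !big_split /= sumrN -!mulr_sumr -/S -/X -/Q; field; exact: lt0r_neq0.
by rewrite subr_ge0 ler_pdivrMr // mulrC.
Qed.

Lemma sum_geom (rho : R) n : 0 <= rho -> rho < 1 ->
  \sum_(k < n) rho ^+ k <= (1 - rho)^-1.
Proof.
move=> r0 r1; have h : 0 < 1 - rho by rewrite subr_gt0.
have : (1 - rho) * \sum_(k < n) rho ^+ k = 1 - rho ^+ n.
  elim: n => [|n IH]; first by rewrite big_ord0 mulr0 expr0 subrr.
  by rewrite big_ord_recr /= mulrDr IH exprS; ring.
move=> E; rewrite -[leRHS]mul1r ler_pdivlMr // mulrC E gerBl exprn_ge0 //.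
Qed.

Lemma nsq_sum_weighted m c n (v : 'I_n -> 'M[R]_(m, c)) (w : 'I_n -> R) :
  (forall k, 0 < w k) ->
  nsq (\sum_k v k) <= (\sum_k w k) * (\sum_k nsq (v k) / w k).
Proof.
move=> w0; rewrite /nsq.
apply: le_trans (_ : \sum_i \sum_j (\sum_k w k) * (\sum_k v k i j ^+ 2 / w k) <= _).
  apply: ler_sum => i _; apply: ler_sum => j _; rewrite summxE.
  exact: sqr_sum_weighted.
under eq_bigr do rewrite -mulr_sumr.
rewrite -mulr_sumr ler_wpM2l ?sumr_ge0 // => [k _|]; first exact: ltW.
rewrite le_eqVlt; apply/orP; left; apply/eqP.
under eq_bigr do rewrite exchange_big; rewrite exchange_big; apply: eq_bigr => k _.
by rewrite mulr_suml; apply: eq_bigr => i _; rewrite mulr_suml.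
Qed.

(** An exponentially discounted sum of the past. Thanks to [geomS] it is driven by a contraction,
    and it dominates every convolution with a geometric kernel. *)
Definition geom (rho : R) (y : nat -> R) (k : nat) : R :=
  \sum_(j < k.+1) rho ^+ (k - j) * y j.

Lemma geomS rho y k : geom rho y k.+1 = rho * geom rho y k + y k.+1.
Proof.
rewrite /geom big_ord_recr /= subnn expr0 mul1r mulr_sumr; congr (_ + _).
apply: eq_bigr => j _; rewrite subSn; last by rewrite -ltnS.
by rewrite exprS mulrA.
Qed.

Lemma geom_ge0 rho y k : 0 <= rho -> (forall j, 0 <= y j) -> 0 <= geom rho y k.
Proof. by move=> r0 y0; apply: sumr_ge0 => j _; rewrite mulr_ge0 ?exprn_ge0. Qed.

Lemma geom_ge rho y k : 0 <= rho -> (forall j, 0 <= y j) -> y k <= geom rho y k.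
Proof.
move=> r0 y0; rewrite /geom big_ord_recr /= subnn expr0 mul1r lerDr.
by apply: sumr_ge0 => j _; rewrite mulr_ge0 ?exprn_ge0.
Qed.

Lemma geom_back rho y k i : 0 < rho -> (forall j, 0 <= y j) -> (i <= k)%N ->
  geom rho y (k - i)%N <= rho^-1 ^+ i * geom rho y k.
Proof.
move=> r0 y0; elim: i k => [|i IH] k ik; first by rewrite subn0 expr0 mul1r.
case: k ik => // k ik; rewrite subSS.
apply: le_trans (IH k ik) _; rewrite exprSr -mulrA.
rewrite ler_wpM2l ?exprn_ge0 ?invr_ge0 ?(ltW r0) //.
by rewrite ler_pdivlMl // geomS lerDl.
Qed.

(** Weighted Cauchy-Schwarz with weights [rho^n]: of the two powers in [(rho^n)^2], one pays for the
    weight and the other remains as the discount. *)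
Lemma geom_conv a b c (M : nat -> 'M[R]_(a, b)) (v : nat -> 'M[R]_(b, c)) C rho k :
  0 < rho -> rho < 1 -> (forall n, nsq (M n) <= C * (rho ^+ n) ^+ 2) ->
  nsq (conv M v k) <= (1 - rho)^-1 * C * geom rho (fun j => nsq (v j)) k.
Proof.
move=> r0 r1 MC.
have C0 : 0 <= C by have := MC 0%N; rewrite expr0 expr1n mulr1; apply/le_trans/nsq_ge0.
have h : 0 < 1 - rho by rewrite subr_gt0.
rewrite /conv; apply: le_trans (nsq_sum_weighted (w := fun n => rho ^+ n) _ _) _.
  by move=> n; rewrite exprn_gt0.
rewrite -mulrA; apply: ler_pM.
- by apply: sumr_ge0 => j _; rewrite exprn_ge0 // ltW.
- by apply: sumr_ge0 => j _; rewrite divr_ge0 ?nsq_ge0 ?exprn_ge0 // ltW.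
- exact: sum_geom (ltW r0) r1.
rewrite /geom mulr_sumr [leRHS](reindex_inj rev_ord_inj) /=.
apply: ler_sum => j _; rewrite subSS subKn; last by rewrite -ltnS.
have rj : 0 < rho ^+ j by rewrite exprn_gt0.
rewrite ler_pdivrMr //; apply: le_trans (nsqM _ _) _.
apply: le_trans (ler_wpM2r (nsq_ge0 _) (MC j)) _.
by rewrite le_eqVlt; apply/orP; left; apply/eqP; ring.
Qed.

(** The contraction [rho] is what admits the running sum of [L] on the left:
    [(1 - rho) * L n + rho * L n] restores [L n], so the left side grows at each step by a factor at
    most [1 + bet n] and the term [e n]. *)
Lemma gronwall (L bet e : nat -> R) (rho : R) n :
  (forall k, 0 <= L k) -> (forall k, 0 <= bet k) -> (forall k, 0 <= e k) ->
  rho < 1 ->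
  (forall k, L k.+1 <= (rho + bet k) * L k + e k) ->
  (1 - rho) * \sum_(k < n) L k + L n
    <= expR (\sum_(k < n) bet k) * (L 0%N + \sum_(k < n) e k).
Proof.
move=> L0 b0 e0 r1 HL; elim: n => [|n IH].
  by rewrite !big_ord0 mulr0 add0r expR0 mul1r addr0.
rewrite !big_ord_recr /= expRD.
set E := expR (\sum_(k < n) bet k) in IH *; set G := \sum_(k < n) e k in IH *.
set S := \sum_(k < n) L k in IH *.
have E1 : 1 <= E by rewrite -expR0 ler_expR sumr_ge0.
have X1 := expR_ge1Dx (bet n); set X := expR (bet n) in X1 *.
have h1 := HL n; have Ln := L0 n; have bn := b0 n; have en := e0 n.
have S0 : 0 <= (1 - rho) * S by rewrite mulr_ge0 ?sumr_ge0 // subr_ge0 ltW.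
have h2 : (1 - rho) * S + L n + bet n * L n <= X * (E * (L 0%N + G)).
  apply: le_trans (_ : X * ((1 - rho) * S + L n) <= _).
    have : (1 + bet n) * ((1 - rho) * S + L n) <= X * ((1 - rho) * S + L n).
      by rewrite ler_wpM2r // addr_ge0.
    have : 0 <= bet n * ((1 - rho) * S) by rewrite mulr_ge0.
    lra.
  by rewrite ler_wpM2l //; lra.
have h3 : e n <= E * X * e n.
  rewrite ler_peMl // -[1]mulr1 ler_pM //; lra.
rewrite !mulrDr; rewrite !mulrDr in h2; lra.
Qed.

Lemma bounded_sum_small (dl : nat -> R) (C e : R) : (forall k, 0 <= dl k) ->
  (forall n, \sum_(k < n) dl k <= C) -> 0 < e ->
  exists k0, forall k, (k0 <= k)%N -> dl k <= e.
Proof.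
move=> d0 dC e0.
have cv : cvgn (series dl).
  apply: nondecreasing_is_cvgn.
    by apply/nondecreasing_seqP => n; rewrite seriesSr lerDl.
  by exists C => _ [n _ <-]; rewrite /series /= big_mkord.
have /cvgr0_norm_lt /(_ _ e0) [k0 _ H] := cvg_series_cvg_0 cv.
exists k0 => k kk; apply: le_trans (ler_norm _) _; apply: ltW; exact: H.
Qed.

Lemma ln1D_le (e y : R) : 0 < e -> 0 <= y -> ln (1 + y) <= e * y + (e - ln e).
Proof.
move=> e0 y0; have p : 0 < 1 + y by rewrite ltr_pwDl.
have -> : ln (1 + y) = ln (1 + (e * (1 + y) - 1)) - ln e.
  have -> : 1 + (e * (1 + y) - 1) = e * (1 + y) by ring.
  by rewrite lnM ?posrE //; ring.
have h : 0 < e * (1 + y) by rewrite mulr_gt0.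
have := @le_ln1Dx R (e * (1 + y) - 1) _.
move=> H; have := H _; lra.
Qed.

(** * Deterministic growth of the trace *)

Section Bounds.
Variables (Lk nu Pk ak dk Fk : nat -> R) (rho C1 C2 C3 m : R).
Hypotheses (L0 : forall k, 0 <= Lk k) (nu0 : forall k, 0 <= nu k)
  (P0 : forall k, 0 <= Pk k) (a0 : forall k, 0 <= ak k)
  (d0 : forall k, 0 <= dk k) (F0 : forall k, 0 <= Fk k).
Hypotheses (rho1 : rho < 1) (C10 : 0 <= C1) (C20 : 0 <= C2) (m0 : 0 <= m).
Hypothesis LS : forall k, Lk k.+1 <= rho * Lk k + 2 * Pk k + nu k.
Hypothesis FL : forall k, Fk k <= C1 * Lk k.
Hypothesis nuC : forall n, \sum_(k < n) nu k <= C1 * n.+1%:R.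
Let s n := m + \sum_(k < n) Fk k.
Hypothesis aC : forall n, \sum_(k < n) ak k <= C2 * (1 + ln (1 + s n)).

Lemma s_ge0 n : 0 <= s n.
Proof. by rewrite addr_ge0 // sumr_ge0. Qed.

(** In the application [Lk] is the discounted past, [Pk] the squared prediction error, [ak] that
    error over [1 + gain], [dk] the trace decrease and [Fk] the squared regressor. As [dk] is
    summable it is eventually below [e1], so the Gronwall exponent is at most a constant plus [ep]
    times [l n]; solving for the logarithm of [1 + s n] costs the factor [1 + kappa]. *)
Lemma polynomial_growth (kappa : R) : 0 < kappa ->
  (forall n, \sum_(k < n) dk k <= C3) ->
  (forall k, Pk k <= 2 * ak k + ak k * dk k * Fk k) ->
  exists K, forall n, ln (1 + s n) <= K + (1 + kappa) * ln n.+1%:R.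
Proof.
move=> k0 dC PF.
(* Chosen so that [(1 + kappa) * (1 - 2 * ep) = 1]: one [ep] is spent in the Gronwall exponent, the
   other on the logarithm of [1 + l n]. *)
pose ep := kappa / (2 * (1 + kappa)).
have ep0 : 0 < ep by rewrite divr_gt0 // mulr_gt0 // addr_gt0.
(* Makes [2 * C1 * C2 * e1 <= ep], where the left side is the coefficient of [l n] in the bound for
   the sum of [bet]. *)
pose e1 := ep / (2 * C1 * C2 + 1).
have q0 : 0 < 2 * C1 * C2 + 1 by rewrite ltr_wpDl // !mulr_ge0.
have e10 : 0 < e1 by rewrite divr_gt0.
have [n0 Hn0] := bounded_sum_small d0 dC e10.
pose K1 := \sum_(k < n0) ak k * dk k.
have K10 : 0 <= K1 by apply: sumr_ge0 => k _; rewrite mulr_ge0.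
have ad n : \sum_(k < n) ak k * dk k <= K1 + e1 * \sum_(k < n) ak k.
  elim: n => [|n IH]; first by rewrite !big_ord0 mulr0 addr0.
  have [nn|nn] := leqP n0 n; last first.
    apply: le_trans (_ : K1 <= _); last by rewrite lerDl mulr_ge0 ?sumr_ge0 // ltW.
    by apply: (ler_sum_ord_widen (f := fun k => ak k * dk k)) => // k; rewrite mulr_ge0.
  rewrite !big_ord_recr /= mulrDr addrA; apply: lerD => //.
  by rewrite mulrC ler_wpM2r // Hn0.
pose bet k := 2 * C1 * (ak k * dk k).
pose e k := 4 * ak k + nu k.
have HL k : Lk k.+1 <= (rho + bet k) * Lk k + e k.
  apply: le_trans (LS k) _; rewrite /bet /e mulrDl.
  have h1 := PF k; have h2 := FL k.
  have h3 : ak k * dk k * Fk k <= ak k * dk k * (C1 * Lk k).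
    by rewrite ler_wpM2l // mulr_ge0.
  lra.
have b0 k : 0 <= bet k by rewrite !mulr_ge0.
have e0 k : 0 <= e k by rewrite addr_ge0 // mulr_ge0.
pose l n := 1 + ln (1 + s n).
have l1 n : 1 <= l n by rewrite lerDl ln_ge0 // lerDl s_ge0.
pose C4 := 1 + m + C1 / (1 - rho) * (Lk 0%N + 4 * C2 + C1).
have r1 : 0 < 1 - rho by rewrite subr_gt0.
have c0 : 0 <= C1 / (1 - rho) by rewrite divr_ge0 // ltW.
have C41 : 1 <= C4.
  by rewrite /C4 -addrA lerDl addr_ge0 // mulr_ge0 // !addr_ge0 // mulr_ge0.
have main n : 1 + s n <= C4 * expR (2 * C1 * K1 + ep * l n) * (n.+1%:R * (1 + l n)).
  set E := expR _.
  have E1 : 1 <= E.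
    have u1 : 0 <= 2 * C1 * K1 by rewrite !mulr_ge0.
    have u2 : 0 <= ep * l n.
      by rewrite mulr_ge0 ?(ltW ep0) //; have := l1 n; lra.
    by rewrite -expR0 ler_expR addr_ge0.
  have G := gronwall n L0 b0 e0 rho1 HL.
  have Eb : expR (\sum_(k < n) bet k) <= E.
    rewrite ler_expR -mulr_sumr.
    have h1 := ad n; have h2 := aC n; rewrite -/(l n) in h2.
    have h3 : 2 * C1 * \sum_(k < n) ak k * dk k <= 2 * C1 * (K1 + e1 * (C2 * l n)).
      rewrite ler_wpM2l // ?mulr_ge0 //; apply: le_trans h1 _.
      by rewrite lerD2l ler_wpM2l // ltW.
    apply: le_trans h3 _; rewrite mulrDr lerD2l.
    have -> : 2 * C1 * (e1 * (C2 * l n)) = e1 * (2 * C1 * C2) * l n by ring.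
    rewrite ler_wpM2r //; first by have := l1 n; lra.
    rewrite /e1 mulrAC ler_pdivrMr // ler_wpM2l ?lerDl //; exact: ltW.
  have ln1 := l1 n.
  have N1 : 1 <= n.+1%:R :> R by rewrite ler1n.
  have eG : \sum_(k < n) e k <= 4 * C2 * l n + C1 * n.+1%:R.
    rewrite big_split /= -mulr_sumr -mulrA; apply: lerD; last exact: nuC.
    by rewrite ler_wpM2l //; exact: aC.
  have NN : n.+1%:R <= n.+1%:R * (1 + l n) by rewrite ler_peMr //; lra.
  have Nl : l n <= n.+1%:R * (1 + l n).
    by apply: le_trans (_ : 1 * (1 + l n) <= _); [lra|rewrite ler_wpM2r //; lra].
  have Gb : Lk 0%N + \sum_(k < n) e k
      <= (Lk 0%N + 4 * C2 + C1) * (n.+1%:R * (1 + l n)).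
    have q1 : Lk 0%N <= Lk 0%N * (n.+1%:R * (1 + l n)) by rewrite ler_peMr //; lra.
    have q2 : 4 * C2 * l n <= 4 * C2 * (n.+1%:R * (1 + l n)).
      by rewrite ler_wpM2l // mulr_ge0.
    have q3 : C1 * n.+1%:R <= C1 * (n.+1%:R * (1 + l n)) by rewrite ler_wpM2l.
    by rewrite !mulrDl; lra.
  have SL : \sum_(k < n) Lk k
      <= (1 - rho)^-1 * (E * ((Lk 0%N + 4 * C2 + C1) * (n.+1%:R * (1 + l n)))).
    rewrite ler_pdivlMl //; apply: le_trans (_ : (1 - rho) * \sum_(k < n) Lk k + Lk n <= _).
      by rewrite lerDl.
    apply: le_trans G _; apply: ler_pM => //.
    by rewrite addr_ge0 // sumr_ge0.
  have SF : \sum_(k < n) Fk k <= C1 * \sum_(k < n) Lk k.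
    by rewrite mulr_sumr; apply: ler_sum => k _.
  have h5 : 1 + m <= (1 + m) * (E * (n.+1%:R * (1 + l n))).
    rewrite ler_peMr ?addr_ge0 // -[1]mulr1 ler_pM //; lra.
  have h6 : C1 * \sum_(k < n) Lk k <= C1 / (1 - rho) * (Lk 0%N + 4 * C2 + C1)
      * (E * (n.+1%:R * (1 + l n))).
    apply: le_trans (ler_wpM2l C10 SL) _.
    by rewrite le_eqVlt; apply/orP; left; apply/eqP; ring.
  have -> : C4 * E * (n.+1%:R * (1 + l n)) = (1 + m) * (E * (n.+1%:R * (1 + l n)))
    + C1 / (1 - rho) * (Lk 0%N + 4 * C2 + C1) * (E * (n.+1%:R * (1 + l n))).
    by rewrite /C4; ring.
  rewrite /s; lra.
pose K0 := ln C4 + 2 * C1 * K1 + (ep - ln ep) + 2 * ep.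
exists ((1 + kappa) * K0) => n.
have sp : 0 < 1 + s n by rewrite ltr_pwDl // s_ge0.
have ln1 := l1 n.
have p1 : 0 < n.+1%:R :> R by rewrite ltr0n.
have p2 : 0 < 1 + l n by lra.
have p3 : 0 < C4 by lra.
have : ln (1 + s n) <= ln (C4 * expR (2 * C1 * K1 + ep * l n) * (n.+1%:R * (1 + l n))).
  by rewrite ler_ln ?posrE // !mulr_gt0 ?expR_gt0.
rewrite !lnM ?posrE ?mulr_gt0 ?expR_gt0 // expRK.
have := ln1D_le ep0 (le_trans ler01 ln1).
have -> : l n = 1 + ln (1 + s n) by [].
set y := ln (1 + s n); set z := ln n.+1%:R => h1 h2.
have h3 : (1 - 2 * ep) * y <= K0 + z by rewrite /K0; lra.
have h4 : (1 + kappa) * (1 - 2 * ep) = 1.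
  by rewrite /ep; field; rewrite lt0r_neq0 // addr_gt0.
have : (1 + kappa) * ((1 - 2 * ep) * y) <= (1 + kappa) * (K0 + z).
  by rewrite ler_wpM2l // addr_ge0 // ltW.
by rewrite mulrA h4 mul1r mulrDr.
Qed.

(* The ratios [ak k / lam k] are eventually small, hence
   [\sum Pk <= O(ln s) + eps s] while [s <= O(n + \sum Pk)]. *)
Lemma linear_growth (lam : nat -> R) (K : R) :
  (forall n, ln (1 + s n) <= K * n.+1%:R) ->
  (forall eta, 0 < eta -> exists k0, forall k, (k0 <= k)%N ->
     0 < lam k /\ ak k <= eta * lam k) ->
  (forall k, 0 < lam k -> Pk k <= ak k * (1 + Fk k / lam k)) ->
  exists K', forall n, s n <= K' * n.+1%:R.
Proof.
move=> lnK small PF.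
have r1 : 0 < 1 - rho by rewrite subr_gt0.
have c0 : 0 <= C1 / (1 - rho) by rewrite divr_ge0 // ltW.
(* Feeding [Pk] back through Gronwall and [FL] returns the sum of [Fk] with coefficient
   [C1 / (1 - rho) * (2 * eta)]; this choice keeps it at most 1/2, so that it moves to the left
   side. *)
pose eta := (4 * (C1 / (1 - rho)) + 1)^-1.
have eta0 : 0 < eta by rewrite invr_gt0 ltr_wpDl // mulr_ge0.
have [k0 Hk] := small _ eta0.
pose K1 := \sum_(k < k0) Pk k.
have K10 : 0 <= K1 by exact: sumr_ge0.
have PB n : \sum_(k < n) Pk k <= K1 + \sum_(k < n) ak k + eta * \sum_(k < n) Fk k.
  elim: n => [|n IH]; first by rewrite !big_ord0 mulr0 !addr0.
  have [nn|nn] := leqP k0 n; last first.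
    apply: le_trans (_ : K1 <= _).
      exact: (ler_sum_ord_widen (f := Pk)).
    by rewrite -addrA lerDl addr_ge0 ?mulr_ge0 ?sumr_ge0 // ltW.
  have [lp al] := Hk n nn.
  have : Pk n <= ak n + eta * Fk n.
    apply: le_trans (PF n lp) _; rewrite mulrDr mulr1 lerD2l mulrA mulrAC.
    rewrite ler_wpM2r // ler_pdivrMr //.
  rewrite !big_ord_recr /=; lra.
pose Kp := `|K|.
have KN n : 1 + ln (1 + s n) <= (1 + Kp) * n.+1%:R.
  have N1 : 1 <= n.+1%:R :> R by rewrite ler1n.
  have := lnK n; have : K * n.+1%:R <= Kp * n.+1%:R by rewrite ler_wpM2r // ler_norm.
  rewrite mulrDl mul1r; lra.
pose D := Lk 0%N + 2 * K1 + 2 * C2 * (1 + Kp) + C1.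
exists (2 * (m + C1 / (1 - rho) * D)) => n.
have N1 : 1 <= n.+1%:R :> R by rewrite ler1n.
have HL k : Lk k.+1 <= (rho + 0) * Lk k + (2 * Pk k + nu k).
  by rewrite addr0 addrA; exact: LS.
have e0 k : 0 <= 2 * Pk k + nu k by rewrite addr_ge0 // mulr_ge0.
have := gronwall n L0 (fun=> lexx 0) e0 rho1 HL.
have E1 : expR (\sum_(k < n) (0 : R)) = 1 by rewrite big1 // expR0.
rewrite E1 mul1r big_split /= -mulr_sumr => G.
have h1 := PB n; have h2 := aC n; have h3 := nuC n.
have h4 : C2 * (1 + ln (1 + s n)) <= C2 * ((1 + Kp) * n.+1%:R) by rewrite ler_wpM2l.
have SF0 : 0 <= \sum_(k < n) Fk k by exact: sumr_ge0.
have h5 : (1 - rho) * \sum_(k < n) Lk k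
    <= D * n.+1%:R + 2 * eta * \sum_(k < n) Fk k.
  have q1 : Lk 0%N <= Lk 0%N * n.+1%:R by rewrite ler_peMr.
  have q2 : K1 <= K1 * n.+1%:R by rewrite ler_peMr.
  have := L0 n; rewrite /D !mulrDl; lra.
have SF : \sum_(k < n) Fk k <= C1 * \sum_(k < n) Lk k.
  by rewrite mulr_sumr; apply: ler_sum => k _.
have h6 : \sum_(k < n) Lk k <= (1 - rho)^-1 * (D * n.+1%:R + 2 * eta * \sum_(k < n) Fk k).
  by rewrite ler_pdivlMl.
have h7 := le_trans SF (ler_wpM2l C10 h6).
have h8 : C1 / (1 - rho) * (2 * eta) <= 2^-1.
  rewrite /eta; move: c0; set c := C1 / (1 - rho) => c0.
  have p : 0 < 4 * c + 1 by rewrite ltr_wpDl // mulr_ge0.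
  have -> : c * (2 * (4 * c + 1)^-1) = 2 * c / (4 * c + 1) by ring.
  rewrite ler_pdivrMr //; lra.
have h9 : C1 / (1 - rho) * (2 * eta) * \sum_(k < n) Fk k <= 2^-1 * \sum_(k < n) Fk k.
  by rewrite ler_wpM2r.
have h10 : m <= m * n.+1%:R by rewrite ler_peMr.
have h11 : C1 * ((1 - rho)^-1 * (D * n.+1%:R + 2 * eta * \sum_(k < n) Fk k))
  = C1 / (1 - rho) * D * n.+1%:R + C1 / (1 - rho) * (2 * eta) * \sum_(k < n) Fk k.
  by ring.
rewrite h11 in h7; have {h7 h11}h12 := le_trans h7 (lerD (lexx _) h9).
rewrite /s; set Y := C1 / (1 - rho) * D in h12 *.
have -> : 2 * (m + Y) * n.+1%:R = 2 * (m * n.+1%:R) + 2 * (Y * n.+1%:R) by ring.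
have : 0 <= m * n.+1%:R by rewrite mulr_ge0.
lra.
Qed.

End Bounds.

End Growth.

(** * The model along a path *)

Section Blocks.
Context {R : realType}.

Lemma dot_mxcol d p (u v : 'I_p -> 'cV[R]_d) :
  dot (\mxcol_(i < p) u i) (\mxcol_(i < p) v i) = \sum_i dot (u i) (v i).
Proof.
have : (\mxcol_(i < p) u i)^T *m (\mxcol_(i < p) v i) = \sum_i (u i)^T *m v i.
  by rewrite tr_mxcol mul_mxrow_mxcol.
rewrite dotE => /matrixP/(_ 0 0); rewrite mxE eqxx mulr1n summxE => ->.
by apply: eq_bigr => i _; rewrite dotE mxE eqxx mulr1n.
Qed.

Lemma nsq_mxcol d p (v : 'I_p -> 'cV[R]_d) :
  nsq (\mxcol_(i < p) v i) = \sum_i nsq (v i).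
Proof. by rewrite -dotvv dot_mxcol; apply: eq_bigr => i _; rewrite dotvv. Qed.

Lemma conv_finite a b c m (N : 'I_m -> 'M[R]_(a, b)) (M : nat -> 'M[R]_(a, b))
    (v : nat -> 'M[R]_(b, c)) k :
  (forall j, M j.+1 = if insub j is Some i then N i else 0) -> (m <= k)%N ->
  conv M v k = M 0%N *m v k + \sum_(j < m) N j *m v (k - j.+1)%N.
Proof.
move=> MN mk; rewrite /conv big_ord_recl subn0; congr (_ + _).
rewrite [RHS](eq_bigr (fun j : 'I_m => M j.+1 *m v (k - j.+1)%N)); last first.
  by move=> j _; rewrite MN valK.
rewrite [RHS](big_ord_widen k (fun j => M j.+1 *m v (k - j.+1)%N)) // [RHS]big_mkcond.
apply: eq_bigr => j _; rewrite lift0; case: ifPn => // jm.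
by rewrite MN insubF ?mul0mx //; exact: negbTE.
Qed.

End Blocks.

Section Model.
Context {R : realType} {disp : measure_display} {T : measurableType disp}.
Variables (d p q : nat) (A : 'I_p -> 'M[R]_d) (B : 'I_q -> 'M[R]_d).
Variables (X U : int -> T -> 'cV[R]_d) (eps xi x : nat -> T -> 'cV[R]_d).
Variable thetah : nat -> T -> 'M[R]_(delta_dim d p q, d).
Hypothesis arxX : arx (theta_of A B) X U eps.
Hypothesis ls : is_estimator ls_gain X U thetah.
Hypothesis control : tracking_control X U thetah x xi.
Variable w : T.

Let Z k := Phi p q X U k w.
(* [terr n] is the estimation error, [perr k] the prediction error
   [(theta - thetah_k)^t Phi_k]. *)
Definition terr n := thetah n w - theta_of A B.
Definition perr k : 'cV[R]_d := - ((terr k)^T *m Phi p q X U k w).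

Lemma output_decomp k : X k.+1%:Z w = x k.+1 w + perr k + eps k.+1 w + xi k.+1 w.
Proof.
rewrite arxX control /perr /terr linearB /= mulmxBl.
set a := _ *m _; set b := _ *m _.
by rewrite opprB; apply/matrixP => i j; rewrite !mxE; ring.
Qed.

(** An index shift to keep in mind: [S_n] contains [Phi_n], while [Nm n] stops just before it, so
    step [n] of the estimator inverts [Nm n.+1]. *)
Lemma S_Nm n : S_ p q ls_gain X U n w = Nm Z n.+1.
Proof.
rewrite /S_ /Nm addrC big_mkord; congr (_ + _).
by apply: eq_bigr => k _; rewrite scale1r.
Qed.

(** Normal equations in cumulative form: after multiplication by [Nm n.+1], the prediction error
    cancels against the rank-one update of [Nm]. This identifies the recursive estimator with the
    abstract recursion [Mv]. *)
Lemma Nm_terr n : Nm Z n *m terr n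
  = terr 0 + \sum_(k < n) Z k *m (eps k.+1 w)^T.
Proof.
elim: n => [|n IH]; first by rewrite /Nm !big_ord0 !addr0 mul1mx.
have E : terr n.+1 = terr n + Jm Z n.+1 *m Z n *m (eps n.+1 w + perr n)^T.
  rewrite /terr ls S_Nm invmx_Nm scale1r addrAC; congr (_ + _ *m _^T).
  rewrite arxX /perr /terr linearB /= mulmxBl.
  by apply/matrixP => i j; rewrite !mxE; ring.
rewrite E mulmxDr !mulmxA Nm_Jm mul1mx NmS mulmxDl IH big_ord_recr /= -!addrA.
congr (_ + (_ + (_ + _))).
rewrite /perr -/(Z n); move: (terr n) (Z n) => t z.
have -> : (eps n.+1 w + - (t^T *m z))^T = (eps n.+1 w)^T - z^T *m t.
  by rewrite linearB /= trmx_mul trmxK.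
by rewrite mulmxBr mulmxA addrC subrK.
Qed.

(** Each output coordinate is a scalar least squares problem with the same regressor, so [Qf] and
    [tau] apply column by column. *)
Lemma col_terr n j :
  col j (terr n) = Jm Z n *m Mv Z (col j (terr 0)) (fun k => eps k.+1 w j 0) n.
Proof.
have : terr n = Jm Z n *m (Nm Z n *m terr n) by rewrite mulmxA Jm_Nm mul1mx.
move=> ->; rewrite Nm_terr colE -mulmxA -colE; congr (_ *m _).
apply/matrixP => i l; rewrite !mxE !summxE (ord1 l); congr (_ + _).
by apply: eq_bigr => k _; rewrite !mxE big_ord1 !mxE mulrC.
Qed.

Lemma tau_perr n j :
  tau Z (col j (terr 0)) (fun k => eps k.+1 w j 0) n = - perr n j 0.
Proof.
rewrite /tau -col_terr /perr mxE opprK mxE; apply: eq_bigr => k _.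
by rewrite !mxE mulrC.
Qed.

Lemma Qf_terr n j : Qf Z (col j (terr 0)) (fun k => eps k.+1 w j 0) n
  = dot (col j (terr n)) (Nm Z n *m col j (terr n)).
Proof.
rewrite /Qf -col_terr [LHS]dotC; congr dot.
by rewrite (col_terr n) mulmxA Nm_Jm mul1mx.
Qed.

Lemma nsq_Phi k : nsq (Z k) = \sum_(i < p) nsq (X (k%:Z - i%:Z) w)
  + \sum_(j < q) nsq (U (k%:Z - j.+1%:Z) w).
Proof. by rewrite nsq_col_mx !nsq_mxcol. Qed.

Lemma theta_Phi k : (theta_of A B)^T *m Z k
  = \sum_(i < p) A i *m X (k%:Z - i%:Z) w
    + \sum_(j < q) B j *m U (k%:Z - j.+1%:Z) w.
Proof. by rewrite /theta_of trmxK mul_row_col !mul_mxrow_mxcol. Qed.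

(* Processes shifted so that the value at [k] is the one entering the output at
   time [k], and cut off at [0]: the model then reads [B * us = A * Xs - es] for
   convolutions, up to the finitely supported term [init_defect]. *)
Definition Xs k : 'cV[R]_d := if k is j.+1 then X j.+1%:Z w else 0.
Definition us k : 'cV[R]_d := if k is j.+1 then U j%:Z w else 0.
Definition es k : 'cV[R]_d := if k is j.+1 then eps j.+1 w else 0.
Definition xs k : 'cV[R]_d := if k is j.+1 then xi j.+1 w else 0.
Definition rs k : 'cV[R]_d := if k is j.+1 then x j.+1 w + perr j else 0.

Lemma X_Xs k i : (i < k)%N -> X (k%:Z - i%:Z) w = Xs (k - i)%N.
Proof.
move=> ik; have E : (k - i)%N = (k - i.+1).+1 by lia.
by rewrite E /Xs; congr (X _ w); lia.
Qed.

Lemma U_us k j : (j < k)%N -> U (k%:Z - j.+1%:Z) w = us (k - j)%N.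
Proof.
move=> jk; have E : (k - j)%N = (k - j.+1).+1 by lia.
by rewrite E /us; congr (U _ w); lia.
Qed.

Lemma Xs_decomp k : Xs k = es k + xs k + rs k.
Proof.
case: k => [|k] /=; first by rewrite !addr0.
by rewrite output_decomp; apply/matrixP => i j; rewrite !mxE; ring.
Qed.

Definition init_defect k : 'cV[R]_d := conv (Bc B) us k - conv (Ac A) Xs k + es k.

Lemma init_defect_eq0 k : (p + q < k)%N -> init_defect k = 0.
Proof.
case: k => // k pqk; rewrite /init_defect.
have pk : (p <= k)%N by lia.
have qk : (q <= k)%N by lia.
rewrite (conv_finite (N := B)) //; last exact: leqW.
rewrite (conv_finite (N := fun i => - A i)) //; last exact: leqW.
have EB : \sum_(j < q) B j *m us (k.+1 - j.+1)%N
    = \sum_(j < q) B j *m U (k%:Z - j.+1%:Z) w.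
  apply: eq_bigr => j _; have jq := ltn_ord j; rewrite subSS U_us //; lia.
have EA : \sum_(i < p) - A i *m Xs (k.+1 - i.+1)%N
    = - \sum_(i < p) A i *m X (k%:Z - i%:Z) w.
  rewrite -sumrN; apply: eq_bigr => i _; have ip := ltn_ord i.
  rewrite mulNmx subSS X_Xs //; lia.
rewrite EB EA /= !mul1mx arxX theta_Phi.
set a := \sum_(i < p) _; set b := \sum_(j < q) _.
by apply/matrixP => i j; rewrite !mxE; ring.
Qed.

Variables (D Pc : nat -> 'M[R]_d).
Hypothesis exps : expansions A B D Pc.

(** Convolution by [D] inverts [B] in the relation of the model, and [expansions_conv] rewrites [D]
    applied to [A]. The invertibility of B(z) on the disc acts here: inputs become a geometric
    filter of outputs and noise. *)
Lemma us_conv k : us k = conv (fun n => D n + Pc n) Xs k - conv D es k + conv D init_defect k.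
Proof.
have [DB DA] := expansions_conv exps.
rewrite -[LHS]conv_delta -(eq_conv DB (fun=> erefl)) -convA.
rewrite -(eq_conv DA (fun=> erefl)) -convA -convNr -!convDr.
apply: eq_conv => // n; rewrite /init_defect.
by apply/matrixP => i j; rewrite !mxE; ring.
Qed.

(** When the outputs are decomposed, the two contributions of [D] to [es] cancel. So [eps] is
    filtered by [P_k] but [xi] by [D_k + P_k], the asymmetry visible in the matrices H and K. *)
Lemma us_conv_noise k :
  us k = conv Pc es k + conv (fun n => D n + Pc n) xs k
    + (conv (fun n => D n + Pc n) rs k + conv D init_defect k).
Proof.
rewrite us_conv (eq_conv (fun=> erefl) Xs_decomp) !convDr convDl [in RHS]convDl.
rewrite !(convDl D Pc).
by apply/matrixP => i j; rewrite !mxE; ring.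
Qed.

Lemma nsq_le_entries a b (M : 'M[R]_(a, b)) C : 0 <= C ->
  (forall i j, `|M i j| <= C) -> nsq M <= (a * b)%:R * C ^+ 2.
Proof.
move=> C0 H; rewrite /nsq; apply: le_trans (_ : \sum_(i < a) \sum_(j < b) C ^+ 2 <= _).
  apply: ler_sum => i _; apply: ler_sum => j _.
  by rewrite -(real_normK (num_real _)) lerXn2r ?nnegrE.
by rewrite sumr_const sumr_const !card_ord -mulrnA mulr_natl mulnC.
Qed.

Lemma geometric_nsq : exists C rho : R, [/\ 0 <= C, 0 < rho, rho < 1 &
  [/\ forall n, nsq (D n) <= C * (rho ^+ n) ^+ 2,
     forall n, nsq (Pc n) <= C * (rho ^+ n) ^+ 2 &
     forall n, nsq (D n + Pc n) <= C * (rho ^+ n) ^+ 2]].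
Proof.
have [C [rho [C0 r0 r1 HD HP]]] := expansions_geometric exps.
have rn n : 0 <= rho ^+ n by rewrite exprn_ge0 // ltW.
exists ((d * d)%:R * (2 * C) ^+ 2), rho; split=> //; first by rewrite mulr_ge0 ?sqr_ge0.
have H (M : nat -> 'M[R]_d) : (forall k i j, `|M k i j| <= C * rho ^+ k) ->
    forall n, nsq (M n) <= (d * d)%:R * (2 * C) ^+ 2 * (rho ^+ n) ^+ 2.
  move=> HM n; rewrite -mulrA -exprMn; apply: nsq_le_entries.
    by rewrite !mulr_ge0.
  move=> i j; apply: le_trans (HM n i j) _; rewrite -mulrA ler_peMl ?mulr_ge0 //.
  by rewrite ler1n.
split; [exact: H|exact: H|move=> n].
rewrite -mulrA -exprMn; apply: nsq_le_entries; first by rewrite !mulr_ge0.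
move=> i j; rewrite mxE; apply: le_trans (ler_normD _ _) _.
by rewrite -mulrA mulr2n mulrDl mul1r; apply: lerD.
Qed.

(** Up to time [p + q] the regressor may involve the initial state, which the cut-off processes do
    not see; its square is inserted into the discounted sum by hand. *)
Definition init_nsq k : R := if (k <= p + q)%N then nsq (Z k) else 0.
Definition yk k : R := nsq (Xs k) + nsq (es k) + nsq (init_defect k) + init_nsq k.
Definition nuk k : R := 2 * nsq (x k.+1 w + eps k.+1 w + xi k.+1 w)
  + nsq (eps k.+1 w) + nsq (init_defect k.+1) + init_nsq k.+1.

Lemma init_nsq_ge0 k : 0 <= init_nsq k.
Proof. by rewrite /init_nsq; case: ifP => // _; exact: nsq_ge0. Qed.

Lemma yk_ge0 k : 0 <= yk k.
Proof. by rewrite /yk !addr_ge0 ?nsq_ge0 ?init_nsq_ge0. Qed.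

Lemma nuk_ge0 k : 0 <= nuk k.
Proof. by rewrite /nuk !addr_ge0 ?mulr_ge0 ?nsq_ge0 ?init_nsq_ge0. Qed.

(** Past the initial period every block of the regressor is at most [p + q] steps old, and
    [geom_back] charges a constant for going back that far; the input blocks are reached through
    [us_conv]. *)
Lemma regressor_bound : exists C1 rho : R, [/\ 0 <= C1, 0 < rho, rho < 1,
  forall k, nsq (Z k) <= C1 * geom rho yk k &
  forall k, geom rho yk k.+1 <= rho * geom rho yk k + 2 * nsq (perr k) + nuk k].
Proof.
have [C [rho [C0 r0 r1 [HD HP HQ]]]] := geometric_nsq.
have h : 0 < 1 - rho by rewrite subr_gt0.
pose c := (1 - rho)^-1 * C; have c0 : 0 <= c by rewrite mulr_ge0 ?invr_ge0 // ltW.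
have g0 k : 0 <= geom rho yk k by apply: geom_ge0; [exact: ltW|exact: yk_ge0].
have usB k : nsq (us k) <= 8 * c * geom rho yk k.
  rewrite us_conv; apply: le_trans (nsqD _ _) _.
  have h1 := nsqB (conv (fun n => D n + Pc n) Xs k) (conv D es k).
  have h2 := geom_conv Xs k r0 r1 HQ.
  have h3 := geom_conv es k r0 r1 HD.
  have h4 := geom_conv init_defect k r0 r1 HD.
  have q1 : geom rho (fun j => nsq (Xs j)) k + geom rho (fun j => nsq (es j)) k
      + geom rho (fun j => nsq (init_defect j)) k <= geom rho yk k.
    rewrite -!big_split; apply: ler_sum => j _; rewrite /= -!mulrDr.
    by rewrite ler_wpM2l ?exprn_ge0 ?(ltW r0) // lerDl init_nsq_ge0.
  have p1 : 0 <= geom rho (fun j => nsq (Xs j)) k by apply: geom_ge0 => [|j]; rewrite ?nsq_ge0 ?ltW.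
  have p2 : 0 <= geom rho (fun j => nsq (es j)) k by apply: geom_ge0 => [|j]; rewrite ?nsq_ge0 ?ltW.
  have p3 : 0 <= geom rho (fun j => nsq (init_defect j)) k by apply: geom_ge0 => [|j]; rewrite ?nsq_ge0 ?ltW.
  rewrite -/c in h2 h3 h4.
  move: h1 h2 h3 h4 q1 p1 p2 p3.
  set X1 := nsq (conv _ Xs k); set X2 := nsq (conv D es k); set X3 := nsq (conv D init_defect k).
  set Y1 := geom _ _ k; set Y2 := geom _ _ k; set Y3 := geom _ _ k; set Y4 := geom _ _ k.
  set W := nsq _ => h1 h2 h3 h4 q1 p1 p2 p3.
  have q2 : c * (Y1 + Y2 + Y3) <= c * Y4 by rewrite ler_wpM2l.
  have u1 : 0 <= c * Y1 by rewrite mulr_ge0.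
  have u2 : 0 <= c * Y2 by rewrite mulr_ge0.
  have u3 : 0 <= c * Y3 by rewrite mulr_ge0.
  lra.
pose b := rho^-1 ^+ (p + q).
have b1 i : (i <= p + q)%N -> rho^-1 ^+ i <= b.
  by move=> ipq; apply: ler_weXn2l => //; rewrite invf_ge1 // ltW.
have b0 : 1 <= b by rewrite -(expr0 rho^-1); exact: b1.
have bp : 0 <= b by lra.
exists (1 + p%:R * b + q%:R * (8 * c * b)), rho; split=> //.
- have u1 : 0 <= p%:R * b by apply: mulr_ge0.
  have u2 : 0 <= q%:R * (8 * c * b) by apply: mulr_ge0 => //; apply: mulr_ge0 => //; apply: mulr_ge0.
  lra.
- move=> k; have gk := g0 k; rewrite !mulrDl mul1r.
  have t1 : 0 <= p%:R * b * geom rho yk k by rewrite mulr_ge0 ?mulr_ge0.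
  have t2 : 0 <= q%:R * (8 * c * b) * geom rho yk k.
    by apply: mulr_ge0 => //; apply: mulr_ge0 => //; apply: mulr_ge0 => //; apply: mulr_ge0.
  have [kpq|kpq] := leqP k (p + q).
    have : nsq (Z k) <= geom rho yk k.
      apply: le_trans (geom_ge k (ltW r0) yk_ge0).
      by rewrite /yk /init_nsq kpq lerDr !addr_ge0 ?nsq_ge0.
    lra.
  rewrite nsq_Phi; apply: le_trans (_ : p%:R * b * geom rho yk k
      + q%:R * (8 * c * b) * geom rho yk k <= _); last by lra.
  apply: lerD.
    rewrite -mulrA mulr_natl -[p in _ *+ p]card_ord -sumr_const.
    apply: ler_sum => i _; have ip := ltn_ord i.
    have ik : (i < k)%N by apply: leq_trans ip (leq_trans (leq_addr q p) (ltnW kpq)).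
    rewrite (X_Xs ik).
    apply: le_trans (_ : geom rho yk (k - i)%N <= _).
      apply: le_trans (geom_ge _ (ltW r0) yk_ge0).
      by rewrite /yk -!addrA lerDl !addr_ge0 ?nsq_ge0 ?init_nsq_ge0.
    apply: le_trans (geom_back r0 yk_ge0 (ltnW ik)) _.
    by rewrite ler_wpM2r // b1 // (leq_trans (ltnW ip)) // leq_addr.
  rewrite -mulrA mulr_natl -[q in _ *+ q]card_ord -sumr_const.
  apply: ler_sum => j _; have jq := ltn_ord j.
  have jk : (j < k)%N by apply: leq_trans jq (leq_trans (leq_addl p q) (ltnW kpq)).
  rewrite (U_us jk).
  have c8 : 0 <= 8 * c by apply: mulr_ge0.
  apply: le_trans (usB _) _; rewrite -[leRHS]mulrA ler_wpM2l //.
  apply: le_trans (geom_back r0 yk_ge0 (ltnW jk)) _.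
  by rewrite ler_wpM2r // b1 // (leq_trans (ltnW jq)) // leq_addl.
- move=> k; rewrite geomS -addrA lerD2l /yk /nuk.
  have : nsq (Xs k.+1) <= 2 * nsq (perr k) + 2 * nsq (x k.+1 w + eps k.+1 w + xi k.+1 w).
    rewrite /Xs output_decomp.
    have -> : x k.+1 w + perr k + eps k.+1 w + xi k.+1 w
        = perr k + (x k.+1 w + eps k.+1 w + xi k.+1 w).
      by apply/matrixP => i j; rewrite !mxE; ring.
    exact: nsqD.
  rewrite /es; lra.
Qed.

End Model.

(** * Persistent excitation *)

Section Excitation.
Context {R : realType} {disp : measure_display} {T : measurableType disp}.
Variables (d p q : nat) (A : 'I_p -> 'M[R]_d) (B : 'I_q -> 'M[R]_d).
Variables (X U : int -> T -> 'cV[R]_d) (eps xi x : nat -> T -> 'cV[R]_d).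
Variable thetah : nat -> T -> 'M[R]_(delta_dim d p q, d).
Hypothesis arxX : arx (theta_of A B) X U eps.
Hypothesis control : tracking_control X U thetah x xi.
Hypotheses (p1 : (1 <= p)%N) (q1 : (1 <= q)%N).
Variable w : T.

Let Z k := Phi p q X U k w.
Let theta := theta_of A B.
Let E n v := dot v (Nm Z n *m v).
Let r k := rs A B X U x thetah w k.

(** Cauchy-Schwarz for the inner product defined by [Nm], after writing [M] as [Nm] applied to
    [Jm *m M]. *)
Lemma sqr_dot_inv m (Y : nat -> 'cV[R]_m) n (z M : 'cV[R]_m) :
  dot z M ^+ 2 <= dot z (Nm Y n *m z) * dot M (Jm Y n *m M).
Proof.
set N := Nm Y n; set y := Jm Y n *m M.
have ->: dot M y = dot y (N *m y) by rewrite /y /N mulmxA Nm_Jm mul1mx dotC.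
have -> : dot z M = dot z (N *m y) by rewrite /y /N mulmxA Nm_Jm mul1mx.
have psd v : 0 <= dot v (N *m v).
  exact: le_trans (nsq_ge0 _) (dot_Nm_ge _ _ _).
have sym u v : dot u (N *m v) = dot v (N *m u).
  by rewrite dotC dot_mulmxl /N Nm_sym.
set a := dot z (N *m z); set b := dot y (N *m y); set c := dot z (N *m y).
have H t : 0 <= a - 2 * t * c + t ^+ 2 * b.
  have := psd (z - t *: y).
  rewrite mulmxBr -scalemxAr !dotBl !dotBr !dotZl !dotZr (sym y z) -/a -/b -/c.
  by congr (_ <= _); ring.
have a0 : 0 <= a by exact: psd.
have [b0|b0] := eqVneq b 0.
  have [c0|c0] := eqVneq c 0; first by rewrite c0 expr0n mulr_ge0 // psd.
  (* In the degenerate case [b = 0] the quadratic in [t] is affine, and this [t] gives it the value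
     -1 when [c] is not 0. *)
  have := H ((a + 1) / (2 * c)); rewrite b0 mulr0 addr0.
  have -> : 2 * ((a + 1) / (2 * c)) * c = a + 1 by field; rewrite c0.
  lra.
have bp : 0 < b by rewrite lt_def b0 psd.
have := H (c / b).
have -> : a - 2 * (c / b) * c + (c / b) ^+ 2 * b = (a * b - c ^+ 2) / b by field.
by rewrite pmulr_lge0 ?invr_gt0 // subr_ge0.
Qed.

(* The direction whose X-block [i] is [a i] and whose U-block [j] is [b j]. *)
Definition mkv (a b : nat -> 'cV[R]_d) : 'cV[R]_(delta_dim d p q) :=
  col_mx (\mxcol_(i < p) a i) (\mxcol_(j < q) b j).

(** Padding with zeros beyond the blocks makes a shift in time the plain composition with
    [succn]. *)
Lemma mkvP (v : 'cV[R]_(delta_dim d p q)) : exists a b,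
  [/\ v = mkv a b, forall i, (p <= i)%N -> a i = 0 &
      forall j, (q <= j)%N -> b j = 0].
Proof.
exists (fun i => if insub i is Some k then submxcol (usubmx v) k else 0).
exists (fun j => if insub j is Some k then submxcol (dsubmx v) k else 0).
split.
- rewrite -[LHS]vsubmxK /mkv; congr col_mx.
    by rewrite -[LHS]submxcolK; apply: eq_mxcol => i; rewrite valK.
  by rewrite -[LHS]submxcolK; apply: eq_mxcol => i; rewrite valK.
- by move=> i pi; rewrite insubF // ltnNge pi.
- by move=> i pi; rewrite insubF // ltnNge pi.
Qed.

Lemma nsq_mkv a b : nsq (mkv a b)
  = \sum_(i < p) nsq (a i) + \sum_(j < q) nsq (b j).
Proof. by rewrite nsq_col_mx !nsq_mxcol. Qed.

Lemma dot_mkv a b k : dot (Z k) (mkv a b)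
  = \sum_(i < p) dot (X (k%:Z - i%:Z) w) (a i)
    + \sum_(j < q) dot (U (k%:Z - j.+1%:Z) w) (b j).
Proof. by rewrite /Z dot_col_mx !dot_mxcol. Qed.

Section Shift.
Variables a b : nat -> 'cV[R]_d.
Hypotheses (a_p : forall i, (p <= i)%N -> a i = 0)
  (b_q : forall j, (q <= j)%N -> b j = 0).

Lemma sum_shiftS (n : nat) (f : nat -> 'cV[R]_d) (y : int -> 'cV[R]_d) (k : nat) :
  f n = 0 ->
  \sum_(i < n) dot (y (k.+1%:Z - i%:Z)) (f i)
  = dot (y k.+1%:Z) (f 0%N) + \sum_(i < n) dot (y (k%:Z - i%:Z)) (f i.+1).
Proof.
move=> fn.
have -> : \sum_(i < n) dot (y (k.+1%:Z - i%:Z)) (f i)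
    = \sum_(i < n.+1) dot (y (k.+1%:Z - i%:Z)) (f i).
  by rewrite big_ord_recr /= fn dotC dot0l addr0.
rewrite big_ord_recl subr0; congr (_ + _).
apply: eq_bigr => i _; rewrite lift0; congr (dot (y _) _); lia.
Qed.

Lemma dot_shift k : dot (Z k.+1) (mkv a b)
  = dot (X k.+1%:Z w) (a 0%N) + dot (U k%:Z w) (b 0%N)
    + dot (Z k) (mkv (a \o succn) (b \o succn)).
Proof.
rewrite !dot_mkv (@sum_shiftS p a (X^~ w) k (a_p (leqnn p))).
rewrite (eq_bigr (fun j : 'I_q => dot (U (k%:Z - j%:Z) w) (b j))); last first.
  by move=> j _; congr (dot (U _ w) _); lia.
have -> : \sum_(j < q) dot (U (k%:Z - j%:Z) w) (b j)
    = dot (U k%:Z w) (b 0%N) + \sum_(j < q) dot (U (k%:Z - j.+1%:Z) w) (b j.+1).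
  have := @sum_shiftS q b (fun i => U (i - 1) w) k (b_q (leqnn q)).
  rewrite (eq_bigr (fun j : 'I_q => dot (U (k%:Z - j%:Z) w) (b j))); last first.
    by move=> j _; congr (dot (U _ w) _); lia.
  move=> ->; congr (_ + _); first by congr (dot (U _ w) _); lia.
  by apply: eq_bigr => j _; congr (dot (U _ w) _); lia.
rewrite addrACA; congr (_ + _).
Qed.

Lemma nsq_shift : nsq (mkv a b)
  = nsq (a 0%N) + nsq (b 0%N) + nsq (mkv (a \o succn) (b \o succn)).
Proof.
have H n (f : nat -> 'cV[R]_d) : f n = 0 ->
    \sum_(i < n) nsq (f i) = nsq (f 0%N) + \sum_(i < n) nsq (f i.+1).
  move=> fn; have -> : \sum_(i < n) nsq (f i) = \sum_(i < n.+1) nsq (f i).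
    by rewrite big_ord_recr /= fn nsq0 addr0.
  by rewrite big_ord_recl; congr (_ + _).
by rewrite !nsq_mkv (H p a (a_p (leqnn p))) (H q b (b_q (leqnn q))) addrACA.
Qed.

Let g := a 0%N.
Let h := a 0%N + b 0%N.
Let u := mkv (a \o succn) (b \o succn) - theta *m b 0%N.

(** The model gives [U_k = X_{k+1} - theta^t Phi_k - eps_{k+1}], so [eps] cancels in the input
    block: it enters through [a 0] alone, while [xi] enters through [a 0 + b 0]. What remains is
    linear in [(r k.+1, Z k)], free of the noises of time [k.+1]. *)
Lemma dot_noise k : dot (Z k.+1) (mkv a b)
  = dot g (eps k.+1 w) + dot h (xi k.+1 w)
    + dot (col_mx (r k.+1) (Z k)) (col_mx h u).
Proof.
have XE : X k.+1%:Z w = eps k.+1 w + xi k.+1 w + r k.+1.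
  by rewrite (output_decomp arxX control) /r /=; apply/matrixP => i j; rewrite !mxE; ring.
have [r1 Er] : exists r1, r1 = r k.+1 by eexists.
rewrite -Er in XE *.
rewrite dot_shift (dot_col_mx r1 h (Z k) u) /u dotBr.
have -> : dot (Z k) (theta *m b 0%N) = dot (theta^T *m Z k) (b 0%N).
  by rewrite [RHS]dot_mulmxl trmxK.
have -> : theta^T *m Z k = X k.+1%:Z w - U k%:Z w - eps k.+1 w.
  by rewrite arxX; apply/matrixP => i j; rewrite !mxE; ring.
rewrite !dotBl XE /h /g.
move: (eps k.+1 w) (xi k.+1 w) (U k%:Z w) (a 0%N) (b 0%N)
  (dot (Z k) _) => e1 x1 u1 a1 b1 D.
rewrite !dotDl !dotDr !(dotC _ b1) !(dotC _ a1).
ring.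
Qed.

Lemma nsq_regr : nsq (col_mx h u) <= (6 + 2 * nsq theta) * nsq (mkv a b).
Proof.
rewrite nsq_col_mx /h /u nsq_shift.
have h1 := nsqD (a 0%N) (b 0%N).
have h2 := nsqB (mkv (a \o succn) (b \o succn)) (theta *m b 0%N).
have h3 := nsqM theta (b 0%N).
have h4 := nsq_ge0 (a 0%N); have h5 := nsq_ge0 (b 0%N).
have h6 := nsq_ge0 (mkv (a \o succn) (b \o succn)).
have h7 : 0 <= nsq theta * nsq (a 0%N) by rewrite mulr_ge0 ?nsq_ge0.
have h8 : 0 <= nsq theta * nsq (mkv (a \o succn) (b \o succn)).
  by rewrite mulr_ge0 ?nsq_ge0.
lra.
Qed.

(** One time step later, the original direction differs from the shifted one only by the terms in
    [a 0] and [b 0]; these involve two blocks of [Z k.+1] and are charged to the trace. *)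
Lemma excitation_step2 (n : nat) : E n (mkv (a \o succn) (b \o succn))
  <= 3 * E n.+1 (mkv a b) + 3 * (nsq (a 0%N) + nsq (b 0%N)) * \tr (Nm Z n.+1).
Proof.
set v := mkv a b; set v' := mkv _ _.
rewrite /E !dot_Nm trace_Nm.
have v0 : nsq v' <= nsq v.
  by rewrite /v nsq_shift lerDr addr_ge0 // nsq_ge0.
have vv := nsq_ge0 v.
have S k : dot (Z k) v' ^+ 2 <= 3 * dot (Z k.+1) v ^+ 2
    + 3 * (nsq (a 0%N) + nsq (b 0%N)) * nsq (Z k.+1).
  (* Both vectors are blocks of [Z k.+1] because [p] and [q] are positive. *)
  have Zk : nsq (X k.+1%:Z w) + nsq (U k%:Z w) <= nsq (Z k.+1).
    rewrite /Z nsq_Phi -(prednK p1) -(prednK q1) !big_ord_recl.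
    have -> : (k.+1%:Z - (@ord0 p.-1)%:Z) = k.+1%:Z by rewrite subr0.
    have -> : (k.+1%:Z - (@ord0 q.-1).+1%:Z) = k%:Z by rewrite /=; lia.
    rewrite addrACA lerDl addr_ge0 //; apply: sumr_ge0 => i _; exact: nsq_ge0.
  have h1 := sqr_dot_le (X k.+1%:Z w) (a 0%N).
  have h2 := sqr_dot_le (U k%:Z w) (b 0%N).
  have -> : dot (Z k) v' = dot (Z k.+1) v - dot (X k.+1%:Z w) (a 0%N) - dot (U k%:Z w) (b 0%N).
    by rewrite dot_shift -/v'; ring.
  move: h1 h2 Zk (nsq_ge0 (X k.+1%:Z w)) (nsq_ge0 (U k%:Z w)) (nsq_ge0 (a 0%N)) (nsq_ge0 (b 0%N)).
  set xx := nsq (X _ _); set uu := nsq (U _ _); set aa := nsq (a _); set bb := nsq (b _).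
  set zz := nsq (Z _); set D1 := dot (X _ _) _; set D2 := dot (U _ _) _; set D3 := dot (Z _) _.
  move=> h1 h2 h3 x0 u0 a0' b0'.
  have q1' : (aa + bb) * (xx + uu) <= (aa + bb) * zz by rewrite ler_wpM2l // addr_ge0.
  have q2 : 0 <= aa * uu by rewrite mulr_ge0.
  have q3 : 0 <= bb * xx by rewrite mulr_ge0.
  have := sqr_ge0 (D3 + D1); have := sqr_ge0 (D3 + D2); have := sqr_ge0 (D1 - D2).
  lra.
have : \sum_(k < n) dot (Z k) v' ^+ 2 <= 3 * \sum_(k < n) dot (Z k.+1) v ^+ 2
    + 3 * (nsq (a 0%N) + nsq (b 0%N)) * \sum_(k < n) nsq (Z k.+1).
  by rewrite !mulr_sumr -big_split; apply: ler_sum => k _; exact: S.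
have -> : \sum_(k < n.+1) dot (Z k) v ^+ 2
    = dot (Z 0%N) v ^+ 2 + \sum_(k < n) dot (Z k.+1) v ^+ 2.
  by rewrite big_ord_recl.
have -> : \sum_(k < n.+1) nsq (Z k) = nsq (Z 0%N) + \sum_(k < n) nsq (Z k.+1).
  by rewrite big_ord_recl.
have t0 := sqr_ge0 (dot (Z 0%N) v).
have t1 : 0 <= 3 * (nsq (a 0%N) + nsq (b 0%N)) * ((delta_dim d p q)%:R + nsq (Z 0%N)).
  by rewrite !mulr_ge0 // addr_ge0 // nsq_ge0.
rewrite mulrDr in t1; rewrite !mulrDr; lra.
Qed.

Variables (n : nat) (c Q : R).
Let Z' k := col_mx (r k.+1) (Z k).
Hypothesis Q0 : 0 <= Q.
Hypothesis noise_lb : forall g h : 'cV[R]_d, c * n%:R * (nsq g + nsq h)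
   <= \sum_(k < n) (dot g (eps k.+1 w) + dot h (xi k.+1 w)) ^+ 2.
Hypothesis Qeps : forall i, Qf Z' 0 (fun k => eps k.+1 w i 0) n <= Q.
Hypothesis Qxi : forall i, Qf Z' 0 (fun k => xi k.+1 w i 0) n <= Q.
Hypothesis Qsmall : 4 * d%:R * Q <= c * n%:R.

(** The sum pairs [y] with the martingale vectors [Mv], so [sqr_dot_inv] bounds it by [Q] and the
    quadratic form of [y]. The arithmetic-geometric inequality is balanced to give that form the
    weight 1/2, as [excitation_step1] requires. *)
Lemma cross_bound (e : nat -> 'cV[R]_d) (f : 'cV[R]_d)
    (y : 'cV[R]_(d + delta_dim d p q)) :
  (forall i, Qf Z' 0 (fun k => e k.+1 i 0) n <= Q) ->
  - (2 * \sum_(k < n) dot f (e k.+1) * dot (Z' k) y)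
  <= 2 * d%:R * Q * nsq f + 2^-1 * dot y (Nm Z' n *m y).
Proof.
move=> HQ; set N := dot y _.
have N0 : 0 <= N by exact: le_trans (nsq_ge0 _) (dot_Nm_ge _ _ _).
have -> : \sum_(k < n) dot f (e k.+1) * dot (Z' k) y
    = \sum_i f i 0 * dot y (Mv Z' 0 (fun k => e k.+1 i 0) n).
  have -> : \sum_i f i 0 * dot y (Mv Z' 0 (fun k => e k.+1 i 0) n)
     = \sum_i \sum_(k < n) f i 0 * e k.+1 i 0 * dot (Z' k) y.
    apply: eq_bigr => i _; rewrite /Mv add0r dotC dot_suml mulr_sumr.
    by apply: eq_bigr => k _; rewrite dotZl mulrA.
  by rewrite exchange_big; apply: eq_bigr => k _; rewrite mulr_suml.
have [d0|d0] := posnP d.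
  have E1 (F : 'I_d -> R) : \sum_i F i = 0.
    by apply: big1 => i; have := ltn_ord i; rewrite [X in (_ < X)%N]d0.
  rewrite E1 mulr0 oppr0 addr_ge0 ?mulr_ge0 ?nsq_ge0 //.
have dp : 0 < d%:R :> R by rewrite ltr0n.
rewrite -mulrN -sumrN mulr_sumr nsq_cV.
have -> : 2 * d%:R * Q * \sum_i f i 0 ^+ 2 + 2^-1 * N
    = \sum_i (2 * d%:R * Q * f i 0 ^+ 2 + 2^-1 * N / d%:R).
  have t : (2^-1 * N / d%:R) *+ d = 2^-1 * N by rewrite -mulr_natr divfK ?lt0r_neq0.
  by rewrite big_split /= -mulr_sumr sumr_const card_ord t.
apply: ler_sum => i _; set D := dot y _.
have HD : D ^+ 2 <= N * Q.
  apply: le_trans (sqr_dot_inv Z' n y _) _.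
  by apply: ler_wpM2l => //; exact: HQ.
(* 2 |f D| <= 2 d f^2 D^2 / N + N / (2 d) *)
have [N00|Np] := eqVneq N 0.
  have D0 : D = 0.
    by apply/eqP; rewrite -sqrf_eq0 eq_le sqr_ge0 andbT -(mul0r Q) -N00.
  rewrite D0 mulr0 oppr0 mulr0 N00 mulr0 mul0r addr0.
  by apply: mulr_ge0; [apply: mulr_ge0 => //; apply: mulr_ge0|exact: sqr_ge0].
have Npos : 0 < N by rewrite lt_def Np.
have K0 : 0 < N / d%:R by rewrite divr_gt0.
set K := N / d%:R in K0.
have NK : N = K * d%:R by rewrite /K divfK // lt0r_neq0.
have -> : 2^-1 * N / d%:R = 2^-1 * K by rewrite /K mulrA.
have HD2 : f i 0 ^+ 2 * D ^+ 2 <= f i 0 ^+ 2 * (K * d%:R * Q).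
  by rewrite ler_wpM2l ?sqr_ge0 // -NK.
rewrite -(ler_pM2r K0).
have := sqr_ge0 (K + 2 * (f i 0 * D)); nra.
Qed.

(** Expanding the square leaves two cross terms, with [eps] and with [xi], each costing half of the
    quadratic form of [y]. Together they consume the sum of [dot (Z' k) y ^+ 2] present in the
    expansion, plus [nsq y], which [nsq_regr] returns to the direction itself. [Qsmall] keeps the
    remaining terms below half of the noise. *)
Lemma excitation_step1 :
  c * n%:R * (nsq g + nsq h) <= 2 * (7 + 2 * nsq theta) * E n.+1 (mkv a b).
Proof.
set v := mkv a b; set y := col_mx h u.
have L1 := noise_lb g h.
have L2 := @cross_bound (eps^~ w) g y Qeps; have L3 := @cross_bound (xi^~ w) h y Qxi.
have Ny : dot y (Nm Z' n *m y) = nsq y + \sum_(k < n) dot (Z' k) y ^+ 2.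
  exact: dot_Nm.
rewrite Ny in L2 L3.
have Ev : nsq v + \sum_(k < n) dot (Z k.+1) v ^+ 2 <= E n.+1 v.
  rewrite /E dot_Nm lerD2l [leRHS]big_ord_recl lerDr; exact: sqr_ge0.
have ex : \sum_(k < n) dot (Z k.+1) v ^+ 2
  = \sum_(k < n) (dot g (eps k.+1 w) + dot h (xi k.+1 w)) ^+ 2
    + 2 * \sum_(k < n) dot g (eps k.+1 w) * dot (Z' k) y
    + 2 * \sum_(k < n) dot h (xi k.+1 w) * dot (Z' k) y
    + \sum_(k < n) dot (Z' k) y ^+ 2.
  rewrite !mulr_sumr -!big_split; apply: eq_bigr => k _ /=.
  rewrite dot_noise -/y -/(Z' k); ring.
have L4 := nsq_regr; rewrite -/v -/y in L4.
have g0 := nsq_ge0 g; have h0 := nsq_ge0 h; have v0 := nsq_ge0 v.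
have L5 : 2 * d%:R * Q * (nsq g + nsq h) <= 2^-1 * (c * n%:R * (nsq g + nsq h)).
  have : 2 * d%:R * Q <= 2^-1 * (c * n%:R) by have := Qsmall; lra.
  by move=> H; rewrite mulrA ler_wpM2r // addr_ge0.
have L6 : nsq v <= E n.+1 v by exact: dot_Nm_ge.
have t0 := nsq_ge0 theta.
have L7 : (6 + 2 * nsq theta) * nsq v <= (6 + 2 * nsq theta) * E n.+1 v.
  by rewrite ler_wpM2l // addr_ge0 // mulr_ge0.
rewrite mulrDr in L5; lra.
Qed.

End Shift.

Definition tailn (j : nat) (f : nat -> 'cV[R]_d) : nat -> 'cV[R]_d := fun i => f (i + j)%N.

Section Iterate.
Variables (n m : nat) (c Q S : R).
Let Z' k := col_mx (r k.+1) (Z k).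
Hypotheses (c0 : 0 < c) (Q0 : 0 <= Q).
Hypothesis Em : m = (p + q)%N.
Hypothesis nm : (2 * m.+1 <= n)%N.
Hypothesis noise_lb : forall k (g h : 'cV[R]_d), (n <= 2 * k)%N ->
  c * k%:R * (nsq g + nsq h)
   <= \sum_(l < k) (dot g (eps l.+1 w) + dot h (xi l.+1 w)) ^+ 2.
Hypothesis Qeps : forall k i, (k <= n)%N -> Qf Z' 0 (fun k => eps k.+1 w i 0) k <= Q.
Hypothesis Qxi : forall k i, (k <= n)%N -> Qf Z' 0 (fun k => xi k.+1 w i 0) k <= Q.
Hypothesis Qsmall : forall k, (n <= 2 * k)%N -> 4 * d%:R * Q <= c * k%:R.
Hypothesis trS : \tr (Nm Z n) <= S.

(** [K0] converts leading coefficients into the quadratic form, and [K1], of order trace over [n],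
    is the cost of one shift. The shifted times stay above [n / 2], so the same constants serve all
    [p + q] steps. *)
Let K0 := 2 * (7 + 2 * nsq theta) / c.
Let K1 := 3 + 9 * K0 * (2 * S / n%:R).

(* Each step bounds the first coefficients [a 0], [b 0] of a direction by its
   quadratic form, and shifts the remaining ones one step back in time. *)
Lemma excitation_iter (a b : nat -> 'cV[R]_d) :
  (forall i, (p <= i)%N -> a i = 0) -> (forall j, (q <= j)%N -> b j = 0) ->
  n%:R * nsq (mkv a b) <= (6 * K0 * m%:R) * (K1 ^+ m * E n (mkv a b)).
Proof.
move=> a_p b_q.
have np : (0 < n)%N by lia.
have n0 : 0 < n%:R :> R by rewrite ltr0n.
have K00 : 0 < K0.
  by rewrite /K0 divr_gt0 // mulr_gt0 // ltr_pwDl // mulr_ge0 // nsq_ge0.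
have S0 : 0 <= S.
  by apply: le_trans trS; apply: le_trans (trace_Nm_ge _ _).
have K11 : 1 <= K1.
  have : 0 <= 9 * K0 * (2 * S / n%:R).
    by apply: mulr_ge0; [apply: mulr_ge0 => //; exact: ltW|rewrite divr_ge0 // mulr_ge0].
  by rewrite /K1; lra.
pose v j := mkv (tailn j a) (tailn j b).
have ta j i : (p <= i)%N -> tailn j a i = 0.
  by move=> pi; apply: a_p; exact: leq_trans pi (leq_addr _ _).
have tb j i : (q <= i)%N -> tailn j b i = 0.
  by move=> pi; apply: b_q; exact: leq_trans pi (leq_addr _ _).
have vS j : mkv (tailn j a \o succn) (tailn j b \o succn) = v j.+1.
  by rewrite /v; congr mkv; apply/funext => i; rewrite /tailn /= addSnnS.
have E0 k u : 0 <= E k u.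
  exact: le_trans (nsq_ge0 _) (dot_Nm_ge _ _ _).
have step j : (j < m)%N ->
    n%:R * (nsq (a j) + nsq (b j)) <= 6 * K0 * E (n - j)%N (v j) /\
    E (n - j.+1)%N (v j.+1) <= K1 * E (n - j)%N (v j).
  move=> jm; have nj : (n - j)%N = (n - j.+1).+1 by lia.
  have nj2 : (n <= 2 * (n - j.+1))%N by lia.
  have njn : (n - j.+1 <= n)%N by lia.
  have := @excitation_step1 (tailn j a) (tailn j b) (ta j) (tb j) (n - j.+1)%N c Q
    Q0 (fun g h => noise_lb g h nj2) (fun i => Qeps i njn) (fun i => Qxi i njn)
    (Qsmall nj2).
  have := @excitation_step2 (tailn j a) (tailn j b) (ta j) (tb j) (n - j.+1)%N.
  have tE (f : nat -> 'cV[R]_d) : tailn j f 0%N = f j by rewrite /tailn add0n.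
  rewrite vS -nj -/(v j) !tE.
  set Ej := E (n - j)%N (v j); set Ej' := E _ (v j.+1).
  set t := \tr _; set aj := a j; set bj := b j => h2 h1.
  have tS : t <= S.
    by apply: le_trans trS; apply: trace_Nm_mono; rewrite leq_subr.
  have h3 : nsq aj + nsq bj <= 3 * (nsq aj + nsq (aj + bj)).
    have := nsqB (aj + bj) aj; rewrite (_ : aj + bj - aj = bj); last first.
      by rewrite addrC addKr.
    have := nsq_ge0 aj; have := nsq_ge0 (aj + bj); lra.
  have h4 : n%:R * (nsq aj + nsq (aj + bj)) <= 2 * K0 * Ej.
    have nn : n%:R <= 2 * (n - j.+1)%:R :> R by rewrite -natrM ler_nat.
    have G0 : 0 <= nsq aj + nsq (aj + bj) by rewrite addr_ge0 // nsq_ge0.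
    have H1 := ler_wpM2r G0 nn.
    have H2 : (n - j.+1)%:R * (nsq aj + nsq (aj + bj)) <= K0 * Ej.
      have -> : K0 * Ej = 2 * (7 + 2 * nsq theta) * Ej / c by rewrite /K0; ring.
      rewrite ler_pdivlMr //; apply: le_trans h1.
      by rewrite le_eqVlt; apply/orP; left; apply/eqP; ring.
    move: H1 H2; set G := nsq aj + _; set kk := (n - j.+1)%:R; set KE := K0 * Ej.
    have -> : 2 * K0 * Ej = 2 * KE by exact: esym (mulrA _ _ _).
    have -> : 2 * kk * G = 2 * (kk * G) by exact: esym (mulrA _ _ _).
    lra.
  have h5 : n%:R * (nsq aj + nsq bj) <= 6 * K0 * Ej.
    have : n%:R * (nsq aj + nsq bj) <= n%:R * (3 * (nsq aj + nsq (aj + bj))).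
      by rewrite ler_wpM2l // ltW.
    lra.
  split=> //.
  have h6 : nsq aj + nsq bj <= 6 * K0 * Ej / n%:R by rewrite ler_pdivlMr // mulrC.
  have h7 : (nsq aj + nsq bj) * t <= 6 * K0 * Ej / n%:R * S.
    apply: ler_pM => //; first by rewrite addr_ge0 // nsq_ge0.
    by rewrite (le_trans _ (trace_Nm_ge _ _)).
  have -> : K1 * Ej = 3 * Ej + 3 * (6 * K0 * Ej / n%:R * S) by rewrite /K1; ring.
  apply: le_trans h2 _; apply: lerD => //.
  have -> : 3 * (nsq aj + nsq bj) * t = 3 * ((nsq aj + nsq bj) * t).
    exact: esym (mulrA _ _ _).
  by rewrite ler_wpM2l.
have Eb j : (j <= m)%N -> E (n - j)%N (v j) <= K1 ^+ j * E n (mkv a b).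
  elim: j => [|j IH] jm.
    rewrite subn0 expr0 mul1r le_eqVlt; apply/orP; left; apply/eqP; congr (E _ (mkv _ _)).
      by apply/funext => i; rewrite /tailn addn0.
    by apply/funext => i; rewrite /tailn addn0.
  have [_ h] := step j jm; apply: le_trans h _; rewrite exprS -mulrA.
  by rewrite ler_wpM2l ?IH //; [lra|exact: ltnW].
have key : n%:R * \sum_(j < m) (nsq (a j) + nsq (b j))
   <= (6 * K0 * m%:R) * (K1 ^+ m * E n (mkv a b)).
  rewrite mulr_sumr; apply: le_trans (_ : \sum_(j < m) 6 * K0 * (K1 ^+ m * E n (mkv a b)) <= _).
    apply: ler_sum => j _; have [h _] := step j (ltn_ord j).
    apply: le_trans h _; rewrite ler_wpM2l //; first by apply: mulr_ge0 => //; exact: ltW.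
    apply: le_trans (Eb j (ltnW (ltn_ord j))) _; rewrite ler_wpM2r //.
    apply: ler_weXn2l => //; exact: ltnW.
  by rewrite sumr_const card_ord -mulr_natr le_eqVlt; apply/orP; left; apply/eqP; ring.
apply: le_trans key; rewrite ler_wpM2l ?(ltW n0) // nsq_mkv big_split /= Em.
by apply: lerD; apply: (ler_sum_ord_widen (f := fun i => nsq (_ i))) => [i|];
  rewrite ?nsq_ge0 ?leq_addr ?leq_addl.
Qed.

End Iterate.

End Excitation.

(** * Empirical means of filtered noises *)

Section Averages.
Context {R : realType}.

Lemma cvg_mx m n (f : nat -> 'M[R]_(m, n)) (M : 'M[R]_(m, n)) :
  (forall i j, f k i j @[k --> \oo] --> M i j) -> f k @[k --> \oo] --> M.
Proof.
move=> fM A [Q /= QM QA].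
have : \forall k \near \oo, forall i j, Q i j (f k i j).
  apply: filter_forall => i; apply: filter_forall => j; exact: (fM i j _ (QM i j)).
by apply: filterS => k Qk; apply: QA.
Qed.

Lemma cvg_mx_entry m n (f : nat -> 'M[R]_(m, n)) (M : 'M[R]_(m, n)) i j :
  f k @[k --> \oo] --> M -> f k i j @[k --> \oo] --> M i j.
Proof.
move=> fM; apply: (@cvg_comp _ _ _ f (fun M : 'M[R]_(m, n) => M i j) _ _ _ fM).
exact: coord_continuous.
Qed.

Lemma cvg_epsN (u : nat -> R) (l : R) : (u n @[n --> \oo] --> l) <->
  (forall e, 0 < e -> exists N, forall n, (N <= n)%N -> `|u n - l| <= e).
Proof.
split=> [/cvgrPdist_le H e e0|H].
  have [N _ NH] := H e e0; exists N => n Nn; rewrite distrC; exact: NH.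
apply/cvgrPdist_le => e e0; have [N NH] := H e e0.
by exists N => // n /= Nn; rewrite distrC; exact: NH.
Qed.

Lemma cvg_eqfun (u v : nat -> R) (l : R) : u =1 v ->
  u n @[n --> \oo] --> l -> v n @[n --> \oo] --> l.
Proof. by move=> /funext ->. Qed.

Definition mean (u : nat -> R) n : R := n%:R^-1 * \sum_(k < n) u k.
Definition sh m (v : nat -> 'cV[R]_m) a k : 'cV[R]_m :=
  if (a <= k)%N then v (k - a)%N else 0.

Lemma cvg_avg_shift (u : nat -> R) b (l : R) :
  mean u n @[n --> \oo] --> l ->
  mean (fun k => if (b <= k)%N then u (k - b)%N else 0) n @[n --> \oo] --> l.
Proof.
rewrite /mean => H; rewrite -(cvg_shiftn b) /=.
have E n : \sum_(k < n + b) (if (b <= k)%N then u (k - b)%N else 0) = \sum_(k < n) u k.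
  rewrite addnC big_split_ord /= big1 ?add0r; last first.
    by move=> i _; rewrite leqNgt ltn_ord.
  by apply: eq_bigr => i _; rewrite leq_addr addKn.
(* The delayed sum has the same terms, so only the normalization changes, by the factor
   [n / (n + b)]. *)
have -> : (fun n => (n + b)%:R^-1 * \sum_(k < n + b) (if (b <= k)%N then u (k - b)%N else 0))
   = (fun n => (1 - b%:R * (n + b)%:R^-1) * (n%:R^-1 * \sum_(k < n) u k)).
  apply/funext => n; rewrite E; case: n => [|n]; first by rewrite !big_ord0 !mulr0.
  have n0 : (n.+1 + b)%:R != 0 :> R by rewrite pnatr_eq0.
  have n1 : n.+1%:R != 0 :> R by rewrite pnatr_eq0.
  rewrite mulrA; congr (_ * _).
  apply: (mulfI n0); rewrite mulfV // !mulrA mulrBr mulr1 mulrCA mulfV // mulr1.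
  by rewrite natrD addrK mulfV.
rewrite -[l]mul1r; apply: cvgM => //.
rewrite -[X in _ --> X]subr0; apply: cvgB; first exact: cvg_cst.
rewrite -[X in _ --> X](mulr0 b%:R); apply: cvgM; first exact: cvg_cst.
rewrite (cvg_shiftn b (fun n => n%:R^-1 : R)).
rewrite -(cvg_shiftS (fun n => n%:R^-1 : R)).
exact: cvg_harmonic.
Qed.

Lemma av_shift m (W : nat -> 'cV[R]_m) s t i j (l : R) : (i <= j)%N ->
  mean (fun k => W (k + (j - i))%N s 0 * W k t 0) n @[n --> \oo] --> l ->
  mean (fun k => sh W i k s 0 * sh W j k t 0) n @[n --> \oo] --> l.
Proof.
move=> ij /(cvg_avg_shift j); set u := mean _; set u' := mean _.
suff -> : u' = u by [].
apply/funext => n; congr (_ * _).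
apply: eq_bigr => k _; rewrite /sh; case: (leqP j k) => jk; last first.
  by rewrite [X in _ * X]mxE mulr0.
rewrite (leq_trans ij jk); congr (W _ s 0 * _); lia.
Qed.

Lemma sum_geom_seq (rho : R) y n : 0 <= rho -> rho < 1 -> (forall j, 0 <= y j) ->
  \sum_(k < n) geom rho y k <= (1 - rho)^-1 * \sum_(k < n) y k.
Proof.
move=> r0 r1 y0; have h : 0 < 1 - rho by rewrite subr_gt0.
rewrite mulrC ler_pdivlMr // mulrC.
case: n => [|n]; first by rewrite !big_ord0 mulr0.
have H : (1 - rho) * (\sum_(k < n.+1) geom rho y k) + rho * geom rho y n = \sum_(k < n.+1) y k.
  elim: n => [|n IH]; first by rewrite !big_ord1 /geom big_ord1 expr0; ring.
  by rewrite big_ord_recr [RHS]big_ord_recr /= -IH geomS; ring.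
by rewrite -H lerDl mulr_ge0 // geom_ge0.
Qed.

Lemma meanD u v n : mean (fun k => u k + v k) n = mean u n + mean v n.
Proof. by rewrite /mean big_split mulrDr. Qed.

Lemma meanZ a u n : mean (fun k => a * u k) n = a * mean u n.
Proof. by rewrite /mean -mulr_sumr mulrCA. Qed.

Lemma mean_sum (I : Type) (s : seq I) (u : I -> nat -> R) n :
  mean (fun k => \sum_(i <- s) u i k) n = \sum_(i <- s) mean (u i) n.
Proof. by rewrite /mean exchange_big mulr_sumr. Qed.

Lemma mean_le u v n : (forall k, u k <= v k) -> mean u n <= mean v n.
Proof. by move=> uv; rewrite /mean ler_wpM2l ?invr_ge0 //; apply: ler_sum. Qed.

Lemma mean_ge0 u n : (forall k, 0 <= u k) -> 0 <= mean u n.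
Proof. by move=> u0; rewrite /mean mulr_ge0 ?invr_ge0 // sumr_ge0. Qed.

Lemma mean_norm u n : `|mean u n| <= mean (fun k => `|u k|) n.
Proof.
by rewrite /mean normrM ger0_norm ?invr_ge0 // ler_wpM2l ?invr_ge0 // ler_norm_sum.
Qed.

Lemma eq_mean u v n : (forall k, u k = v k) -> mean u n = mean v n.
Proof. by move=> uv; congr (_ * _); apply: eq_bigr. Qed.

Lemma ler_2ab (a b t : R) : 0 < t -> 2 * `|a * b| <= t * a ^+ 2 + t^-1 * b ^+ 2.
Proof.
move=> t0; rewrite normrM -(real_normK (num_real a)) -(real_normK (num_real b)).
move: `|a| `|b| => {}a {}b.
rewrite -subr_ge0.
have -> : t * a ^+ 2 + t^-1 * b ^+ 2 - 2 * (a * b) = t^-1 * (t * a - b) ^+ 2.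
  by field; rewrite gt_eqF.
by rewrite mulr_ge0 ?sqr_ge0 ?invr_ge0 ?(ltW t0).
Qed.

(* Approximation in the mean square of both factors is enough for the
   convergence of the average of a product. *)
Lemma cvg_mean_mul (f g : nat -> R) (lff lgg l : R) :
  (forall eta : R, 0 < eta -> exists f' g' : nat -> R, exists lff' lgg' l' : R,
    [/\ [/\ mean (fun k => f' k ^+ 2) n @[n --> \oo] --> lff',
             mean (fun k => g' k ^+ 2) n @[n --> \oo] --> lgg' &
             mean (fun k => f' k * g' k) n @[n --> \oo] --> l'],
     [/\ `|lff' - lff| <= 1, `|lgg' - lgg| <= 1 & `|l' - l| <= eta] &
     exists N, forall n, (N <= n)%N ->
       mean (fun k => (f k - f' k) ^+ 2) n <= eta ^+ 2 /\
       mean (fun k => (g k - g' k) ^+ 2) n <= eta ^+ 2]) ->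
  mean (fun k => f k * g k) n @[n --> \oo] --> l.
Proof.
move=> H; apply/cvg_epsN => e e0.
(* [K] dominates the sum of all errors in units of [eta]: the mean square terms, the truncated
   average and its limit. *)
pose K := 7 + `|lff| + `|lgg|.
have K0 : 1 <= K by have := normr_ge0 lff; have := normr_ge0 lgg; rewrite /K; lra.
pose eta := Num.min 1 (e / K).
have eta0 : 0 < eta by rewrite lt_min ltr01 divr_gt0 //; lra.
have eta1 : eta <= 1 by rewrite ge_min lexx.
have etae : eta * K <= e by rewrite -ler_pdivlMr ?ge_min ?lexx ?orbT //; lra.
have [f' [g' [lff' [lgg' [l' [[F G FG] [hf hg hl] [N0 HN0]]]]]]] := H _ eta0.
have [N1 HN1] := (cvg_epsN _ _).1 F 1 ltr01.
have [N2 HN2] := (cvg_epsN _ _).1 G 1 ltr01.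
have [N3 HN3] := (cvg_epsN _ _).1 FG eta eta0.
exists (N0 + N1 + N2 + N3)%N => n Nn.
have [n0 n1 n2 n3] : [/\ (N0 <= n)%N, (N1 <= n)%N, (N2 <= n)%N & (N3 <= n)%N].
  by move: Nn; clear => Nn; split; lia.
have [hdf hdg] := HN0 n n0.
have {HN1} k1 := HN1 n n1.
have {HN2} k2 := HN2 n n2.
have {HN3} k3 := HN3 n n3.
have key : `|mean (fun k => f k * g k) n - mean (fun k => f' k * g' k) n|
  <= 2^-1 * (eta * mean (fun k => f' k ^+ 2) n + eta * mean (fun k => g' k ^+ 2) n
     + (eta^-1 + 1) * mean (fun k => (f k - f' k) ^+ 2) n
     + (eta^-1 + 1) * mean (fun k => (g k - g' k) ^+ 2) n).
  rewrite -mulN1r -meanZ -meanD.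
  apply: le_trans (mean_norm _ _) _; rewrite -!meanZ -!meanD -meanZ.
  apply: mean_le => k.
  have h1 := ler_2ab (f' k) (g k - g' k) eta0.
  have h2 := ler_2ab (g' k) (f k - f' k) eta0.
  have h3 := ler_2ab (f k - f' k) (g k - g' k) ltr01.
  have -> : f k * g k + -1 * (f' k * g' k) = f' k * (g k - g' k) + g' k * (f k - f' k)
     + (f k - f' k) * (g k - g' k) by ring.
  have t1 := ler_normD (f' k * (g k - g' k) + g' k * (f k - f' k)) ((f k - f' k) * (g k - g' k)).
  have t2 := ler_normD (f' k * (g k - g' k)) (g' k * (f k - f' k)).
  move: h1 h2 h3 t1 t2; rewrite invr1 !mul1r ![(eta^-1 + 1) * _]mulrDl !mul1r.
  set A1 := `|f' k * _|; set A2 := `|g' k * _|; set A3 := `|(f k - f' k) * _|.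
  set A4 := `|_ + _ + _|; set A5 := `|_ + _|.
  set B1 := eta * _; set B2 := eta^-1 * _; set B3 := eta * _; set B4 := eta^-1 * _.
  set B5 := _ ^+ 2; set B6 := _ ^+ 2.
  move: A1 A2 A3 A4 A5 B1 B2 B3 B4 B5 B6 => A1 A2 A3 A4 A5 B1 B2 B3 B4 B5 B6.
  clear; lra.
move: hf hg hl hdf hdg k1 k2 k3 key.
set a1 := mean _ n; set a2 := mean _ n; set a3 := mean _ n; set a4 := mean _ n.
set a5 := mean _ n; set a6 := mean _ n.
move=> hf hg hl hdf hdg k1 k2 k3 key.
have i1 : (eta^-1 + 1) * a1 <= eta + eta ^+ 2.
  have -> : eta + eta ^+ 2 = (eta^-1 + 1) * eta ^+ 2 by field; rewrite gt_eqF.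
  by rewrite ler_wpM2l // addr_ge0 // invr_ge0 ltW.
have i2 : (eta^-1 + 1) * a2 <= eta + eta ^+ 2.
  have -> : eta + eta ^+ 2 = (eta^-1 + 1) * eta ^+ 2 by field; rewrite gt_eqF.
  by rewrite ler_wpM2l // addr_ge0 // invr_ge0 ltW.
have i3 : eta * a3 <= eta * (`|lff| + 2).
  apply: ler_wpM2l; first exact: ltW.
  move: hf k1 (ler_norm lff); rewrite !ler_norml => /andP[_ ?] /andP[_ ?]; lra.
have i4 : eta * a4 <= eta * (`|lgg| + 2).
  apply: ler_wpM2l; first exact: ltW.
  move: hg k2 (ler_norm lgg); rewrite !ler_norml => /andP[_ ?] /andP[_ ?]; lra.
have i5 : eta ^+ 2 <= eta by rewrite expr2 ler_piMl // ltW.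
have t1 := ler_distD a5 a6 l; have t2 := ler_distD l' a5 l.
have et : eta * (7 + `|lff| + `|lgg|) <= e by exact: etae.
have p1 : 0 <= eta * `|lff| by rewrite mulr_ge0 // ltW.
have p2 : 0 <= eta * `|lgg| by rewrite mulr_ge0 // ltW.
move: hl k3 key i1 i2 i3 i4 i5 t1 t2 et p1 p2; rewrite !mulrDr.
move: `|a6 - a5| `|a5 - l'| `|l' - l| `|a6 - l| `|a5 - l| => z1 z2 z3 z4 z5.
move: ((eta^-1 + 1) * a1) ((eta^-1 + 1) * a2) (eta * a3) (eta * a4) (eta ^+ 2)
  (eta * `|lff|) (eta * `|lgg|) => b1 b2 b3 b4 b5 b6 b7.
clear -eta0; lra.
Qed.

Section Filtered.
Variables (m c : nat) (W : nat -> 'cV[R]_c) (Rc : nat -> 'M[R]_(m, c)).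
Variable Sig : 'M[R]_c.
Hypothesis lag : forall j s t, mean (fun k => W (k + j)%N s 0 * W k t 0) n @[n --> \oo]
  --> (if j == 0%N then Sig s t else 0).

Let trunc L k : 'cV[R]_m := \sum_(a < L) Rc a *m sh W a k.

Lemma mean_shifts a b s t : mean (fun k => sh W a k s 0 * sh W b k t 0) n @[n --> \oo]
  --> (if a == b then Sig s t else 0).
Proof.
have [ab|ba] := leqP a b.
  apply: av_shift => //; have := @lag (b - a)%N s t.
  by rewrite subn_eq0 eqn_leq ab.
have -> : (if a == b then Sig s t else 0) = (if (a - b)%N == 0%N then Sig t s else 0).
  by rewrite subn_eq0 eqn_leq (leqNgt a b) ba.
have -> : mean (fun k => sh W a k s 0 * sh W b k t 0)
    = mean (fun k => sh W b k t 0 * sh W a k s 0).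
  by apply/funext => n; apply: eq_mean => k; rewrite mulrC.
by apply: av_shift (ltnW ba) _; exact: lag.
Qed.

(** Distinct delays are empirically uncorrelated, so only the diagonal terms survive in the
    limit. *)
Lemma mean_trunc L i j : mean (fun k => trunc L k i 0 * trunc L k j 0) n @[n --> \oo]
  --> (\sum_(a < L) Rc a *m Sig *m (Rc a)^T) i j.
Proof.
have -> : mean (fun k => trunc L k i 0 * trunc L k j 0)
  = (fun n => \sum_(a < L) \sum_(b < L) \sum_s \sum_t Rc a i s * Rc b j t
       * mean (fun k => sh W a k s 0 * sh W b k t 0) n).
  apply/funext => n.
  rewrite (eq_mean (v := fun k => \sum_(a < L) \sum_(b < L) \sum_s \sum_t
     (Rc a i s * Rc b j t) * (sh W a k s 0 * sh W b k t 0))); last first.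
    move=> k; rewrite /trunc !summxE mulr_suml; apply: eq_bigr => a _.
    rewrite mulr_sumr; apply: eq_bigr => b _; rewrite !mxE mulr_suml.
    apply: eq_bigr => s _; rewrite mulr_sumr; apply: eq_bigr => t _; ring.
  rewrite mean_sum; apply: eq_bigr => a _; rewrite mean_sum; apply: eq_bigr => b _.
  rewrite mean_sum; apply: eq_bigr => s _; rewrite mean_sum; apply: eq_bigr => t _.
  by rewrite meanZ.
have -> : (\sum_(a < L) Rc a *m Sig *m (Rc a)^T) i j
   = \sum_(a < L) \sum_(b < L) \sum_s \sum_t Rc a i s * Rc b j t
       * (if a == b then Sig s t else 0).
  rewrite summxE; apply: eq_bigr => a _.
  rewrite (bigD1 a) //= [X in _ = _ + X]big1 ?addr0; last first.
    move=> b ba; apply: big1 => s _; apply: big1 => t _.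
    by rewrite eq_sym (negbTE ba) mulr0.
  rewrite mxE exchange_big; apply: eq_bigr => t _; rewrite mxE mulr_suml.
  by apply: eq_bigr => s _; rewrite eqxx mxE; ring.
apply: cvg_bigsum => a; apply: cvg_bigsum => b; apply: cvg_bigsum => s.
apply: cvg_bigsum => t; apply: cvgM; first exact: cvg_cst.
exact: mean_shifts.
Qed.

(** The remainder is again a convolution, delayed by [L], with the tail kernel; the geometric bound
    of that kernel carries the small factor [rho^L]. *)
Lemma conv_trunc L k : conv Rc W k - trunc L k
  = sh (fun k => conv (fun b => Rc (L + b)%N) W k) L k.
Proof.
rewrite /sh; case: leqP => Lk; last first.
  rewrite /trunc /conv (big_ord_widen_cond L predT (fun a => Rc a *m W (k - a)%N)) //.
  apply/eqP; rewrite subr_eq0; apply/eqP; rewrite big_mkcond; apply: eq_bigr => a _.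
  by rewrite ltnS /sh /=; case: (leqP a k) => //; rewrite mulmx0.
rewrite /conv -(subnKC Lk) addKn -addnS big_split_ord /= addrAC.
rewrite (eq_bigr (fun a : 'I_L => Rc a *m sh W a (L + (k - L)))) ?subrr ?add0r.
  by apply: eq_bigr => b _; rewrite subnDl.
move=> a _; rewrite /sh ifT //; exact: leq_trans (ltnW (ltn_ord a)) (leq_addr _ _).
Qed.

Lemma mean_tail C rho L n : 0 < rho -> rho < 1 ->
  (forall a, nsq (Rc a) <= C * (rho ^+ a) ^+ 2) ->
  mean (fun k => nsq (conv Rc W k - trunc L k)) n
    <= ((1 - rho)^-1 ^+ 2 * C * mean (fun k => nsq (W k)) n) * (rho ^+ L) ^+ 2.
Proof.
move=> r0 r1 RC.
have h : 0 < 1 - rho by rewrite subr_gt0.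
have C0 : 0 <= C by have := RC 0%N; rewrite expr0 expr1n mulr1; apply/le_trans/nsq_ge0.
have RL b : nsq (Rc (L + b)%N) <= C * (rho ^+ L) ^+ 2 * (rho ^+ b) ^+ 2.
  by apply: le_trans (RC _) _; rewrite exprD exprMn mulrA.
set g := geom rho (fun j => nsq (W j)).
have g0 j : 0 <= g j by apply: geom_ge0 => [|i]; [exact: ltW|exact: nsq_ge0].
set K := (1 - rho)^-1 * (C * (rho ^+ L) ^+ 2).
have K0 : 0 <= K by apply: mulr_ge0; [rewrite invr_ge0 ltW|apply: mulr_ge0 => //; exact: sqr_ge0].
apply: le_trans (_ : K * mean g n <= _).
  rewrite /mean mulrCA ler_wpM2l ?invr_ge0 // mulr_sumr.
  apply: le_trans (_ : \sum_(k < n | (L <= k)%N) K * g (k - L)%N <= _).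
    rewrite [leRHS]big_mkcond; apply: ler_sum => k _; rewrite conv_trunc /sh.
    case: ifP => _; last by rewrite nsq0.
    exact: (geom_conv W (k - L) r0 r1 RL).
  rewrite (sum_shift (fun k => K * g k)).
  rewrite (big_ord_widen n (fun k => K * g k)) ?leq_subr // [leLHS]big_mkcond.
  apply: ler_sum => k _; case: ifP => // _; by rewrite mulr_ge0.
rewrite /mean mulrCA [leRHS]mulrAC [leRHS]mulrCA ler_wpM2l ?invr_ge0 //.
have -> : (1 - rho)^-1 ^+ 2 * C * (rho ^+ L) ^+ 2 = K * (1 - rho)^-1.
  by rewrite /K; ring.
rewrite -[leRHS]mulrA ler_wpM2l //; apply: sum_geom_seq => //; first exact: ltW.
by move=> j; exact: nsq_ge0.
Qed.

Lemma mean_nsqW : exists K N, forall n, (N <= n)%N -> mean (fun k => nsq (W k)) n <= K.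
Proof.
have H : mean (fun k => nsq (W k)) n @[n --> \oo] --> \sum_s Sig s s.
  have -> : mean (fun k => nsq (W k)) = (fun n => \sum_s mean (fun k => W k s 0 * W k s 0) n).
    apply/funext => n; rewrite -mean_sum; apply: eq_mean => k; rewrite nsq_cV.
    by apply: eq_bigr => s _; rewrite expr2.
  apply: cvg_bigsum => s; have := @lag 0%N s s; rewrite eqxx.
  by apply: cvg_eqfun => n; apply: eq_mean => k; rewrite addn0.
have [N HN] := (cvg_epsN _ _).1 H 1 ltr01.
exists (\sum_s Sig s s + 1), N => n /HN; rewrite ler_norml => /andP[_]; lra.
Qed.

(** [L] is fixed first, by the tail bound, which is uniform in large [n]; then [n] grows for the
    finite truncation. *)
Lemma cvg_mean_outer (Z : nat -> 'cV[R]_m) (M : 'M[R]_m) C rho :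
  0 < rho -> rho < 1 -> (forall a, nsq (Rc a) <= C * (rho ^+ a) ^+ 2) ->
  mean (fun k => nsq (Z k - conv Rc W k)) n @[n --> \oo] --> (0 : R) ->
  (forall i j, (\sum_(a < L) Rc a *m Sig *m (Rc a)^T) i j @[L --> \oo] --> M i j) ->
  n%:R^-1 *: \sum_(k < n) Z k *m (Z k)^T @[n --> \oo] --> M.
Proof.
move=> r0 r1 RC ZW HM; apply: cvg_mx => i j.
have -> : (fun n => (n%:R^-1 *: \sum_(k < n) Z k *m (Z k)^T) i j)
    = mean (fun k => Z k i 0 * Z k j 0).
  apply/funext => n; rewrite mxE summxE; congr (_ * _).
  by apply: eq_bigr => k _; rewrite !mxE big_ord1 mxE.
apply: (@cvg_mean_mul (fun k => Z k i 0) (fun k => Z k j 0) (M i i) (M j j) (M i j)).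
move=> eta eta0.
have [K [N HK]] := mean_nsqW.
have h : 0 < 1 - rho by rewrite subr_gt0.
have C0 : 0 <= C by have := RC 0%N; rewrite expr0 expr1n mulr1; apply/le_trans/nsq_ge0.
pose K1 := 4 * ((1 - rho)^-1 ^+ 2 * C * (`|K| + 1)) + 1.
have K0 : 0 <= (1 - rho)^-1 ^+ 2 * C * (`|K| + 1).
  by apply: mulr_ge0; [apply: mulr_ge0 => //; exact: sqr_ge0|rewrite addr_ge0].
have K10 : 0 < K1 by rewrite /K1; lra.
have e2 : 0 < eta ^+ 2 by rewrite exprn_gt0.
have rhoc : (rho ^+ L @[L --> \oo] --> (0 : R)).
  by apply: cvg_expr; rewrite ger0_norm // ltW.
have [L0 HL0] := (cvg_epsN _ _).1 rhoc (Num.min 1 (eta ^+ 2 / K1)) ltac:(by rewrite lt_min ltr01 divr_gt0).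
have [L1 HL1] := (cvg_epsN _ _).1 (HM i i) 1 ltr01.
have [L2 HL2] := (cvg_epsN _ _).1 (HM j j) 1 ltr01.
have [L3 HL3] := (cvg_epsN _ _).1 (HM i j) eta eta0.
have [N1 HN1] := (cvg_epsN _ _).1 ZW (eta ^+ 2 / 4) ltac:(by rewrite divr_gt0).
pose L := (L0 + L1 + L2 + L3)%N.
have [l0 l1 l2 l3] : [/\ (L0 <= L)%N, (L1 <= L)%N, (L2 <= L)%N & (L3 <= L)%N].
  by rewrite /L; clear; split; lia.
exists (fun k => trunc L k i 0), (fun k => trunc L k j 0).
do 3!eexists; split; [split| |].
- have := @mean_trunc L i i; apply: cvg_eqfun => n.
  by apply: eq_mean => k; rewrite expr2.
- have := @mean_trunc L j j; apply: cvg_eqfun => n.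
  by apply: eq_mean => k; rewrite expr2.
- exact: mean_trunc.
- by split; [exact: HL1|exact: HL2|exact: HL3].
exists (N + N1)%N => n Nn.
have n0 : (N <= n)%N by apply: leq_trans Nn; exact: leq_addr.
have n1 : (N1 <= n)%N by apply: leq_trans Nn; exact: leq_addl.
have D : mean (fun k => nsq (Z k - trunc L k)) n <= eta ^+ 2.
  apply: le_trans (_ : 2 * mean (fun k => nsq (Z k - conv Rc W k)) n
     + 2 * mean (fun k => nsq (conv Rc W k - trunc L k)) n <= _).
    rewrite -!meanZ -meanD; apply: mean_le => k.
    have -> : Z k - trunc L k = (Z k - conv Rc W k) + (conv Rc W k - trunc L k).
      by rewrite addrA subrK.
    exact: nsqD.
  have t1 := HN1 n n1; rewrite subr0 in t1.
  have t1' := le_trans (ler_norm _) t1.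
  have t2 := @mean_tail C rho L n r0 r1 RC.
  have t3 : (rho ^+ L) ^+ 2 <= eta ^+ 2 / K1.
    have := HL0 L l0; rewrite subr0 ger0_norm ?exprn_ge0 ?(ltW r0) // le_min => /andP[u1 u2].
    by apply: le_trans u2; rewrite expr2 ler_piMl ?exprn_ge0 ?(ltW r0).
  have t4 : ((1 - rho)^-1 ^+ 2 * C * mean (fun k => nsq (W k)) n) * (rho ^+ L) ^+ 2
     <= ((1 - rho)^-1 ^+ 2 * C * (`|K| + 1)) * (eta ^+ 2 / K1).
    apply: ler_pM => //.
    - apply: mulr_ge0; first by apply: mulr_ge0 => //; exact: sqr_ge0.
      by apply: mean_ge0 => k; exact: nsq_ge0.
    - exact: sqr_ge0.
    - apply: ler_wpM2l; first by apply: mulr_ge0 => //; exact: sqr_ge0.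
      by have := HK n n0; have := ler_norm K; lra.
  have t5 : ((1 - rho)^-1 ^+ 2 * C * (`|K| + 1)) * (eta ^+ 2 / K1) <= eta ^+ 2 / 4.
    rewrite mulrCA ler_wpM2l //; first exact: ltW.
    by rewrite ler_pdivrMr // /K1; lra.
  move: t1' t2 t4 t5.
  set z1 := mean _ n; set z2 := mean _ n; set z3 := _ * (rho ^+ L) ^+ 2; set z4 := _ * (_ / K1).
  by clear; lra.
split; apply: le_trans D; apply: mean_le => k.
  by apply: le_trans (nsq_entry _ i 0); rewrite !mxE.
by apply: le_trans (nsq_entry _ j 0); rewrite !mxE.
Qed.

End Filtered.

End Averages.

(** * The limiting matrix *)

Section LimitMatrix.
Context {R : realType}.

Lemma cvg_geom_series (u : nat -> R) K rho : 0 < rho -> rho < 1 ->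
  (forall n, `|u n| <= K * rho ^+ n) -> exists l : R, \sum_(b < L) u b @[L --> \oo] --> l.
Proof.
move=> r0 r1 uK.
have K0 : 0 <= K by have := uK 0%N; rewrite expr0 mulr1; apply: le_trans.
have H : cvgn (series u).
  apply: normed_cvg; apply: (@series_le_cvg _ _ (geometric K rho)) => [n|n|n|].
  - exact: normr_ge0.
  - by rewrite /= mulr_ge0 ?exprn_ge0 // ltW.
  - exact: uK.
  - by apply: is_cvg_geometric_series; rewrite ger0_norm // ltW.
exists (limn (series u)); move: H; apply: cvg_eqfun => n.
by rewrite /series /= big_mkord.
Qed.

Section Coefficients.
Variables (d : nat) (Gam Del : 'M[R]_d) (D Pc : nat -> 'M[R]_d) (C rho : R).
Hypotheses (r0 : 0 < rho) (r1 : rho < 1).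
Let Q n := D n + Pc n.
Hypothesis HP : forall n, nsq (Pc n) <= C * (rho ^+ n) ^+ 2.
Hypothesis HQ : forall n, nsq (Q n) <= C * (rho ^+ n) ^+ 2.

Lemma mx_series_cvg (M : nat -> 'M[R]_d) (G : 'M[R]_d) m :
  (forall n, nsq (M n) <= C * (rho ^+ n) ^+ 2) ->
  exists l : 'M[R]_d, forall s t,
    (\sum_(b < L) M (b + m)%N *m G *m (M b)^T) s t @[L --> \oo] --> l s t.
Proof.
move=> HM.
have C0 : 0 <= C by have := HM 0%N; rewrite expr0 expr1n mulr1; apply/le_trans/nsq_ge0.
have rle n : rho ^+ n <= 1 by rewrite exprn_ile1 // ltW.
have rge n : 0 <= rho ^+ n by rewrite exprn_ge0 // ltW.
pose K := C * nsq G * C.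
have K0 : 0 <= K by rewrite /K !mulr_ge0 ?nsq_ge0.
have entry b s t : `|(M (b + m)%N *m G *m (M b)^T) s t| <= Num.sqrt K * rho ^+ b.
  rewrite -(@ler_pXn2r _ 2%N) ?nnegrE //; last by rewrite mulr_ge0 ?sqrtr_ge0.
  rewrite exprMn sqr_sqrtr // real_normK ?num_real //.
  apply: le_trans (nsq_entry _ _ _) _; apply: le_trans (nsqM _ _) _.
  rewrite nsq_tr /K -[leRHS]mulrA; apply: ler_pM => //; try exact: nsq_ge0.
  apply: le_trans (nsqM _ _) _; apply: ler_wpM2r; first exact: nsq_ge0.
  apply: le_trans (HM _) _; rewrite -[leRHS]mulr1; apply: ler_wpM2l => //.
  by rewrite exprn_ile1 // ltW.
have H s t : exists l : R, (\sum_(b < L) M (b + m)%N *m G *m (M b)^T) s t @[L --> \oo] --> l.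
  have [l Hl] := cvg_geom_series r0 r1 (fun b => entry b s t).
  by exists l; move: Hl; apply: cvg_eqfun => L; rewrite summxE.
pose l s t := projT1 (cid (H s t)).
by exists (\matrix_(s, t) l s t) => s t; rewrite mxE; exact: projT2 (cid (H s t)).
Qed.

Lemma mx_series_limn (M : nat -> 'M[R]_d) (G : 'M[R]_d) m :
  (forall n, nsq (M n) <= C * (rho ^+ n) ^+ 2) ->
  forall s t, (\sum_(b < L) M (b + m)%N *m G *m (M b)^T) s t @[L --> \oo]
   --> limn (fun n => \sum_(m <= k < n) M k *m G *m (M (k - m)%N)^T) s t.
Proof.
move=> HM; have [l Hl] := mx_series_cvg G m HM.
suff -> : limn (fun n => \sum_(m <= k < n) M k *m G *m (M (k - m)%N)^T) = l by [].
apply: cvg_lim; first exact: norm_hausdorff.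
rewrite -(cvg_shiftn m) /=.
have -> : (fun n => \sum_(m <= k < n + m) M k *m G *m (M (k - m)%N)^T)
   = (fun n => \sum_(b < n) M (b + m)%N *m G *m (M b)^T).
  apply/funext => n; rewrite -{1}[m]add0n big_addn addnK big_mkord.
  by apply: eq_bigr => b _; rewrite addnK.
exact: cvg_mx.
Qed.

Hypothesis P0 : Pc 0%N = 0.

(** The [Pc] series in [Hcoef] starts one index later than the other, but the missing term contains
    [P_0 = 0]. Both thus become correlations of their kernels at lag [m], the index being [m.+1]. *)
Lemma Hcoef_cvg m s t :
  (\sum_(b < L) (Pc (b + m)%N *m Gam *m (Pc b)^T + Q (b + m)%N *m Del *m (Q b)^T)) s t
    @[L --> \oo] --> Hcoef Gam Del D Pc m.+1 s t.
Proof.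
have E1 : (fun n => \sum_(m.+1 <= k < n) Pc k *m Gam *m (Pc (k.+1 - m.+1)%N)^T)
    = (fun n => \sum_(m <= k < n) Pc k *m Gam *m (Pc (k - m)%N)^T).
  apply/funext => n; have [mn|mn] := ltnP m n.
    rewrite [RHS]big_ltn // subnn P0 trmx0 mulmx0 add0r.
    by apply: eq_bigr => k _; rewrite subSS.
  by rewrite !big_geq // ltnW.
have E2 : (fun n => \sum_(m <= k < n) Qc D Pc k *m Del *m (Qc D Pc (k.+1 - m.+1)%N)^T)
    = (fun n => \sum_(m <= k < n) Q k *m Del *m (Q (k - m)%N)^T).
  by apply/funext => n; apply: eq_bigr => k _; rewrite subSS.
rewrite /Hcoef E1 E2 {E1 E2}.
rewrite mxE.
apply: (cvg_eqfun _ (cvgD (@mx_series_limn Pc Gam m HP s t) (@mx_series_limn Q Del m HQ s t))).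
by move=> n; rewrite big_split mxE.
Qed.

Variables p q : nat.
(** Kernels of the regressor as a filter of the stacked noise [(eps, xi)]: X-block [i] is the sum of
    the two noises delayed by [i], and U-block [j] is the filtered input delayed by [j]. *)
Let RX (i : 'I_p) (a : nat) : 'M[R]_(d, d + d) := if a == i then row_mx 1%:M 1%:M else 0.
Let RU (j : 'I_q) (a : nat) : 'M[R]_(d, d + d) :=
  if (j <= a)%N then row_mx (Pc (a - j)%N) (Q (a - j)%N) else 0.
Definition Rcoef (a : nat) : 'M[R]_(delta_dim d p q, d + d) :=
  col_mx (\mxcol_(i < p) RX i a) (\mxcol_(j < q) RU j a).
Definition Sig : 'M[R]_(d + d) := block_mx Gam 0 0 Del.

Lemma Sig_row (M1 M2 N1 N2 : 'M[R]_d) :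
  row_mx M1 M2 *m Sig *m (row_mx N1 N2)^T = M1 *m Gam *m N1^T + M2 *m Del *m N2^T.
Proof.
by rewrite mul_row_block !mulmx0 addr0 add0r tr_row_mx mul_row_col.
Qed.

Let GXX L i i' := \sum_(a < L) RX i a *m Sig *m (RX i' a)^T.
Let GXU L i j := \sum_(a < L) RX i a *m Sig *m (RU j a)^T.
Let GUX L j i := \sum_(a < L) RU j a *m Sig *m (RX i a)^T.
Let GUU L j j' := \sum_(a < L) RU j a *m Sig *m (RU j' a)^T.

Lemma Rcoef_outer L : \sum_(a < L) Rcoef a *m Sig *m (Rcoef a)^T =
  block_mx (\mxblock_(i < p, i' < p) GXX L i i') (\mxblock_(i < p, j < q) GXU L i j)
   (\mxblock_(j < q, i < p) GUX L j i) (\mxblock_(j < q, j' < q) GUU L j j').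
Proof.
rewrite /GXX /GXU /GUX /GUU !mxblock_sum.
elim: L => [|L IH]; first by rewrite !big_ord0 block_mx0.
rewrite 5!big_ord_recr /= IH -add_block_mx; congr (_ + _).
rewrite /Rcoef mul_col_mx tr_col_mx mul_col_row !tr_mxcol.
by rewrite 2!(mxcol_mul _ Sig) !mul_mxcol_mxrow.
Qed.

Lemma cvg_const_from (u : nat -> R) l N : (forall n, (N <= n)%N -> u n = l) ->
  u n @[n --> \oo] --> l.
Proof.
move=> H; apply/cvg_epsN => e e0; exists N => n /H ->.
by rewrite subrr normr0 ltW.
Qed.

Lemma GXX_E L i i' : (p <= L)%N -> GXX L i i' = if i == i' then Gam + Del else 0.
Proof.
move=> pL; have iL : (i < L)%N by exact: leq_trans (ltn_ord i) pL.
rewrite /GXX (bigD1 (Ordinal iL)) //= [X in _ + X]big1 ?addr0; last first.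
  move=> a; rewrite -val_eqE /= => ai; rewrite /RX (negbTE ai) !mul0mx //.
rewrite /RX eqxx val_eqE; case: eqP => _; last by rewrite trmx0 mulmx0.
by rewrite Sig_row trmx1 !mul1mx !mulmx1.
Qed.

Lemma GUX_E L j i : (p <= L)%N ->
  GUX L j i = if (j <= i)%N then Kcoef Gam Del D Pc (i - j)%N else 0.
Proof.
move=> pL; have iL : (i < L)%N by exact: leq_trans (ltn_ord i) pL.
rewrite /GUX (bigD1 (Ordinal iL)) //= [X in _ + X]big1 ?addr0; last first.
  by move=> a; rewrite -val_eqE /= => ai; rewrite /RX (negbTE ai) trmx0 mulmx0.
rewrite /RX eqxx /RU; case: ifP => _; last by rewrite !mul0mx.
by rewrite Sig_row trmx1 !mulmx1.
Qed.

Hypotheses (Gam_sym : Gam^T = Gam) (Del_sym : Del^T = Del).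

Lemma Sig_sym : Sig^T = Sig.
Proof. by rewrite /Sig tr_block_mx Gam_sym Del_sym !trmx0. Qed.

Lemma GXU_tr L i j : GXU L i j = (GUX L j i)^T.
Proof.
rewrite /GXU /GUX raddf_sum; apply: eq_bigr => a _ /=.
by rewrite !trmx_mul trmxK Sig_sym mulmxA.
Qed.

Lemma GUU_tr L i j : GUU L i j = (GUU L j i)^T.
Proof.
rewrite /GUU raddf_sum; apply: eq_bigr => a _ /=.
by rewrite !trmx_mul trmxK Sig_sym mulmxA.
Qed.

Lemma GUU_cvg (j j' : 'I_q) s t : (j <= j')%N ->
  GUU L j j' s t @[L --> \oo] --> Hcoef Gam Del D Pc (j' - j).+1 s t.
Proof.
move=> jj'; rewrite -(cvg_shiftn j') /=.
have := @Hcoef_cvg (j' - j)%N s t; apply: cvg_eqfun => L.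
rewrite /GUU addnC big_split_ord /= [X in X + _]big1 ?add0r; last first.
  by move=> a _; rewrite /RU [in X in _ *m X]leqNgt ltn_ord trmx0 mulmx0.
congr (fun_of_matrix _ s t); apply: eq_bigr => b _.
rewrite /RU leq_addr (leq_trans jj' (leq_addr _ _)) Sig_row addKn.
by rewrite (_ : (j' + b - j = b + (j' - j))%N) //; lia.
Qed.

(** An X-block has a single nonzero coefficient, so the blocks that involve one are constant for
    [L >= p]; only the U-U block is a genuine series. *)
Lemma Lambda_cvg s t :
  (\sum_(a < L) Rcoef a *m Sig *m (Rcoef a)^T) s t @[L --> \oo]
    --> Lambda Gam Del D Pc s t.
Proof.
have -> : (fun L => (\sum_(a < L) Rcoef a *m Sig *m (Rcoef a)^T) s t)
  = (fun L => block_mx (\mxblock_(i < p, i' < p) GXX L i i') (\mxblock_(i < p, j < q) GXU L i j)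
   (\mxblock_(j < q, i < p) GUX L j i) (\mxblock_(j < q, j' < q) GUU L j j') s t).
  by apply/funext => L; rewrite Rcoef_outer.
rewrite /Lambda.
case: (split_ordP s) => {}s ->; case: (split_ordP t) => {}t ->.
- rewrite block_mxEul; apply: (@cvg_const_from _ _ p) => L pL.
  rewrite block_mxEul /Lmx !mxE GXX_E //.
  case: eqP => _; last by rewrite !mxE.
  by rewrite conform_mx_id.
- rewrite block_mxEur; apply: (@cvg_const_from _ _ p) => L pL.
  rewrite block_mxEur /Kmx !mxE GXU_tr GUX_E // mxE; by case: ifP.
- rewrite block_mxEdl; apply: (@cvg_const_from _ _ p) => L pL.
  by rewrite block_mxEdl /Kmx !mxE GUX_E.
- rewrite block_mxEdr.
  have -> : (fun L => block_mx (\mxblock_(i < p, i' < p) GXX L i i') (\mxblock_(i < p, j < q) GXU L i j)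
   (\mxblock_(j < q, i < p) GUX L j i) (\mxblock_(j < q, j' < q) GUU L j j')
     (rshift _ s) (rshift _ t)) = (fun L => GUU L (tagnat.sig1 s) (tagnat.sig1 t) (tagnat.sig2 s) (tagnat.sig2 t)).
    by apply/funext => L; rewrite block_mxEdr mxE.
  rewrite /Hmx mxE; case: leqP => st; first exact: GUU_cvg.
  rewrite mxE; have := @GUU_cvg _ _ (tagnat.sig2 t) (tagnat.sig2 s) (ltnW st).
  by apply: cvg_eqfun => L; rewrite GUU_tr mxE.
Qed.

End Coefficients.
End LimitMatrix.

(** * Quantitative positive definiteness *)

Section PositiveDefinite.
Context {R : realType}.

Lemma posdef_gt0 m (M : 'M[R]_m) v : posdef M -> v != 0 -> 0 < dot v (M *m v).
Proof. by move=> [_ Mp] /Mp; rewrite -mulmxA dotE mxE eqxx mulr1n. Qed.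

Lemma posdef_ge0 m (M : 'M[R]_m) v : posdef M -> 0 <= dot v (M *m v).
Proof.
move=> Mp; have [->|v0] := eqVneq v 0; first by rewrite mulmx0 dot0l.
exact/ltW/posdef_gt0.
Qed.

Lemma posdef_sqr_le m (M : 'M[R]_m) (u v : 'cV[R]_m) : posdef M ->
  dot u (M *m v) ^+ 2 <= dot u (M *m u) * dot v (M *m v).
Proof.
move=> Mp; have Ms := Mp.1; have psd z := posdef_ge0 z Mp.
have sym : dot v (M *m u) = dot u (M *m v).
  by rewrite dotC dot_mulmxl Ms.
have [v0|v0] := eqVneq v 0; first by rewrite v0 mulmx0 dotC !dot0l expr0n /= mulr0.
set a := dot v (M *m v); have a0 : 0 < a by exact: posdef_gt0.
set b := dot u (M *m v).
have := psd (a *: u - b *: v).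
rewrite mulmxBr -!scalemxAr !dotBl !dotBr !dotZl !dotZr sym -/a -/b.
move: (dot u (M *m u)) => c H.
have : 0 <= a * (c * a - b ^+ 2) by apply: le_trans H _; rewrite le_eqVlt; apply/orP; left; apply/eqP; ring.
by rewrite pmulr_rge0 // subr_ge0.
Qed.

Lemma posdef_unitmx m (M : 'M[R]_m) : posdef M -> M \in unitmx.
Proof.
move=> [Ms Mp]; rewrite -row_free_unit -kermx_eq0; apply/negP => /negP K0.
have [u uK u0] := rowV0Pn K0.
have uM : u *m M = 0 by apply/sub_kermxP.
have u0' : u^T != 0 by rewrite trmx_eq0.
by have := Mp _ u0'; rewrite trmxK uM mul0mx mxE ltxx.
Qed.

(* Cauchy-Schwarz for the inner product of M, applied to the vectors
   [M^-1 e_i], gives the constant [1 / tr (M^-1)]. *)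
Lemma posdef_lower m (M : 'M[R]_m) : posdef M ->
  exists2 c : R, 0 < c & forall v, c * nsq v <= dot v (M *m v).
Proof.
move=> Mp; have Mu := posdef_unitmx Mp; have Ms := Mp.1.
have psd z := posdef_ge0 z Mp.
pose e i := invmx M *m delta_mx i 0 : 'cV[R]_m.
pose t := \sum_i dot (e i) (M *m e i).
have t0 : 0 <= t by apply: sumr_ge0.
have key v : nsq v <= t * dot v (M *m v).
  rewrite nsq_cV mulr_suml; apply: ler_sum => i _.
  have -> : v i 0 = dot (e i) (M *m v).
    rewrite -{1}Ms -dot_mulmxl /e mulmxA mulmxV // mul1mx /dot (bigD1 i) //= big1.
      by rewrite addr0 mxE !eqxx mul1r.
    by move=> j ji; rewrite mxE (negbTE ji) mul0r.
  exact: posdef_sqr_le.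
exists (1 + t)^-1; first by rewrite invr_gt0 ltr_pwDl.
move=> v; rewrite mulrC ler_pdivrMr ?ltr_pwDl // mulrC.
apply: le_trans (key v) _; rewrite mulrDl mul1r lerDr; exact: psd.
Qed.

Lemma dot_le_entries m (M : 'M[R]_m) (e : R) v : 0 <= e ->
  (forall i j, `|M i j| <= e) -> `|dot v (M *m v)| <= e * m%:R * nsq v.
Proof.
move=> e0 Me.
have Ms : dot v (M *m v) = \sum_i \sum_j v i 0 * (M i j * v j 0).
  rewrite /dot; apply: eq_bigr => i _; rewrite mxE mulr_sumr; exact: eq_bigr.
rewrite Ms; apply: le_trans (ler_norm_sum _ _ _) _.
apply: le_trans (_ : \sum_i \sum_j (e / 2 * v i 0 ^+ 2 + e / 2 * v j 0 ^+ 2) <= _).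
  apply: ler_sum => i _; apply: le_trans (ler_norm_sum _ _ _) _.
  apply: ler_sum => j _; rewrite mulrCA normrM.
  have h := ler_2ab (v i 0) (v j 0) ltr01; rewrite invr1 !mul1r in h.
  apply: le_trans (ler_wpM2r (normr_ge0 _) (Me i j)) _.
  have h' := ler_wpM2l e0 h; lra.
have -> : \sum_i \sum_j (e / 2 * v i 0 ^+ 2 + e / 2 * v j 0 ^+ 2)
   = \sum_(i < m) (m%:R * (e / 2 * v i 0 ^+ 2) + e / 2 * nsq v).
  apply: eq_bigr => i _; rewrite big_split sumr_const card_ord mulr_natl.
  by rewrite nsq_cV mulr_sumr.
rewrite big_split /= -!mulr_sumr -nsq_cV sumr_const card_ord -mulr_natl.
by move: (nsq v) => V; rewrite le_eqVlt; apply/orP; left; apply/eqP; field.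
Qed.

End PositiveDefinite.

(** * Logarithms against roots of n *)

Section LogGrowth.
Context {R : realType}.

(** The fourth root of [n + 1] is written through [expR]. Two quantities of that order, such as a
    logarithm and the excitation loss, multiply to a square root, which is o(n). *)
Lemma expR_half n : expR (ln n.+1%:R / 4) ^+ 2 = Num.sqrt n.+1%:R :> R.
Proof.
have p : 0 < n.+1%:R :> R by [].
apply/eqP; rewrite -(@eqrXn2 _ 2%N) ?sqrtr_ge0 ?exprn_ge0 ?expR_ge0 //.
rewrite sqr_sqrtr ?ltW // -!expRM_natl.
by rewrite -[X in _ == X](lnK p); apply/eqP; congr expR; field.
Qed.

Lemma ln_le_expR4 n : 1 + ln n.+1%:R <= 4 * expR (ln n.+1%:R / 4) :> R.
Proof. have := @expR_ge1Dx R (ln n.+1%:R / 4); lra. Qed.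

Lemma ln_nat_ge0 n : 0 <= ln n.+1%:R :> R.
Proof. by rewrite ln_ge0 // ler1n. Qed.

Lemma ln_nat_le n : ln n.+1%:R <= n%:R :> R.
Proof. by rewrite -natr1 addrC; apply: le_ln1Dx; rewrite (lt_le_trans (ltrN10 _)). Qed.

Lemma sqrt_small (e : R) : 0 < e -> exists N, forall n, (N <= n)%N ->
  Num.sqrt n.+1%:R <= e * n%:R.
Proof.
move=> e0; have [N HN] : exists N : nat, 2 / e ^+ 2 <= N%:R.
  exists (Num.bound (2 / e ^+ 2)); apply: ltW; apply: archi_boundP.
  by rewrite divr_ge0 ?sqr_ge0.
exists N.+1 => n Nn; have n0 : 0 < n%:R :> R by rewrite ltr0n (leq_trans _ Nn).
rewrite -(@ler_pXn2r _ 2%N) ?nnegrE ?sqrtr_ge0 //; last by rewrite mulr_ge0 ?ltW.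
rewrite sqr_sqrtr // exprMn.
have h : 2 / e ^+ 2 <= n%:R by apply: le_trans HN _; rewrite ler_nat ltnW.
rewrite ler_pdivrMr ?exprn_gt0 // in h.
have n1 : 1 <= n%:R :> R by rewrite ler1n -(ltr0n R).
rewrite -natr1; apply: le_trans (_ : 2 * n%:R <= _); first by lra.
by rewrite [n%:R ^+ 2]expr2 mulrA ler_wpM2r // [leRHS]mulrC.
Qed.

End LogGrowth.

(** * Conclusions along a path *)

Section Sums.
Context {R : realType}.

Lemma fin_common_bound (I : finType) (f : I -> nat -> R) (b : nat -> R) :
  (forall n, 0 <= b n) -> (forall i, exists C, forall n, f i n <= C * b n) ->
  exists2 C, 0 <= C & forall n i, f i n <= C * b n.
Proof.
move=> b0 H; pose C i := projT1 (cid (H i)).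
have HC i n : f i n <= C i * b n by exact: (projT2 (cid (H i)) n).
exists (\sum_i `|C i|) => [|n i]; first by apply: sumr_ge0 => i _.
apply: le_trans (HC i n) _; rewrite ler_wpM2r //.
apply: le_trans (ler_norm _) _; rewrite (bigD1 i) //= lerDl.
by apply: sumr_ge0 => j _.
Qed.

Lemma sum_finite_le (f : nat -> R) N n : (forall k, 0 <= f k) ->
  (forall k, (N <= k)%N -> f k = 0) -> \sum_(k < n) f k <= \sum_(k < N) f k.
Proof.
move=> f0 fN; have [nN|Nn] := leqP n N; first exact: ler_sum_ord_widen.
have -> : \sum_(k < n) f k = \sum_(k < N) f k; last by [].
rewrite -(subnKC (ltnW Nn)) big_split_ord /= [X in _ + X]big1 ?addr0 // => k _.
by rewrite fN // leq_addr.
Qed.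

Lemma sum_small_le (f : nat -> R) N n e : (forall k, 0 <= f k) -> 0 <= e ->
  (forall n, (N <= n)%N -> \sum_(k < n) f k <= e * n%:R) ->
  \sum_(k < n) f k <= \sum_(k < N) f k + e * n%:R.
Proof.
move=> f0 e0 H; have [nN|Nn] := leqP n N.
  apply: le_trans (ler_sum_ord_widen f0 nN) _.
  by rewrite lerDl mulr_ge0.
by apply: le_trans (H _ (ltnW Nn)) _; rewrite lerDr sumr_ge0.
Qed.

End Sums.

Section Path.
Context {R : realType} {disp : measure_display} {T : measurableType disp}.
Variables (d p q : nat) (A : 'I_p -> 'M[R]_d) (B : 'I_q -> 'M[R]_d).
Variables (X U : int -> T -> 'cV[R]_d) (eps xi x : nat -> T -> 'cV[R]_d).
Variable thetah : nat -> T -> 'M[R]_(delta_dim d p q, d).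
Hypothesis arxX : arx (theta_of A B) X U eps.
Hypothesis ls : is_estimator ls_gain X U thetah.
Hypothesis control : tracking_control X U thetah x xi.
Hypotheses (p1 : (1 <= p)%N) (q1 : (1 <= q)%N).
Variables (D Pc : nat -> 'M[R]_d) (Gam Del : 'M[R]_d).
Hypothesis exps : expansions A B D Pc.
Hypotheses (Gam_pos : posdef Gam) (Del_pos : posdef Del).
Variable w : T.

Let Z k := Phi p q X U k w.
Let r k := rs A B X U x thetah w k.
Let pr k := perr A B X U thetah w k.
Let Z' k := col_mx (r k.+1) (Z k).
Let tn n := terr A B thetah w n.
Let V k : 'cV[R]_(d + d) := col_mx (eps k.+1 w) (xi k.+1 w).
Let s n := \tr (Nm Z n).
Let ac k := nsq (pr k) / (1 + gain Z k).

(** These properties of the fixed path [w], together with [cross_eps] and [cross_xi] below, are the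
    whole probabilistic input; the rest of the section is deterministic. *)
Hypothesis small_x : forall e, 0 < e -> exists N, forall n, (N <= n)%N ->
  \sum_(k < n) nsq (x k.+1 w) <= e * n%:R.
Hypothesis lagV : forall j a b, mean (fun k => V (k + j)%N a 0 * V k b 0) n @[n --> \oo]
  --> (if j == 0%N then Sig Gam Del a b else 0).
Hypothesis LSb : forall j, exists C, forall n,
  Qf Z (col j (tn 0)) (fun k => eps k.+1 w j 0) n
  + \sum_(k < n) tau Z (col j (tn 0)) (fun k => eps k.+1 w j 0) k ^+ 2 / (1 + gain Z k)
  <= C * (1 + ln (1 + s n)).
Hypothesis Qeps : forall i, exists C, forall n,
  Qf Z' 0 (fun k => eps k.+1 w i 0) n <= C * (1 + ln (1 + \tr (Nm Z' n))) ^+ 2.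
Hypothesis Qxi : forall i, exists C, forall n,
  Qf Z' 0 (fun k => xi k.+1 w i 0) n <= C * (1 + ln (1 + \tr (Nm Z' n))) ^+ 2.

Lemma trace_ge0 n : 0 <= s n.
Proof. exact: le_trans (trace_Nm_ge _ _). Qed.

Lemma lnt_ge1 n : 1 <= 1 + ln (1 + s n).
Proof. by rewrite lerDl ln_ge0 // lerDl trace_ge0. Qed.

Lemma LS_bounds : exists2 C, 0 <= C & forall n,
  \sum_(k < n) ac k <= C * (1 + ln (1 + s n)) /\
  forall j, dot (col j (tn n)) (Nm Z n *m col j (tn n)) <= C * (1 + ln (1 + s n)).
Proof.
have [C C0 HC] := fin_common_bound (fun n => le_trans ler01 (lnt_ge1 n)) LSb.
exists (d%:R * C + C) => [|n]; first by rewrite addr_ge0 // mulr_ge0.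
have l1 := lnt_ge1 n; have l0 : 0 <= 1 + ln (1 + s n) by lra.
have Q0 j : 0 <= Qf Z (col j (tn 0)) (fun k => eps k.+1 w j 0) n by exact: Qf_ge0.
have S0 j : 0 <= \sum_(k < n) tau Z (col j (tn 0)) (fun k => eps k.+1 w j 0) k ^+ 2 / (1 + gain Z k).
  by apply: sumr_ge0 => k _; rewrite divr_ge0 ?sqr_ge0 // addr_ge0 // gain_ge0.
split.
  have -> : \sum_(k < n) ac k = \sum_j \sum_(k < n)
      tau Z (col j (tn 0)) (fun k => eps k.+1 w j 0) k ^+ 2 / (1 + gain Z k).
    rewrite exchange_big; apply: eq_bigr => k _; rewrite /ac nsq_cV mulr_suml.
    by apply: eq_bigr => j _; rewrite tau_perr // sqrrN.
  apply: le_trans (_ : \sum_(j < d) C * (1 + ln (1 + s n)) <= _).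
    by apply: ler_sum => j _; have := HC n j; have := Q0 j; lra.
  by rewrite sumr_const card_ord mulrDl -mulrA mulr_natl lerDl mulr_ge0.
move=> j; have := HC n j; have := S0 j; rewrite Qf_terr // -/(tn n).
have : 0 <= d%:R * C * (1 + ln (1 + s n)) by rewrite !mulr_ge0.
by rewrite [(_ + C) * _]mulrDl; lra.
Qed.

Lemma noise_sum : exists2 K, 0 <= K & forall n, \sum_(k < n) nsq (V k) <= K * n%:R.
Proof.
have H : mean (fun k => nsq (V k)) n @[n --> \oo] --> \sum_a Sig Gam Del a a.
  have -> : mean (fun k => nsq (V k)) = (fun n => \sum_a mean (fun k => V k a 0 * V k a 0) n).
    apply/funext => n; rewrite -mean_sum; apply: eq_mean => k; rewrite nsq_cV.
    by apply: eq_bigr => a _; rewrite expr2.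
  apply: cvg_bigsum => a; have := @lagV 0%N a a; rewrite eqxx.
  by apply: cvg_eqfun => n; apply: eq_mean => k; rewrite addn0.
have [K HK] := cvg_real_bounded H.
exists `|K| => // n; case: n => [|n]; first by rewrite big_ord0 mulr0.
have := le_trans (ler_norm _) (le_trans (HK n.+1) (ler_norm K)).
by rewrite /mean mulrC ler_pdivrMr.
Qed.

Lemma nsq_noise k : nsq (eps k.+1 w) <= nsq (V k) /\ nsq (xi k.+1 w) <= nsq (V k).
Proof. by rewrite nsq_col_mx lerDl lerDr !nsq_ge0. Qed.

Lemma x_sum : exists2 K, 0 <= K & forall n, \sum_(k < n) nsq (x k.+1 w) <= K * n.+1%:R.
Proof.
have [N HN] := small_x ltr01.
exists (\sum_(k < N) nsq (x k.+1 w) + 1) => [|n].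
  by rewrite addr_ge0 // sumr_ge0 // => k _; exact: nsq_ge0.
have := sum_small_le n (fun k => nsq_ge0 (x k.+1 w)) ler01 HN.
set a := \sum_(k < N) _ => H; apply: le_trans H _.
have a0 : 0 <= a by apply: sumr_ge0 => k _; exact: nsq_ge0.
rewrite -natr1 mulrDl mul1r; have := mulr_ge0 a0 (ler0n R n); lra.
Qed.

Lemma nuk_sum : exists2 K, 0 <= K &
  forall n, \sum_(k < n) nuk A B X U eps xi x w k <= K * n.+1%:R.
Proof.
have [K K0 HK] := noise_sum; have [K' K'0 HK'] := x_sum.
pose f k := nsq (init_defect A B X U eps w k.+1) + init_nsq p q X U w k.+1.
have f0 k : 0 <= f k by rewrite addr_ge0 ?nsq_ge0 ?init_nsq_ge0.
have fN k : (p + q <= k)%N -> f k = 0.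
  by move=> pqk; rewrite /f init_defect_eq0 // nsq0 add0r /init_nsq ltnNge pqk.
pose c := \sum_(k < p + q) f k.
have c0 : 0 <= c by apply: sumr_ge0.
exists (8 * K' + 13 * K + c) => [|n]; first by rewrite !addr_ge0 ?mulr_ge0.
apply: le_trans (_ : \sum_(k < n) (8 * nsq (x k.+1 w) + 13 * nsq (V k) + f k) <= _).
  apply: ler_sum => k _; rewrite /nuk /f.
  have [h1 h2] := nsq_noise k.
  have h3 := nsqD (x k.+1 w + eps k.+1 w) (xi k.+1 w).
  have h4 := nsqD (x k.+1 w) (eps k.+1 w).
  lra.
rewrite !big_split /= -!mulr_sumr.
have h1 := HK n; have h2 := HK' n; have h3 : \sum_(k < n) f k <= c by exact: sum_finite_le.
have n1 : n%:R <= n.+1%:R :> R by rewrite ler_nat.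
have n2 : 1 <= n.+1%:R :> R by rewrite ler1n.
have h4 := ler_wpM2l K0 n1; have h5 := ler_wpM2l c0 n2.
rewrite /f big_split /= in h3; rewrite !mulrDl; lra.
Qed.

(** No excitation enters: the summable sequence of [polynomial_growth] is the trace decrease [decr],
    whose sum is at most the dimension. *)
Lemma poly_growth kappa : 0 < kappa ->
  exists K, forall n, ln (1 + s n) <= K + (1 + kappa) * ln n.+1%:R.
Proof.
move=> k0.
have [C1 [rho [C10 r0 r1 FL LS]]] := regressor_bound arxX control w exps.
have [K2 K20 nuC] := nuk_sum; have [C2 C20 HC2] := LS_bounds.
have y0 := yk_ge0 A B X U eps w.
have g0 k : 0 <= geom rho (yk A B X U eps w) k by apply: geom_ge0 => //; exact: ltW.
have gn k := gain_ge0 Z k.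
have sE n : s n = (delta_dim d p q)%:R + \sum_(k < n) nsq (Z k) by exact: trace_Nm.
have HLS k := le_trans (FL k) (ler_wpM2r (g0 k) (ltac:(by rewrite lerDl) : C1 <= C1 + K2)).
have Hnu n := le_trans (nuC n) (ler_wpM2r (ler0n _ _) (ltac:(by rewrite lerDr) : K2 <= C1 + K2)).
have Hac n : \sum_(k < n) ac k
    <= C2 * (1 + ln (1 + ((delta_dim d p q)%:R + \sum_(k < n) nsq (Z k)))).
  by rewrite -sE; exact: (HC2 n).1.
have H := @polynomial_growth R (geom rho (yk A B X U eps w)) (nuk A B X U eps xi x w)
  (fun k => nsq (pr k)) ac (decr Z) (fun k => nsq (Z k)) rho (C1 + K2) C2
  (delta_dim d p q)%:R (delta_dim d p q)%:R g0
  (nuk_ge0 A B X U eps xi x w)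
  (fun k => divr_ge0 (nsq_ge0 _) (addr_ge0 ler01 (gn k)))
  (decr_ge0 Z) (fun k => nsq_ge0 _) r1 (addr_ge0 C10 K20) C20 (ler0n _ _) LS
  HLS Hnu Hac kappa k0 (sum_decr_le Z).
have [|K HK] := H.
  move=> k; have := gain_le_decr Z k; have := gn k; rewrite /ac => h1 h2.
  have p0 : 0 < 1 + gain Z k by rewrite ltr_pwDl.
  have -> : 2 * (nsq (pr k) / (1 + gain Z k)) + nsq (pr k) / (1 + gain Z k) * decr Z k * nsq (Z k)
     = nsq (pr k) * ((2 + decr Z k * nsq (Z k)) / (1 + gain Z k)).
    by field; rewrite lt0r_neq0.
  by rewrite ler_peMr ?nsq_ge0 // ler_pdivlMr // mul1r; lra.
by exists K => n; rewrite sE.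
Qed.

Lemma nsq_r k : nsq (r k.+1) <= 2 * nsq (Z k.+1) + 4 * nsq (V k).
Proof.
have E : r k.+1 = Xs X w k.+1 - (es eps w k.+1 + xs xi w k.+1).
  by rewrite (Xs_decomp arxX control) addrC addKr.
rewrite E; apply: le_trans (nsqB _ _) _.
have h := nsqD (es eps w k.+1) (xs xi w k.+1).
have h1 : nsq (Xs X w k.+1) <= nsq (Z k.+1).
  have E2 : Xs X w k.+1 = X (k.+1%:Z - 0%:Z) w by rewrite (X_Xs X w (ltn0Sn k)).
  rewrite E2 nsq_Phi (bigD1 (Ordinal p1)) //=.
  by rewrite -addrA lerDl addr_ge0 ?sumr_ge0 // => *; exact: nsq_ge0.
have := nsq_col_mx (eps k.+1 w) (xi k.+1 w); rewrite -/(V k) => hV.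
rewrite /es /xs in h *; lra.
Qed.

(** The added component [r] is an output minus noises, so the enlarged trace exceeds that of [Z] by
    a multiple of it plus O(n). Only the logarithm matters, and the polynomial bound with
    [kappa = 1] is enough. *)
Lemma trace_Z' : exists2 K, 0 <= K & forall n,
  1 + ln (1 + \tr (Nm Z' n)) <= K * (1 + ln n.+1%:R).
Proof.
have [K K0 HK] := noise_sum; have [L HL] := poly_growth ltr01.
pose c := 5 + d%:R + 4 * K.
have c0 : 1 <= c by have := ler0n R d; rewrite /c; lra.
have tr n : 1 + \tr (Nm Z' n) <= c * n.+1%:R * (1 + s n.+1).
  rewrite trace_Nm natrD.
  have -> : \sum_(k < n) nsq (Z' k) = \sum_(k < n) nsq (r k.+1) + \sum_(k < n) nsq (Z k).
    by rewrite -big_split; apply: eq_bigr => k _; rewrite nsq_col_mx.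
  have h1 : \sum_(k < n) nsq (r k.+1) <= 2 * s n.+1 + 4 * (K * n%:R).
    apply: le_trans (_ : 2 * \sum_(k < n) nsq (Z k.+1) + 4 * \sum_(k < n) nsq (V k) <= _).
      rewrite !mulr_sumr -big_split; apply: ler_sum => k _; exact: nsq_r.
    apply: lerD; rewrite ler_wpM2l // /s trace_Nm big_ord_recl /= addrA.
    by rewrite lerDr addr_ge0 ?nsq_ge0.
  have h2 : (delta_dim d p q)%:R + \sum_(k < n) nsq (Z k) <= s n.+1.
    have := trace_Nm Z n => <-; exact: trace_Nm_mono.
  have s1 := trace_ge0 n.+1.
  have n1 : 1 <= n.+1%:R :> R by rewrite ler1n.
  have n2 : n%:R <= n.+1%:R :> R by rewrite ler_nat.
  have h3 : K * n%:R <= K * n.+1%:R by rewrite ler_wpM2l.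
  apply: le_trans (_ : (1 + d%:R + 4 * (K * n.+1%:R)) + 3 * s n.+1 <= _); first by lra.
  apply: le_trans (_ : c * n.+1%:R + 3 * s n.+1 <= _).
    have := ler_wpM2l (ler0n R d) n1; rewrite /c !mulrDl; lra.
  rewrite mulrDr mulr1 lerD2l ler_wpM2r //.
  have := ler_wpM2l (le_trans ler01 c0) n1; have := ler0n R d; rewrite mulr1 /c; lra.
exists (1 + (ln c + `|L| + 2 * ln 2) + 3) => [|n].
  have := ln_ge0 c0; have := normr_ge0 L; have : 0 <= ln 2 :> R by rewrite ln_ge0 // ler1n.
  by lra.
have l0 := @ln_nat_ge0 R n.
have c1 : 0 < c by lra.
have sp : 0 < 1 + s n.+1 by have := trace_ge0 n.+1; lra.
have h : ln (1 + \tr (Nm Z' n)) <= ln c + ln n.+1%:R + (L + 2 * ln n.+2%:R).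
  apply: le_trans (_ : ln (c * n.+1%:R * (1 + s n.+1)) <= _).
    rewrite ler_ln ?posrE ?mulr_gt0 //.
    by rewrite ltr_pwDl // (le_trans _ (trace_Nm_ge _ _)).
  rewrite !lnM ?posrE ?mulr_gt0 // lerD2l.
  by have := HL n.+1; rewrite (_ : 1 + 1 = 2 :> R).
have h2 : ln n.+2%:R <= ln 2 + ln n.+1%:R :> R.
  rewrite -lnM ?posrE // ler_ln ?posrE ?mulr_gt0 //.
  rewrite -natrM ler_nat; lia.
have h3 := ler_norm L.
have h4 : 0 <= (ln c + `|L| + 2 * ln 2) * ln n.+1%:R.
  rewrite mulr_ge0 // !addr_ge0 ?ln_ge0 ?mulr_ge0 ?ln_ge0 // ler1n //.
move: h h2 h3 h4 l0; rewrite !mulrDr !mulr1 [(1 + _ + 3) * _]mulrDl [(1 + (_ + _)) * _]mulrDl.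
move: (\tr _) (ln c) (ln n.+1%:R) (ln n.+2%:R) (`|L|) (ln 2) => t lc l1 l2 L' l22.
move: (ln (1 + t)) ((_ + _ + _) * _) => lt y; lra.
Qed.

Lemma Q_bound : exists2 C, 0 <= C & forall n k i, (k <= n)%N ->
  Qf Z' 0 (fun k => eps k.+1 w i 0) k <= C * (1 + ln n.+1%:R) ^+ 2 /\
  Qf Z' 0 (fun k => xi k.+1 w i 0) k <= C * (1 + ln n.+1%:R) ^+ 2.
Proof.
have [K K0 HK] := trace_Z'.
have b0 n : 0 <= (1 + ln (1 + \tr (Nm Z' n))) ^+ 2 by exact: sqr_ge0.
have [C1 C10 H1] := fin_common_bound b0 Qeps.
have [C2 C20 H2] := fin_common_bound b0 Qxi.
exists ((C1 + C2) * K ^+ 2) => [|n k i kn]; first by rewrite mulr_ge0 ?addr_ge0 ?sqr_ge0.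
have t1 : 1 <= 1 + ln (1 + \tr (Nm Z' k)).
  by rewrite lerDl ln_ge0 // lerDl (le_trans _ (trace_Nm_ge _ _)).
have le2 : (1 + ln (1 + \tr (Nm Z' k))) ^+ 2 <= K ^+ 2 * (1 + ln n.+1%:R) ^+ 2.
  rewrite -exprMn; have p0 : 0 <= K * (1 + ln n.+1%:R).
    by rewrite mulr_ge0 // addr_ge0 // ln_nat_ge0.
  rewrite lerXn2r ?nnegrE //; first by lra.
  apply: le_trans (HK k) _; rewrite ler_wpM2l // lerD2l ler_ln ?posrE //.
  by rewrite ler_nat.
split.
  apply: le_trans (H1 k i) _; apply: le_trans (ler_wpM2l C10 le2) _.
  by rewrite -[leRHS]mulrA; apply: ler_wpM2r; [rewrite mulr_ge0 ?sqr_ge0|rewrite lerDl].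
apply: le_trans (H2 k i) _; apply: le_trans (ler_wpM2l C20 le2) _.
by rewrite -[leRHS]mulrA; apply: ler_wpM2r; [rewrite mulr_ge0 ?sqr_ge0|rewrite lerDr].
Qed.

(** The empirical covariance of [(eps, xi)] tends to the block diagonal matrix of [Gam] and [Del],
    the cross averages tending to 0. That limit is positive definite, so [g] and [h] can vary
    independently. *)
Lemma noise_lower : exists2 c, 0 < c & exists N, forall k (g h : 'cV[R]_d), (N <= k)%N ->
  c * k%:R * (nsq g + nsq h)
    <= \sum_(l < k) (dot g (eps l.+1 w) + dot h (xi l.+1 w)) ^+ 2.
Proof.
have [c1 c10 H1] := posdef_lower Gam_pos; have [c2 c20 H2] := posdef_lower Del_pos.
pose c := Num.min c1 c2; have c0 : 0 < c by rewrite lt_min c10.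
(* An entrywise error [del] changes the quadratic form by at most [del * (d + d)] times [nsq v],
   which stays within half of [c]; the [.+1] avoids a division by 0. *)
pose del := c / 2 / (d + d).+1%:R.
have del0 : 0 < del by rewrite !divr_gt0.
have : \forall k \near \oo, forall a b,
    `|mean (fun k => V k a 0 * V k b 0) k - Sig Gam Del a b| <= del.
  apply: filter_forall => a; apply: filter_forall => b.
  have H : mean (fun k => V k a 0 * V k b 0) k @[k --> \oo] --> Sig Gam Del a b.
    have := @lagV 0%N a b; rewrite eqxx; apply: cvg_eqfun => n.
    by apply: eq_mean => k; rewrite addn0.
  have [N HN] := (cvg_epsN _ _).1 H del del0.
  by exists N.
move=> [N _ HN]; exists (c / 2); first by rewrite divr_gt0.
exists N.+1 => k g h Nk; have {}HN := HN k (ltnW Nk).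
have k0 : 0 < k%:R :> R by rewrite ltr0n (leq_trans _ Nk).
pose v := col_mx g h.
pose M := k%:R^-1 *: (Nm V k - 1%:M).
have E : \sum_(l < k) (dot g (eps l.+1 w) + dot h (xi l.+1 w)) ^+ 2 = k%:R * dot v (M *m v).
  rewrite /M -scalemxAl dotZr mulrA mulfV ?gt_eqF // mul1r mulmxBl mul1mx dotBr dot_Nm.
  rewrite dotvv addrC addKr; apply: eq_bigr => l _.
  by rewrite dot_col_mx (dotC g) (dotC h).
have ME a b : `|(M - Sig Gam Del) a b| <= del.
  have -> : (M - Sig Gam Del) a b = mean (fun k => V k a 0 * V k b 0) k - Sig Gam Del a b.
    rewrite mxE [in X in _ + X]mxE; congr (_ - _).
    rewrite /M /Nm addrC addKr mxE summxE; congr (_ * _).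
    by apply: eq_bigr => l _; rewrite !mxE big_ord1 !mxE.
  exact: HN.
have S : c * nsq v <= dot v (Sig Gam Del *m v).
  rewrite /v /Sig mul_block_col !mul0mx addr0 add0r dot_col_mx nsq_col_mx mulrDr.
  have h1 := H1 g; have h2 := H2 h.
  apply: lerD; [apply: le_trans h1|apply: le_trans h2]; apply: ler_wpM2r; rewrite ?nsq_ge0 //.
    by rewrite ge_min lexx.
  by rewrite ge_min lexx orbT.
have D1 := dot_le_entries v (ltW del0) ME.
have vv : nsq v = nsq g + nsq h by rewrite nsq_col_mx.
have D2 : del * (d + d)%:R * nsq v <= c / 2 * nsq v.
  rewrite ler_wpM2r ?nsq_ge0 // /del -mulrA ler_piMr ?divr_ge0 ?(ltW c0) //.
  by rewrite mulrC ler_pdivrMr // mul1r ler_nat.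
rewrite mulmxBl dotBr in D1.
have D3 : dot v (Sig Gam Del *m v) - dot v (M *m v) <= c / 2 * nsq v.
  apply: le_trans D2; apply: le_trans D1; rewrite distrC; exact: ler_norm.
rewrite E -vv [_ * k%:R]mulrC -mulrA ler_wpM2l ?(ltW k0) //.
move: S D3; move: (dot _ _) (dot _ _) (nsq v) => a b z; lra.
Qed.

Lemma Nm_ge_ratio : exists2 C, 0 < C & exists N, forall n v, (N <= n)%N ->
  n%:R * nsq v <= C * (1 + s n / n%:R) ^+ (p + q) * dot v (Nm Z n *m v).
Proof.
have [c c0 [N0 Hc]] := noise_lower; have [Q Q0 HQ] := Q_bound.
(* The factors of 128: 4 from the condition [small] below, 16 from comparing the squared logarithm
   with a square root, 2 from [n <= 2 * k]. *)
have [N1 HN1] := @sqrt_small R (c / (128 * (d%:R * Q + 1))) ltac:(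
  by rewrite divr_gt0 // mulr_gt0 // ltr_pwDr // mulr_ge0).
pose K0 := 2 * (7 + 2 * nsq (theta_of A B)) / c.
have K00 : 0 <= K0.
  by rewrite divr_ge0 ?(ltW c0) // mulr_ge0 // addr_ge0 // mulr_ge0 // nsq_ge0.
pose M := 3 + 18 * K0.
have M0 : 0 <= M by rewrite addr_ge0 // mulr_ge0.
exists (6 * K0 * (p + q)%:R * M ^+ (p + q) + 1).
  by rewrite ltr_wpDl // mulr_ge0 ?exprn_ge0 // mulr_ge0 // mulr_ge0.
exists (2 * N0 + N1 + 2 * (p + q).+1)%N => n v Nn.
have [n0 n1 n2] : [/\ (2 * N0 <= n)%N, (N1 <= n)%N & (2 * (p + q).+1 <= n)%N].
  by move: Nn; clear => Nn; split; lia.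
have np : 0 < n%:R :> R by rewrite ltr0n; lia.
have [a [b [-> ap bq]]] := mkvP v.
have Qn0 : 0 <= Q * (1 + ln n.+1%:R) ^+ 2 by rewrite mulr_ge0 ?sqr_ge0.
have noise k (g h : 'cV[R]_d) : (n <= 2 * k)%N -> c * k%:R * (nsq g + nsq h)
    <= \sum_(l < k) (dot g (eps l.+1 w) + dot h (xi l.+1 w)) ^+ 2.
  by move=> nk; apply: Hc; move: n0 nk; clear; lia.
have small k : (n <= 2 * k)%N -> 4 * d%:R * (Q * (1 + ln n.+1%:R) ^+ 2) <= c * k%:R.
  move=> nk; have h1 := HN1 n n1.
  have h2 : (1 + ln n.+1%:R) ^+ 2 <= 16 * Num.sqrt n.+1%:R :> R.
    rewrite -expR_half (_ : 16 = 4 ^+ 2) -?exprMn; last by rewrite -natrX.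
    rewrite lerXn2r ?nnegrE ?mulr_ge0 ?expR_ge0 ?addr_ge0 ?ln_nat_ge0 //.
    exact: ln_le_expR4.
  have nk' : n%:R <= 2 * k%:R :> R by rewrite -natrM ler_nat.
  have dQ0 : 0 <= d%:R * Q by rewrite mulr_ge0.
  have h3 : d%:R * Q * (1 + ln n.+1%:R) ^+ 2 <= (d%:R * Q + 1) * (16 * Num.sqrt n.+1%:R).
    by apply: ler_pM => //; [exact: sqr_ge0|rewrite lerDl].
  have h4 : (d%:R * Q + 1) * (16 * Num.sqrt n.+1%:R) <= c / 8 * n%:R.
    have e1 : 0 < d%:R * Q + 1 by rewrite ltr_pwDr.
    apply: le_trans (_ : (d%:R * Q + 1) * (16 * (c / (128 * (d%:R * Q + 1)) * n%:R)) <= _).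
      by rewrite ler_wpM2l ?(ltW e1) // ler_wpM2l.
    rewrite le_eqVlt; apply/orP; left; apply/eqP; field; exact: lt0r_neq0.
  have h5 : c / 8 * n%:R <= c / 8 * (2 * k%:R) by rewrite ler_wpM2l // divr_ge0 // ltW.
  have -> : 4 * d%:R * (Q * (1 + ln n.+1%:R) ^+ 2) = 4 * (d%:R * Q * (1 + ln n.+1%:R) ^+ 2) by ring.
  lra.
have := excitation_iter arxX control p1 q1 c0 Qn0 (erefl (p + q)%N) n2 noise
  (fun k i kn => (HQ n k i kn).1) (fun k i kn => (HQ n k i kn).2) small (lexx _) ap bq.
rewrite -/K0 -/(s n) => H; apply: le_trans H _; rewrite [leLHS]mulrA ler_wpM2r //.
  exact: le_trans (nsq_ge0 _) (dot_Nm_ge _ _ _).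
have sn : 0 <= s n / n%:R by rewrite divr_ge0 ?trace_ge0.
apply: le_trans (_ : 6 * K0 * (p + q)%:R * (M * (1 + s n / n%:R)) ^+ (p + q) <= _).
  apply: ler_wpM2l; first by rewrite mulr_ge0 // mulr_ge0.
  have t1 : 0 <= K0 * (s n / n%:R) by rewrite mulr_ge0.
  have -> : 3 + 9 * K0 * (2 * s n / n%:R) = 3 + 18 * (K0 * (s n / n%:R)) by ring.
  apply: lerXn2r; rewrite ?nnegrE.
  - by rewrite addr_ge0 // mulr_ge0.
  - by rewrite mulr_ge0 // addr_ge0.
  - by rewrite /M mulrDr mulr1 mulrDl mulrA; lra.
rewrite exprMn mulrA ler_wpM2r ?exprn_ge0 ?addr_ge0 // lerDl //.
Qed.

Lemma log_s : exists2 C, 0 <= C & forall n, 1 + ln (1 + s n) <= C * (1 + ln n.+1%:R).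
Proof.
have [K HK] := poly_growth ltr01; exists (3 + `|K|) => [|n]; first by rewrite addr_ge0.
have := HK n; have l0 := @ln_nat_ge0 R n; have := ler_norm K.
have := mulr_ge0 (normr_ge0 K) l0; rewrite mulrDr mulr1 mulrDl; lra.
Qed.

Lemma ac_ge0 k : 0 <= ac k.
Proof. by rewrite divr_ge0 ?nsq_ge0 // addr_ge0 // gain_ge0. Qed.

Lemma ac_log : exists2 C, 0 <= C & forall n, \sum_(k < n) ac k <= C * (1 + ln n.+1%:R).
Proof.
have [C1 C10 H1] := LS_bounds; have [C2 C20 H2] := log_s.
exists (C1 * C2) => [|n]; first exact: mulr_ge0.
by apply: le_trans (H1 n).1 _; rewrite -mulrA ler_wpM2l.
Qed.

Lemma ac_ln k C : 0 <= C -> (forall n, \sum_(k < n) ac k <= C * (1 + ln n.+1%:R)) ->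
  ac k <= 2 * C * (1 + ln k.+1%:R).
Proof.
move=> C0 H; apply: le_trans (_ : \sum_(j < k.+1) ac j <= _).
  by rewrite big_ord_recr lerDr; apply: sumr_ge0 => j _; exact: ac_ge0.
apply: le_trans (H k.+1) _; rewrite -mulrA mulrCA ler_wpM2l //.
have h2 : ln k.+2%:R <= 1 + ln k.+1%:R :> R.
  have e1 : k.+2%:R = k.+1%:R * (1 + k.+1%:R^-1) :> R.
    by rewrite mulrDr mulr1 mulfV // natr1.
  have i0 : 0 <= k.+1%:R^-1 :> R by rewrite invr_ge0.
  have i1 : k.+1%:R^-1 <= 1 :> R by rewrite invf_le1 ?ler1n.
  have e2 : 0 < 1 + k.+1%:R^-1 :> R by rewrite ltr_pwDl.
  rewrite e1 lnM ?posrE //.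
  rewrite addrC lerD2r; apply: le_trans i1; apply: le_ln1Dx.
  by apply: lt_le_trans i0; exact: ltrN10.
have := @ln_nat_ge0 R k; lra.
Qed.

(** The polynomial bound is used with the excess 1/(4(p+q)), so that the power [p + q] leaves a
    fourth root of [n]. *)
Lemma ratio_growth : exists2 M, 0 <= M & forall n, (0 < n)%N ->
  (1 + s n / n%:R) ^+ (p + q) <= M * expR (ln n.+1%:R / 4).
Proof.
have m0 : 0 < (p + q)%:R :> R by rewrite ltr0n; lia.
have kp0 : 0 < (4 * (p + q)%:R)^-1 :> R by rewrite invr_gt0 mulr_gt0.
have [K HK] := poly_growth kp0.
exists ((1 + 2 * expR K) ^+ (p + q)) => [|n n0].
  by rewrite exprn_ge0 // addr_ge0 // mulr_ge0 // expR_ge0.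
pose L : R := ln n.+1%:R; have L0 : 0 <= L by exact: ln_nat_ge0.
pose kap : R := (4 * (p + q)%:R)^-1.
have -> : expR (L / 4) = expR (kap * L) ^+ (p + q).
  rewrite -expRM_natl; congr expR; rewrite /kap; move: ((p + q)%:R) m0 => m m0.
  by field; exact: lt0r_neq0.
have k0 : 0 <= kap by rewrite invr_ge0 mulr_ge0 // ltW.
have np : 0 < n%:R :> R by rewrite ltr0n.
have e1 : 1 <= expR (kap * L) by rewrite -expR0 ler_expR mulr_ge0.
rewrite -exprMn; apply: lerXn2r; rewrite ?nnegrE.
- by rewrite addr_ge0 // divr_ge0 // trace_ge0.
- by rewrite mulr_ge0 ?expR_ge0 // addr_ge0 // mulr_ge0 // expR_ge0.
rewrite mulrDl mul1r; apply: lerD => //.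
have sp : 0 < 1 + s n by have := trace_ge0 n; lra.
have h : 1 + s n <= expR K * (n.+1%:R * expR (kap * L)).
  rewrite -[leLHS]lnK ?posrE // -{1}[n.+1%:R]lnK ?posrE // -/L -!expRD ler_expR.
  by have := HK n; rewrite -/kap -/L mulrDl mul1r.
have n2 : n.+1%:R <= 2 * n%:R :> R by rewrite -natrM ler_nat; lia.
rewrite ler_pdivrMr //; apply: le_trans (_ : expR K * (2 * n%:R * expR (kap * L)) <= _).
  apply: le_trans (_ : 1 + s n <= _); first by rewrite lerDr.
  apply: le_trans h _; rewrite ler_wpM2l ?expR_ge0 // ler_wpM2r ?expR_ge0 //.
by rewrite le_eqVlt; apply/orP; left; apply/eqP; ring.
Qed.

Lemma lin_growth : exists2 K, 0 <= K & forall n, s n <= K * n.+1%:R.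
Proof.
have [C1 [rho [C10 r0 r1 FL LS]]] := regressor_bound arxX control w exps.
have [K2 K20 nuC] := nuk_sum; have [C2 C20 HC2] := LS_bounds.
have y0 := yk_ge0 A B X U eps w.
have g0 k : 0 <= geom rho (yk A B X U eps w) k by apply: geom_ge0 => //; exact: ltW.
have gn k := gain_ge0 Z k.
have sE n : s n = (delta_dim d p q)%:R + \sum_(k < n) nsq (Z k) by exact: trace_Nm.
have HLS k := le_trans (FL k) (ler_wpM2r (g0 k) (ltac:(by rewrite lerDl) : C1 <= C1 + K2)).
have Hnu n := le_trans (nuC n) (ler_wpM2r (ler0n _ _) (ltac:(by rewrite lerDr) : K2 <= C1 + K2)).
have Hac n : \sum_(k < n) ac k
    <= C2 * (1 + ln (1 + ((delta_dim d p q)%:R + \sum_(k < n) nsq (Z k)))).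
  by rewrite -sE; exact: (HC2 n).1.
have [C C0 [N HN]] := Nm_ge_ratio; have [M M0 HM] := ratio_growth.
have [C3 C30 H3] := ac_log; have [C4 C40 H4] := log_s.
(* The lower bound for [Nm k] provided by [Nm_ge_ratio]. The value 0 at early times makes the
   requirements under [0 < lam k] vacuous there. *)
pose lam k : R := if (maxn 1 N <= k)%N then k%:R / (C * (1 + s k / k%:R) ^+ (p + q)) else 0.
have sk k : 0 <= s k / k%:R by rewrite divr_ge0 // trace_ge0.
have den k : 0 < C * (1 + s k / k%:R) ^+ (p + q).
  by rewrite mulr_gt0 // exprn_gt0 // ltr_pwDl.
have [||| K' HK'] := @linear_growth R (geom rho (yk A B X U eps w)) (nuk A B X U eps xi x w)
  (fun k => nsq (pr k)) ac (fun k => nsq (Z k)) rho (C1 + K2) C2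
  (delta_dim d p q)%:R g0
  (nuk_ge0 A B X U eps xi x w) (fun k => nsq_ge0 _)
  (fun k => divr_ge0 (nsq_ge0 _) (addr_ge0 ler01 (gn k)))
  (fun k => nsq_ge0 _) r1 (addr_ge0 C10 K20) C20 (ler0n _ _) LS
  HLS Hnu Hac lam C4.
- move=> n; rewrite -sE; have := H4 n; have h := @ln_nat_le R n.
  have : C4 * (1 + ln n.+1%:R) <= C4 * n.+1%:R.
    by rewrite ler_wpM2l // -[leRHS]natr1 [leRHS]addrC lerD2l.
  lra.
- move=> eta eta0.
  (* [ac k] is at most a logarithm, hence a fourth root, and [k / lam k] is another fourth root:
     their product is a square root, below any multiple of [k] in the end. [Q] collects the
     constants. *)
  pose Q := C * M * (2 * C3) * 4 + 1.
  have Q0 : 0 < Q by rewrite ltr_wpDl // !mulr_ge0 // ltW.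
  have [N1 HN1] := @sqrt_small R (eta / Q) ltac:(by rewrite divr_gt0).
  exists (maxn 1 N + N1)%N => k kN.
  have k1 : (maxn 1 N <= k)%N by apply: leq_trans kN; exact: leq_addr.
  have k2 : (N1 <= k)%N by apply: leq_trans kN; exact: leq_addl.
  have k3 : (0 < k)%N by apply: leq_trans k1; exact: leq_maxl.
  rewrite /lam k1; split; first by rewrite divr_gt0 // ltr0n.
  rewrite mulrA ler_pdivlMr //.
  pose E : R := expR (ln k.+1%:R / 4).
  have E0 : 0 <= E by exact: expR_ge0.
  have a1 : ac k <= 2 * C3 * (4 * E).
    apply: le_trans (ac_ln k C30 H3) _; rewrite ler_wpM2l ?mulr_ge0 //.
    exact: ln_le_expR4.
  have a2 : C * (1 + s k / k%:R) ^+ (p + q) <= C * (M * E).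
    by rewrite ler_wpM2l ?(ltW C0) // HM.
  apply: le_trans (ler_pM (ac_ge0 k) (ltW (den k)) a1 a2) _.
  have -> : 2 * C3 * (4 * E) * (C * (M * E)) = (Q - 1) * E ^+ 2 by rewrite /Q; ring.
  rewrite expR_half; apply: le_trans (_ : Q * Num.sqrt k.+1%:R <= _).
    by rewrite ler_wpM2r ?sqrtr_ge0 // lerBlDr lerDl.
  have := ler_wpM2l (ltW Q0) (HN1 k k2); congr (_ <= _).
  by field; exact: lt0r_neq0.
- move=> k; rewrite /lam; case: ifP => [kN lam0|_]; last by rewrite ltxx.
  have kN' : (N <= k)%N by apply: leq_trans kN; exact: leq_maxr.
  have low v : k%:R / (C * (1 + s k / k%:R) ^+ (p + q)) * nsq v <= dot v (Nm Z k *m v).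
    by rewrite mulrAC ler_pdivrMr // [leRHS]mulrC HN.
  have h := Jm_le_of_Nm_ge (Z k) lam0 low.
  have p0 : 0 < 1 + gain Z k by rewrite ltr_pwDl.
  rewrite /ac mulrAC ler_pdivlMr // ler_wpM2l ?nsq_ge0 // lerD2l; exact: h.
exists `|K'| => // n; rewrite sE; apply: le_trans (HK' n) _.
by rewrite ler_wpM2r // ler_norm.
Qed.

Lemma Nm_ge_linear : exists2 c, 0 < c & exists N, forall n v, (N <= n)%N ->
  c * n%:R * nsq v <= dot v (Nm Z n *m v).
Proof.
have [C C0 [N HN]] := Nm_ge_ratio; have [K K0 HK] := lin_growth.
have den : 0 < C * (1 + 2 * K) ^+ (p + q).
  by rewrite mulr_gt0 // exprn_gt0 // ltr_pwDl // mulr_ge0.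
exists (C * (1 + 2 * K) ^+ (p + q))^-1; first by rewrite invr_gt0.
exists (maxn 1 N) => n v; rewrite geq_max => /andP[n1 nN].
rewrite -mulrA ler_pdivrMl //; apply: le_trans (HN n v nN) _.
have np : 0 < n%:R :> R by rewrite ltr0n.
apply: ler_wpM2r; first exact: le_trans (nsq_ge0 _) (dot_Nm_ge _ _ _).
rewrite ler_wpM2l ?(ltW C0) //; apply: lerXn2r; rewrite ?nnegrE.
- by rewrite addr_ge0 // divr_ge0 // trace_ge0.
- by rewrite addr_ge0 // mulr_ge0.
rewrite lerD2l ler_pdivrMr //; apply: le_trans (HK n) _.
have n2 : n.+1%:R <= 2 * n%:R :> R by rewrite -natrM ler_nat; lia.
by rewrite [2 * K]mulrC -mulrA ler_wpM2l.
Qed.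

Lemma perr_sum : exists2 C, 0 <= C &
  forall n, \sum_(k < n) nsq (pr k) <= C * (1 + ln n.+1%:R).
Proof.
have [c c0 [N HN]] := Nm_ge_linear; have [K K0 HK] := lin_growth; have [C C0 HC] := ac_log.
pose G := 1 + 3 * K / c.
have G0 : 0 <= G by rewrite addr_ge0 // divr_ge0 ?mulr_ge0 // ltW.
pose N' := maxn 1 N.
pose f k := if (k < N')%N then nsq (pr k) else 0.
have f0 k : 0 <= f k by rewrite /f; case: ifP => // _; exact: nsq_ge0.
have fN k : (N' <= k)%N -> f k = 0 by rewrite /f ltnNge => ->.
have a0 : 0 <= \sum_(k < N') f k by apply: sumr_ge0.
exists (\sum_(k < N') f k + G * C) => [|n]; first by rewrite addr_ge0 // mulr_ge0.
have l0 := @ln_nat_ge0 R n.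
apply: le_trans (_ : \sum_(k < n) f k + G * \sum_(k < n) ac k <= _).
  rewrite mulr_sumr -big_split; apply: ler_sum => k _ /=; rewrite /f.
  case: ltnP => kN; first by rewrite lerDl mulr_ge0 // ac_ge0.
  rewrite add0r.
  have [k1 kN'] : (1 <= k)%N /\ (N <= k)%N.
    by move: kN; rewrite geq_max => /andP[].
  have kp : 0 < k%:R :> R by rewrite ltr0n.
  have ck : 0 < c * k%:R by rewrite mulr_gt0.
  have g1 := Jm_le_of_Nm_ge (Z k) ck (fun v => HN k v kN').
  (* The squared regressor is at most [s k.+1], hence at most [K * k.+2], and [k.+2 <= 3 * k] for
     [k >= 1]. *)
  have g2 : gain Z k <= 3 * K / c.
    apply: le_trans g1 _; rewrite ler_pdivrMr //.
    have -> : 3 * K / c * (c * k%:R) = K * (3 * k%:R) by field; exact: lt0r_neq0.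
    apply: le_trans (_ : s k.+1 <= _).
      rewrite /s trace_Nm big_ord_recr /= addrA lerDr addr_ge0 //.
      by apply: sumr_ge0 => i _; exact: nsq_ge0.
    apply: le_trans (HK _) _; rewrite ler_wpM2l // -natrM ler_nat; move: k1; clear; lia.
  have p0 : 0 < 1 + gain Z k by rewrite ltr_pwDl // gain_ge0.
  have -> : nsq (pr k) = (1 + gain Z k) * ac k by rewrite /ac; field; exact: lt0r_neq0.
  by rewrite ler_wpM2r ?ac_ge0 // lerD2l.
rewrite [leRHS]mulrDl; apply: lerD.
  apply: le_trans (sum_finite_le n f0 fN) _; rewrite ler_peMr //; lra.
by rewrite -mulrA ler_wpM2l.
Qed.

Lemma terr_bound : exists2 C, 0 <= C & exists N, forall n, (N <= n)%N ->
  nsq (tn n) <= C * ((1 + ln n.+1%:R) / n%:R).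
Proof.
have [c c0 [N HN]] := Nm_ge_linear; have [C1 C10 H1] := LS_bounds.
have [C2 C20 H2] := log_s.
exists (d%:R * (C1 * C2 / c)) => [|].
  by rewrite mulr_ge0 // divr_ge0 ?(ltW c0) // mulr_ge0.
exists (maxn 1 N) => n; rewrite geq_max => /andP[n1 nN].
have np : 0 < n%:R :> R by rewrite ltr0n.
rewrite nsq_col; apply: le_trans (_ : \sum_(j < d) (C1 * C2 / c) * ((1 + ln n.+1%:R) / n%:R) <= _).
  apply: ler_sum => j _.
  have h1 := HN n (col j (tn n)) nN; have h2 := (H1 n).2 j.
  have h3 : C1 * (1 + ln (1 + s n)) <= C1 * (C2 * (1 + ln n.+1%:R)) by rewrite ler_wpM2l.
  have h4 := le_trans h1 (le_trans h2 h3).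
  rewrite mulrC -ler_pdivlMr ?mulr_gt0 // in h4; apply: le_trans h4 _.
  rewrite le_eqVlt; apply/orP; left; apply/eqP; field.
  by rewrite !lt0r_neq0.
by rewrite sumr_const card_ord -[_ * (_ / _) *+ _]mulr_natl mulrA.
Qed.

Lemma log_small (e : R) : 0 < e -> exists N, forall n, (N <= n)%N -> 1 + ln n.+1%:R <= e * n%:R.
Proof.
move=> e0; have [N HN] := @sqrt_small R (e / 16) ltac:(by rewrite divr_gt0).
exists N => n Nn; have h := HN n Nn; have l0 := @ln_nat_ge0 R n.
have h2 : (1 + ln n.+1%:R) ^+ 2 <= 16 * Num.sqrt n.+1%:R :> R.
  rewrite -expR_half (_ : 16 = 4 ^+ 2) -?exprMn; last by rewrite -natrX.
  rewrite lerXn2r ?nnegrE ?mulr_ge0 ?expR_ge0 ?addr_ge0 //.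
  exact: ln_le_expR4.
have h3 : 1 + ln n.+1%:R <= (1 + ln n.+1%:R) ^+ 2 :> R.
  by rewrite expr2 ler_peMr ?addr_ge0 // lerDl.
rewrite mulrAC ler_pdivlMr // in h; lra.
Qed.

Lemma r_small (e : R) : 0 < e -> exists N, forall n, (N <= n)%N ->
  \sum_(k < n) nsq (r k.+1) <= e * n%:R.
Proof.
move=> e0; have [C C0 HC] := perr_sum.
have e1 : 0 < e / 4 by rewrite divr_gt0.
have e2 : 0 < e / (4 * (C + 1)) by rewrite divr_gt0 // mulr_gt0 // ltr_pwDr.
have [N1 H1] := small_x e1; have [N2 H2] := log_small e2.
exists (maxn N1 N2) => n; rewrite geq_max => /andP[n1 n2].
apply: le_trans (_ : 2 * \sum_(k < n) nsq (x k.+1 w) + 2 * \sum_(k < n) nsq (pr k) <= _).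
  by rewrite !mulr_sumr -big_split; apply: ler_sum => k _; exact: nsqD.
have h1 := H1 n n1; have h2 := H2 n n2; have h3 := HC n.
have C1 : 0 < C + 1 by rewrite ltr_pwDr.
have h4 : C * (1 + ln n.+1%:R) <= e / 4 * n%:R.
  apply: le_trans (_ : (C + 1) * (1 + ln n.+1%:R) <= _).
    by rewrite ler_wpM2r ?addr_ge0 ?ln_nat_ge0 // lerDl.
  have := ler_wpM2l (ltW C1) h2; congr (_ <= _); field; exact: lt0r_neq0.
lra.
Qed.

(** The stacked noise re-indexed with the value 0 at time 0, to match the cut-off processes [Xs] and
    [us]. *)
Let W k : 'cV[R]_(d + d) := col_mx (es eps w k) (xs xi w k).

Lemma lagW j a b : mean (fun k => W (k + j)%N a 0 * W k b 0) n @[n --> \oo]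
  --> (if j == 0%N then Sig Gam Del a b else 0).
Proof.
have := cvg_avg_shift 1 (@lagV j a b); apply: cvg_eqfun => n; apply: eq_mean => k.
case: k => [|k] /=; last by rewrite subn1.
by rewrite /W /= col_mx0 [in X in _ = _ * X]mxE mulr0.
Qed.

Lemma sum_col_mx m1 m2 n c (f : nat -> 'M[R]_(m1, c)) (g : nat -> 'M[R]_(m2, c)) :
  \sum_(a < n) col_mx (f a) (g a) = col_mx (\sum_(a < n) f a) (\sum_(a < n) g a).
Proof.
elim: n => [|n IH]; first by rewrite !big_ord0 col_mx0.
by rewrite 3!big_ord_recr /= IH add_col_mx.
Qed.

Lemma conv_Rcoef k : (p + q < k)%N -> conv (Rcoef D Pc p q) W k =
  col_mx (\mxcol_(i < p) (es eps w (k - i)%N + xs xi w (k - i)%N))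
    (\mxcol_(j < q) (conv Pc (es eps w) (k - j)%N
       + conv (fun n => D n + Pc n) (xs xi w) (k - j)%N)).
Proof.
move=> pqk; rewrite /conv /Rcoef.
pose RXW (a : nat) (i : 'I_p) : 'cV[R]_d :=
  (if a == i then row_mx 1%:M 1%:M else 0) *m W (k - a)%N.
pose RUW (a : nat) (j : 'I_q) : 'cV[R]_d :=
  (if (j <= a)%N then row_mx (Pc (a - j)%N) (D (a - j)%N + Pc (a - j)%N) else 0) *m W (k - a)%N.
transitivity (\sum_(a < k.+1) col_mx (\mxcol_(i < p) RXW a i) (\mxcol_(j < q) RUW a j)).
  by apply: eq_bigr => a _; rewrite mul_col_mx !mxcol_mul.
transitivity (col_mx (\sum_(a < k.+1) \mxcol_(i < p) RXW a i) (\sum_(a < k.+1) \mxcol_(j < q) RUW a j)).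
  exact: (sum_col_mx k.+1 (fun a => \mxcol_(i < p) RXW a i) (fun a => \mxcol_(j < q) RUW a j)).
rewrite -!mxcol_sum; congr col_mx; apply/eq_mxcol => i.
  have ik : (i < k.+1)%N by have := ltn_ord i; lia.
  rewrite /RXW (bigD1 (Ordinal ik)) //= eqxx [X in _ + X]big1 ?addr0; last first.
    by move=> a; rewrite -val_eqE /= => /negbTE ->; rewrite mul0mx.
  by rewrite /W mul_row_col !mul1mx.
have jk : (i <= k)%N by have := ltn_ord i; lia.
rewrite /RUW (bigID (fun a : 'I_k.+1 => (i <= a)%N)) /= [X in _ + X]big1 ?addr0; last first.
  by move=> a /negbTE ->; rewrite mul0mx.
rewrite (eq_bigr (fun a : 'I_k.+1 => (fun b => Pc b *m es eps w (k - i - b)%N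
   + (D b + Pc b) *m xs xi w (k - i - b)%N) (a - i)%N)); last first.
  move=> a ia; rewrite ia /W mul_row_col.
  by rewrite (_ : (k - i - (a - i) = k - a)%N) //; have := ltn_ord a; lia.
by rewrite (sum_shift (fun b => Pc b *m es eps w (k - i - b)%N
   + (D b + Pc b) *m xs xi w (k - i - b)%N)) subSn // big_split.
Qed.

(** The error of the filter representation comes from the part [r] of the outputs explained by
    neither noise, from its filtered image in the inputs, and from the transient of the initial
    state. *)
Lemma Phi_conv k : (p + q < k)%N -> Z k - conv (Rcoef D Pc p q) W k =
  col_mx (\mxcol_(i < p) r (k - i)%N)
    (\mxcol_(j < q) (conv (fun n => D n + Pc n) r (k - j)%N
       + conv D (init_defect A B X U eps w) (k - j)%N)).
Proof.
move=> pqk; rewrite conv_Rcoef // /Z /Phi opp_col_mx add_col_mx -!mxcolB.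
congr col_mx; apply/eq_mxcol => i.
  rewrite X_Xs; last by have := ltn_ord i; lia.
  by rewrite (Xs_decomp arxX control) [es _ _ _ + _ + _]addrC addrK.
rewrite U_us; last by have := ltn_ord i; lia.
by rewrite (us_conv_noise arxX control w exps) addrAC subrr add0r.
Qed.

Lemma nsq_row_mx m n1 n2 (M : 'M[R]_(m, n1)) (N : 'M[R]_(m, n2)) :
  nsq (row_mx M N) = nsq M + nsq N.
Proof. by rewrite -nsq_tr tr_row_mx nsq_col_mx !nsq_tr. Qed.

Lemma nsq_mxcol_mx m n c (M : 'I_m -> 'M[R]_(n, c)) :
  nsq (\mxcol_(i < m) M i) = \sum_i nsq (M i).
Proof.
transitivity (\sum_j \sum_i nsq (col j (M i))).
  rewrite nsq_col; apply: eq_bigr => j _; rewrite -nsq_mxcol; congr nsq.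
  by apply/colP => l; rewrite !mxE.
by rewrite exchange_big; apply: eq_bigr => i _; rewrite nsq_col.
Qed.

Lemma Rcoef_bound C rho : 0 <= C -> 0 < rho -> rho < 1 ->
  (forall n, nsq (Pc n) <= C * (rho ^+ n) ^+ 2) ->
  (forall n, nsq (D n + Pc n) <= C * (rho ^+ n) ^+ 2) ->
  exists C', forall a, nsq (Rcoef D Pc p q a) <= C' * (rho ^+ a) ^+ 2.
Proof.
move=> C0 r0 r1 HP HQ.
pose bp := (rho ^+ p) ^+ 2; pose bq := (rho ^+ q) ^+ 2.
have bp0 : 0 < bp by rewrite !exprn_gt0.
have bq0 : 0 < bq by rewrite !exprn_gt0.
pose c1 := nsq (row_mx 1%:M 1%:M : 'M[R]_(d, d + d)) / bp.
have c10 : 0 <= c1 by rewrite divr_ge0 ?nsq_ge0 // ltW.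
pose c2 := 2 * C / bq.
have c20 : 0 <= c2 by rewrite divr_ge0 ?(ltW bq0) // mulr_ge0.
have sq_mono i j : (i <= j)%N -> (rho ^+ j) ^+ 2 <= (rho ^+ i) ^+ 2.
  move=> ij; rewrite -!exprM; apply: ler_wiXn2l; [exact: ltW|exact: ltW|].
  by rewrite leq_mul2r ij orbT.
exists (p%:R * c1 + q%:R * c2) => a.
have ra : 0 <= (rho ^+ a) ^+ 2 by exact: sqr_ge0.
rewrite /Rcoef nsq_col_mx !nsq_mxcol_mx mulrDl; apply: lerD.
  apply: le_trans (_ : \sum_(i < p) c1 * (rho ^+ a) ^+ 2 <= _).
    apply: ler_sum => i _; case: eqP => [->|_]; last by rewrite nsq0 mulr_ge0.
    rewrite /c1 mulrAC ler_pdivlMr // ler_wpM2l ?nsq_ge0 //.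
    by apply: sq_mono; exact: ltnW.
  by rewrite sumr_const card_ord -[leLHS]mulr_natl mulrA.
apply: le_trans (_ : \sum_(i < q) c2 * (rho ^+ a) ^+ 2 <= _).
  apply: ler_sum => j _; case: leqP => ja; last by rewrite nsq0 mulr_ge0.
  rewrite nsq_row_mx; apply: le_trans (lerD (HP _) (HQ _)) _.
  have -> : C * (rho ^+ (a - j)) ^+ 2 + C * (rho ^+ (a - j)) ^+ 2 = 2 * C * (rho ^+ (a - j)) ^+ 2.
    by ring.
  rewrite /c2 [leRHS]mulrAC ler_pdivlMr // -[leLHS]mulrA ler_wpM2l ?mulr_ge0 //.
  have -> : rho ^+ a = rho ^+ (a - j) * rho ^+ j by rewrite -exprD subnK.
  rewrite exprMn ler_wpM2l ?sqr_ge0 //; apply: sq_mono; exact: ltnW.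
by rewrite sumr_const card_ord -[leLHS]mulr_natl mulrA.
Qed.

(** Discounted sums cost only a factor [(1 - rho)^-1] after summation in time, so the mean square
    error is controlled by that of [r], which is negligible, and by a transient of finite
    support. *)
Lemma mean_diff : mean (fun k => nsq (Z k - conv (Rcoef D Pc p q) W k)) n @[n --> \oo] --> (0 : R).
Proof.
have [C [rho [C0 r0 r1 [HD HP HQ]]]] := geometric_nsq exps.
have h : 0 < 1 - rho by rewrite subr_gt0.
pose c := (1 - rho)^-1 * C; have c0 : 0 <= c by rewrite mulr_ge0 ?invr_ge0 // ltW.
pose b := rho^-1 ^+ (p + q).
have b0 : 0 <= b by rewrite exprn_ge0 // invr_ge0 ltW.
have b1 i : (i <= p + q)%N -> rho^-1 ^+ i <= b.
  by move=> ipq; apply: ler_weXn2l => //; rewrite invf_ge1 // ltW.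
pose e := init_defect A B X U eps w.
pose y k := nsq (r k) + nsq (e k).
have y0 k : 0 <= y k by rewrite addr_ge0 ?nsq_ge0.
have g0 k : 0 <= geom rho y k by apply: geom_ge0 => //; exact: ltW.
pose G := p%:R * b + q%:R * (4 * c * b).
have G0 : 0 <= G.
  apply: addr_ge0; apply: mulr_ge0 => //; apply: mulr_ge0 => //; exact: mulr_ge0.
pose df k := nsq (Z k - conv (Rcoef D Pc p q) W k).
have main k : (p + q < k)%N -> df k <= G * geom rho y k.
  move=> pqk; rewrite /df Phi_conv // nsq_col_mx !nsq_mxcol /G mulrDl; apply: lerD.
    apply: le_trans (_ : \sum_(i < p) b * geom rho y k <= _).
      apply: ler_sum => i _; have ip := ltn_ord i.
      apply: le_trans (_ : geom rho y (k - i)%N <= _).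
        apply: le_trans (geom_ge _ (ltW r0) y0); rewrite lerDl; exact: nsq_ge0.
      apply: le_trans (geom_back r0 y0 _) _; first by move: ip pqk; clear; lia.
      by rewrite ler_wpM2r // b1 //; move: ip; clear; lia.
    by rewrite sumr_const card_ord -[leLHS]mulr_natl mulrA.
  apply: le_trans (_ : \sum_(j < q) 4 * c * b * geom rho y k <= _).
    apply: ler_sum => j _; have jq := ltn_ord j.
    apply: le_trans (nsqD _ _) _.
    have h1 := geom_conv r (k - j)%N r0 r1 HQ.
    have h2 := geom_conv e (k - j)%N r0 r1 HD.
    have h3 : geom rho (fun l => nsq (r l)) (k - j)%N + geom rho (fun l => nsq (e l)) (k - j)%N
       = geom rho y (k - j)%N.
      by rewrite -big_split; apply: eq_bigr => l _; rewrite /= -mulrDr.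
    have h4 : geom rho y (k - j)%N <= b * geom rho y k.
      apply: le_trans (geom_back r0 y0 _) _; first by move: jq pqk; clear; lia.
      by rewrite ler_wpM2r // b1 //; move: jq; clear; lia.
    have h5 : c * geom rho y (k - j)%N <= c * (b * geom rho y k) by rewrite ler_wpM2l.
    rewrite -/c in h1 h2; rewrite -h3 mulrDr in h5.
    have := mulr_ge0 c0 (mulr_ge0 b0 (g0 k)).
    have -> : 4 * c * b * geom rho y k = 4 * (c * (b * geom rho y k)) by ring.
    move: h1 h2 h5; rewrite -/e.
    move: (nsq (conv _ r _)) (nsq (conv D e _)) => u1 u2.
    move: (c * geom rho (fun l => nsq (r l)) _) (c * geom rho (fun l => nsq (e l)) _) => u3 u4.
    by move: (c * _) => u5; lra.
  by rewrite sumr_const card_ord -[leLHS]mulr_natl mulrA.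
pose c3 := \sum_(k < (p + q).+1) df k.
have df0 k : 0 <= df k by exact: nsq_ge0.
have c30 : 0 <= c3 by apply: sumr_ge0.
pose c4 := \sum_(k < (p + q).+1) nsq (e k).
have c40 : 0 <= c4 by apply: sumr_ge0 => k _; exact: nsq_ge0.
pose G' := G * (1 - rho)^-1.
have G'0 : 0 <= G' by rewrite mulr_ge0 // invr_ge0 ltW.
have total n : \sum_(k < n) df k <= c3 + G' * (\sum_(k < n) nsq (r k.+1) + c4).
  pose f k := if (k < (p + q).+1)%N then df k else 0.
  have f0 k : 0 <= f k by rewrite /f; case: ifP.
  have fN k : ((p + q).+1 <= k)%N -> f k = 0 by move=> kN; rewrite /f ltnNge kN.
  apply: le_trans (_ : \sum_(k < n) f k + G * \sum_(k < n) geom rho y k <= _).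
    rewrite mulr_sumr -big_split; apply: ler_sum => k _ /=; rewrite /f.
    case: ltnP => kN; first by rewrite lerDl mulr_ge0.
    by rewrite add0r main.
  apply: lerD.
    apply: le_trans (sum_finite_le n f0 fN) _; apply: ler_sum => k _.
    by rewrite /f ltn_ord.
  rewrite -mulrA ler_wpM2l //; apply: le_trans (sum_geom_seq n (ltW r0) r1 y0) _.
  rewrite ler_wpM2l ?invr_ge0 ?(ltW h) // big_split; apply: lerD.
    case: n => [|n]; first by rewrite !big_ord0.
    rewrite big_ord_recl /= nsq0 add0r [leRHS]big_ord_recr /= lerDl; exact: nsq_ge0.
  apply: (@sum_finite_le R (fun k => nsq (e k))) => [k|k kN]; first exact: nsq_ge0.
  by rewrite /e init_defect_eq0 // nsq0.
apply/cvg_epsN => e1 e10.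
have G1 : 0 < G' + 1 by rewrite ltr_pwDr.
have e11 : 0 < e1 / (2 * (G' + 1)) by rewrite divr_gt0 // mulr_gt0.
have [N1 HN1] := r_small e11.
pose K := c3 + G' * c4; have K0 : 0 <= K by rewrite addr_ge0 // mulr_ge0.
have e12 : 0 < e1 / (2 * (K + 1)) by rewrite divr_gt0 // mulr_gt0 // ltr_pwDr.
have [N2 HN2] := log_small e12.
exists (N1 + N2).+1 => n nN.
have [n1 n2 n3] : [/\ (N1 <= n)%N, (N2 <= n)%N & (0 < n)%N].
  by move: nN; clear => nN; split; lia.
have np : 0 < n%:R :> R by rewrite ltr0n.
rewrite subr0 ger0_norm; last by apply: mean_ge0 => k; exact: nsq_ge0.
rewrite /mean mulrC ler_pdivrMr //; apply: le_trans (total n) _.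
have h1 : G' * \sum_(k < n) nsq (r k.+1) <= e1 / 2 * n%:R.
  apply: le_trans (_ : (G' + 1) * (e1 / (2 * (G' + 1)) * n%:R) <= _).
    apply: ler_pM => //; [by apply: sumr_ge0 => k _; exact: nsq_ge0|by rewrite lerDl|exact: HN1].
  by rewrite le_eqVlt; apply/orP; left; apply/eqP; field; exact: lt0r_neq0.
have h2 : K <= e1 / 2 * n%:R.
  have l0 := @ln_nat_ge0 R n.
  apply: le_trans (_ : (K + 1) * (e1 / (2 * (K + 1)) * n%:R) <= _).
    apply: le_trans (_ : (K + 1) * 1 <= _); first by rewrite mulr1 lerDl.
    apply: ler_wpM2l; first by rewrite addr_ge0.
    by apply: le_trans (HN2 n n2); lra.
  rewrite le_eqVlt; apply/orP; left; apply/eqP; field; apply: lt0r_neq0; lra.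
rewrite /K in h2; rewrite mulrDr; lra.
Qed.

Lemma Nm_limit : n%:R^-1 *: \sum_(k < n) Z k *m (Z k)^T @[n --> \oo] --> Lambda Gam Del D Pc.
Proof.
have [C [rho [C0 r0 r1 [HD HP HQ]]]] := geometric_nsq exps.
have [C' HC'] := Rcoef_bound C0 r0 r1 HP HQ.
apply: (cvg_mean_outer lagW r0 r1 HC' mean_diff).
move=> i j; apply: (Lambda_cvg r0 r1 HP HQ exps.1 Gam_pos.1 Del_pos.1).
Qed.

Lemma S_limit : n%:R^-1 *: S_ p q ls_gain X U n w @[n --> \oo] --> Lambda Gam Del D Pc.
Proof.
apply: cvg_mx => i j.
have H := @cvg_mx_entry R _ _ _ _ i j Nm_limit.
rewrite -(cvg_shiftS (fun n => (n%:R^-1 *: \sum_(k < n) Z k *m (Z k)^T) i j)) /= in H.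
(* [S_] at [n.+1] sums [n.+2] outer products but is divided by [n.+1], hence the factor
   [1 + n.+1%:R^-1]; the identity matrix is divided away. *)
have E n : (n.+1%:R^-1 *: S_ p q ls_gain X U n.+1 w) i j
  = (n.+2%:R^-1 *: \sum_(k < n.+2) Z k *m (Z k)^T) i j * (1 + n.+1%:R^-1)
    + n.+1%:R^-1 * (1%:M : 'M[R]_(delta_dim d p q)) i j.
  rewrite S_Nm /Nm !mxE -/Z mulrDr addrC; congr (_ + _).
  rewrite mulrAC; congr (_ * _); rewrite -{1}[n.+2%:R]natr1.
  move: (n.+1%:R) (ltr0Sn R n) => m m0; field.
  by apply/andP; split; apply: lt0r_neq0; lra.
rewrite -(cvg_shiftS (fun n => (n%:R^-1 *: S_ p q ls_gain X U n w) i j)) /=.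
have h1 : (n.+1%:R^-1 : R) @[n --> \oo] --> (0 : R) by exact: cvg_harmonic.
rewrite -(cvg_shiftS (fun n => (n.+1%:R^-1 *: \sum_(k < n.+1) Z k *m (Z k)^T) i j)) /= in H.
pose L : R := Lambda Gam Del D Pc i j.
pose c : R := (1%:M : 'M[R]_(delta_dim d p q)) i j.
pose G n : R := (n.+2%:R^-1 *: \sum_(k < n.+2) Z k *m (Z k)^T) i j.
have H2 : (fun n => G n * (1 + n.+1%:R^-1) + n.+1%:R^-1 * c) @ \oo --> L * (1 + 0) + 0 * c.
  apply: cvgD; apply: cvgM => //; [|exact: cvg_cst].
  by apply: cvgD => //; exact: cvg_cst.
move: H2; rewrite mul0r !addr0 mulr1; apply: cvg_eqfun => n.
by rewrite E.
Qed.

Hypothesis cross_eps : forall i j, exists C, forall n,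
  `|\sum_(k < n) pr k i 0 * eps k.+1 w j 0| <= C * s34 (1 + \sum_(k < n) pr k i 0 ^+ 2).
Hypothesis cross_xi : forall i j, exists C, forall n,
  `|\sum_(k < n) pr k i 0 * xi k.+1 w j 0| <= C * s34 (1 + \sum_(k < n) pr k i 0 ^+ 2).

(** The quadratic variation is already O(log n) by [perr_sum], so a linear bound on [s34]
    suffices. *)
Lemma cross_log (e : nat -> T -> 'cV[R]_d) i j :
  (exists C, forall n, `|\sum_(k < n) pr k i 0 * e k.+1 w j 0|
     <= C * s34 (1 + \sum_(k < n) pr k i 0 ^+ 2)) ->
  exists C, forall n, `|\sum_(k < n) pr k i 0 * e k.+1 w j 0| <= C * (1 + ln n.+1%:R).
Proof.
move=> [C HC]; have [C1 C10 H1] := perr_sum; have [C2 H2] := s34_le (@ltr01 R).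
exists (`|C| * (1 + C1 + `|C2|)) => n; apply: le_trans (HC n) _.
have s0 : 0 <= \sum_(k < n) pr k i 0 ^+ 2 by apply: sumr_ge0 => k _; exact: sqr_ge0.
apply: le_trans (ler_wpM2r (s34_ge0 _) (ler_norm C)) _; rewrite -mulrA ler_wpM2l //.
have h1 := H2 (1 + \sum_(k < n) pr k i 0 ^+ 2) ltac:(by rewrite addr_ge0).
have h2 : \sum_(k < n) pr k i 0 ^+ 2 <= C1 * (1 + ln n.+1%:R).
  by apply: le_trans (H1 n); apply: ler_sum => k _; exact: nsq_entry.
have l0 := @ln_nat_ge0 R n; have h3 := ler_norm C2.
have h4 := mulr_ge0 (normr_ge0 C2) l0.
rewrite !mulrDl !mulrDr !mulr1; rewrite mulrDr mulr1 in h2; lra.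
Qed.

Lemma cost_entry i j n : (avg_cost X x n w - avg_noise eps xi n w) i j
  = n%:R^-1 * (\sum_(k < n) pr k i 0 * pr k j 0
     + (\sum_(k < n) pr k i 0 * eps k.+1 w j 0 + \sum_(k < n) pr k i 0 * xi k.+1 w j 0)
     + (\sum_(k < n) pr k j 0 * eps k.+1 w i 0 + \sum_(k < n) pr k j 0 * xi k.+1 w i 0)).
Proof.
rewrite /avg_cost /avg_noise /avg_outer !mxE -mulrBr; congr (_ * _).
rewrite !summxE !big_add1 /= !big_mkord -sumrB -!big_split; apply: eq_bigr => k _ /=.
rewrite !mxE !big_ord1 !mxE (output_decomp arxX control) !mxE -/(pr k).
by ring.
Qed.

Lemma cost_bound : exists2 C, 0 <= C & forall n,
  enorm (avg_cost X x n w - avg_noise eps xi n w) <= C * ((1 + ln n.+1%:R) / n%:R).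
Proof.
pose f (ij : 'I_d * 'I_d) n := `|(avg_cost X x n w - avg_noise eps xi n w) ij.1 ij.2|.
pose b n : R := (1 + ln n.+1%:R) / n%:R.
have l0 n := @ln_nat_ge0 R n.
have b0 n : 0 <= b n by rewrite divr_ge0 // addr_ge0.
have [|C C0 HC] := @fin_common_bound R _ f b b0.
  move=> [i j] /=; have [C1 C10 H1] := perr_sum.
  have [C2 H2] := cross_log (cross_eps i j); have [C3 H3] := cross_log (cross_xi i j).
  have [C4 H4] := cross_log (cross_eps j i); have [C5 H5] := cross_log (cross_xi j i).
  exists (C1 + C2 + C3 + C4 + C5) => n; rewrite /f /= cost_entry normrM ger0_norm ?invr_ge0 //.
  rewrite /b mulrA [leRHS]mulrC ler_wpM2l ?invr_ge0 //.
  have h1 : `|\sum_(k < n) pr k i 0 * pr k j 0| <= C1 * (1 + ln n.+1%:R).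
    apply: le_trans (H1 n); apply: le_trans (ler_norm_sum _ _ _) _.
    apply: ler_sum => k _; have := ler_2ab (pr k i 0) (pr k j 0) ltr01.
    have := nsq_entry (pr k) i 0; have := nsq_entry (pr k) j 0; rewrite invr1; lra.
  rewrite !mulrDl.
  apply: le_trans (ler_normD _ _) _; rewrite -addrA; apply: lerD; last first.
    by apply: le_trans (ler_normD _ _) _; apply: lerD.
  apply: le_trans (ler_normD _ _) _; rewrite -addrA; apply: lerD => //.
  by apply: le_trans (ler_normD _ _) _; apply: lerD.
exists (d%:R * C) => [|n]; first exact: mulr_ge0.
rewrite -(@ler_pXn2r _ 2%N) ?nnegrE ?enorm_ge0 //; last first.
  by apply: mulr_ge0; [exact: mulr_ge0|exact: b0].
rewrite enorm_sqr; have Cb : 0 <= C * b n by rewrite mulr_ge0.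
apply: le_trans (nsq_le_entries Cb (fun i j => HC n (i, j))) _.
by rewrite natrM -!expr2 -exprMn mulrA.
Qed.

Lemma noise_avg_limit : avg_noise eps xi n w @[n --> \oo] --> Gam + Del.
Proof.
apply: cvg_mx => i j.
have H a b : mean (fun k => V k a 0 * V k b 0) n @[n --> \oo] --> Sig Gam Del a b.
  have := @lagV 0%N a b; rewrite eqxx; apply: cvg_eqfun => n.
  by apply: eq_mean => k; rewrite addn0.
pose l := @lshift d d; pose r' := @rshift d d.
have H1 := cvgD (cvgD (H (l i) (l j)) (H (l i) (r' j))) (cvgD (H (r' i) (l j)) (H (r' i) (r' j))).
have E : (fun n => avg_noise eps xi n w i j) =
  (fun n => mean (fun k => V k (l i) 0 * V k (l j) 0) n + mean (fun k => V k (l i) 0 * V k (r' j) 0) n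
   + (mean (fun k => V k (r' i) 0 * V k (l j) 0) n + mean (fun k => V k (r' i) 0 * V k (r' j) 0) n)).
  apply/funext => n; rewrite -!meanD /avg_noise /avg_outer !mxE; congr (_ * _).
  rewrite summxE big_add1 /= big_mkord; apply: eq_bigr => k _.
  have Vl a : V k (l a) 0 = eps k.+1 w a 0 by rewrite /V /l col_mxEu.
  have Vr a : V k (r' a) 0 = xi k.+1 w a 0 by rewrite /V /r' col_mxEd.
  by rewrite !Vl !Vr !mxE big_ord1 !mxE; ring.
rewrite E (_ : (Gam + Del) i j = Sig Gam Del (l i) (l j) + Sig Gam Del (l i) (r' j)
   + (Sig Gam Del (r' i) (l j) + Sig Gam Del (r' i) (r' j))); first exact: H1.
by rewrite /Sig block_mxEul block_mxEur block_mxEdl block_mxEdr !mxE addr0 add0r.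
Qed.

Lemma cvg0_bound (f : nat -> R) C N : 0 <= C ->
  (forall n, (N <= n)%N -> `|f n| <= C * ((1 + ln n.+1%:R) / n%:R)) -> f n @[n --> \oo] --> (0 : R).
Proof.
move=> C0 H; apply/cvg_epsN => e e0.
have e1 : 0 < e / (C + 1) by rewrite divr_gt0 // ltr_pwDr.
have [N' HN'] := log_small e1; exists (N + N').+1 => n nN.
have [n1 n2 n3] : [/\ (N <= n)%N, (N' <= n)%N & (0 < n)%N].
  by move: nN; clear => nN; split; lia.
rewrite subr0; apply: le_trans (H n n1) _; have np : 0 < n%:R :> R by rewrite ltr0n.
rewrite mulrA ler_pdivrMr //; apply: le_trans (_ : (C + 1) * (1 + ln n.+1%:R) <= _).
  by rewrite ler_wpM2r ?addr_ge0 ?ln_nat_ge0 // lerDl.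
have C1 : 0 < C + 1 by rewrite ltr_pwDr.
have := ler_wpM2l (ltW C1) (HN' n n2); congr (_ <= _); field; exact: lt0r_neq0.
Qed.

Lemma cost_limit : avg_cost X x n w @[n --> \oo] --> Gam + Del.
Proof.
have [C C0 HC] := cost_bound; apply: cvg_mx => i j.
have H1 := @cvg_mx_entry R _ _ _ _ i j noise_avg_limit.
have H2 : ((avg_cost X x n w - avg_noise eps xi n w) i j : R) @[n --> \oo] --> (0 : R).
  apply: (@cvg0_bound _ C 0%N) => // n _; apply: le_trans (HC n).
  rewrite -(@ler_pXn2r _ 2%N) ?nnegrE ?enorm_ge0 // enorm_sqr real_normK ?num_real //.
  exact: nsq_entry.
have H3 : (fun n => (avg_cost X x n w - avg_noise eps xi n w) i j + avg_noise eps xi n w i j)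
    @ \oo --> 0 + (Gam + Del) i j by exact: cvgD H2 H1.
move: H3; rewrite add0r; apply: cvg_eqfun => n.
by rewrite !mxE subrK.
Qed.

Lemma theta_limit : thetah n w @[n --> \oo] --> theta_of A B.
Proof.
have [C C0 [N HN]] := terr_bound; apply: cvg_mx => i j.
have H2 : ((tn n i j) ^+ 2 : R) @[n --> \oo] --> (0 : R).
  apply: (@cvg0_bound _ C N) => // n nN; rewrite ger0_norm ?sqr_ge0 //.
  apply: le_trans (HN n nN); exact: nsq_entry.
apply/cvg_epsN => e e0; have [N' HN'] := (cvg_epsN _ _).1 H2 (e ^+ 2) ltac:(by rewrite exprn_gt0).
exists N' => n /HN'; rewrite subr0 ger0_norm ?sqr_ge0 // => h.
rewrite -(@ler_pXn2r _ 2%N) ?nnegrE ?(ltW e0) // real_normK ?num_real //.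
by apply: le_trans h; rewrite /tn /terr !mxE.
Qed.

(** The constant adds up [1 <= ln n / ln 2] and [n + 1 <= n^2], both valid from 2 on; at 1 the right
    side vanishes. *)
Lemma ln_ratio : exists2 C, 0 <= C & forall n, (2 <= n)%N ->
  (1 + ln n.+1%:R) / n%:R <= C * (ln n%:R / n%:R) :> R.
Proof.
have l2 : 0 < ln 2 :> R by rewrite ln_gt0 // ltr1n.
exists ((ln 2)^-1 + 2) => [|n n2]; first by rewrite addr_ge0 // invr_ge0 ltW.
have np : 0 < n%:R :> R by rewrite ltr0n; lia.
rewrite mulrA ler_wpM2r ?invr_ge0 // mulrDl; apply: lerD.
  by rewrite mulrC ler_pdivlMr // mul1r ler_ln ?posrE // ler_nat.
have -> : 2 * ln n%:R = ln (n%:R * n%:R) :> R by rewrite lnM ?posrE //; ring.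
by rewrite ler_ln ?posrE ?mulr_gt0 // -natrM ler_nat; nia.
Qed.

Lemma path_conclusion :
  [/\ n%:R^-1 *: S_ p q ls_gain X U n w @[n --> \oo] --> Lambda Gam Del D Pc,
      avg_cost X x n w @[n --> \oo] --> Gam + Del,
      exists C, forall n, (2 <= n)%N ->
        enorm (avg_cost X x n w - avg_noise eps xi n w) <= C * (ln n%:R / n%:R),
      thetah n w @[n --> \oo] --> theta_of A B &
      exists C N, forall n, (N <= n)%N ->
        nsq (thetah n w - theta_of A B) <= C * (ln n%:R / n%:R)].
Proof.
have [C C0 HC] := ln_ratio; split.
- exact: S_limit.
- exact: cost_limit.
- have [C1 C10 H1] := cost_bound; exists (C1 * C) => n n2.
  by apply: le_trans (H1 n) _; rewrite -mulrA ler_wpM2l ?HC.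
- exact: theta_limit.
- have [C1 C10 [N HN]] := terr_bound; exists (C1 * C), (maxn 2 N) => n.
  rewrite geq_max => /andP[n2 nN]; apply: le_trans (HN n nN) _.
  by rewrite -mulrA ler_wpM2l ?HC.
Qed.

End Path.

(** * Almost sure assembly *)

Section Adapted.
Context {R : realType} {disp : measure_display} {T : measurableType disp}.
Variables (d p q : nat) (A : 'I_p -> 'M[R]_d) (B : 'I_q -> 'M[R]_d).
Variables (X U : int -> T -> 'cV[R]_d) (eps xi x : nat -> T -> 'cV[R]_d).
Variable thetah : nat -> T -> 'M[R]_(delta_dim d p q, d).
Hypothesis arxX : arx (theta_of A B) X U eps.
Hypothesis ls : is_estimator ls_gain X U thetah.
Hypothesis control : tracking_control X U thetah x xi.
Variable H : nat -> set_system T.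
Hypothesis filtH : filtration H.
Hypothesis init : init_state_meas (H 0%N) X U (thetah 0%N).
Hypothesis meas_eps : forall k, mx_meas_wrt (H k.+1) (eps k.+1).
Hypothesis meas_xi : forall k, mx_meas_wrt (H k.+1) (xi k.+1).
Hypothesis meas_x : forall k, mx_meas_wrt (H k) (x k.+1).

Let sH n := filt_sigma filtH n.

Lemma mx_meas_le m c (Y : T -> 'M[R]_(m, c)) k n : (k <= n)%N ->
  mx_meas_wrt (H k) Y -> mx_meas_wrt (H n) Y.
Proof. by move=> kn; apply: mx_meas_sub; exact: (filt_le filtH kn). Qed.

Lemma meas_mxcol m c (G : set_system T) (Y : 'I_m -> T -> 'cV[R]_c) :
  (forall i, mx_meas_wrt G (Y i)) -> mx_meas_wrt G (fun w => \mxcol_(i < m) Y i w).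
Proof.
move=> mY s t.
rewrite (_ : (fun w => _) = fun w => Y (tagnat.sig1 s) w (tagnat.sig2 s) t); first exact: mY.
by apply/funext => w; rewrite mxE.
Qed.

(** One induction carries all claims around the feedback loop: [U_n] needs [thetah_n] and
    [xi_{n+1}], [X_{n+1}] needs [U_n], and [thetah_{n+1}] needs [X_{n+1}]. At time [n] inputs are
    thus known up to [U_{n-1}]. The filtration is left abstract because the result serves both [F]
    and the enlarged one. *)
Lemma adapted_model n :
  [/\ forall i, (i < n + p)%N -> mx_meas_wrt (H n) (X (n%:Z - i%:Z)),
      forall j, (j < n + q)%N -> mx_meas_wrt (H n) (U (n%:Z - j.+1%:Z)),
      forall k, (k <= n)%N -> mx_meas_wrt (H n) (Phi p q X U k) &
      mx_meas_wrt (H n) (thetah n)].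
Proof.
have PhiM m : (forall i, (i < m + p)%N -> mx_meas_wrt (H m) (X (m%:Z - i%:Z))) ->
    (forall j, (j < m + q)%N -> mx_meas_wrt (H m) (U (m%:Z - j.+1%:Z))) ->
    mx_meas_wrt (H m) (Phi p q X U m).
  move=> mX mU; apply: mx_meas_col => //; apply: meas_mxcol => i.
    by apply: mX; exact: leq_trans (ltn_ord i) (leq_addl _ _).
  by apply: mU; exact: leq_trans (ltn_ord i) (leq_addl _ _).
elim: n => [|n [mX mU mPhi mth]].
  have [iX iU ith] := init.
  have mX0 i : (i < 0 + p)%N -> mx_meas_wrt (H 0) (X (0%N%:Z - i%:Z)).
    by move=> ip; have := iX (Ordinal ip); rewrite sub0r.
  have mU0 j : (j < 0 + q)%N -> mx_meas_wrt (H 0) (U (0%N%:Z - j.+1%:Z)).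
    by move=> jq; have := iU (Ordinal jq); rewrite sub0r.
  by split=> // k; rewrite leqn0 => /eqP ->; exact: PhiM.
have nn := leqnSn n.
have mPhin := mx_meas_le nn (mPhi n (leqnn n)).
have mthn := mx_meas_le nn mth.
have mUn : mx_meas_wrt (H n.+1) (U n%:Z).
  rewrite (_ : U n%:Z = fun w => x n.+1 w - (thetah n w)^T *m Phi p q X U n w + xi n.+1 w).
    apply: mx_measD => //; apply: mx_measB => //; first exact: mx_meas_le nn _.
    by apply: mx_measM => //; exact: mx_meas_tr.
  by apply/funext => w; exact: control.
have mXn : mx_meas_wrt (H n.+1) (X n.+1%:Z).
  rewrite (_ : X n.+1%:Z = fun w => (theta_of A B)^T *m Phi p q X U n w + U n%:Z w + eps n.+1 w).
    apply: mx_measD => //; apply: mx_measD => //; apply: mx_measM => //; exact: mx_meas_cst.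
  by apply/funext => w; exact: arxX.
have mX' i : (i < n.+1 + p)%N -> mx_meas_wrt (H n.+1) (X (n.+1%:Z - i%:Z)).
  case: i => [|i] ip; first by rewrite subr0.
  rewrite (_ : n.+1%:Z - i.+1%:Z = n%:Z - i%:Z); last by lia.
  by apply: mx_meas_le nn _; apply: mX.
have mU' j : (j < n.+1 + q)%N -> mx_meas_wrt (H n.+1) (U (n.+1%:Z - j.+1%:Z)).
  case: j => [|j] jq; first by rewrite (_ : n.+1%:Z - 1%:Z = n%:Z) //; lia.
  rewrite (_ : n.+1%:Z - j.+2%:Z = n%:Z - j.+1%:Z); last by lia.
  by apply: mx_meas_le nn _; apply: mU.
have mPhi' k : (k <= n.+1)%N -> mx_meas_wrt (H n.+1) (Phi p q X U k).
  rewrite leq_eqVlt => /predU1P[->|kn]; first exact: PhiM.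
  by apply: mx_meas_le nn _; exact: mPhi.
split=> //.
rewrite (_ : thetah n.+1 = fun w => thetah n w + Jm (fun k => Phi p q X U k w) n.+1 *m Phi p q X U n w
    *m (X n.+1%:Z w - U n%:Z w - (thetah n w)^T *m Phi p q X U n w)^T).
  apply: mx_measD => //; apply: mx_measM => //.
    apply: mx_measM => //.
    by apply: (@mx_meas_comp_Jm _ _ _ _ (sH n.+1) _ (Phi p q X U)) => k kn; apply: mPhi'; exact: ltnW.
  apply: mx_meas_tr; apply: mx_measB => //; first exact: mx_measB.
  by apply: mx_measM => //; exact: mx_meas_tr.
by apply/funext => w; rewrite ls S_Nm invmx_Nm scale1r.
Qed.

Lemma meas_Phi n : mx_meas_wrt (H n) (Phi p q X U n).
Proof. by have [_ _ H1 _] := adapted_model n; exact: H1. Qed.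

Lemma meas_terr n : mx_meas_wrt (H n) (terr A B thetah ^~ n).
Proof.
have [_ _ _ H1] := adapted_model n; apply: mx_measB => //; exact: mx_meas_cst.
Qed.

Lemma meas_perr n : mx_meas_wrt (H n) (fun w => perr A B X U thetah w n).
Proof.
apply: mx_measN => //; apply: mx_measM => //; last exact: meas_Phi.
by apply: mx_meas_tr; exact: meas_terr.
Qed.

Lemma meas_regressor n :
  mx_meas_wrt (H n) (fun w => col_mx (rs A B X U x thetah w n.+1) (Phi p q X U n w)).
Proof.
apply: mx_meas_col => //; last exact: meas_Phi.
by apply: mx_measD => //; exact: meas_perr.
Qed.

End Adapted.

(** * White noise relative to a filtration *)

Section Noise.
Context {R : realType} {disp : measure_display} {T : measurableType disp}.
Variable P : probability T R.
Variable d : nat.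

(** Coordinates and diagonal covariances are enough, all martingale arguments being scalar. *)
Definition white_noise (H : nat -> set_system T) (e : nat -> T -> 'cV[R]_d) (V : 'M[R]_d) : Prop :=
  [/\ forall k i, meas_wrt (H k.+1) (fun w => e k.+1 w i 0),
      forall k i, is_cond_exp P (H k) (fun w => e k.+1 w i 0) (fun=> 0) &
      forall k i, is_cond_exp P (H k) (fun w => e k.+1 w i 0 ^+ 2) (fun=> V i i)].

Lemma white_intro (H : nat -> set_system T) e V :
  mart_diff P H e -> cond_covariance P H e V -> white_noise H e V.
Proof.
move=> [me e0] eV; split=> k i; first exact: me.
  by have := e0 k i 0; rewrite (_ : (fun=> (0 : 'cV[R]_d) i 0) = fun=> 0) //;
    apply/funext => w; rewrite mxE.
have := eV k i i; rewrite (_ : (fun w => (e k.+1 w *m (e k.+1 w)^T) i i) = fun w => e k.+1 w i 0 ^+ 2) //.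
by apply/funext => w; rewrite mxE big_ord1 mxE expr2.
Qed.

Lemma white_join (xi : nat -> T -> 'cV[R]_d) V (C2 : set (T -> R)) :
  (forall k i, measurable_fun [set: T] (fun w => xi k.+1 w i 0)) ->
  (forall f, C2 f -> measurable_fun [set: T] f) ->
  indep_sigma P (sigma_gen (\bigcup_n coords (xi n.+1))) (sigma_gen C2) ->
  white_noise (past xi) xi V ->
  white_noise (fun n => sigma_gen (\bigcup_(k in `I_n) coords (xi k.+1) `|` C2)) xi V.
Proof.
move=> mxi mC2 ind [_ x0 x2].
have sub n : \bigcup_(k in `I_n) coords (xi k.+1) `<=` \bigcup_k coords (xi k.+1).
  by move=> f [k _ Hf]; exists k.
have mCx f : (\bigcup_k coords (xi k.+1)) f -> measurable_fun [set: T] f.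
  by move=> [k _ [i [j ->]]]; rewrite (ord1 j); exact: mxi.
have inC k i n : (k < n)%N ->
    (\bigcup_(k in `I_n) coords (xi k.+1)) (fun w => xi k.+1 w i 0).
  by move=> kn; exists k => //; exists i, 0.
have mX k i : meas_wrt (sigma_gen (\bigcup_k coords (xi k.+1))) (fun w => xi k.+1 w i 0).
  by apply: sigma_gen_meas; exists k => //; exists i, 0.
split=> k i.
- by apply: sigma_gen_meas; left; exact: inC.
- exact: (cond_exp_join (sub k) mCx mC2 ind (mX k i) (x0 k i)).
- apply: (cond_exp_join (sub k) mCx mC2 ind _ (x2 k i)).
  by apply: meas_wrtX => //; exact: sigma_gen_sigma.
Qed.

Lemma white_s34 H e V (Y : nat -> T -> R) i : filtration H -> white_noise H e V ->
  (forall k, meas_wrt (H k) (Y k)) ->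
  {ae P, forall w, exists C : R, forall n,
     `|\sum_(k < n) Y k w * e k.+1 w i 0| <= C * s34 (1 + \sum_(k < n) Y k w ^+ 2)}.
Proof.
move=> fH [me e0 e2] mY.
exact: (martingale_s34 fH (fun k => me k i) (fun k => e0 k i) (fun k => e2 k i) mY).
Qed.

Lemma white_Qf H e V m (Z : nat -> T -> 'cV[R]_m) i : filtration H -> white_noise H e V ->
  (forall k, mx_meas_wrt (H k) (Z k)) ->
  {ae P, forall w, exists C : R, forall n,
     Qf (Z^~ w) 0 (fun k => e k.+1 w i 0) n <= C * lntr Z n w ^+ 2}.
Proof.
move=> fH [me e0 e2] mZ.
exact: (Qf_weak fH (fun k => me k i) (fun k => e0 k i) (fun k => e2 k i) mZ
  (mx_meas_cst (filt_sigma fH 0%N) (0 : 'cV[R]_m))).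
Qed.

Lemma measurable_enorm m n (M : T -> 'M[R]_(m, n)) :
  mx_meas_wrt measurable M -> measurable_fun [set: T] (fun w => enorm (M w)).
Proof.
move=> mM; apply: (@meas_wrt_fun _ _ _ (@measurable _ T)) => //.
apply: (@meas_wrt_comp _ _ _ _ sigma_measurable Num.sqrt).
  by apply: continuous_measurable_fun; exact: sqrt_continuous.
apply: meas_wrt_sum => [|i]; first exact: sigma_measurable.
apply: meas_wrt_sum => [|j]; first exact: sigma_measurable.
by apply: meas_wrtX; [exact: sigma_measurable|exact: mM].
Qed.

Lemma entry_le_enorm m n (M : 'M[R]_(m, n)) i j : `|M i j| <= enorm M.
Proof.
rewrite -(@ler_pXn2r _ 2%N) ?nnegrE ?enorm_ge0 // enorm_sqr real_normK ?num_real //.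
exact: nsq_entry.
Qed.

Lemma white_Qf_strong H e V m (Z : nat -> T -> 'cV[R]_m) (M0 : T -> 'cV[R]_m) alpha i :
  filtration H -> white_noise H e V -> 2 < alpha -> finite_cond_moment P H e alpha ->
  (forall k, mx_meas_wrt (H k) (Z k)) -> mx_meas_wrt (H 0%N) M0 ->
  {ae P, forall w, exists C : R, forall n,
     Qf (Z^~ w) (M0 w) (fun k => e k.+1 w i 0) n
     + \sum_(k < n) tau (Z^~ w) (M0 w) (fun k => e k.+1 w i 0) k ^+ 2 / (1 + gain (Z^~ w) k)
     <= C * lntr Z n w}.
Proof.
move=> fH [me e0 e2] a2 [W [HW Wfin]] mZ mM0.
apply: (Qf_strong fH (fun k => me k i) (fun k => e0 k i) (fun k => e2 k i) mZ mM0 a2 _ _ HW Wfin).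
  move=> k; apply: measurable_enorm => a b; rewrite (ord1 b).
  apply: meas_wrt_sub (me k a); exact: filt_meas.
by move=> k w; exact: entry_le_enorm.
Qed.

End Noise.

(** * Empirical autocovariances of the noises *)

Section Lags.
Context {R : realType}.

(** The lagged product is a martingale transform whose predictable factor is [g] delayed by [j]. Its
    sum is of order [s34] of a linear quantity, hence o(n). *)
Lemma lag_limit (f g : nat -> R) j :
  (exists C, forall n, `|\sum_(k < n) (if (j <= k)%N then g (k - j)%N else 0) * f k|
    <= C * s34 (1 + \sum_(k < n) (if (j <= k)%N then g (k - j)%N else 0) ^+ 2)) ->
  (exists K, forall n, \sum_(k < n) g k ^+ 2 <= K * n%:R) ->
  mean (fun k => f (k + j)%N * g k) n @[n --> \oo] --> (0 : R).
Proof.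
move=> [C HC] [K HK]; apply/cvg_epsN => e e0.
have shiftE (h : nat -> R) n :
    \sum_(k < n + j) (if (j <= k)%N then h (k - j)%N else 0) = \sum_(k < n) h k.
  rewrite addnC big_split_ord /= big1 ?add0r; last by move=> i _; rewrite leqNgt ltn_ord.
  by apply: eq_bigr => i _; rewrite leq_addr addKn.
have E n : \sum_(k < n) f (k + j)%N * g k
    = \sum_(k < n + j) (if (j <= k)%N then g (k - j)%N else 0) * f k.
  rewrite -(shiftE (fun k => f (k + j)%N * g k)); apply: eq_bigr => k _.
  by case: leqP => jk; rewrite ?mul0r // subnK // mulrC.
have K0 : 0 <= K.
  by have := HK 1%N; rewrite mulr1; apply: le_trans; apply: sumr_ge0 => k _; exact: sqr_ge0.
have C1 : 0 < `|C| + 1 by rewrite ltr_pwDr.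
have K1 : 0 < K + 1 by rewrite ltr_pwDr.
pose del := e / (2 * (`|C| + 1) * (K + 1)).
have del0 : 0 < del by rewrite divr_gt0 // !mulr_gt0.
have [C2 HC2] := s34_le del0.
pose K3 := (`|C| + 1) * (del + `|C2|).
have K30 : 0 <= K3 by rewrite mulr_ge0 ?(ltW C1) // addr_ge0 // ltW.
have [N HN] : exists N : nat, K3 / (e / 2) <= N%:R.
  exists (Num.bound (K3 / (e / 2))); apply: ltW; apply: archi_boundP.
  by rewrite divr_ge0 // divr_ge0 // ltW.
exists N.+1 => n Nn; rewrite subr0 /mean E normrM ger0_norm ?invr_ge0 //.
have np : 0 < n%:R :> R by rewrite ltr0n (leq_trans _ Nn).
rewrite ler_pdivrMl //; apply: le_trans (HC (n + j)%N) _.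
have -> : \sum_(k < n + j) (if (j <= k)%N then g (k - j)%N else 0) ^+ 2 = \sum_(k < n) g k ^+ 2.
  rewrite -(shiftE (fun k => g k ^+ 2)); apply: eq_bigr => k _.
  by case: leqP => // _; rewrite expr0n.
set S := \sum_(k < n) _; have S0 : 0 <= S by apply: sumr_ge0 => k _; exact: sqr_ge0.
have h1 := HC2 (1 + S) ltac:(by rewrite addr_ge0).
apply: le_trans (_ : (`|C| + 1) * s34 (1 + S) <= _).
  rewrite ler_wpM2r ?s34_ge0 //; have := ler_norm C; lra.
have h2 : S <= (K + 1) * n%:R.
  by apply: le_trans (HK n) _; rewrite ler_wpM2r // lerDl.
have h3 : s34 (1 + S) <= (del + `|C2|) + del * ((K + 1) * n%:R).
  apply: le_trans h1 _; have := ler_wpM2l (ltW del0) h2; have := ler_norm C2.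
  by rewrite mulrDr mulr1; lra.
apply: le_trans (ler_wpM2l (ltW C1) h3) _; rewrite mulrDr -/K3.
have -> : (`|C| + 1) * (del * ((K + 1) * n%:R)) = e / 2 * n%:R.
  rewrite /del; move: C1 K1; move: (`|C| + 1) (K + 1) => c k c0 k0.
  by field; rewrite !lt0r_neq0.
have h4 : K3 <= e / 2 * n%:R.
  rewrite mulrC -ler_pdivrMr ?divr_gt0 //; apply: le_trans HN _.
  by rewrite ler_nat ltnW.
have -> : n%:R * e = e / 2 * n%:R + e / 2 * n%:R by field.
by rewrite lerD2r.
Qed.

Lemma avg_outer_mean d (v : nat -> 'cV[R]_d) n i j :
  avg_outer v n i j = mean (fun k => v k.+1 i 0 * v k.+1 j 0) n.
Proof.
rewrite /avg_outer mxE summxE big_add1 /= big_mkord; congr (_ * _).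
by apply: eq_bigr => k _; rewrite mxE big_ord1 mxE.
Qed.

Lemma avg_outer_cvg d (v : nat -> 'cV[R]_d) (V : 'M[R]_d) i j : avg_outer v n @[n --> \oo] --> V ->
  mean (fun k => v k.+1 i 0 * v k.+1 j 0) n @[n --> \oo] --> V i j.
Proof.
move=> H; apply: cvg_eqfun (@cvg_mx_entry R _ _ _ _ i j H) => n.
exact: avg_outer_mean.
Qed.

Lemma avg_outer_sqr d (v : nat -> 'cV[R]_d) (V : 'M[R]_d) i : avg_outer v n @[n --> \oo] --> V ->
  exists K, forall n, \sum_(k < n) v k.+1 i 0 ^+ 2 <= K * n%:R.
Proof.
move=> H; have [K HK] := cvg_real_bounded (@avg_outer_cvg d v V i i H).
exists `|K|; case=> [|n]; first by rewrite big_ord0 mulr0.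
have := le_trans (ler_norm _) (le_trans (HK n.+1) (ler_norm K)).
rewrite /mean mulrC ler_pdivrMr //; congr (_ <= _).
Qed.

(** [Hfe] includes the lag 0, which the other three exclude: the two noises are uncorrelated also at
    equal times, and this makes the limit block diagonal. *)
Lemma lags_of_noise d (e f : nat -> 'cV[R]_d) (G D : 'M[R]_d) :
  avg_outer e n @[n --> \oo] --> G -> avg_outer f n @[n --> \oo] --> D ->
  (forall j a b, mean (fun k => e (k + j.+1).+1 a 0 * e k.+1 b 0) n @[n --> \oo] --> (0 : R)) ->
  (forall j a b, mean (fun k => e (k + j.+1).+1 a 0 * f k.+1 b 0) n @[n --> \oo] --> (0 : R)) ->
  (forall j a b, mean (fun k => f (k + j).+1 a 0 * e k.+1 b 0) n @[n --> \oo] --> (0 : R)) ->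
  (forall j a b, mean (fun k => f (k + j.+1).+1 a 0 * f k.+1 b 0) n @[n --> \oo] --> (0 : R)) ->
  let V k := col_mx (e k.+1) (f k.+1) in
  forall j a b, mean (fun k => V (k + j)%N a 0 * V k b 0) n @[n --> \oo]
    --> (if j == 0%N then Sig G D a b else 0).
Proof.
move=> He Hf Hee Hef Hfe Hff V j a b.
have Vl k i : V k (lshift d i) 0 = e k.+1 i 0 by rewrite /V col_mxEu.
have Vr k i : V k (rshift d i) 0 = f k.+1 i 0 by rewrite /V col_mxEd.
case: (split_ordP a) => {}a ->; case: (split_ordP b) => {}b ->; case: j => [|j] /=.
- rewrite /Sig block_mxEul; apply: cvg_eqfun (@avg_outer_cvg _ e G a b He) => n.
  by apply: eq_mean => k; rewrite !Vl addn0.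
- by apply: cvg_eqfun (Hee j a b) => n; apply: eq_mean => k; rewrite !Vl.
- rewrite /Sig block_mxEur mxE; apply: cvg_eqfun (Hfe 0%N b a) => n.
  by apply: eq_mean => k; rewrite Vl Vr !addn0 mulrC.
- by apply: cvg_eqfun (Hef j a b) => n; apply: eq_mean => k; rewrite Vl Vr.
- rewrite /Sig block_mxEdl mxE; apply: cvg_eqfun (Hfe 0%N a b) => n.
  by apply: eq_mean => k; rewrite Vl Vr !addn0.
- by apply: cvg_eqfun (Hfe j.+1 a b) => n; apply: eq_mean => k; rewrite Vl Vr.
- rewrite /Sig block_mxEdr; apply: cvg_eqfun (@avg_outer_cvg _ f D a b Hf) => n.
  by apply: eq_mean => k; rewrite !Vr addn0.
- by apply: cvg_eqfun (Hff j a b) => n; apply: eq_mean => k; rewrite !Vr.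
Qed.

End Lags.

Section LagsNoise.
Context {R : realType} {disp : measure_display} {T : measurableType disp}.
Variable P : probability T R.
Variable d : nat.

(** [j0] is the delay with which [f] becomes known: 1 for a noise adapted to [H], 0 for one known in
    advance. *)
Lemma white_lag (H : nat -> set_system T) (e f : nat -> T -> 'cV[R]_d) (V W : 'M[R]_d) (j0 : nat) :
  filtration H -> white_noise P H e V ->
  (forall k b, meas_wrt (H (k + j0)%N) (fun w => f k.+1 w b 0)) ->
  {ae P, forall w, avg_outer (f^~ w) n @[n --> \oo] --> W} ->
  {ae P, forall w, forall (j : nat) a b,
    mean (fun k => e (k + (j0 + j)).+1 w a 0 * f k.+1 w b 0) n @[n --> \oo] --> (0 : R)}.
Proof.
move=> fH we mf fW.
have main : {ae P, forall w, forall j : nat, forall a b, exists C : R, forall n,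
   `|\sum_(k < n) (if (j0 + j <= k)%N then f (k - (j0 + j)).+1 w b 0 else 0) * e k.+1 w a 0|
    <= C * s34 (1 + \sum_(k < n) (if (j0 + j <= k)%N then f (k - (j0 + j)).+1 w b 0 else 0) ^+ 2)}.
  apply: ae_foralln => j; apply: filter_forall => a; apply: filter_forall => b.
  apply: (white_s34 (Y := fun k w => if (j0 + j <= k)%N then f (k - (j0 + j)).+1 w b 0 else 0) a fH we).
  move=> k; case: leqP => jk; last exact: meas_wrt_cst (filt_sigma fH k) _.
  apply: meas_wrt_sub (mf (k - (j0 + j))%N b); apply: (filt_le fH); lia.
apply: filterS2 main fW => w Hw fw j a b.
exact: (lag_limit (f := fun k => e k.+1 w a 0) (g := fun k => f k.+1 w b 0) (Hw j a b) (avg_outer_sqr b fw)).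
Qed.

End LagsNoise.

Section Final.
Context {R : realType} {disp : measure_display} {T : measurableType disp}.

Lemma meas_wrt_measurable (f : T -> R) : measurable_fun [set: T] f -> meas_wrt measurable f.
Proof. by move=> mf B mB; rewrite -[X in measurable X]setTI; exact: mf. Qed.

Lemma little_o_sum (x : nat -> R) :
  (fun n => \sum_(1 <= k < n.+1) x k : R^o) =o_\oo (fun n => n%:R : R^o) ->
  forall e, 0 < e -> exists N, forall n, (N <= n)%N -> \sum_(k < n) x k.+1 <= e * n%:R.
Proof.
move=> /eqoP H e e0; have [N _ HN] := H e e0; exists N => n Nn.
have := HN n Nn; rewrite big_add1 /= big_mkord [`|n%:R|]ger0_norm //.
by apply: le_trans; exact: ler_norm.
Qed.

Lemma big_O_of_bound (f : nat -> R) : (forall n, 0 <= f n) ->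
  (exists C N, forall n, (N <= n)%N -> f n <= C * (ln n%:R / n%:R)) ->
  (fun n => f n : R^o) =O_\oo (fun n => ln n%:R / n%:R : R^o).
Proof.
move=> f0 [C [N H]]; apply/eqO_exP; exists (`|C| + 1); first by rewrite ltr_pwDr.
exists N => // n /= Nn; rewrite ger0_norm //; apply: le_trans (H n Nn) _.
apply: le_trans (ler_norm _) _; rewrite normrM ler_wpM2r //.
by rewrite lerDl.
Qed.

End Final.

Theorem theorem4p1
  (R : realType) (disp : measure_display) (T : measurableType disp)
  (P : probability T R)
  (d p q : nat) (d_ge1 : (1 <= d)%N) (p_ge1 : (1 <= p)%N) (q_ge1 : (1 <= q)%N)
  (* model *)
  (A : 'I_p -> 'M[R]_d) (B : 'I_q -> 'M[R]_d)
  (F : nat -> set_system T)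
  (X U : int -> T -> 'cV[R]_d)
  (eps xi x : nat -> T -> 'cV[R]_d)
  (thetah : nat -> T -> 'M[R]_(delta_dim d p q, d))
  (Gam Del : 'M[R]_d)
  (filtF : filtration F)
  (init_F0 : init_state_meas (F 0%N) X U (thetah 0%N))
  (arxX : arx (theta_of A B) X U eps)
  (* driven noise *)
  (eps_mart : mart_diff P F eps)
  (Gam_pos : posdef Gam)
  (eps_cov : cond_covariance P F eps Gam)
  (eps_slln : slln P eps Gam)
  (* reference trajectory *)
  (x_pred : forall n, mx_meas_wrt (F n) (x n.+1))
  (x_small : {ae P, forall w,
     (fun n => \sum_(1 <= k < n.+1) enorm (x k w) ^+ 2 : R^o)
       =o_\oo (fun n => n%:R : R^o)})
  (* exogenous noise *)
  (xi_adapted : forall n, mx_meas_wrt (F n.+1) (xi n.+1))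
  (Del_pos : posdef Del)
  (xi_noise : centered_noise P xi Del)
  (xi_indep : indep_sigma P
     (sigma_gen (\bigcup_n coords (xi n.+1)))
     (sigma_gen (\bigcup_n coords (eps n.+1) `|` \bigcup_n coords (x n.+1)
                 `|` init_state_coords X U (thetah 0%N))))
  (xi_slln : slln P xi Del)
  (* LS estimator and persistently excited tracking control *)
  (ls : is_estimator ls_gain X U thetah)
  (control : tracking_control X U thetah x xi)
  (* coefficients of B^-1(z) and B^-1(z) (A(z) - I) *)
  (B_causal : causal B)
  (D Pc : nat -> 'M[R]_d)
  (exps : expansions A B D Pc)
  (eps_moment : exists alpha : R, 2 < alpha /\ finite_cond_moment P F eps alpha) :
  [/\ {ae P, forall w,
        n%:R^-1 *: S_ p q ls_gain X U n w @[n --> \oo] --> Lambda Gam Del D Pc},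
      {ae P, forall w, avg_cost X x n w @[n --> \oo] --> Gam + Del},
      {ae P, forall w,
        (fun n => enorm (avg_cost X x n w - avg_noise eps xi n w) : R^o)
          =O_\oo (fun n => ln n%:R / n%:R : R^o)},
      {ae P, forall w, thetah n w @[n --> \oo] --> theta_of A B} &
      {ae P, forall w,
        (fun n => enorm (thetah n w - theta_of A B) ^+ 2 : R^o)
          =O_\oo (fun n => ln n%:R / n%:R : R^o)}].
Proof.
pose C2 : set (T -> R) := \bigcup_n coords (eps n.+1) `|` \bigcup_n coords (x n.+1)
  `|` init_state_coords X U (thetah 0%N).
pose C1 n : set (T -> R) := \bigcup_(k in `I_n) coords (xi k.+1).
(* The enlarged filtration: the whole sequences [eps] and [x] and the initial state are known from
   time 0, while [xi] is revealed step by step and stays white by independence. *)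
pose G n : set_system T := sigma_gen (C1 n `|` C2).
have mF m c n (Y : T -> 'M[R]_(m, c)) i j : mx_meas_wrt (F n) Y ->
    measurable_fun [set: T] (fun w => Y w i j).
  by move=> mY; apply: meas_wrt_fun (mY i j); exact: (filt_meas filtF).
have mxi k i : measurable_fun [set: T] (fun w => xi k.+1 w i 0).
  exact: mF (xi_adapted k).
have mC2 f : C2 f -> measurable_fun [set: T] f.
  have [iX iU ith] := init_F0.
  move=> [[[k _ [i [j ->]]]|[k _ [i [j ->]]]]|[[[k _ [i [j ->]]]|[k _ [i [j ->]]]]|[i [j ->]]]].
  - exact: mF (eps_mart.1 k).
  - exact: mF (x_pred k).
  - exact: mF (iX k).
  - exact: mF (iU k).
  - exact: mF ith.
have filtG : filtration G.
  split; first by move=> n; exact: sigma_gen_sigma.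
  split=> n.
    apply: sigma_gen_sub; first exact: sigma_measurable.
    move=> f [[k _ [i [j ->]]]|/mC2 mf]; last exact: meas_wrt_measurable.
    by rewrite (ord1 j); exact: meas_wrt_measurable.
  apply: sigma_gen_mono; apply: setSU => f [k /= kn Hf]; exists k => //=; exact: ltnW.
have CG n (f : T -> R) : C2 f -> meas_wrt (G n) f.
  by move=> Cf; apply: sigma_gen_meas; right.
have epsG k n : mx_meas_wrt (G n) (eps k.+1).
  by move=> i j; apply: CG; left; left; exists k => //; exists i, j.
have xG k n : mx_meas_wrt (G n) (x k.+1).
  by move=> i j; apply: CG; left; right; exists k => //; exists i, j.
have xiG k : mx_meas_wrt (G k.+1) (xi k.+1).
  by move=> i j; apply: sigma_gen_meas; left; exists k => //=; exists i, j.
have initG : init_state_meas (G 0%N) X U (thetah 0%N).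
  split=> [k i j|k i j|i j]; apply: CG; right.
  - by left; left; exists k => //; exists i, j.
  - by left; right; exists k => //; exists i, j.
  - by right; exists i, j.
have wF : white_noise P F eps Gam := white_intro eps_mart eps_cov.
have wG : white_noise P G xi Del.
  exact: white_join mxi mC2 xi_indep (white_intro xi_noise.1 xi_noise.2).
have mPhi := meas_Phi arxX ls control filtF init_F0 eps_mart.1 xi_adapted x_pred.
have mterr := meas_terr arxX ls control filtF init_F0 eps_mart.1 xi_adapted x_pred.
have mperrF := meas_perr arxX ls control filtF init_F0 eps_mart.1 xi_adapted x_pred.
have mregF := meas_regressor arxX ls control filtF init_F0 eps_mart.1 xi_adapted x_pred.
have mperrG := meas_perr arxX ls control filtG initG (fun k => epsG k k.+1) xiG (fun k => xG k k).
have mregG := meas_regressor arxX ls control filtG initG (fun k => epsG k k.+1) xiG (fun k => xG k k).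
have [alpha [a2 mom]] := eps_moment.
have aeLS : {ae P, forall w (j : 'I_d), exists C : R, forall n,
    Qf (Phi p q X U ^~ w) (col j (terr A B thetah w 0)) (fun k => eps k.+1 w j 0) n
    + \sum_(k < n) tau (Phi p q X U ^~ w) (col j (terr A B thetah w 0))
        (fun k => eps k.+1 w j 0) k ^+ 2 / (1 + gain (Phi p q X U ^~ w) k)
    <= C * lntr (Phi p q X U) n w}.
  apply: filter_forall => j.
  apply: (white_Qf_strong (M0 := fun w => col j (terr A B thetah w 0)) j filtF wF a2 mom mPhi).
  move=> a b; rewrite (_ : (fun w => _) = fun w => terr A B thetah w 0 a j); first exact: mterr.
  by apply/funext => w; rewrite mxE.
have aeQeps : {ae P, forall w (i : 'I_d), exists C : R, forall n,
    Qf (fun k => col_mx (rs A B X U x thetah w k.+1) (Phi p q X U k w)) 0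
      (fun k => eps k.+1 w i 0) n
    <= C * lntr (fun k w => col_mx (rs A B X U x thetah w k.+1) (Phi p q X U k w)) n w ^+ 2}.
  apply: filter_forall => i; exact: (white_Qf i filtF wF mregF).
have aeQxi : {ae P, forall w (i : 'I_d), exists C : R, forall n,
    Qf (fun k => col_mx (rs A B X U x thetah w k.+1) (Phi p q X U k w)) 0
      (fun k => xi k.+1 w i 0) n
    <= C * lntr (fun k w => col_mx (rs A B X U x thetah w k.+1) (Phi p q X U k w)) n w ^+ 2}.
  apply: filter_forall => i; exact: (white_Qf i filtG wG mregG).
have aeCeps : {ae P, forall w (i j : 'I_d), exists C : R, forall n,
    `|\sum_(k < n) perr A B X U thetah w k i 0 * eps k.+1 w j 0|
    <= C * s34 (1 + \sum_(k < n) perr A B X U thetah w k i 0 ^+ 2)}.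
  apply: filter_forall => i; apply: filter_forall => j.
  exact: (white_s34 (Y := fun k w => perr A B X U thetah w k i 0) j filtF wF (fun k => mperrF k i 0)).
have aeCxi : {ae P, forall w (i j : 'I_d), exists C : R, forall n,
    `|\sum_(k < n) perr A B X U thetah w k i 0 * xi k.+1 w j 0|
    <= C * s34 (1 + \sum_(k < n) perr A B X U thetah w k i 0 ^+ 2)}.
  apply: filter_forall => i; apply: filter_forall => j.
  exact: (white_s34 (Y := fun k w => perr A B X U thetah w k i 0) j filtG wG (fun k => mperrG k i 0)).
(* The filtration is dictated by the later factor: [F] when it is [eps], [G] when it is [xi]. The
   products at equal times come from [G], where [eps] is known beforehand. *)
have aeEE := white_lag (j0 := 1) filtF wF (fun k b => ltac:(rewrite addn1; exact: (eps_mart.1 k b 0))) eps_slln.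
have aeEX := white_lag (j0 := 1) filtF wF (fun k b => ltac:(rewrite addn1; exact: (xi_adapted k b 0))) xi_slln.
have aeXE := white_lag (j0 := 0) filtG wG (fun k b => epsG k _ b 0) eps_slln.
have aeXX := white_lag (j0 := 1) filtG wG (fun k b => ltac:(rewrite addn1; exact: (xiG k b 0))) xi_slln.
have good : {ae P, forall w,
  [/\ n%:R^-1 *: S_ p q ls_gain X U n w @[n --> \oo] --> Lambda Gam Del D Pc,
      avg_cost X x n w @[n --> \oo] --> Gam + Del,
      exists C, forall n, (2 <= n)%N ->
        enorm (avg_cost X x n w - avg_noise eps xi n w) <= C * (ln n%:R / n%:R),
      thetah n w @[n --> \oo] --> theta_of A B &
      exists C N, forall n, (N <= n)%N ->
        nsq (thetah n w - theta_of A B) <= C * (ln n%:R / n%:R)]}.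
  have andP (Q1 Q2 : T -> Prop) : {ae P, forall w, Q1 w} -> {ae P, forall w, Q2 w} ->
      {ae P, forall w, Q1 w /\ Q2 w} by exact: filterS2.
  have H1 := andP _ _ (andP _ _ aeLS aeQeps) (andP _ _ aeQxi (andP _ _ aeCeps aeCxi)).
  have H2 := andP _ _ (andP _ _ aeEE aeEX) (andP _ _ aeXE aeXX).
  have H3 := andP _ _ (andP _ _ eps_slln xi_slln) x_small.
  apply: filterS (andP _ _ H1 (andP _ _ H2 H3)) => w.
  move=> [[[hLS hQe] [hQx [hCe hCx]]] [[[hEE hEX] [hXE hXX]] [[he hx] hs]]].
  have small := little_o_sum hs.
  apply: (path_conclusion arxX ls control p_ge1 q_ge1 exps Gam_pos Del_pos _ _ hLS hQe hQx hCe hCx).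
    move=> e e0; have [N HN] := small e e0; exists N => n Nn.
    by apply: le_trans (HN n Nn); apply: ler_sum => k _; rewrite enorm_sqr.
  exact: (lags_of_noise he hx hEE hEX hXE hXX).
split; apply: filterS good => w [c1 c2 [C c3] c4 [C' [N c5]]] //.
  by apply: big_O_of_bound => [n|]; [exact: enorm_ge0|exists C, 2%N].
apply: big_O_of_bound => [n|]; first exact: sqr_ge0.
by exists C', N => n Nn; rewrite enorm_sqr; exact: c5.
Qed.
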